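(* Let $q\geq3$ be an integer. Then there is a constant $\beta_{q}>0$ depending only on $q$ such that there are arbitrarily large values of $x$ for which \[ \big|\mathcal{E}_{q}(x)\big|\geq\beta_{q}\,x^{2q-1}(\log x)^{1/4}(\log\log x)^{1/8}. \]
   Context: For $(v,w)\in\mathbb{R}^{2q}\times\mathbb{R}$ let $\mathcal{N}(v,w)=\big(|v|_{2}^{4}+w^{2}\big)^{1/4}$ (Cygan–Korányi norm), $\mathcal{B}=\{\mathcal{N}\leq1\}$, $\delta_{x}(v,w)=(xv,x^{2}w)$ for $x>0$, and $\mathcal{E}_{q}(x)=|\mathbb{Z}^{2q+1}\cap\delta_{x}\mathcal{B}|-\mathrm{vol}(\mathcal{B})x^{2q+2}$, where $\mathrm{vol}$ is $(2q+1)$-dimensional volume. *)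

(* Defs.v *)
From HB Require Import structures.
From mathcomp Require Import all_boot all_order all_algebra.
From mathcomp Require Import finmap.
From mathcomp Require Import zify.
From mathcomp Require Import all_classical all_reals all_analysis.
From mathcomp Require Import measurable_realfun.

Set Implicit Arguments.
Unset Strict Implicit.
Unset Printing Implicit Defensive.

Import Order.TTheory GRing.Theory Num.Theory.
Import numFieldNormedType.Exports.

Local Open Scope classical_set_scope.
Local Open Scope ring_scope.

Section lebesgue_tuple_step.
Context (R : realType) (n : nat).
Local Notation mR := (measurableTypeR R).
Variable m : {sigma_finite_measure set (n.-tuple mR) -> \bar R}.

Let cons_pair (p : mR * n.-tuple mR) : n.+1.-tuple mR :=
  [the n.+1.-tuple mR of p.1 :: p.2].

Let mcons_pair : measurable_fun [set: mR * n.-tuple mR] cons_pair.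
Proof. by apply: measurable_cons. Qed.

Definition lebesgue_cons : set (n.+1.-tuple mR) -> \bar R :=
  pushforward (@lebesgue_measure R \x m)%E
    (fun p : mR * n.-tuple mR => [the n.+1.-tuple mR of p.1 :: p.2]).

Let lebesgue_cons0 : lebesgue_cons set0 = 0%E.
Proof. by rewrite /lebesgue_cons /pushforward preimage_set0 measure0. Qed.

Let lebesgue_cons_ge0 A : (0 <= lebesgue_cons A)%E.
Proof. exact: measure_ge0. Qed.

Let lebesgue_cons_sigma_additive : semi_sigma_additive lebesgue_cons.
Proof.
move=> F mF tF mUF; rewrite /lebesgue_cons /pushforward preimage_bigcup.
apply: measure_semi_sigma_additive.
- by move=> k; rewrite -[X in measurable X]setTI; exact: mcons_pair.
- apply/trivIsetP => /= i j _ _ ij; rewrite -preimage_setI.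
  by move/trivIsetP : tF => /(_ _ _ _ _ ij) ->//; rewrite preimage_set0.
- by rewrite -preimage_bigcup -[X in measurable X]setTI; exact: mcons_pair.
Qed.

HB.instance Definition _ := isMeasure.Build _ _ _ lebesgue_cons
  lebesgue_cons0 lebesgue_cons_ge0 lebesgue_cons_sigma_additive.

Let lebesgue_cons_sigma_finite : sigma_finite setT lebesgue_cons.
Proof.
have /sigma_finiteP[F [TF ndF Foo]] := sigma_finiteT (@lebesgue_measure R).
have /sigma_finiteP[G [TG ndG Goo]] := sigma_finiteT m.
pose uncons (t : n.+1.-tuple mR) : mR * n.-tuple mR :=
  (thead t, [tuple of behead t]).
have uK p : uncons (cons_pair p) = p.
  by case: p => a t; congr pair; apply: val_inj.
have mu : measurable_fun [set: n.+1.-tuple mR] uncons.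
  apply/measurable_fun_pairP; split.
  - exact: (measurable_tnth (T := mR) (ord0 : 'I_n.+1)).
  - exact: measurable_behead.
exists (fun k => uncons @^-1` (F k `*` G k)).
  apply/seteqP; split=> // t _.
  have [i _ Fi] : (\bigcup_i F i) (uncons t).1 by rewrite -TF.
  have [j _ Gj] : (\bigcup_i G i) (uncons t).2 by rewrite -TG.
  exists (maxn i j) => //; split.
  - by move: Fi; exact/subsetPset/ndF/leq_maxl.
  - by move: Gj; exact/subsetPset/ndG/leq_maxr.
move=> k; have [mFk Fkoo] := Foo k; have [mGk Gkoo] := Goo k; split.
  by rewrite -[X in measurable X]setTI; apply: mu => //; exact: measurableX.
rewrite /lebesgue_cons /pushforward.
rewrite (_ : _ @^-1` _ = F k `*` G k).
  by rewrite product_measure1E// lte_mul_pinfty// ge0_fin_numE.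
by apply/funext => p; exact: (congr1 (F k `*` G k) (uK p)).
Qed.

HB.instance Definition _ := @Measure_isSigmaFinite.Build _ _ _ lebesgue_cons
  lebesgue_cons_sigma_finite.

End lebesgue_tuple_step.

(* [n]-dimensional Lebesgue measure, as the [n]-fold product of the
   one-dimensional one transported to [n.-tuple]; the zero-dimensional measure
   is the unit mass at the empty tuple. *)
Fixpoint lebesgue_tuple (R : realType) (n : nat) :
    {sigma_finite_measure set (n.-tuple (measurableTypeR R)) -> \bar R} :=
  match n with
  | 0 => [the {sigma_finite_measure set _ -> \bar R} of
           dirac ([tuple] : 0.-tuple (measurableTypeR R))]
  | n'.+1 => [the {sigma_finite_measure set _ -> \bar R} of
           lebesgue_cons (lebesgue_tuple R n')]
  end.

Section koranyi.
Context (R : realType).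

Definition enorm (n : nat) (v : n.-tuple R) : R :=
  Num.sqrt (\sum_(i < n) tnth v i ^+ 2).

Definition knorm (q : nat) (p : (2 * q).-tuple R * R) : R :=
  (enorm p.1 ^+ 4 + p.2 ^+ 2) `^ 4^-1.

Definition kball (q : nat) : set ((2 * q).-tuple R * R) :=
  [set p | knorm p <= 1].

Definition dilation (q : nat) (x : R) (p : (2 * q).-tuple R * R) :
    (2 * q).-tuple R * R :=
  ([tuple x * tnth p.1 i | i < 2 * q], x ^+ 2 * p.2).

Definition integer_points (q : nat) : set ((2 * q).-tuple R * R) :=
  [set p | (forall i, tnth p.1 i \is a Num.int) /\ p.2 \is a Num.int].

Definition kvol (q : nat) (A : set ((2 * q).-tuple R * R)) : \bar R :=
  (lebesgue_tuple R (2 * q) \x @lebesgue_measure R)%E A.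

(* [fset_set] and [fine] are meaningful here by [finite_lattice_points] and
   [kvol_kball_fin_num] below. *)
Definition lattice_error (q : nat) (x : R) : R :=
  #|` fset_set (@integer_points q `&` dilation x @` @kball q)|%:R
  - fine (kvol (@kball q)) * x ^+ (2 * q + 2).

End koranyi.

Section well_definedness.
Context (R : realType).
Local Notation mR := (measurableTypeR R).

Lemma lebesgue_tuple_box (n : nat) (A : 'I_n -> set mR) :
  (forall i, measurable (A i)) ->
  lebesgue_tuple R n [set t | forall i, A i (tnth t i)] =
  (\prod_(i < n) @lebesgue_measure R (A i))%E.
Proof.
elim: n A => [|n IH] A mA /=.
  rewrite big_ord0 diracE mem_set//= => i; by case: i.
rewrite big_ord_recl -IH; last by move=> i.
rewrite -product_measure1E//.
  rewrite /lebesgue_cons /pushforward; congr (product_measure1 _ _ _).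
  apply/seteqP; split=> -[a t] /=.
    move=> h; split; first exact: (h ord0).
    by move=> i; have := h (lift ord0 i); rewrite tnthS.
  move=> [h0 h] i; case: (unliftP ord0 i) => [j ->|->]; last exact: h0.
  by rewrite tnthS; exact: h.
rewrite (_ : [set t | _] =
    \bigcap_(i in [set: 'I_n]) ((@tnth _ mR ^~ i) @^-1` A (lift ord0 i))).
  apply: fin_bigcap_measurable => // i _.
  by rewrite -[X in measurable X]setTI; apply: measurable_tnth.
by apply/seteqP; split=> t /= h i; [move=> _; exact: h|exact: h].
Qed.

Lemma enorm_coord (n : nat) (v : n.-tuple R) i : `|tnth v i| <= enorm v.
Proof.
rewrite /enorm -sqrtr_sqr ler_sqrt; last by apply: sumr_ge0 => j _; exact: sqr_ge0.
rewrite (bigD1 i)//= lerDl; apply: sumr_ge0 => j _; exact: sqr_ge0.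
Qed.

Lemma kballE (q : nat) (p : (2 * q).-tuple R * R) :
  kball p <-> enorm p.1 ^+ 4 + p.2 ^+ 2 <= 1.
Proof.
have h0 : 0 <= enorm p.1 ^+ 4 + p.2 ^+ 2.
  by rewrite addr_ge0 ?sqr_ge0// exprn_ge0// sqrtr_ge0.
have e1 : 1 `^ 4^-1 = 1 :> R by rewrite powR1.
rewrite /kball /knorm /=; split=> h.
  rewrite leNgt; apply/negP => h1; move: h; rewrite leNgt => /negP; apply.
  by rewrite -[ltLHS]e1 gt0_ltr_powR// ?nnegrE// invr_gt0.
by rewrite -[leRHS]e1 ge0_ler_powR// ?nnegrE// invr_ge0.
Qed.

Lemma kball_bounded (q : nat) (p : (2 * q).-tuple R * R) :
  kball p -> (forall i, `|tnth p.1 i| <= 1) /\ `|p.2| <= 1.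
Proof.
move/kballE => h.
have e0 : 0 <= enorm p.1 by exact: sqrtr_ge0.
have h1 : enorm p.1 ^+ 4 <= 1 by apply: le_trans h; rewrite lerDl sqr_ge0.
have h2 : p.2 ^+ 2 <= 1 by apply: le_trans h; rewrite lerDr exprn_ge0.
split=> [i|].
  by apply: le_trans (enorm_coord _ _) _; rewrite -(@expr_le1 _ 4).
by rewrite -(@expr_le1 _ 2)// real_normK// num_real.
Qed.

Lemma finite_int_bounded (M : R) :
  finite_set [set y : R | y \is a Num.int /\ `|y| <= M].
Proof.
pose K := Num.bound M.
apply: (@sub_finite_set _ _ ((fun k : nat => k%:R - K%:R : R) @` `I_(K + K).+1)).
  move=> y [/intrP[z ->] zM].
  have : `|z%:~R| < K%:R :> R.
    by apply: le_lt_trans zM (archi_boundP (le_trans (normr_ge0 _) zM)).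
  rewrite ltr_norml => /andP[zl zr].
  have zl' : (- K%:Z < z)%R by rewrite -(ltr_int R) mulrNz.
  have zr' : (z < K%:Z)%R by rewrite -(ltr_int R).
  have zK0 : (0 <= z + K%:Z)%R by rewrite -lerBlDr sub0r ltW.
  exists (absz (z + K%:Z)) => /=.
    by move: zl' zr' zK0; lia.
  by rewrite natr_absz ger0_norm// intrD addrK.
exact/finite_image/finite_II.
Qed.

Lemma finite_tuple_box (n : nat) (A : set R) :
  finite_set A -> finite_set [set t : n.-tuple R | forall i, A (tnth t i)].
Proof.
move=> finA; elim: n => [|n IH].
  apply: (sub_finite_set _ (finite_set1 [tuple])) => t _ /=.
  exact: tuple0.
apply: (sub_finite_set _ (finite_image
  (fun p : R * n.-tuple R => [tuple of p.1 :: p.2]) (finite_setX finA IH))).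
move=> t At; exists (thead t, [tuple of behead t]) => /=.
  split=> [|i /=]; first exact: At.
  by rewrite tnth_behead; exact: At.
by rewrite -tuple_eta.
Qed.

Lemma finite_lattice_points (q : nat) (x : R) :
  finite_set (@integer_points R q `&` dilation x @` @kball R q).
Proof.
have finx := finite_int_bounded `|x|; have finx2 := finite_int_bounded (`|x| ^+ 2).
apply: sub_finite_set (finite_setX (@finite_tuple_box (2 * q) _ finx) finx2).
move=> r [[+ +] [p /kball_bounded[bv bw] rE]] => /=.
rewrite -{r}rE /= => intv intw; split=> /=.
  move=> i; rewrite tnth_mktuple; split; first by have := intv i; rewrite tnth_mktuple.
  by rewrite normrM ler_piMr.
split; first exact: intw.
by rewrite normrM normrX ler_piMr// exprn_ge0.
Qed.

Lemma measurable_kball (q : nat) :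
  measurable (@kball R q : set ((2 * q).-tuple mR * mR)).
Proof.
pose f (p : (2 * q).-tuple mR * mR) : R :=
  (\sum_(i < 2 * q) (tnth p.1 i : R) ^+ 2) ^+ 2 + (p.2 : R) ^+ 2.
have fE p : f p = enorm (p.1 : (2 * q).-tuple R) ^+ 4 + p.2 ^+ 2.
  rewrite /f /enorm (_ : 4 = 2 * 2)%N// exprM sqr_sqrtr//.
  by apply: sumr_ge0 => i _; exact: sqr_ge0.
have mf : measurable_fun [set: (2 * q).-tuple mR * mR] f.
  apply: measurable_funD; last first.
    by apply: measurable_funX; exact: measurable_snd.
  apply: measurable_funX; apply: measurable_sum => i; apply: measurable_funX.
  exact: (measurableT_comp (measurable_tnth (T := mR) i) measurable_fst).
rewrite (_ : kball (q := q) = [set: (2 * q).-tuple mR * mR] `&` f @^-1` `]-oo, 1]).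
  exact: mf.
rewrite setTI; apply/seteqP; split=> p.
  by move=> /kballE h; rewrite /preimage /= in_itv /= fE.
by rewrite /preimage /= in_itv /= fE => h; apply/kballE.
Qed.

Lemma kvol_kball_fin_num (q : nat) : kvol (@kball R q) \is a fin_num.
Proof.
pose I := `[-1, 1]%classic : set mR.
have mI : measurable I by exact: measurable_itv.
have mB : measurable [set t : (2 * q).-tuple mR | forall i, I (tnth t i)].
  rewrite (_ : [set t | _] =
      \bigcap_(i in [set: 'I_(2 * q)]) ((@tnth _ mR ^~ i) @^-1` I)).
    apply: fin_bigcap_measurable => // i _.
    by rewrite -[X in measurable X]setTI; apply: measurable_tnth.
  by apply/seteqP; split=> t /= h i; [move=> _; exact: h|exact: h].
rewrite ge0_fin_numE ?measure_ge0//.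
apply: (@le_lt_trans _ _ ((lebesgue_tuple R (2 * q) \x @lebesgue_measure R)%E
    ([set t | forall i, I (tnth t i)] `*` I))).
  apply: le_measure; rewrite ?inE; [exact: measurable_kball|exact: measurableX|].
  move=> p /kball_bounded[bv bw]; split=> [i|]; rewrite /I /= in_itv /= -ler_norml//.
have Ioo : (@lebesgue_measure R I < +oo)%E.
  by rewrite /I lebesgue_measure_itv /=; case: ifPn => _; rewrite ?ltry.
have boxE := @lebesgue_tuple_box (2 * q) (fun=> I) (fun=> mI).
have box_fin : lebesgue_tuple R (2 * q)
    [set t | forall i, I (tnth t i)] \is a fin_num.
  by rewrite boxE; apply: prode_fin_num => i _; rewrite ge0_fin_numE.
by rewrite product_measure1E// lte_mul_pinfty.
Qed.

End well_definedness.

(* Main.v *)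
(** Write [X = x^2], so that one counts the points with [sqrt (|v|^4 + w^2) <= X].  Summing the
  radial weight [(c^2 - |v|^4 - w^2)_+^(5/2)] over the lattice and applying to the result a fourth
  difference of step [h] in [c] at [c = Y], corrected by a multiple of the second difference so that
  it annihilates [c^(q+6)], gives a quantity [S] in which the volume term disappears.  The resulting
  kernel has total variation [O((Y h)^(5/2))], hence [|S| <= C (Y h)^(5/2) sup |E|].

  For a lower bound of [S], the number of representations of [n] by [2q] squares is detected by a
  discrete circle method, and the sum over [(n, w)] is evaluated by Poisson summation (in Fejér
  form), which produces frequencies [t = |(b/d + p, l)|] with oscillation [cos (2 pi Y t)] and the
  nonnegative amplitude [wker].  Near a rational [b/d] the theta sum factors through the Gauss sum
  [S(b/d)], and the integral over the arc is a Fejér mean of nonnegative terms; the total mass of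
  the arcs with [d >= 2] is at most [sum |S(b/d)|^(2q) <= 7/10] of that of the arc at [0].  If [Y]
  is chosen by Dirichlet's theorem so that [Y sqrt n] is close to an integer for every sum of two
  squares [n <= N ~ h^-2], the arc at [0] contributes almost its full mass and [S >= c1 Y^(q+2) h^2].
  Therefore [sup |E| >= c Y^(q-1/2) h^(-1/2)].

  By Landau's theorem there are [O(N / sqrt (log N))] sums of two squares up to [N], so one may
  take [log Y <= C N / sqrt (log N)], and [h^(-1/2) ~ N^(1/4)] is then of order at least
  [(log Y)^(1/4) (log log Y)^(1/8)]. *)
Require Import Defs.
From HB Require Import structures.
From mathcomp Require Import all_boot all_order all_algebra.
From mathcomp Require Import finmap.
From mathcomp Require Import all_classical all_reals all_analysis.
From mathcomp Require Import complex.
From mathcomp Require Import ring lra zify.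

Set Implicit Arguments.
Unset Strict Implicit.
Unset Printing Implicit Defensive.
Import Order.TTheory GRing.Theory Num.Theory.
Import numFieldNormedType.Exports.
Local Open Scope ring_scope.

(** The exponent 5/2 makes everything explicit: a slice integral of [(A - b^2)_+^(5/2)] is a
    multiple of the polynomial [A^3], so the planar Fourier transform of the weight is an elementary
    integral and no Bessel asymptotics occur. The fourth difference suits its decay [t^-4]: it turns
    [cos (2 pi t c)] into [16 sin^4 (pi t h) cos (2 pi t c)], so the amplitude is nonnegative and
    stays bounded near [t = 0]. The obstacle is that no logarithm may be lost, the gain being itself
    only logarithmic. Hence the theta sums carry trapezoidal weights, whose correlations decay
    quadratically. The hypothesis [q >= 3] enters twice: the sum of [d * d^-3] over denominators
    converges on the minor arcs, and the mass of the other arcs is below 1. With the worst signs on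
    the other arcs, [99/100 - 7/10 = 29/100] of the mass of the arc at 0 remains; four errors of
    1/20 leave 9/100. This is possible because the lower bound for the arc at 0 does not depend on
    the largest denominator [D], so [D] is fixed before the other parameters. *)

Ltac drop_unusable :=
  repeat match goal with
  | H : forall _, _ |- _ => clear H
  | H : is_true (leq _ _) |- _ => clear H
  | H : is_true (leq _ _ && leq _ _) |- _ => clear H
  | H : @eq nat _ _ |- _ => clear H
  | H : ex _ |- _ => clear H
  end.

Ltac rlra := drop_unusable; lra.
Ltac rnra := drop_unusable; nra.

(** * Complex moduli, additive characters, elementary trigonometric bounds *)

Section complex_modulus.
Context (R : realType).
Implicit Types (z w : R[i]) (x y : R).

(** The norm of [R[i]] takes values in [R[i]]; this is the same modulus as a real number, so that
    real inequalities apply to it. *)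
Definition cabs z : R := complex.Re `|z|.

Lemma normC_cabs z : `|z| = (cabs z)%:C%C.
Proof. by rewrite /cabs normc_def. Qed.

Lemma cabs_sqr z : cabs z ^+ 2 = complex.Re z ^+ 2 + complex.Im z ^+ 2.
Proof. by rewrite /cabs normc_def /= sqr_sqrtr // addr_ge0 ?sqr_ge0. Qed.

Lemma cabs_ge0 z : 0 <= cabs z.
Proof. by rewrite /cabs normc_def /= sqrtr_ge0. Qed.

Lemma cabsM z w : cabs (z * w) = cabs z * cabs w.
Proof. by apply: complexI; rewrite rmorphM -!normC_cabs normrM. Qed.

Lemma cabsD z w : cabs (z + w) <= cabs z + cabs w.
Proof. by rewrite -lecR rmorphD /= -!normC_cabs ler_normD. Qed.

Lemma cabsN z : cabs (- z) = cabs z.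
Proof. by apply: complexI; rewrite -!normC_cabs normrN. Qed.

Lemma cabsB z w : cabs (z - w) <= cabs z + cabs w.
Proof. by rewrite -(cabsN w) cabsD. Qed.

Lemma cabs0 : cabs 0 = 0.
Proof. by apply: complexI; rewrite -normC_cabs normr0. Qed.

Lemma cabs1 : cabs 1 = 1.
Proof. by apply: complexI; rewrite -normC_cabs normr1. Qed.

Lemma cabsX z n : cabs (z ^+ n) = cabs z ^+ n.
Proof. by apply: complexI; rewrite rmorphXn /= -!normC_cabs normrX. Qed.

Lemma cabs_real x : cabs x%:C%C = `|x|.
Proof. by rewrite /cabs normc_def /= expr0n /= addr0 sqrtr_sqr. Qed.

Lemma cabs_sum (I : Type) (s : seq I) (P : pred I) (F : I -> R[i]) :
  cabs (\sum_(i <- s | P i) F i) <= \sum_(i <- s | P i) cabs (F i).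
Proof.
elim/big_rec2 : _ => [|i a b _ h]; first by rewrite cabs0.
by apply: le_trans (cabsD _ _) _; rewrite lerD2l.
Qed.

Lemma ReM z w :
  complex.Re (z * w) = complex.Re z * complex.Re w - complex.Im z * complex.Im w.
Proof. by case: z => a b; case: w. Qed.

Lemma ReD z w : complex.Re (z + w) = complex.Re z + complex.Re w.
Proof. by case: z => a b; case: w. Qed.

Lemma ReN z : complex.Re (- z) = - complex.Re z.
Proof. by case: z. Qed.

Lemma Re_sum (I : Type) (s : seq I) (P : pred I) (F : I -> R[i]) :
  complex.Re (\sum_(i <- s | P i) F i) = \sum_(i <- s | P i) complex.Re (F i).
Proof. by elim/big_rec2 : _ => // i a b _ <-; rewrite ReD. Qed.

Lemma ReZ x z : complex.Re (x%:C%C * z) = x * complex.Re z.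
Proof. by rewrite ReM /= mul0r subr0. Qed.

Lemma Re_le_cabs z : `|complex.Re z| <= cabs z.
Proof.
by rewrite -(@ler_pXn2r _ 2) ?nnegrE ?cabs_ge0 // real_normK ?num_real // cabs_sqr lerDl sqr_ge0.
Qed.

Lemma cabs_sqrE z : (cabs z ^+ 2)%:C%C = z * z^*%C.
Proof.
rewrite cabs_sqr; case: z => a b /=; simpc; congr (_ +i* _)%C => /=; ring.
Qed.

Lemma cabsXB z w n M : cabs z <= M -> cabs w <= M ->
  cabs (z ^+ n.+1 - w ^+ n.+1) <= n.+1%:R * M ^+ n * cabs (z - w).
Proof.
move=> hz hw; have M0 : 0 <= M := le_trans (cabs_ge0 _) hz.
rewrite subrXX cabsM mulrC ler_wpM2r ?cabs_ge0 //.
apply: le_trans (cabs_sum _ _ _) _.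
have -> : n.+1%:R * M ^+ n = \sum_(i < n.+1) M ^+ n.
  by rewrite sumr_const card_ord mulr_natl.
apply: ler_sum => i _; rewrite cabsM !cabsX /=.
have -> : M ^+ n = M ^+ (n - i) * M ^+ i by rewrite -exprD subnK // -ltnS.
by apply: ler_pM; rewrite ?exprn_ge0 ?cabs_ge0 // lerXn2r ?nnegrE ?cabs_ge0.
Qed.

(** The additive character [e(x) = exp (2 pi i x)]. *)
Definition ce x : R[i] := (cos (2 * pi * x) +i* sin (2 * pi * x))%C.

Lemma ceD x y : ce (x + y) = ce x * ce y.
Proof. by rewrite /ce mulrDr cosD sinD; simpc; congr (_ +i* _)%C; ring. Qed.

Lemma ce0 : ce 0 = 1.
Proof. by rewrite /ce mulr0 cos0 sin0. Qed.

Lemma ceN x : ce (- x) = (ce x)^*%C.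
Proof. by rewrite /ce mulrN cosN sinN. Qed.

Lemma ce_nat n : ce n%:R = 1.
Proof.
elim: n => [|n IH]; first exact: ce0.
rewrite -natr1 ceD IH mul1r /ce mulr1 (_ : 2 * pi = pi *+ 2) ?cos2pi ?sin2pi //.
by rewrite mulr_natl.
Qed.

Lemma ce_int (k : int) : ce k%:~R = 1.
Proof.
case: k => n; first by rewrite -pmulrn ce_nat.
by rewrite NegzE mulrNz ceN -pmulrn ce_nat conjc1.
Qed.

Lemma ceDint x (k : int) : ce (x + k%:~R) = ce x.
Proof. by rewrite ceD ce_int mulr1. Qed.

Lemma cabs_ce x : cabs (ce x) = 1.
Proof.
by apply/eqP; rewrite -(@pexpr_eq1 _ _ 2) ?cabs_ge0 // cabs_sqr /= cos2Dsin2.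
Qed.

Lemma ceX x n : ce x ^+ n = ce (n%:R * x).
Proof.
elim: n => [|n IH]; first by rewrite expr0 mul0r ce0.
by rewrite exprS IH -ceD -natr1 mulrDl mul1r addrC.
Qed.

Lemma ce_sum (I : Type) (s : seq I) (P : pred I) (F : I -> R) :
  ce (\sum_(i <- s | P i) F i) = \prod_(i <- s | P i) ce (F i).
Proof. by elim/big_rec2 : _ => [|i a b _ <-]; rewrite ?ce0 ?ceD. Qed.

Lemma derive_le (f f' : R -> R) (a b : R) : a <= b ->
  (forall x, a <= x <= b -> is_derive x 1 f (f' x)) ->
  (forall x, a <= x <= b -> 0 <= f' x) -> f a <= f b.
Proof.
rewrite le_eqVlt => /orP[/eqP -> //|ab] df f0.
have [||c] := @MVT R f f' a b ab.
- by move=> x; rewrite in_itv /= => /andP[h1 h2]; apply: df; rewrite !ltW.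
- apply: derivable_within_continuous => x; rewrite in_itv /= => h.
  by have [] := df x h.
rewrite in_itv /= => /andP[h1 h2] h; rewrite -subr_ge0 h mulr_ge0 ?f0 ?subr_ge0 ?ltW //.
Qed.

(** The rules below apply to plain lambda terms and yield derivatives in an unsimplified form; this
    lemma leaves the simplification as a separate equation. *)
Lemma der_eq (f : R -> R) x a b : is_derive x 1 f a -> a = b -> is_derive x 1 f b.
Proof. by move=> ? <-. Qed.

Lemma der_id x : is_derive x 1 (fun t : R => t) 1.
Proof. exact: is_derive_id. Qed.

Lemma der_cst (c x : R) : is_derive x 1 (fun=> c) 0.
Proof. exact: is_derive_cst. Qed.

Lemma derD (f g : R -> R) x a b : is_derive x 1 f a -> is_derive x 1 g b ->
  is_derive x 1 (fun t => f t + g t) (a + b).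
Proof. by move=> ? ?; exact: is_deriveD. Qed.

Lemma derN (f : R -> R) x a : is_derive x 1 f a -> is_derive x 1 (fun t => - f t) (- a).
Proof. by move=> ?; exact: is_deriveN. Qed.

Lemma derM (f g : R -> R) x a b : is_derive x 1 f a -> is_derive x 1 g b ->
  is_derive x 1 (fun t => f t * g t) (f x * b + g x * a).
Proof. by move=> ? ?; exact: is_deriveM. Qed.

Lemma derX (f : R -> R) n x (a : R) : is_derive x 1 f a ->
  is_derive x 1 (fun t => f t ^+ n.+1) (n.+1%:R * f x ^+ n * a).
Proof.
move=> h; have H := @is_deriveX _ _ f n.+1 x 1 a h.
rewrite (_ : n.+1%:R * f x ^+ n * a = (n.+1%:R * f x ^+ n) *: a) //.
suff -> : (fun t => f t ^+ n.+1) = f ^+ n.+1 by [].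
by apply/funext => t; rewrite exprfctE.
Qed.

Lemma der_comp (f g : R -> R) x (a b : R) : is_derive (g x) 1 f a -> is_derive x 1 g b ->
  is_derive x 1 (fun t => f (g t)) (a * b).
Proof.
by move=> hf hg; exact: (@is_derive1_comp R f g x a b hf hg).
Qed.

Lemma der_sin (g : R -> R) x b : is_derive x 1 g b ->
  is_derive x 1 (fun t => sin (g t)) (cos (g x) * b).
Proof. exact: der_comp (is_derive_sin _). Qed.

Lemma der_cos (g : R -> R) x b : is_derive x 1 g b ->
  is_derive x 1 (fun t => cos (g t)) (- sin (g x) * b).
Proof. exact: der_comp (is_derive_cos _). Qed.

Lemma der_sqrt (g : R -> R) x (b : R) : 0 < g x -> is_derive x 1 g b ->
  is_derive x 1 (fun t => Num.sqrt (g t)) (b / (2 * Num.sqrt (g x))).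
Proof.
move=> g0 hg; apply: der_eq (der_comp (is_derive1_sqrt g0) hg) _.
by rewrite mulrC.
Qed.

Lemma der_inv (g : R -> R) x (b : R) : g x != 0 -> is_derive x 1 g b ->
  is_derive x 1 (fun t => (g t)^-1) (- b / g x ^+ 2).
Proof.
move=> g0 hg; have := @is_deriveV _ g x b 1 g0 hg.
rewrite (_ : - b / g x ^+ 2 = - (g x) ^- 2 *: b) // /GRing.scale /=.
by rewrite mulNr mulNr mulrC.
Qed.

Lemma sin_le_id x : 0 <= x -> sin x <= x.
Proof.
move=> x0; rewrite -subr_ge0.
pose f (t : R) : R := t - sin t.
have -> : x - sin x = f x by [].
rewrite (_ : 0 = f 0); last by rewrite /f sin0 subr0.
apply: (@derive_le f (fun t => 1 - cos t)) => // t _; rewrite ?subr_ge0 ?cos_le1 //.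
Qed.

Lemma abs_sin_le x : `|sin x| <= `|x|.
Proof.
have h y : 0 <= y -> `|sin y| <= y.
  move=> y0; rewrite ler_norml sin_le_id // andbT.
  have [y4|y4] := leP y 1.
    apply: (@le_trans _ _ 0); first by rewrite oppr_le0.
    by apply: sin_ge0_pi; rewrite y0 (le_trans y4) // (le_trans _ (pi_ge2 R)) // ler1n.
  by apply: le_trans (sin_geN1 _); rewrite lerN2 ltW.
have [x0|x0] := leP 0 x; first by rewrite (ger0_norm x0) h.
by rewrite -normrN -sinN -[leRHS]normrN (@ger0_norm _ (- x)) ?h // oppr_ge0 ltW.
Qed.

Lemma cos_half x : 1 - cos x = 2 * sin (x / 2) ^+ 2.
Proof.
have -> : cos x = cos ((x / 2) *+ 2) by congr cos; rewrite mulr2n; field.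
rewrite cos_mulr2n sin2cos2 mulr2n; ring.
Qed.

Lemma cos_ge_quad x : 1 - x ^+ 2 / 2 <= cos x.
Proof.
have : sin (x / 2) ^+ 2 <= (x / 2) ^+ 2.
  by rewrite -[X in X <= _]real_normK ?num_real // -[leRHS]real_normK ?num_real //
     ler_pXn2r ?nnegrE // abs_sin_le.
have := cos_half x; rewrite expr_div_n; rlra.
Qed.

Lemma cabs_ce_sub1 x : cabs (ce x - 1) = 2 * `|sin (pi * x)|.
Proof.
apply/eqP; rewrite -(@eqrXn2 _ 2) ?cabs_ge0 ?mulr_ge0 // exprMn real_normK ?num_real //.
rewrite cabs_sqr /=; apply/eqP.
have := cos_half (2 * pi * x); have := cos2Dsin2 (2 * pi * x).
have -> : 2 * pi * x / 2 = pi * x by field.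
set c := cos _; set s := sin _; set u := sin _; rewrite subr0 => h1 h2.
have -> : s ^+ 2 = 1 - c ^+ 2 by rewrite -h1; ring.
have -> : u ^+ 2 = (1 - c) / 2 by rewrite h2; field.
by field.
Qed.

Lemma cabs_ceB x y : cabs (ce x - ce y) <= 2 * pi * `|x - y|.
Proof.
have -> : ce x - ce y = ce y * (ce (x - y) - 1).
  by rewrite mulrBr mulr1 -ceD addrCA subrr addr0.
rewrite cabsM cabs_ce mul1r cabs_ce_sub1 -mulrA ler_pM2l //.
by apply: le_trans (abs_sin_le _) _; rewrite normrM ger0_norm ?pi_ge0.
Qed.

Lemma cos_lip x y : `|cos x - cos y| <= `|x - y|.
Proof.
have -> : cos x - cos y = - 2 * sin ((x + y) / 2) * sin ((x - y) / 2).
  have ex : x = (x + y) / 2 + (x - y) / 2 by field.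
  have ey : y = (x + y) / 2 - (x - y) / 2 by field.
  have -> : cos x = cos ((x + y) / 2 + (x - y) / 2) by rewrite -ex.
  have -> : cos y = cos ((x + y) / 2 - (x - y) / 2) by rewrite -ey.
  rewrite cosD cosB; ring.
rewrite !normrM normrN (@ger0_norm _ 2) //.
have h1 := sin_max ((x + y) / 2); have h2 := abs_sin_le ((x - y) / 2).
apply: (@le_trans _ _ (2 * 1 * `|(x - y) / 2|)).
  by rewrite ler_pM ?mulr_ge0 // ler_pM2l.
by rewrite normrM (@ger0_norm _ 2^-1) // mulr1 mulrCA divff // mulr1.
Qed.

Lemma sin_lip x y : `|sin x - sin y| <= `|x - y|.
Proof.
rewrite -!cosBpihalf; apply: le_trans (cos_lip _ _) _.
by rewrite opprB addrA subrK.
Qed.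

Lemma pi_lt4 : pi < 4 :> R.
Proof. by have := pihalf_lt2 R; rewrite ltr_pdivrMr // -natrM. Qed.

Lemma sin_jordan_quarter x : 0 <= x <= pi / 4 -> x / 2 <= sin x.
Proof.
move=> /andP[x0 x1].
have pi4 := pi_lt4; have pi2 := pi_ge2 R.
rewrite -subr_ge0.
pose f (t : R) : R := sin t - t / 2.
have -> : sin x - x / 2 = f x by [].
rewrite (_ : 0 = f 0); last by rewrite /f sin0 mul0r subr0.
apply: (@derive_le f (fun t => cos t - 1 / 2)) => // t /andP[t0 tx]; last first.
  have := cos_ge_quad t; have : t ^+ 2 <= 1 by rewrite expr_le1 //; rlra.
  rlra.
apply: der_eq (derD (is_derive_sin _) (derN (derM (der_id _) (der_cst _ _)))) _.
by rewrite mulr0 add0r mulrC.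
Qed.

(** Together with [cabs_ce_sub1], this bounds [|e(x) - 1|] below by twice the distance of [x] to the
    nearest integer. Up to 1/4 it is a Jordan inequality; from 1/4 to 1/2 the quadratic bound for
    the cosine around the maximum of the sine is enough. *)
Lemma abs_sin_pi_ge x : `|x| <= 1 / 2 -> `|x| <= `|sin (pi * x)|.
Proof.
have pi4 := pi_lt4; have pi2 := pi_ge2 R.
have key y : 0 <= y <= 1 / 2 -> y <= sin (pi * y).
  move=> /andP[y0 y1]; have [h|h] := leP y (1 / 4).
    have := @sin_jordan_quarter (pi * y); rewrite mulr_ge0 ?pi_ge0 //=.
    move=> H; apply: le_trans (H _); [rnra|rnra].
  have -> : pi * y = pi / 2 - pi * (1 / 2 - y) by field.
  rewrite sinB sin_pihalf cos_pihalf mul0r subr0 mul1r.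
  have e : 0 <= pi * (1 / 2 - y) <= pi / 4 by apply/andP; split; rnra.
  set u := pi * (1 / 2 - y) in e *; have := cos_ge_quad u.
  have : u ^+ 2 <= 1 by move: e => /andP[u0 u1]; rewrite expr_le1 //; rlra.
  rlra.
move=> hx; have [x0|x0] := leP 0 x.
  by move: hx; rewrite ger0_norm // => hx; rewrite (le_trans _ (ler_norm _)) // key // x0.
have nx : 0 <= - x by rewrite oppr_ge0 ltW.
move: hx; rewrite -normrN ger0_norm // => hx.
rewrite -[X in _ <= X]normrN -sinN -mulrN (le_trans _ (ler_norm _)) // key //.
by rewrite nx hx.
Qed.

End complex_modulus.

(** * Integration by antiderivatives *)

Section integral.
Context (R : realType).
Local Open Scope classical_set_scope.
Implicit Types (f g F G : R -> R) (a b c d e k l x y M : R).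

Lemma derive0_eq F a b : a <= b -> (forall x, a <= x <= b -> is_derive x 1 F 0) -> F a = F b.
Proof.
move=> ab h; apply: le_anti; apply/andP; split.
  by apply: (@derive_le _ F (fun=> 0)).
have := @derive_le _ (fun x => - F x) (fun=> - 0) a b ab.
rewrite lerN2; apply => x hx; last by rewrite oppr0.
exact: derN (h x hx).
Qed.

Lemma is_derive_of_bound F x : (forall e : R, 0 < e ->
    \forall y \near x, `|F y - F x| <= e * `|y - x|) -> is_derive x 1 F 0.
Proof.
move=> h.
have cv : h^-1 *: (F (h *: 1 + x) - F x) @[h --> 0^'] --> (0 : R).
  apply/cvgrPdist_le => e e0; have /nbhs_ballP[d /= d0 hd] := h _ e0.
  near=> t; rewrite sub0r normrN /GRing.scale /= mulr1 normrM normfV.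
  have t0 : t != 0 by near: t; exact: nbhs_dnbhs_neq.
  rewrite ler_pdivrMl ?normr_gt0 // mulrC.
  have /hd : ball x d (t + x).
    rewrite /ball /= opprD addrCA subrr addr0 normrN.
    near: t; apply: dnbhs0_lt; exact: d0.
  by rewrite addrK.
apply: DeriveDef; first by apply/cvg_ex; exists 0.
exact: cvg_lim cv.
Unshelve. all: by end_near. Qed.

Lemma antiderivative_on f (n : nat) : continuous f ->
  exists G, G 0 = 0 /\ forall x, - n%:R < x < n%:R -> is_derive x 1 G (f x).
Proof.
move=> cf; pose H x := \int[lebesgue_measure]_(t in `[(- n%:R : R), x]) f t.
exists (fun x => H x - H 0); split; first by rewrite subrr.
move=> x /andP[h1 h2].
have itg : lebesgue_measure.-integrable `[(- n%:R : R), n%:R] (EFin \o f).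
  apply: continuous_compact_integrable; first exact: segment_compact.
  exact: continuous_subspaceT.
have [dH HE] := @continuous_FTC1_closed R f (- n%:R) x n%:R h2 itg h1 (cf x).
have dd : is_derive x 1 H (f x) by rewrite -HE derive1E; exact: derivableP.
by apply: der_eq (derD dd (der_cst _ _)) _; rewrite addr0.
Qed.

(** Primitives on []-n, n[] that vanish at 0 agree on overlaps and therefore glue. The index [N x]
    exceeds [|x| + 1], so the points near [x] also lie in the domain of [G (N x)]. *)
Lemma antiderivative_exists f : continuous f ->
  exists F, forall x, is_derive x 1 F (f x).
Proof.
move=> cf.
have /choice[G HG] := fun n => @antiderivative_on f n cf.
have agree m n x : (m <= n)%N -> - m%:R < x < m%:R -> G m x = G n x.
  move=> mn /andP[x1 x2].
  have mn' : m%:R <= n%:R :> R by rewrite ler_nat.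
  have dd (t : R) : - m%:R < t < m%:R -> is_derive t 1 (fun z => G m z - G n z) 0.
    move=> /andP[t1 t2]; rewrite -(subrr (f t)); apply: derD.
      by apply: (HG m).2; rewrite t1.
    by apply: derN; apply: (HG n).2; apply/andP; split; rlra.
  have e0 : G m 0 - G n 0 = 0 by rewrite (HG m).1 (HG n).1 subrr.
  apply/eqP; rewrite -subr_eq0 -e0; apply/eqP.
  have [x0|x0] := leP 0 x.
    by apply/esym/(@derive0_eq (fun z => G m z - G n z) _ _ x0) => t /andP[h1 h2]; apply: dd; rlra.
  by apply: (@derive0_eq (fun z => G m z - G n z) _ _ (ltW x0)) => t /andP[h1 h2]; apply: dd; rlra.
pose N x := (Num.truncn `|x|).+2.
have NP x : `|x| + 1 < (N x)%:R.
  by rewrite /N -natr1 ltrD2r; exact: truncnS_gt.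
exists (fun x => G (N x) x) => x.
have xN : - (N x)%:R < x < (N x)%:R.
  by have := NP x; have := ler_norm x; have := ler_norm (- x); rewrite normrN; rlra.
apply: near_eq_is_derive ((HG (N x)).2 x xN) => //.
near=> y.
have yx : `|y - x| < 1 :> R.
  near: y; apply/nbhs_ballP; exists 1 => //= z; rewrite /ball /= distrC //.
have yb : `|y| < (N x)%:R.
  have := NP x; have := ler_normD (y - x) x; rewrite subrK; rlra.
have yN := NP y.
have hy m : `|y| < m%:R -> - m%:R < y < m%:R by rewrite ltr_norml.
have [h|h] := leqP (N x) (N y).
  by apply: agree => //; exact: hy.
by apply/esym/agree; [exact: ltnW|apply: hy; rlra].
Unshelve. all: by end_near. Qed.

Definition antiderivative f : R -> R :=
  xget (fun=> 0) [set F | forall x, is_derive x 1 F (f x)].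

(** The increment of a chosen primitive: it is oriented, and additivity in the limits holds without
    hypotheses. For an integrand without primitive the chosen function defaults to 0. *)
Definition Int f a b : R := antiderivative f b - antiderivative f a.

Lemma antiderivativeP f : continuous f -> forall x, is_derive x 1 (antiderivative f) (f x).
Proof. by move=> /antiderivative_exists[F hF]; exact: (@xgetPex _ (fun=> 0) [set F | forall x, is_derive x 1 F (f x)] (ex_intro _ F hF)). Qed.

Lemma Int_eq f F a b : (forall x, is_derive x 1 F (f x)) -> Int f a b = F b - F a.
Proof.
move=> hF; rewrite /Int; set A := antiderivative f.
have hA : forall x, is_derive x 1 A (f x).
  exact: (@xgetPex _ (fun=> 0) [set F | forall x, is_derive x 1 F (f x)] (ex_intro _ F hF)).
have : A b - F b = A a - F a.
  apply: (@is_derive_0_is_cst _ (fun x => A x - F x)) => x.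
  by rewrite -(subrr (f x)); apply: derD => //; exact: derN.
rlra.
Qed.

Lemma Int_chasles f a b c : Int f a b + Int f b c = Int f a c.
Proof. rewrite /Int; ring. Qed.

Lemma Intxx f a : Int f a a = 0. Proof. exact: subrr. Qed.

Lemma IntC f a b : Int f b a = - Int f a b.
Proof. by rewrite /Int opprB. Qed.

Lemma IntD f g a b : continuous f -> continuous g ->
  Int (fun x => f x + g x) a b = Int f a b + Int g a b.
Proof.
move=> cf cg; have H x := derD (antiderivativeP cf x) (antiderivativeP cg x).
rewrite (Int_eq _ _ H) /Int; ring.
Qed.

Lemma IntZ f k a b : continuous f -> Int (fun x => k * f x) a b = k * Int f a b.
Proof.
move=> cf.
have H x : is_derive x 1 (fun x => k * antiderivative f x) (k * f x).
  apply: der_eq (derM (der_cst _ _) (antiderivativeP cf x)) _; ring.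
rewrite (Int_eq _ _ H) /Int; ring.
Qed.

Lemma IntB f g a b : continuous f -> continuous g ->
  Int (fun x => f x - g x) a b = Int f a b - Int g a b.
Proof.
move=> cf cg; have H x := derD (antiderivativeP cf x) (derN (antiderivativeP cg x)).
rewrite (Int_eq _ _ H) /Int; ring.
Qed.

Lemma Int_cst k a b : Int (fun=> k) a b = k * (b - a).
Proof.
have H x : is_derive x 1 (fun x : R => k * x) k.
  apply: der_eq (derM (der_cst _ _) (der_id _)) _; ring.
rewrite (Int_eq _ _ H); ring.
Qed.

Lemma Int_sum (I : Type) (s : seq I) (F : I -> R -> R) a b :
  (forall i, continuous (F i)) ->
  Int (fun x => \sum_(i <- s) F i x) a b = \sum_(i <- s) Int (F i) a b.
Proof.
move=> cF; elim: s => [|i s IH].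
  rewrite big_nil (_ : (fun x => _) = fun=> 0) ?Int_cst ?mul0r //.
  by apply/funext => x; rewrite big_nil.
rewrite big_cons -IH -IntD //.
- by congr Int; apply/funext => x; rewrite big_cons.
- move=> x; elim: s {IH} => [|j s IH].
    by under [X in continuous_at _ X]funext do rewrite big_nil; exact: cvg_cst.
  by under [X in continuous_at _ X]funext do rewrite big_cons; apply: cvgD => //; exact: cF.
Qed.

Lemma Int_le f g a b : continuous f -> continuous g -> a <= b ->
  (forall x, a <= x <= b -> f x <= g x) -> Int f a b <= Int g a b.
Proof.
move=> cf cg ab h.
rewrite -subr_ge0 -IntB // /Int subr_ge0.
apply: (@derive_le _ _ (fun x => g x - f x)) => // x hx; last by rewrite subr_ge0 h.
apply: antiderivativeP => y; apply: cvgB; [exact: cg|exact: cf].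
Qed.

Lemma Int_eq_in f g a b : continuous f -> continuous g -> a <= b ->
  (forall x, a <= x <= b -> f x = g x) -> Int f a b = Int g a b.
Proof.
by move=> cf cg ab h; apply: le_anti; rewrite !Int_le // => x hx; rewrite h.
Qed.

Lemma Int_abs f M a b : continuous f -> a <= b ->
  (forall x, a <= x <= b -> `|f x| <= M) -> `|Int f a b| <= M * (b - a).
Proof.
move=> cf ab h; rewrite ler_norml -mulNr -!Int_cst !Int_le //.
- by move=> x; exact: cvg_cst.
- by move=> x /h; rewrite ler_norml => /andP[].
- by move=> x; exact: cvg_cst.
- by move=> x /h; rewrite ler_norml => /andP[].
Qed.

Lemma Int_affine f k l a b : continuous f ->
  k * Int (fun x => f (k * x + l)) a b = Int f (k * a + l) (k * b + l).
Proof.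
move=> cf; have [->|k0] := eqVneq k 0; first by rewrite !mul0r Intxx.
have H x : is_derive x 1 (fun x => k^-1 * antiderivative f (k * x + l)) (f (k * x + l)).
  have D : is_derive x 1 (fun x : R => k * x + l) k.
    apply: der_eq (derD (derM (der_cst _ _) (der_id _)) (der_cst _ _)) _; ring.
  apply: der_eq (derM (der_cst _ _) (der_comp (antiderivativeP cf _) D)) _.
  by field.
by rewrite (Int_eq _ _ H) /Int -mulrBr mulrA divff // mul1r.
Qed.

Lemma continuous_comp2 (T : topologicalType) (f : R -> R -> R) (g h : T -> R) :
  continuous (fun p : R * R => f p.1 p.2) -> continuous g -> continuous h ->
  continuous (fun t => f (g t) (h t)).
Proof.
move=> cf cg ch t; have H := @continuous2_cvg _ _ _ _ (nbhs t) _ g h f (g t) (h t) (cf (g t, h t)).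
by apply: H; [exact: cg|exact: ch].
Qed.

Lemma continuous_fst : continuous (fun p : R * R => p.1).
Proof. by move=> p; exact: cvg_fst. Qed.

Lemma continuous_snd : continuous (fun p : R * R => p.2).
Proof. by move=> p; exact: cvg_snd. Qed.

Lemma continuous_cst (T : topologicalType) (k : R) : continuous (fun _ : T => k).
Proof. by move=> p; exact: cvg_cst. Qed.

Section continuity.
Context (T : topologicalType).
Implicit Types u v : T -> R.

Lemma continuous_add u v : continuous u -> continuous v -> continuous (fun t => u t + v t).
Proof. by move=> cu cv t; apply: cvgD; [exact: cu|exact: cv]. Qed.

Lemma continuous_neg u : continuous u -> continuous (fun t => - u t).
Proof. by move=> cu t; apply: cvgN; exact: cu. Qed.

Lemma continuous_mul u v : continuous u -> continuous v -> continuous (fun t => u t * v t).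
Proof. by move=> cu cv t; apply: cvgM; [exact: cu|exact: cv]. Qed.

Lemma continuous_exprn u n : continuous u -> continuous (fun t => u t ^+ n).
Proof.
by move=> cu t; apply: (@continuous_comp _ _ _ u (fun x : R => x ^+ n)); [exact: cu|exact: exprn_continuous].
Qed.

Lemma continuous_cos_comp u : continuous u -> continuous (fun t => cos (u t)).
Proof. by move=> cu t; apply: (cvg_comp u); [exact: cu|exact: continuous_cos]. Qed.

Lemma continuous_sin_comp u : continuous u -> continuous (fun t => sin (u t)).
Proof. by move=> cu t; apply: (cvg_comp u); [exact: cu|exact: continuous_sin]. Qed.

Lemma continuous_sqrt_comp u : continuous u -> continuous (fun t => Num.sqrt (u t)).
Proof. by move=> cu t; apply: (cvg_comp u); [exact: cu|exact: sqrt_continuous]. Qed.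

Lemma continuous_sum (I : Type) (s : seq I) (F : I -> T -> R) :
  (forall i, continuous (F i)) -> continuous (fun t => \sum_(i <- s) F i t).
Proof.
move=> cF; elim: s => [|i s IH].
  rewrite (_ : (fun t => _) = fun=> 0); first exact: continuous_cst.
  by apply/funext => t; rewrite big_nil.
rewrite (_ : (fun t => _) = fun t => F i t + \sum_(i <- s) F i t).
  exact: continuous_add.
by apply/funext => t; rewrite big_cons.
Qed.

End continuity.

Lemma continuous_idfun : continuous (fun x : R => x).
Proof. by move=> x; exact: cvg_id. Qed.

Lemma continuous_uniform (f : R -> R -> R) x c d e :
  continuous (fun p : R * R => f p.1 p.2) -> 0 < e ->
  \forall s \near x, forall b, c <= b <= d -> `|f s b - f x b| < e.
Proof.
move=> cf e0.
have [+ _] := @compact_near_coveringP R `[c, d].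
move=> /(_ (@segment_compact _ _ _)) /(_ R (nbhs x) (fun s b => `|f s b - f x b| < e) _).
move=> H.
suff : \forall s \near x, `[c, d] `<=` (fun b => `|f s b - f x b| < e).
  by apply: filterS => s hs b hb; apply: hs; rewrite /= in_itv.
apply: H => b _.
pose g (p : R * R) : R := f p.2 p.1 - f x p.1.
have cg : {for (b, x), continuous g}.
  apply: cvgB.
    exact: (continuous_comp2 cf continuous_snd continuous_fst).
  exact: (continuous_comp2 cf (continuous_cst (k := x)) continuous_fst).
have : \forall p \near (b, x), `|g p| < e.
  have /cvgrPdist_lt/(_ e e0) := cg; apply: filterS => p.
  by rewrite {1}/g subrr sub0r normrN.
by [].
Qed.

Lemma continuous_slice (f : R -> R -> R) x :
  continuous (fun p : R * R => f p.1 p.2) -> continuous (f x).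
Proof.
move=> cf; apply: (continuous_comp2 cf (continuous_cst (k := x))).
by move=> y; exact: cvg_id.
Qed.

Lemma continuous_swap (f : R -> R -> R) :
  continuous (fun p : R * R => f p.1 p.2) -> continuous (fun p : R * R => f p.2 p.1).
Proof.
by move=> cf; exact: (continuous_comp2 cf continuous_snd continuous_fst).
Qed.

Lemma continuous_Int (f : R -> R -> R) c d : c <= d ->
  continuous (fun p : R * R => f p.1 p.2) -> continuous (fun x => Int (f x) c d).
Proof.
move=> cd cf x; apply/cvgrPdist_le => e e0.
have e1 : 0 < e / (d - c + 1) by rewrite divr_gt0 // ltr_wpDl // subr_ge0.
near=> s; rewrite -IntB; [|exact: continuous_slice..].
have le1 : e / (d - c + 1) * (d - c) <= e.
  by rewrite mulrAC ler_pdivrMr ?ltr_wpDl ?subr_ge0 // ler_pM2l // lerDl.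
apply: le_trans (Int_abs _ cd _) le1.
  by move=> y; apply: cvgB; exact: continuous_slice.
move=> b hb; rewrite distrC ltW //; move: b hb; near: s.
exact: continuous_uniform.
Unshelve. all: by end_near. Qed.

(** The difference of the two iterated integrals, as a function of the upper limit [x], has
    derivative 0: subtracting the integrand frozen at [x] changes both sides equally, and by uniform
    continuity what is left is [o(|z - x|)]. *)
Lemma Int_fubini (f : R -> R -> R) a b c d : c <= d -> a <= b ->
  continuous (fun p : R * R => f p.1 p.2) ->
  Int (fun x => Int (f x) c d) a b = Int (fun y => Int (fun x => f x y) a b) c d.
Proof.
move=> cd ab cf; have cs := continuous_swap cf.
have cI : continuous (fun x => Int (f x) c d) by exact: continuous_Int.
have csl y : continuous (fun x => f x y) by exact: (@continuous_slice (fun y x => f x y)).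
have cI2 u v : continuous (fun y => Int (fun x => f x y) u v).
  have [uv|vu] := leP u v; first exact: (@continuous_Int (fun y x => f x y)).
  rewrite (_ : (fun y => _) = (fun y => - Int (fun x => f x y) v u)).
    by move=> y; apply: cvgN; apply: (@continuous_Int (fun y x => f x y)); rewrite ?ltW.
  by apply/funext => y; rewrite IntC.
pose e x := Int (fun y => Int (fun x => f x y) a x) c d - Int (fun x => Int (f x) c d) a x.
suff : e a = e b.
  rewrite /e Intxx subr0 (_ : (fun y => _) = fun=> 0).
    by rewrite Int_cst mul0r; rlra.
  by apply/funext => y; rewrite Intxx.
apply: is_derive_0_is_cst => x; apply: is_derive_of_bound => eps eps0.
pose eps' := eps / (2 * (d - c + 1)).
have dc : 0 < d - c + 1 by rewrite ltr_wpDl // subr_ge0.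
have eps'0 : 0 < eps' by rewrite divr_gt0 // mulr_gt0.
have /nbhs_ballP[r /= r0 hr] := @continuous_uniform f x c d eps' cf eps'0.
apply/nbhs_ballP; exists r => //= z xz.
have E : e z - e x = Int (fun y => Int (fun s => f s y - f x y) x z) c d
     - Int (fun s => Int (fun y => f s y - f x y) c d) x z.
  have -> : Int (fun y => Int (fun s => f s y - f x y) x z) c d =
      Int (fun y => Int (fun s => f s y) x z) c d - (z - x) * Int (f x) c d.
    rewrite -IntZ -?IntB //; last exact: continuous_slice.
      by congr Int; apply/funext => y; rewrite IntB //; [rewrite Int_cst mulrC|move=> ?; exact: cvg_cst].
    by move=> y; apply: cvgM; [exact: cvg_cst|exact: continuous_slice].
  have -> : Int (fun s => Int (fun y => f s y - f x y) c d) x z =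
      Int (fun s => Int (f s) c d) x z - (z - x) * Int (f x) c d.
    rewrite mulrC -Int_cst -IntB //; last by move=> ?; exact: cvg_cst.
    by congr Int; apply/funext => s; rewrite IntB //; exact: continuous_slice.
  rewrite /e.
  have -> : Int (fun y => Int (fun s => f s y) x z) c d =
     Int (fun y => Int (fun s => f s y) a z) c d - Int (fun y => Int (fun s => f s y) a x) c d.
    rewrite -IntB //; congr Int; apply/funext => y.
    by rewrite -(Int_chasles _ a x z) addrC addKr.
  rewrite -(Int_chasles (fun s => Int (f s) c d) a x z); ring.
have key u v : u <= v -> (forall s, u <= s <= v -> ball x r s) ->
  `|Int (fun y => Int (fun s => f s y - f x y) u v) c d| <= eps' * (v - u) * (d - c) /\
  `|Int (fun s => Int (fun y => f s y - f x y) c d) u v| <= eps' * (d - c) * (v - u).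
  move=> uv hb.
  have cg : continuous (fun p : R * R => f p.1 p.2 - f x p.2).
    move=> p; apply: cvgB; first exact: cf.
    exact: (continuous_comp2 cf (continuous_cst (k := x)) continuous_snd).
  have cg' := @continuous_swap (fun s y => f s y - f x y) cg.
  split.
    apply: Int_abs => //; first exact: (@continuous_Int (fun y s => f s y - f x y)).
    move=> y hy; apply: Int_abs => //.
      exact: (@continuous_slice (fun y s => f s y - f x y)).
    by move=> s hs; rewrite ltW // hr //; exact: hb.
  apply: Int_abs => //; first exact: (@continuous_Int (fun s y => f s y - f x y)).
  move=> s hs; apply: Int_abs => //.
    exact: (@continuous_slice (fun s y => f s y - f x y)).
  by move=> y hy; rewrite ltW // hr //; exact: hb.
have fin A B : `|A| <= eps' * `|z - x| * (d - c) -> `|B| <= eps' * (d - c) * `|z - x| ->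
    `|A - B| <= eps * `|z - x|.
  move=> hA hB; apply: le_trans (ler_normB _ _) _; apply: le_trans (lerD hA hB) _.
  have -> : eps' * `|z - x| * (d - c) + eps' * (d - c) * `|z - x| =
    (eps' * (2 * (d - c))) * `|z - x| by ring.
  apply: ler_wpM2r => //; rewrite /eps' mulrAC ler_pdivrMr ?mulr_gt0 //.
  by apply: ler_wpM2l; [exact: ltW|rlra].
rewrite E; move: xz; rewrite /ball /= => xz.
have [xz'|zx'] := leP x z.
  have [||h1 h2] := key x z.
  - exact: xz'.
  - by move=> s /andP[s1 s2]; rewrite /ball /= distrC ger0_norm ?subr_ge0 //;
      move: xz; rewrite distrC ger0_norm ?subr_ge0 //; rlra.
  have zx : `|z - x| = z - x by rewrite ger0_norm ?subr_ge0.
  by apply: fin; rewrite zx.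
have [||h1 h2] := key z x.
- exact: ltW.
- by move=> s /andP[s1 s2]; rewrite /ball /= ger0_norm ?subr_ge0 //;
    move: xz; rewrite ger0_norm ?subr_ge0 ?(ltW zx') //; rlra.
apply: fin.
  rewrite (_ : (fun y => _) = (fun y => -1 * Int (fun s => f s y - f x y) z x)).
    rewrite IntZ ?mulN1r ?normrN ?(ltr0_norm (x := z - x)) ?subr_lt0 ?opprB //.
    apply: (@continuous_Int (fun y s => f s y - f x y)); first exact: ltW.
    move=> p; apply: cvgB; first exact: cs.
    exact: (continuous_comp2 cf (continuous_cst (k := x)) continuous_fst).
  by apply/funext => y; rewrite IntC mulN1r.
by rewrite IntC normrN (ltr0_norm (x := z - x)) ?subr_lt0 // opprB.
Qed.

End integral.

Ltac cont1 :=
  lazymatch goal with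
  | |- continuous (fun _ => ?k) => exact: continuous_cst
  | |- continuous (fun x => x) => exact: continuous_idfun
  | |- continuous (fun x => x.1) => exact: continuous_fst
  | |- continuous (fun x => x.2) => exact: continuous_snd
  | |- continuous (fun x => @?f x + @?g x) => refine (@continuous_add _ _ f g _ _)
  | |- continuous (fun x => - @?f x) => refine (@continuous_neg _ _ f _)
  | |- continuous (fun x => @?f x ^+ ?n) => refine (@continuous_exprn _ _ f n _)
  | |- continuous (fun x => @?f x * @?g x) => refine (@continuous_mul _ _ f g _ _)
  | |- continuous (fun x => cos (@?f x)) => refine (@continuous_cos_comp _ _ f _)
  | |- continuous (fun x => sin (@?f x)) => refine (@continuous_sin_comp _ _ f _)
  | |- continuous (fun x => Num.sqrt (@?f x)) => refine (@continuous_sqrt_comp _ _ f _)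
  | |- continuous _ => assumption
  end.
Ltac cont := repeat cont1.

(** * Poisson summation over a disc *)

Section disc_transform.
Context (R : realType).
Implicit Types (a b c d t u x y : R).

Lemma Int_supp (f : R -> R) a b c d : continuous f -> a <= c -> c <= d -> d <= b ->
  (forall x, x <= c -> f x = 0) -> (forall x, d <= x -> f x = 0) ->
  Int f a b = Int f c d.
Proof.
move=> cf ac cd db h1 h2.
have c0 : continuous (fun _ : R => 0 : R) by cont.
rewrite -(Int_chasles f a c b) -(Int_chasles f c d b).
rewrite (@Int_eq_in _ f (fun=> 0) a c) //; last by move=> x /andP[_ ?]; exact: h1.
rewrite (@Int_eq_in _ f (fun=> 0) d b) //; last by move=> x /andP[? _]; exact: h2.
by rewrite !Int_cst !mul0r addr0 add0r.
Qed.

Definition kappa : R := Int (fun b => Num.sqrt (1 - b ^+ 2) ^+ 5) (-1) 1.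

Lemma kappa_gt0 : 0 < kappa.
Proof.
have c1 : continuous (fun b : R => Num.sqrt (1 - b ^+ 2) ^+ 5) by cont.
rewrite /kappa -(Int_chasles _ _ (- (1/2)) _) -(Int_chasles _ (- (1/2)) (1/2) _).
have h x y : x <= y -> 0 <= Int (fun b : R => Num.sqrt (1 - b ^+ 2) ^+ 5) x y.
  move=> xy; have <- : Int (fun=> 0 : R) x y = 0 by rewrite Int_cst mul0r.
  by apply: Int_le => //; exact: continuous_cst.
have h1 : 0 <= Int (fun b : R => Num.sqrt (1 - b ^+ 2) ^+ 5) (-1) (-(1/2)) by apply: h; rlra.
have h2 : 0 <= Int (fun b : R => Num.sqrt (1 - b ^+ 2) ^+ 5) (1/2) 1 by apply: h; rlra.
have : (1/2) ^+ 5 * (1/2 - (- (1/2))) <= Int (fun b : R => Num.sqrt (1 - b ^+ 2) ^+ 5) (-(1/2)) (1/2).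
  rewrite -Int_cst; apply: Int_le; [cont|cont|rlra|].
  move=> x /andP[x1 x2]; apply: lerXn2r; rewrite ?nnegrE ?sqrtr_ge0 //.
  have -> : 1/2 = Num.sqrt ((1/2) ^+ 2) :> R by rewrite sqrtr_sqr ger0_norm //; rlra.
  rewrite ler_sqrt; rnra.
have : 0 < (1/2) ^+ 5 * (1/2 - (- (1/2))) :> R by apply: mulr_gt0; [apply: exprn_gt0|]; rlra.
rlra.
Qed.

(** The substitution [b = x0 + m sqrt A x] brings the slice to the unit interval. The half-integral
    exponent of the weight is what makes the answer a polynomial in [A]. *)
Lemma Int_half_ball (A m x0 M : R) : 0 <= A -> 0 < m -> Num.sqrt A * m + `|x0| <= M ->
  Int (fun b => Num.sqrt (A - (b - x0) ^+ 2 / m ^+ 2) ^+ 5) (- M) M = kappa * A ^+ 3 * m.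
Proof.
move=> A0 m0 hM; set al := Num.sqrt A; have al0 : 0 <= al by exact: sqrtr_ge0.
have AE : A = al ^+ 2 by rewrite sqr_sqrtr.
have am0 : 0 <= al * m by rewrite mulr_ge0 // ltW.
have cf : continuous (fun b : R => Num.sqrt (A - (b - x0) ^+ 2 / m ^+ 2) ^+ 5) by cont.
have z b : al * m <= `|b - x0| -> Num.sqrt (A - (b - x0) ^+ 2 / m ^+ 2) ^+ 5 = 0.
  move=> hb; rewrite ler0_sqrtr ?expr0n // subr_le0 AE ler_pdivlMr ?exprn_gt0 // -exprMn.
  by rewrite -[leRHS]real_normK ?num_real // lerXn2r ?nnegrE.
have nx0 := ler_norm x0; have nx1 := ler_norm (- x0); rewrite normrN in nx1.
have hM1 : - M <= - (al * m) + x0 by rewrite -/al in hM; rlra.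
have hM2 : al * m + x0 <= M by rewrite -/al in hM; rlra.
rewrite (@Int_supp _ _ _ (- (al * m) + x0) (al * m + x0)) //; first last.
- by move=> x hx; apply: z; rewrite ger0_norm; rlra.
- by move=> x hx; apply: z; rewrite ler0_norm; rlra.
- rlra.
- have -> : - (al * m) + x0 = (al * m) * (-1) + x0 by ring.
  have -> : al * m + x0 = (al * m) * 1 + x0 by ring.
  rewrite -Int_affine //.
  have -> : (fun x => Num.sqrt (A - (al * m * x + x0 - x0) ^+ 2 / m ^+ 2) ^+ 5) =
     (fun x => al ^+ 5 * (Num.sqrt (1 - x ^+ 2) ^+ 5)).
    apply/funext => x; rewrite -exprMn; congr (_ ^+ 5).
    have -> : A - (al * m * x + x0 - x0) ^+ 2 / m ^+ 2 = al ^+ 2 * (1 - x ^+ 2).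
      by rewrite AE; field; rewrite gt_eqF.
    by rewrite sqrtrM ?sqr_ge0 // sqrtr_sqr ger0_norm.
  rewrite IntZ; last by cont.
  by rewrite -/kappa AE; ring.
Qed.

(** Fourier transform of the projection of the disc weight to a line, up to the factor [kappa]. *)
Definition I3 c t : R := Int (fun u => (c ^+ 2 - u ^+ 2) ^+ 3 * cos (2 * pi * (t * u))) (- c) c.

(** [Num.sqrt] is 0 on negative reals, so this is the positive part [(c^2 - a^2 - b^2)_+^(5/2)]
    without a case distinction, and it is continuous on the whole plane. *)
Definition Gdisc c a b : R := Num.sqrt (c ^+ 2 - a ^+ 2 - b ^+ 2) ^+ 5.

Lemma Gdisc0l c a b : 0 <= c -> c <= `|a| -> Gdisc c a b = 0.
Proof.
move=> c0 h; rewrite /Gdisc ler0_sqrtr ?expr0n //.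
have : c ^+ 2 <= a ^+ 2 by rewrite -[leRHS]real_normK ?num_real // lerXn2r ?nnegrE.
by have := sqr_ge0 b; rlra.
Qed.

Lemma GdiscC c a b : Gdisc c a b = Gdisc c b a.
Proof. by rewrite /Gdisc addrAC. Qed.

Lemma Gdisc0r c a b : 0 <= c -> c <= `|b| -> Gdisc c a b = 0.
Proof. by rewrite GdiscC; exact: Gdisc0l. Qed.

Definition FT2 c y k M : R := Int (fun a => Int (fun b =>
  Gdisc c a b * cos (2 * pi * (y * a + k * b))) (- M) M) (- M) M.

Lemma FT2_supp c y k M : 0 <= c -> c <= M -> FT2 c y k M = FT2 c y k c.
Proof.
move=> c0 cM; rewrite /FT2.
have cc : continuous (fun p : R * R =>
   Gdisc c p.1 p.2 * cos (2 * pi * (y * p.1 + k * p.2))) by rewrite /Gdisc; cont.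
rewrite (@Int_supp _ (- M) M (- c) c); try rlra.
- apply: Int_eq_in; [| |rlra|].
  + by apply: (@continuous_Int _ (fun a b => Gdisc c a b * cos (2 * pi * (y * a + k * b)))) => //; rlra.
  + by apply: (@continuous_Int _ (fun a b => Gdisc c a b * cos (2 * pi * (y * a + k * b)))) => //; rlra.
  move=> a _; apply: Int_supp; try rlra; first by rewrite /Gdisc; cont.
  + by move=> b hb; rewrite Gdisc0r ?mul0r // ler0_norm; rlra.
  + by move=> b hb; rewrite Gdisc0r ?mul0r // ger0_norm; rlra.
- by apply: (@continuous_Int _ (fun a b => Gdisc c a b * cos (2 * pi * (y * a + k * b)))) => //; rlra.
- move=> a ha; rewrite (_ : (fun b => _) = fun=> 0) ?Int_cst ?mul0r //.
  by apply/funext => b; rewrite Gdisc0l ?mul0r // ler0_norm; rlra.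
- move=> a ha; rewrite (_ : (fun b => _) = fun=> 0) ?Int_cst ?mul0r //.
  by apply/funext => b; rewrite Gdisc0l ?mul0r // ger0_norm; rlra.
Qed.

(** A shear does the work of a rotation: with [u = p a + s b] in place of [a], the phase depends on
    [u] only and the weight on [c^2 - u^2 - (b - s u)^2 / p^2]. The slice integral over [b] has a
    factor [p], which cancels the Jacobian, so substitutions in one variable suffice. *)
Lemma FT2_pos (c t p s : R) : 0 <= c -> 0 < p -> p ^+ 2 + s ^+ 2 = 1 ->
  FT2 c (t * p) (t * s) c = kappa * I3 c t.
Proof.
move=> c0 p0 ps.
have p1 : p <= 1 by have := sqr_ge0 s; rnra.
have s1 : `|s| <= 1.
  by rewrite -(@expr_le1 _ 2) // real_normK ?num_real // -ps lerDr sqr_ge0.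
(* The image of [[-M, M]] under [a -> p a + s b] contains [[-c, c]] whenever [|b| <= c], and
   [[-M, M]] contains the support in [b] for every [u] in [[-c, c]]. *)
pose M := c + 2 * c / p.
have cp : 2 * c <= 2 * c / p by rewrite ler_pdivlMr //; rnra.
have cM : c <= M by rewrite /M; rlra.
rewrite -(FT2_supp _ _ c0 cM) /FT2.
pose H u b := Num.sqrt (c ^+ 2 - u ^+ 2 - (b - s * u) ^+ 2 / p ^+ 2) ^+ 5 * cos (2 * pi * (t * u)).
have cH : continuous (fun q : R * R => H q.1 q.2) by rewrite /H; cont.
have cH2 : continuous (fun q : R * R => H q.2 q.1) by exact: (@continuous_swap _ H).
have cc : continuous (fun q : R * R =>
   Gdisc c q.1 q.2 * cos (2 * pi * (t * p * q.1 + t * s * q.2))) by rewrite /Gdisc; cont.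
have HG a b : H (p * a + s * b) b = Gdisc c a b * cos (2 * pi * (t * p * a + t * s * b)).
  rewrite /H /Gdisc; congr (Num.sqrt _ ^+ 5 * cos _); last by ring.
  have -> : (b - s * (p * a + s * b)) = p * (p * b - s * a).
    have {1}-> : b = (p ^+ 2 + s ^+ 2) * b by rewrite ps mul1r.
    ring.
  have -> : (p * (p * b - s * a)) ^+ 2 / p ^+ 2 = (p * b - s * a) ^+ 2 by field; rewrite gt_eqF.
  have -> : c ^+ 2 - (p * a + s * b) ^+ 2 - (p * b - s * a) ^+ 2 =
    c ^+ 2 - (p ^+ 2 + s ^+ 2) * (a ^+ 2 + b ^+ 2) by ring.
  by rewrite ps; ring.
have H0u u b : c <= `|u| -> H u b = 0.
  move=> h; rewrite /H ler0_sqrtr ?expr0n ?mul0r //.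
  have : c ^+ 2 <= u ^+ 2 by rewrite -[leRHS]real_normK ?num_real // lerXn2r ?nnegrE.
  have : 0 <= (b - s * u) ^+ 2 / p ^+ 2 by rewrite divr_ge0 ?sqr_ge0.
  rlra.
have H0b u b : c <= `|b| -> H u b = 0.
  move=> h; have e : u = p * ((u - s * b) / p) + s * b by field; rewrite gt_eqF.
  by rewrite e HG Gdisc0r ?mul0r.
rewrite Int_fubini //; [|rlra..].
transitivity (Int (fun b => p^-1 * Int (fun u => H u b) (- c) c) (- M) M).
  apply: Int_eq_in.
  - apply: (@continuous_Int _ (fun b a => Gdisc c a b * cos (2 * pi * (t * p * a + t * s * b)))); first rlra.
    by rewrite /Gdisc; cont.
  - apply: continuous_mul; first by cont.
    by apply: (@continuous_Int _ (fun b u => H u b)) => //; rlra.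
  - rlra.
  move=> b hb.
  have csl : continuous (fun u => H u b) by exact: (@continuous_slice _ (fun b u => H u b)).
  have [hbc|hbc] := leP c `|b|.
    have -> : (fun a => Gdisc c a b * cos (2 * pi * (t * p * a + t * s * b))) = fun=> 0.
      by apply/funext => a; rewrite Gdisc0r ?mul0r.
    have -> : (fun u => H u b) = fun=> 0 by apply/funext => u; rewrite H0b.
    by rewrite !Int_cst !mul0r mulr0.
  have -> : (fun a => Gdisc c a b * cos (2 * pi * (t * p * a + t * s * b))) =
     (fun a => (fun u => H u b) (p * a + s * b)) by apply/funext => a; rewrite HG.
  apply: (@mulfI _ p); first by rewrite gt_eqF.
  rewrite (@Int_affine _ (fun u => H u b)) // mulrA divff ?gt_eqF // mul1r.
  have sb : `|s * b| <= c by rewrite normrM; have := normr_ge0 s; have := normr_ge0 b; rnra.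
  have pM : 2 * c <= p * M.
    have -> : p * M = p * c + 2 * c by rewrite /M; field; rewrite gt_eqF.
    rnra.
  move: sb; rewrite ler_norml => /andP[sb1 sb2].
  apply: Int_supp => //; try rlra.
  - by move=> u hu; apply: H0u; rewrite ler0_norm; rlra.
  - by move=> u hu; apply: H0u; rewrite ger0_norm; rlra.
rewrite IntZ; last by apply: (@continuous_Int _ (fun b u => H u b)) => //; rlra.
rewrite -Int_fubini //; [|rlra..].
transitivity (p^-1 * Int (fun u => kappa * p * ((c ^+ 2 - u ^+ 2) ^+ 3 * cos (2 * pi * (t * u)))) (- c) c).
  congr (_ * _); apply: Int_eq_in.
  - by apply: (@continuous_Int _ H) => //; rlra.
  - by cont.
  - rlra.
  move=> u /andP[u1 u2]; rewrite /H.
  have A0 : 0 <= c ^+ 2 - u ^+ 2 by rnra.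
  have -> : (fun b : R => Num.sqrt (c ^+ 2 - u ^+ 2 - (b - s * u) ^+ 2 / p ^+ 2) ^+ 5 * cos (2 * pi * (t * u)))
    = (fun b : R => cos (2 * pi * (t * u)) * Num.sqrt (c ^+ 2 - u ^+ 2 - (b - s * u) ^+ 2 / p ^+ 2) ^+ 5).
    by apply/funext => b; rewrite mulrC.
  rewrite IntZ; last by cont.
  rewrite (Int_half_ball (x0 := s * u) A0 p0); first by ring.
  have h1 : Num.sqrt (c ^+ 2 - u ^+ 2) <= c.
    rewrite -{2}[c]ger0_norm // -sqrtr_sqr ler_sqrt ?sqr_ge0 //; have := sqr_ge0 u; rlra.
  have h2 : `|s * u| <= c.
    rewrite normrM; have : `|u| <= c by rewrite ler_norml; rlra.
    by have := normr_ge0 s; have := normr_ge0 u; rnra.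
  have := sqrtr_ge0 (c ^+ 2 - u ^+ 2); rewrite /M; rnra.
rewrite IntZ; last by cont.
by rewrite /I3; field; rewrite gt_eqF.
Qed.

(** The cosine is even, so a frequency with [y < 0] is replaced by its opposite. For [y = 0] the
    shear degenerates, but exchanging the order of integration leaves a plain slice integral. *)
Lemma FT2E (c y k : R) : 0 <= c -> FT2 c y k c = kappa * I3 c (Num.sqrt (y ^+ 2 + k ^+ 2)).
Proof.
move=> c0; set t := Num.sqrt _.
have t2 : t ^+ 2 = y ^+ 2 + k ^+ 2 by rewrite sqr_sqrtr // addr_ge0 ?sqr_ge0.
have t0 : 0 <= t by exact: sqrtr_ge0.
have cc : continuous (fun q : R * R =>
   Gdisc c q.1 q.2 * cos (2 * pi * (y * q.1 + k * q.2))) by rewrite /Gdisc; cont.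
have [y0|y0] := eqVneq y 0.

  rewrite /FT2 Int_fubini //; [|rlra..].
  rewrite /I3 -IntZ; last by cont.
  apply: Int_eq_in; [|by cont|rlra|].
    apply: (@continuous_Int _ (fun b a => Gdisc c a b * cos (2 * pi * (y * a + k * b)))); first rlra.
    by rewrite /Gdisc; cont.
  move=> b /andP[b1 b2].
  have -> : cos (2 * pi * (t * b)) = cos (2 * pi * (k * b)).
    have : (t - k) * (t + k) = 0 by rewrite -subr_sqr t2 y0 expr0n /= add0r subrr.
    move/eqP; rewrite mulf_eq0 subr_eq0 addr_eq0 => /orP[/eqP -> //|/eqP ->].
    by rewrite mulNr mulrN cosN.
  have A0 : 0 <= c ^+ 2 - b ^+ 2 by rnra.
  transitivity (Int (fun a => cos (2 * pi * (k * b)) *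
     Num.sqrt ((c ^+ 2 - b ^+ 2) - (a - 0) ^+ 2 / 1 ^+ 2) ^+ 5) (- c) c).
    congr Int; apply/funext => a; rewrite y0 mul0r add0r mulrC; congr (_ * _).
    by rewrite /Gdisc subr0 expr1n divr1 addrAC.
  rewrite IntZ; last by cont.
  rewrite (Int_half_ball A0 ltr01); first by ring.
  rewrite mulr1 normr0 addr0 -{2}[c]ger0_norm // -sqrtr_sqr ler_sqrt ?sqr_ge0 //.
  by have := sqr_ge0 b; rlra.
have tp : 0 < t.
  rewrite lt_neqAle t0 andbT eq_sym -sqrf_eq0 t2 paddr_eq0 ?sqr_ge0 // sqrf_eq0.
  by rewrite (negbTE y0).
have nt : t != 0 by rewrite gt_eqF.
have ps : (y / t) ^+ 2 + (k / t) ^+ 2 = 1 by rewrite !expr_div_n -mulrDl -t2 divff // sqrf_eq0.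
have [yp|yn] := ltP 0 y.
  rewrite -(@FT2_pos c t (y / t) (k / t)) ?divr_gt0 //.
  by congr FT2; field.
rewrite -(@FT2_pos c t (- y / t) (- k / t)) //.
- rewrite /FT2; congr Int; apply/funext => a; congr Int; apply/funext => b.
  congr (_ * _); rewrite -cosN; congr cos; field; exact: nt.
- by rewrite divr_gt0 // oppr_gt0 lt_neqAle y0.
- by rewrite !mulNr !sqrrN.
Qed.

End disc_transform.

(** * The Fejer kernel and Poisson summation in Fejer form *)

Section fejer_kernel.
Context (R : realType).
Local Open Scope classical_set_scope.
Implicit Types (a b c d e t u x y : R) (L W n : nat).

Definition fejer L x : R := cabs (\sum_(i < L) ce (i%:R * x)) ^+ 2 / L%:R.

Lemma fejer_ge0 L x : 0 <= fejer L x.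
Proof. by rewrite divr_ge0 // exprn_ge0 // cabs_ge0. Qed.

Lemma fejer_ce L x : (0 < L)%N ->
  \sum_(p : 'I_L * 'I_L) ce ((p.1%:R - p.2%:R) * x) = (L%:R * fejer L x)%:C%C.
Proof.
move=> L0; rewrite /fejer mulrCA divff ?pnatr_eq0 -?lt0n // mulr1 cabs_sqrE.
rewrite rmorph_sum /= big_distrlr /= pair_bigA /=; apply: eq_bigr => p _.
by rewrite mulrBl ceD ceN.
Qed.

Lemma fejer_cos L x : (0 < L)%N ->
  fejer L x = \sum_(p : 'I_L * 'I_L) L%:R^-1 * cos (2 * pi * ((p.1%:R - p.2%:R) * x)).
Proof.
move=> L0; have /(congr1 (@complex.Re R)) := fejer_ce x L0.
rewrite Re_sum /= -mulr_sumr => ->.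
by rewrite mulrA mulVf ?mul1r // pnatr_eq0 -lt0n.
Qed.

Lemma continuous_fejer L : (0 < L)%N -> continuous (fejer L).
Proof.
move=> L0; rewrite (_ : fejer L = fun x =>
   \sum_(p : 'I_L * 'I_L) L%:R^-1 * cos (2 * pi * ((p.1%:R - p.2%:R) * x))).
  by apply: continuous_sum => p; cont.
by apply/funext => x; rewrite fejer_cos.
Qed.

Lemma fejer_periodic L x (k : int) : fejer L (x + k%:~R) = fejer L x.
Proof.
rewrite /fejer; congr (cabs _ ^+ 2 / _); apply: eq_bigr => i _.
by rewrite mulrDr (_ : i%:R * k%:~R = (i%:Z * k)%:~R) ?ceDint // intrM.
Qed.

Lemma geo_ce_bound n x : x != 0 -> `|x| <= 1 / 2 ->
  cabs (\sum_(i < n) ce (i%:R * x)) <= `|x|^-1.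
Proof.
move=> x0 hx; have nx : 0 < `|x| by rewrite normr_gt0.
rewrite -[leRHS]mul1r ler_pdivlMr //.
have s0 : `|x| <= `|sin (pi * x)| by exact: abs_sin_pi_ge.
have E : cabs (\sum_(i < n) ce (i%:R * x)) * cabs (ce x - 1) <= 2.
  rewrite -cabsM mulrC.
  have -> : \sum_(i < n) ce (i%:R * x) = \sum_(i < n) ce x ^+ i.
    by apply: eq_bigr => i _; rewrite ceX.
  by rewrite -subrX1 ceX (le_trans (cabsB _ _)) // cabs_ce cabs1.
rewrite cabs_ce_sub1 in E.
have := cabs_ge0 (\sum_(i < n) ce (i%:R * x)); rnra.
Qed.

Lemma fejer_tail L x : (0 < L)%N -> x != 0 -> `|x| <= 1 / 2 ->
  fejer L x <= (L%:R * x ^+ 2)^-1.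
Proof.
move=> L0 x0 hx; rewrite /fejer invfM mulrC ler_pM2l ?invr_gt0 ?ltr0n //.
rewrite -[x ^+ 2]real_normK ?num_real // -exprVn lerXn2r ?nnegrE ?cabs_ge0 ?invr_ge0 //.
exact: geo_ce_bound.
Qed.

Lemma Int_cos_period (k : int) x : k != 0 ->
  Int (fun t => cos (2 * pi * (k%:~R * t))) x (x + 1) = 0.
Proof.
move=> k0; have kR : k%:~R != 0 :> R by rewrite intr_eq0.
have pi0 := pi_gt0 R.
have H t : is_derive t 1 (fun t => (2 * pi * k%:~R)^-1 * sin (2 * pi * (k%:~R * t)))
    (cos (2 * pi * (k%:~R * t))).
  have D : is_derive t 1 (fun t : R => 2 * pi * (k%:~R * t)) (2 * pi * k%:~R).
    apply: der_eq (derM (der_cst _ _) (derM (der_cst _ _) (der_id _))) _; ring.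
  apply: der_eq (derM (der_cst _ _) (der_sin D)) _.
  by rewrite mulr0 addr0 mulrCA mulVf ?mulr1 // !mulf_neq0 // gt_eqF.
rewrite (Int_eq _ _ H) (mulrDr k%:~R x) mulr1.
have /(congr1 (@complex.Im R)) /= -> := ceDint (k%:~R * x) k.
by rewrite subrr.
Qed.

Lemma Int_fejer L x : (0 < L)%N -> Int (fejer L) x (x + 1) = 1.
Proof.
move=> L0; have -> : fejer L = (fun x =>
   \sum_(p : 'I_L * 'I_L) L%:R^-1 * cos (2 * pi * ((p.1%:R - p.2%:R) * x))).
  by apply/funext => t; rewrite fejer_cos.
rewrite Int_sum; last by move=> p; cont.
rewrite -(pair_bigA _ (fun i j : 'I_L =>
  Int (fun t => L%:R^-1 * cos (2 * pi * ((i%:R - j%:R) * t))) x (x + 1))) /=.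
transitivity (\sum_(i < L) (L%:R^-1 : R)); last first.
  by rewrite sumr_const card_ord -[LHS]mulr_natr mulVf // pnatr_eq0 -lt0n.
apply: eq_bigr => i _; rewrite (bigD1 i) //= big1 ?addr0.
  rewrite IntZ; last by cont.
  have -> : (fun t => cos (2 * pi * ((i%:R - i%:R) * t))) = fun=> 1 :> R.
    by apply/funext => t; rewrite subrr mul0r mulr0 cos0.
  by rewrite Int_cst addrAC subrr add0r !mulr1.
move=> j ji; rewrite IntZ; last by cont.
have := @Int_cos_period (i%:Z - j%:Z) x; rewrite intrD mulrNz -!pmulrn => -> //.
  by rewrite mulr0.
by rewrite subr_eq0 eqz_nat eq_sym.
Qed.

(** The Fejer kernel is an approximate identity at each integer. Closer than [del] to [w],
    continuity uniform in [a] is used against total mass 1; further away in the cell, the kernel is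
    at most [1 / (L del^2)]. Uniformity in [a] is needed to integrate the result over [a]
    afterwards. *)
Lemma fejer_approx (H : R -> R -> R) (S c d e : R) (w : int) :
  continuous (fun p : R * R => H p.1 p.2) -> (forall a b, `|H a b| <= S) -> 0 < e ->
  \forall L \near \oo, forall a, c <= a <= d ->
   `|Int (fun b => H a b * fejer L b) (w%:~R - 1 / 2) (w%:~R + 1 / 2) - H a w%:~R| <= e.
Proof.
move=> cH HS e0; have S0 : 0 <= S := le_trans (normr_ge0 _) (HS 0 0).
have e20 : 0 < e / 2 by rewrite divr_gt0.
have /nbhs_ballP[del /= del0 hdel] :=
  @continuous_uniform _ (fun b a => H a b) w%:~R c d (e / 2) (continuous_swap cH) e20.
have [N hN] : exists N : nat, 4 * S / (e * del ^+ 2) < N%:R.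
  by exists (Num.bound (4 * S / (e * del ^+ 2))); apply: archi_boundP; rewrite divr_ge0 // ?mulr_ge0 ?sqr_ge0 // ltW.
exists (maxn N 1) => // L; rewrite /= geq_max => /andP[NL L0] a ha.
have cF := continuous_fejer L0.
have Lr : 0 < L%:R :> R by rewrite ltr0n.
have cHa : continuous (H a) by exact: continuous_slice.
have Iw : Int (fejer L) (w%:~R - 1 / 2) (w%:~R + 1 / 2) = 1.
  have -> : w%:~R + 1 / 2 = (w%:~R - 1 / 2) + 1 :> R by field.
  exact: Int_fejer.
have -> : Int (fun b => H a b * fejer L b) (w%:~R - 1 / 2) (w%:~R + 1 / 2) - H a w%:~R =
   Int (fun b => (H a b - H a w%:~R) * fejer L b) (w%:~R - 1 / 2) (w%:~R + 1 / 2).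
  rewrite (_ : (fun b => (H a b - H a w%:~R) * fejer L b) =
    (fun b => H a b * fejer L b - H a w%:~R * fejer L b)).
    by rewrite IntB; [rewrite IntZ // Iw mulr1|cont..].
  by apply/funext => b; rewrite mulrBl.
pose g b : R := e / 2 * fejer L b + 2 * S / (L%:R * del ^+ 2).
have cg : continuous g by rewrite /g; cont.
have pw b : w%:~R - 1 / 2 <= b <= w%:~R + 1 / 2 -> `|(H a b - H a w%:~R) * fejer L b| <= g b.
  move=> hb; rewrite normrM (ger0_norm (fejer_ge0 _ _)).
  have F0 := fejer_ge0 L b.
  have q0 : 0 <= 2 * S / (L%:R * del ^+ 2).
    by rewrite divr_ge0 ?mulr_ge0 // ?sqr_ge0 // ltW.
  have [hd|hd] := ltP `|w%:~R - b| del.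
    have := hdel b hd a ha => /ltW h.
    by rewrite /g; have := ler_wpM2r F0 h; rlra.
  have bw : b - w%:~R != 0.
    by rewrite subr_eq0; apply: contraTneq hd => ->; rewrite subrr normr0 -ltNge.
  have := @fejer_tail L (b - w%:~R) L0 bw; rewrite -mulrNz fejer_periodic.
  have nb : `|b - w%:~R| <= 1 / 2 by rewrite ler_norml; rlra.
  rewrite mulrNz => /(_ nb) ft.
  have ft2 : fejer L b <= (L%:R * del ^+ 2)^-1.
    have b2 : 0 < (b - w%:~R) ^+ 2 by rewrite exprn_even_gt0.
    have d2 : 0 < del ^+ 2 by rewrite exprn_gt0.
    apply: le_trans ft _; rewrite lef_pV2 ?posrE; [|exact: mulr_gt0..].
    rewrite ler_pM2l // -[(b - _) ^+ 2]real_normK ?num_real // lerXn2r ?nnegrE //; first exact: ltW.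
    by rewrite distrC.
  have hS : `|H a b - H a w%:~R| <= 2 * S.
    by apply: le_trans (ler_normB _ _) _; have := HS a b; have := HS a w%:~R; rlra.
  rewrite /g; apply: (@le_trans _ _ (2 * S * (L%:R * del ^+ 2)^-1)).
    by apply: ler_pM.
  by rewrite lerDr mulr_ge0 // ltW.
have le12 : w%:~R - 1 / 2 <= w%:~R + 1 / 2 :> R by rlra.
have : Int g (w%:~R - 1 / 2) (w%:~R + 1 / 2) <= e.
  rewrite /g IntD; [|by cont..]; rewrite IntZ // Iw Int_cst.
  have -> : w%:~R + 1 / 2 - (w%:~R - 1 / 2) = 1 :> R by field.
  have : 2 * S / (L%:R * del ^+ 2) <= e / 2.
    rewrite ler_pdivrMr ?mulr_gt0 ?exprn_gt0 //.
    have h : 4 * S / (e * del ^+ 2) <= L%:R by apply: le_trans (ltW hN) _; rewrite ler_nat.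
    rewrite ler_pdivrMr ?mulr_gt0 ?exprn_gt0 // in h; rlra.
  rlra.
apply: le_trans; rewrite ler_norml -mulN1r -IntZ //; apply/andP; split; apply: Int_le => //; try by cont.
  by move=> b /pw; rewrite mulN1r ler_norml => /andP[].
by move=> b /pw; rewrite ler_norml => /andP[].
Qed.

Lemma near_all n (P : nat -> nat -> Prop) :
  (forall i, (i < n)%N -> \forall L \near \oo, P i L) ->
  \forall L \near \oo, forall i, (i < n)%N -> P i L.
Proof.
elim: n => [|n IH] h; first by near=> L.
have h1 := IH (fun i hi => h i (ltnW hi)); have h2 := h n (ltnSn n).
near=> L => i; rewrite ltnS leq_eqVlt => /orP[/eqP ->|].
  by near: L.
by move: i; near: L.
Unshelve. all: by end_near. Qed.

Lemma Int_unit_cells (f : R -> R) x n : Int f x (x + n%:R) =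
  \sum_(i < n) Int f (x + i%:R) (x + i%:R + 1).
Proof.
elim: n => [|n IH]; first by rewrite big_ord0 addr0 Intxx.
by rewrite big_ord_recr /= -IH Int_chasles -natr1 addrA.
Qed.

Definition disc_sum W c y : R := \sum_(m < W.*2.+1) \sum_(w < W.*2.+1)
  Gdisc c (m%:R - W%:R) (w%:R - W%:R) * cos (2 * pi * (y * (m%:R - W%:R))).

(** Summing over pairs of indices produces the difference [x] with multiplicity [L - |x|], i.e. the
    triangular Fejer weights on the dual lattice. The sum is finite, so no convergence of the dual
    series is required. *)
Definition dual_sum L c y : R := (L%:R ^+ 2)^-1 *
  \sum_(p : ('I_L * 'I_L) * ('I_L * 'I_L))
    kappa R * I3 c (Num.sqrt ((y + (p.1.1%:R - p.1.2%:R)) ^+ 2 + (p.2.1%:R - p.2.2%:R) ^+ 2)).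

Lemma dual_sumE L c y M : (0 < L)%N -> 0 <= c -> c <= M ->
  dual_sum L c y = Int (fun a => Int (fun b =>
     Gdisc c a b * cos (2 * pi * (y * a)) * fejer L b) (- M) M * fejer L a) (- M) M.
Proof.
move=> L0 c0 cM.
have Ln : L%:R != 0 :> R by rewrite pnatr_eq0 -lt0n.
have cF := continuous_fejer L0.
pose T (p : ('I_L * 'I_L) * ('I_L * 'I_L)) a b : R := (L%:R ^+ 2)^-1 * (Gdisc c a b *
  cos (2 * pi * ((y + (p.1.1%:R - p.1.2%:R)) * a + (p.2.1%:R - p.2.2%:R) * b))).
have pw a b : Gdisc c a b * cos (2 * pi * (y * a)) * fejer L b * fejer L a = \sum_p T p a b.
  rewrite /T -mulr_sumr -mulr_sumr.
  have E : (L%:R * fejer L a) * (L%:R * fejer L b) * cos (2 * pi * (y * a)) =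
    \sum_(p : ('I_L * 'I_L) * ('I_L * 'I_L)) cos (2 * pi *
      ((y + (p.1.1%:R - p.1.2%:R)) * a + (p.2.1%:R - p.2.2%:R) * b)).
    transitivity (complex.Re ((L%:R * fejer L a)%:C%C * ((L%:R * fejer L b)%:C%C * ce (y * a)))).
      rewrite ReZ ReZ /=; ring.
    rewrite -!fejer_ce // mulrA big_distrlr /= pair_bigA /= mulr_suml Re_sum.
    apply: eq_bigr => p _; rewrite -!ceD /=; congr cos; ring.
  by rewrite -E; field.
have cT p : continuous (fun q : R * R => T p q.1 q.2) by rewrite /T /Gdisc; cont.
have MM : - M <= M by rlra.
transitivity (Int (fun a => \sum_p Int (T p a) (- M) M) (- M) M).
  rewrite Int_sum; last by move=> p; exact: continuous_Int.
  rewrite /dual_sum mulr_sumr; apply: eq_bigr => p _.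
  rewrite -FT2E // -(FT2_supp _ _ c0 cM) /FT2 -IntZ; last first.
    by apply: (@continuous_Int _ (fun a b => Gdisc c a b * cos (2 * pi *
       ((y + (p.1.1%:R - p.1.2%:R)) * a + (p.2.1%:R - p.2.2%:R) * b)))) => //; rewrite /Gdisc; cont.
  by congr Int; apply/funext => a; rewrite -IntZ //; rewrite /Gdisc; cont.
congr Int; apply/funext => a; rewrite mulrC -IntZ; last by rewrite /Gdisc; cont.
rewrite -Int_sum; last by move=> p; exact: continuous_slice.
by congr Int; apply/funext => b; rewrite -pw mulrC.
Qed.

(** By [dual_sumE] the dual sum is the integral of the weight against a product of two Fejer
    kernels; [fejer_approx] is applied in [b] on every unit cell and then in [a]. *)
Lemma poisson_disc W c y : 0 <= c -> c <= W%:R ->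
  dual_sum L c y @[L --> \oo] --> disc_sum W c y.
Proof.
move=> c0 cW; apply/cvgrPdist_le => e e0.
pose n := W.*2.+1; have n0 : 0 < n%:R :> R by rewrite ltr0n.
(* With the extra half, [[-M, M]] is a union of [2 W + 1] unit cells centred at integers. *)
pose M : R := W%:R + 1 / 2.
pose H a b : R := Gdisc c a b * cos (2 * pi * (y * a)).
have cH : continuous (fun p : R * R => H p.1 p.2) by rewrite /H /Gdisc; cont.
have HS a b : `|H a b| <= c ^+ 5.
  rewrite /H normrM -[leRHS]mulr1 ler_pM // ?cos_max // /Gdisc ger0_norm ?exprn_ge0 ?sqrtr_ge0 //.
  rewrite lerXn2r ?nnegrE ?sqrtr_ge0 // -{2}[c]ger0_norm // -sqrtr_sqr ler_sqrt ?sqr_ge0 //.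
  by have := sqr_ge0 a; have := sqr_ge0 b; rlra.
pose e1 := e / (2 * n%:R ^+ 2); have e10 : 0 < e1 by rewrite divr_gt0 // mulr_gt0 // exprn_gt0.
pose e2 := e / (2 * n%:R ^+ 2); have e20 : 0 < e2 by rewrite divr_gt0 // mulr_gt0 // exprn_gt0.
pose z (i : nat) : int := i%:Z - W%:Z.
have zE i : (z i)%:~R = i%:R - W%:R :> R by rewrite /z intrD mulrNz -!pmulrn.
have N1 : \forall L \near \oo, forall i, (i < n)%N -> forall a, - M <= a <= M ->
   `|Int (fun b => H a b * fejer L b) ((z i)%:~R - 1 / 2) ((z i)%:~R + 1 / 2) - H a (z i)%:~R| <= e1.
  by apply: near_all => i _; exact: (fejer_approx _ _ _ cH HS).
have N2 : \forall L \near \oo, forall j, (j < n)%N -> forall i, (i < n)%N ->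
   `|Int (fun a => H a (z j)%:~R * fejer L a) ((z i)%:~R - 1 / 2) ((z i)%:~R + 1 / 2)
     - H (z i)%:~R (z j)%:~R| <= e2.
  apply: near_all => j _; apply: near_all => i _.
  have cH' : continuous (fun p : R * R => H p.2 (z j)%:~R) by rewrite /H /Gdisc; cont.
  have := @fejer_approx (fun _ a => H a (z j)%:~R) (c ^+ 5) 0 0 e2 (z i) cH' (fun _ a => HS a _) e20.
  by apply: filterS => L /(_ 0); apply; rewrite lexx.
have N0 : \forall L \near \oo, (0 < L)%N by exists 1%N.
near=> L.
have L0 : (0 < L)%N by near: L.
have h1 : forall i, (i < n)%N -> forall a, - M <= a <= M ->
   `|Int (fun b => H a b * fejer L b) ((z i)%:~R - 1 / 2) ((z i)%:~R + 1 / 2) - H a (z i)%:~R| <= e1.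
  by near: L.
have h2 : forall j, (j < n)%N -> forall i, (i < n)%N ->
   `|Int (fun a => H a (z j)%:~R * fejer L a) ((z i)%:~R - 1 / 2) ((z i)%:~R + 1 / 2)
     - H (z i)%:~R (z j)%:~R| <= e2.
  by near: L.
have cF := continuous_fejer L0.
have cM : c <= M by rewrite /M; rlra.
have MM : - M <= M by rlra.
have cells (f : R -> R) : Int f (- M) M =
    \sum_(i < n) Int f ((z i)%:~R - 1 / 2) ((z i)%:~R + 1 / 2).
  have MN : M = - M + n%:R.
    by rewrite /M /n -[_.*2.+1%:R]natr1 -muln2 natrM; field.
  rewrite {2}MN Int_unit_cells; apply: eq_bigr => i _; rewrite zE.
  by congr Int; rewrite /M; field.
rewrite (dual_sumE _ L0 c0 cM).
pose K a := Int (fun b => H a b * fejer L b) (- M) M.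
pose S a := \sum_(j < n) H a (z j)%:~R.
have cK : continuous K.
  apply: (@continuous_Int _ (fun a b => H a b * fejer L b)) => //.
  apply: continuous_mul => //.
  by move=> p; apply: (@continuous_comp _ _ _ snd (fejer L)); [exact: cvg_snd|exact: cF].
have cS : continuous S by apply: continuous_sum => j; rewrite /H /Gdisc; cont.
have KS a : - M <= a <= M -> `|K a - S a| <= e / (2 * n%:R).
  move=> ha; rewrite /K cells /S -sumrB; apply: le_trans (ler_norm_sum _ _ _) _.
  apply: (@le_trans _ _ (\sum_(i < n) e1)); first by apply: ler_sum => i _; exact: h1.
  rewrite sumr_const card_ord -[leLHS]mulr_natl /e1 le_eqVlt; apply/orP; left; apply/eqP.
  by field; rewrite gt_eqF.
have -> : (fun a => Int (fun b => Gdisc c a b * cos (2 * pi * (y * a)) * fejer L b) (- M) M * fejer L a)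
  = (fun a => K a * fejer L a) by [].
have In : Int (fejer L) (- M) M = n%:R.
  rewrite cells (eq_bigr (fun=> 1)) ?sumr_const ?card_ord // => i _.
  have -> : (z i)%:~R + 1 / 2 = ((z i)%:~R - 1 / 2) + 1 :> R by field.
  exact: Int_fejer.
have A1 : `|Int (fun a => K a * fejer L a) (- M) M - Int (fun a => S a * fejer L a) (- M) M| <= e / 2.
  have -> : e / 2 = e / (2 * n%:R) * Int (fejer L) (- M) M by rewrite In; field; rewrite gt_eqF.
  rewrite -IntB; [|by cont..]; rewrite -IntZ //.
  have bd a : - M <= a <= M ->
      `|K a * fejer L a - S a * fejer L a| <= e / (2 * n%:R) * fejer L a.
    move=> ha; rewrite -mulrBl normrM (ger0_norm (fejer_ge0 _ _)).
    by apply: ler_wpM2r; [exact: fejer_ge0|exact: KS].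
  rewrite ler_norml -mulN1r -IntZ; last by cont.
  apply/andP; split; apply: Int_le => //; try by cont.
    by move=> a /bd; rewrite mulN1r ler_norml => /andP[].
  by move=> a /bd; rewrite ler_norml => /andP[].
have A2 : `|Int (fun a => S a * fejer L a) (- M) M - disc_sum W c y| <= e / 2.
  have -> : Int (fun a => S a * fejer L a) (- M) M =
     \sum_(i < n) \sum_(j < n) Int (fun a => H a (z j)%:~R * fejer L a)
        ((z i)%:~R - 1 / 2) ((z i)%:~R + 1 / 2).
    rewrite cells; apply: eq_bigr => i _; rewrite -Int_sum.
      by congr Int; apply/funext => a; rewrite /S mulr_suml.
    by move=> j; rewrite /H /Gdisc; cont.
  have -> : disc_sum W c y = \sum_(i < n) \sum_(j < n) H (z i)%:~R (z j)%:~R.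
    by apply: eq_bigr => i _; apply: eq_bigr => j _; rewrite /H !zE.
  rewrite -sumrB; apply: le_trans (ler_norm_sum _ _ _) _.
  apply: (@le_trans _ _ (\sum_(i < n) \sum_(j < n) e2)).
    apply: ler_sum => i _; rewrite -sumrB; apply: le_trans (ler_norm_sum _ _ _) _.
    by apply: ler_sum => j _; exact: h2.
  under eq_bigr do rewrite sumr_const card_ord -mulr_natl.
  rewrite sumr_const card_ord -[leLHS]mulr_natl /e2 le_eqVlt; apply/orP; left; apply/eqP.
  by field; rewrite gt_eqF.
rewrite distrC; move: A1 A2; set A := Int _ _ _; set B := Int _ _ _ => A1 A2.
have := ler_normD (A - B) (B - disc_sum W c y); rewrite addrA subrK; rlra.
Unshelve. all: by end_near. Qed.

End fejer_kernel.

(** * Landau's bound for sums of two squares *)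

Section two_squares_density.
Context (R : realType).
Implicit Types (m n d e p x N Z : nat).

(** Regrouping by [n = d * e]; it is the exchange behind every convolution argument of this part. *)
Lemma dirichlet_sum (g : nat -> nat -> R) Z :
  \sum_(1 <= n < Z.+1) \sum_(1 <= d < Z.+1 | (d %| n)%N) g d (n %/ d)%N =
  \sum_(1 <= d < Z.+1) \sum_(1 <= e < Z.+1 | (d * e <= Z)%N) g d e.
Proof.
rewrite (exchange_big_dep xpredT) //=; apply: eq_big_nat => d /andP[d0 dZ].
rewrite -big_filter -[RHS]big_filter.
have -> : \sum_(e <- [seq e <- index_iota 1 Z.+1 | (d * e <= Z)%N]) g d e =
   \sum_(n <- map (muln d) [seq e <- index_iota 1 Z.+1 | (d * e <= Z)%N]) g d (n %/ d)%N.
  by rewrite big_map; apply: eq_bigr => e _; rewrite mulKn.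
apply: perm_big; apply: uniq_perm.
- by rewrite filter_uniq // iota_uniq.
- rewrite map_inj_in_uniq ?filter_uniq ?iota_uniq // => a b _ _ /eqP.
  by rewrite eqn_pmul2l // => /eqP.
move=> n; rewrite mem_filter mem_index_iota; apply/idP/mapP.
  move=> /andP[/dvdnP[e ->] /andP[h1 h2]]; exists e; last by rewrite mulnC.
  rewrite mem_filter mem_index_iota mulnC; apply/andP; split; first by lia.
  by apply/andP; split; [move: h1; case: e {h2}|nia].
move=> [e]; rewrite mem_filter mem_index_iota => /andP[h1 /andP[h2 h3]] ->.
by rewrite dvdn_mulr //=; apply/andP; split; nia.
Qed.

(** The von Mangoldt function at [d] for [1 <= d <= Z]; the parameter [Z] only makes the sums over
    primes and exponents finite. *)
Definition mangoldt Z d : R :=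
  \sum_(1 <= p < Z.+1 | prime p) \sum_(1 <= k < Z.+1) ((p ^ k)%N == d)%:R * ln p%:R.

Lemma mangoldt_ge0 Z d : 0 <= mangoldt Z d.
Proof.
apply: sumr_ge0 => p pp; apply: sumr_ge0 => k _; rewrite mulr_ge0 // ln_ge0 //.
by rewrite ler1n prime_gt0.
Qed.

Lemma ln_prod (I : Type) (s : seq I) (P : pred I) (F : I -> R) :
  (forall i, P i -> 0 < F i) -> ln (\prod_(i <- s | P i) F i) = \sum_(i <- s | P i) ln (F i).
Proof.
move=> h; have [] : 0 < \prod_(i <- s | P i) F i /\
  ln (\prod_(i <- s | P i) F i) = \sum_(i <- s | P i) ln (F i); last by [].
elim/big_rec2: _ => [|i a b Pi [b0 <-]]; first by rewrite ln1.
by split; [rewrite mulr_gt0 // h|rewrite lnM // posrE h].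
Qed.

Lemma sum_indicator_eq (a n : nat) (F : nat -> R) (P : pred nat) : (1 <= a <= n)%N ->
  \sum_(1 <= d < n.+1 | P d) (a == d)%:R * F d = (P a)%:R * F a.
Proof.
move=> h; rewrite big_mkcond (bigD1_seq a) ?iota_uniq ?mem_index_iota //= eqxx big1 ?addr0.
  by case: (P a); rewrite ?mul1r ?mul0r.
by move=> i ia; rewrite eq_sym (negbTE ia) mul0r; case: ifP.
Qed.

Lemma sum_mangoldt Z m : (1 <= m <= Z)%N -> \sum_(1 <= d < Z.+1 | (d %| m)%N) mangoldt Z d = ln m%:R.
Proof.
move=> /andP[m0 mZ].
have -> : \sum_(1 <= d < Z.+1 | (d %| m)%N) mangoldt Z d =
   \sum_(1 <= p < Z.+1 | prime p) \sum_(1 <= k < Z.+1) ((p ^ k) %| m)%N%:R * ln p%:R.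
  rewrite exchange_big /=; apply: eq_bigr => p pp.
  rewrite exchange_big /=; apply: eq_bigr => k _.
  have [dv|ndv] := boolP (p ^ k %| m)%N.
    rewrite (@sum_indicator_eq _ _ (fun=> ln p%:R)) ?dv //.
    by rewrite expn_gt0 prime_gt0 //= (leq_trans (dvdn_leq m0 dv)).
  rewrite mul0r big1 // => d dm; case: eqP => [E|]; last by rewrite mul0r.
  by rewrite -E (negbTE ndv) in dm.
transitivity (\sum_(1 <= p < Z.+1 | prime p) (logn p m)%:R * ln p%:R : R).
  apply: eq_bigr => p pp; rewrite -mulr_suml; congr (_ * _).
  rewrite logn_count_dvd // natr_sum (big_cat_nat m0) /=; last by lia.
  rewrite [X in _ + X]big1_seq ?addr0 // => k /andP[_]; rewrite mem_index_iota => /andP[mk _].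
  case: (boolP (_ %| _)%N) => // /(dvdn_leq m0).
  by rewrite leqNgt (leq_ltn_trans mk) // ltn_expl // prime_gt1.
have mp : m%:R = \prod_(0 <= p < m.+1) (p%:R ^+ logn p m) :> R.
  rewrite -{1}(@partnT m) // /partn natr_prod; apply: eq_bigr => p _.
  by rewrite natrX.
rewrite mp (big_cat_nat (n := m.+1)) //= [X in _ + X]big1_seq ?addr0; last first.
  move=> p /andP[pp]; rewrite mem_index_iota => /andP[mp' _].
  by rewrite (ltn_log0 mp') mul0r.
rewrite [in RHS]big_ltn // lognE /= expr0 mul1r.
rewrite [in RHS](bigID prime) /= [X in ln (_ * X)]big1 ?mulr1; last first.
  by move=> p np; rewrite lognE (negbTE np).
rewrite ln_prod; last by move=> p pp; rewrite exprn_gt0 // ltr0n prime_gt0.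
by apply: eq_bigr => p pp; rewrite lnXn ?ltr0n ?prime_gt0 // mulr_natl.
Qed.

Lemma sum_dvd n d : (0 < d)%N -> \sum_(1 <= m < n.+1) (d %| m)%N%:R = (n %/ d)%:R :> R.
Proof.
move=> d0; elim: n => [|n IH]; first by rewrite big_geq // div0n.
by rewrite big_nat_recr //= IH divnS // natrD addrC.
Qed.

Definition lnfact n : R := \sum_(1 <= m < n.+1) ln m%:R.

Lemma lnfactE Z n : (n <= Z)%N ->
  lnfact n = \sum_(1 <= d < Z.+1) mangoldt Z d * (n %/ d)%:R.
Proof.
move=> nZ; rewrite /lnfact.
transitivity (\sum_(1 <= m < n.+1) \sum_(1 <= d < Z.+1) mangoldt Z d * (d %| m)%N%:R).
  apply: eq_big_nat => m /andP[m0 mn]; rewrite -(@sum_mangoldt Z) ?m0 ?(leq_trans _ nZ) //.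
  rewrite big_mkcond; apply: eq_bigr => d _; case: (d %| m)%N; rewrite ?mulr1 ?mulr0 //.
rewrite exchange_big /=; apply: eq_big_nat => d /andP[d0 _].
by rewrite -mulr_sumr sum_dvd.
Qed.

Lemma ln2_le1 : ln 2 <= 1 :> R.
Proof.
have h : -1 < 1 :> R by rlra.
by have := le_ln1Dx h; rewrite -[1 + 1]/(2%:R).
Qed.

(** The left side is the logarithm of the central binomial coefficient; a step from [n] to [n + 1]
    adds at most [2 ln 2]. *)
Lemma lnfact_double n : lnfact n.*2 - 2 * lnfact n <= 2 * n%:R.
Proof.
elim: n => [|n IH]; first by rewrite /lnfact double0 big_geq // !mulr0 subr0.
have e1 : lnfact n.+1.*2 = lnfact n.*2 + ln n.*2.+1%:R + ln n.*2.+2%:R.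
  by rewrite /lnfact doubleS big_nat_recr //= big_nat_recr.
have e2 : lnfact n.+1 = lnfact n + ln n.+1%:R by rewrite /lnfact big_nat_recr.
have p1 : 0 < n.+1%:R :> R by rewrite ltr0n.
have e3 : ln n.*2.+2%:R = ln 2 + ln n.+1%:R :> R.
  by rewrite -lnM ?posrE // -natrM -doubleS mul2n.
have e4 : ln n.*2.+1%:R <= ln 2 + ln n.+1%:R :> R.
  by rewrite -e3 ler_ln ?posrE ?ltr0n // ler_nat.
have nS : n.+1%:R = n%:R + 1 :> R by rewrite natr1.
rewrite e1 e2 e3; apply: le_trans (_ : lnfact n.*2 - 2 * lnfact n + 2 * ln 2 <= _).
  by rlra.
by rewrite [X in _ <= 2 * X]nS; have := ln2_le1; rlra.
Qed.

(** In the expansion of the central binomial coefficient, [2 n %/ d - 2 (n %/ d)] is never negative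
    and is 1 for [n < d <= 2 n]. *)
Lemma chebyshev_step Z n : (n.*2 <= Z)%N ->
  \sum_(n.+1 <= d < n.*2.+1) mangoldt Z d <= 2 * n%:R.
Proof.
move=> nZ; apply: le_trans (lnfact_double n).
rewrite (lnfactE nZ) (@lnfactE Z n); last by lia.
rewrite mulr_sumr -sumrB.
have nn : (n.+1 <= n.*2.+1)%N by lia.
have nZ1 : (n.+1 <= Z.+1)%N by lia.
have nZ2 : (n.*2.+1 <= Z.+1)%N by lia.
rewrite [leRHS](big_cat_nat (n := n.+1)) //= [X in _ + X](big_cat_nat (n := n.*2.+1)) //=.
have g0 d : 0 <= mangoldt Z d * (n.*2 %/ d)%:R - 2 * (mangoldt Z d * (n %/ d)%:R).
  have -> : mangoldt Z d * (n.*2 %/ d)%:R - 2 * (mangoldt Z d * (n %/ d)%:R) =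
     mangoldt Z d * ((n.*2 %/ d)%:R - (2 * (n %/ d))%:R) by rewrite natrM; ring.
  rewrite mulr_ge0 ?mangoldt_ge0 // subr_ge0 ler_nat.
  case: d => [|d]; first by rewrite divn0 muln0.
  by rewrite leq_divRL // -mul2n -mulnA leq_mul2l leq_trunc_div.
have h1 : 0 <= \sum_(1 <= d < n.+1) (mangoldt Z d * (n.*2 %/ d)%:R - 2 * (mangoldt Z d * (n %/ d)%:R)).
  by apply: sumr_ge0 => d _.
have h2 : 0 <= \sum_(n.*2.+1 <= d < Z.+1) (mangoldt Z d * (n.*2 %/ d)%:R - 2 * (mangoldt Z d * (n %/ d)%:R)).
  by apply: sumr_ge0 => d _.
suff : \sum_(n.+1 <= d < n.*2.+1) mangoldt Z d <=
  \sum_(n.+1 <= d < n.*2.+1) (mangoldt Z d * (n.*2 %/ d)%:R - 2 * (mangoldt Z d * (n %/ d)%:R)) by rlra.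
apply: ler_sum_nat => d /andP[d1 d2].
have -> : (n %/ d = 0)%N by apply: divn_small.
have -> : (n.*2 %/ d = 1)%N.
  have := leq_trunc_div n.*2 d; have := @ltn_ceil n.*2 d; nia.
by rewrite mulr1 !mulr0 subr0.
Qed.

(** Halving: [chebyshev_step] covers the upper half, induction the lower one. Rounding up can make
    [2 h] exceed the bound by one, whence [n < Z] and the generous constant. *)
Lemma chebyshev Z n : (n < Z)%N -> \sum_(1 <= d < n.+1) mangoldt Z d <= 6 * n%:R.
Proof.
elim/ltn_ind: n => n IH nZ.
case: n IH nZ => [|[|n]] IH nZ; first by rewrite big_geq // mulr0.
  rewrite big_nat1; apply: le_trans (_ : 0 <= _); last by rewrite mulr1.
  have := @sum_mangoldt Z 1; rewrite ln1 => <-; last by lia.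
  rewrite big_mkcond (bigD1_seq 1%N) ?iota_uniq ?mem_index_iota //=; last by lia.
  by rewrite lerDl; apply: sumr_ge0 => d _; case: ifP => // _; exact: mangoldt_ge0.
pose h := n.+3./2.
have hh : (h.*2 = n.+2 \/ h.*2 = n.+3)%N by rewrite /h; lia.
have hZ : (h.*2 <= Z)%N by lia.
have hn : (h < n.+2)%N by lia.
have := IH h hn (ltn_trans hn nZ); have := chebyshev_step hZ.
have : \sum_(1 <= d < n.+3) mangoldt Z d <= \sum_(1 <= d < h.*2.+1) mangoldt Z d.
  have n3 : (n.+3 <= h.*2.+1)%N by lia.
  rewrite [leRHS](big_cat_nat (n := n.+3)) //=.
  by rewrite lerDl; apply: sumr_ge0 => d _; exact: mangoldt_ge0.
have h3 : (h.+1 <= h.*2.+1)%N by lia.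
rewrite [X in _ <= X](big_cat_nat (n := h.+1)) //=.
have : (h.*2)%:R <= n.+3%:R :> R by rewrite ler_nat; lia.
have : 2 <= n.+2%:R :> R by rewrite ler_nat.
rewrite -muln2 natrM -[n.+3%:R]natr1; rlra.
Qed.

(** These are the primes that split in the Gaussian integers. *)
Definition split_only m := (0 < m)%N && all (fun p => p %% 4 == 1)%N (primes m).

Lemma split_only_dvd d m : (d %| m)%N -> split_only m -> split_only d.
Proof.
move=> dm /andP[m0 /allP h]; have d0 : (0 < d)%N by exact: dvdn_gt0 dm.
rewrite /split_only d0; apply/allP => p; rewrite mem_primes => /and3P[pp _ pd].
by apply: h; rewrite mem_primes pp m0 (dvdn_trans pd).
Qed.

Lemma split_onlyM a b : split_only a -> split_only b -> split_only (a * b).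
Proof.
move=> /andP[a0 /allP ha] /andP[b0 /allP hb]; rewrite /split_only muln_gt0 a0 b0.
apply/allP => p; rewrite mem_primes => /and3P[pp _]; rewrite Euclid_dvdM // => /orP[h|h].
  by apply: ha; rewrite mem_primes pp a0.
by apply: hb; rewrite mem_primes pp b0.
Qed.

Definition split_count x : R := \sum_(1 <= m < x.+1 | split_only m) 1.
Definition split_harm x : R := \sum_(1 <= m < x.+1 | split_only m) m%:R^-1.

(** Write [ln x = ln (x / m) + ln m]. The first part is at most [x / m]. The second is a sum of
    [mangoldt] over the divisors [d] of [m]; since [m / d] is again a product of split primes,
    Chebyshev's bound for [d <= x / e] with [e = m / d] gives [6 x / e]. *)
Lemma split_count_ln x : (1 <= x)%N -> split_count x * ln x%:R <= 7 * x%:R * split_harm x.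
Proof.
move=> x1; have xp : 0 < x%:R :> R by rewrite ltr0n.
have h1 : split_count x * ln x%:R <=
    \sum_(1 <= m < x.+1 | split_only m) (x%:R * m%:R^-1) +
    \sum_(1 <= m < x.+1 | split_only m) ln m%:R.
  rewrite /split_count mulr_suml -big_split /= big_mkcond [leRHS]big_mkcond /=.
  apply: ler_sum_nat => m /andP[m0 mx]; case: ifP => // _.
  have mp : 0 < m%:R :> R by rewrite ltr0n.
  have q0 : 0 < x%:R * m%:R^-1 :> R by rewrite divr_gt0.
  have -> : ln x%:R = ln (x%:R * m%:R^-1) + ln m%:R :> R.
    by rewrite -lnM ?posrE // mulrAC -mulrA mulfV ?mulr1 // gt_eqF.
  by rewrite mul1r lerD2r ltW // ln_sublinear.
have h2 : \sum_(1 <= m < x.+1 | split_only m) ln m%:R <= 6 * x%:R * split_harm x.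
  have -> : \sum_(1 <= m < x.+1 | split_only m) ln m%:R =
     \sum_(1 <= m < x.+1) \sum_(1 <= d < x.+1 | (d %| m)%N) (split_only m)%:R * mangoldt x.+1 d.
    rewrite big_mkcond; apply: eq_big_nat => m /andP[m0 mx].
    have <- : \sum_(1 <= d < x.+2 | (d %| m)%N) mangoldt x.+1 d = ln m%:R.
      by apply: sum_mangoldt; lia.
    rewrite -mulr_sumr big_mkcond big_nat_recr //= -big_mkcond /=.
    have -> : (x.+1 %| m)%N = false by apply/negP => /(dvdn_leq m0); lia.
    by rewrite addr0; case: split_only; rewrite ?mul1r ?mul0r.
  apply: (@le_trans _ _ (\sum_(1 <= m < x.+1) \sum_(1 <= d < x.+1 | (d %| m)%N)
     (split_only (m %/ d)%N)%:R * mangoldt x.+1 d)).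
    apply: ler_sum_nat => m _; apply: ler_sum => d dm; apply: ler_wpM2r; first exact: mangoldt_ge0.
    rewrite ler_nat; case: (boolP (split_only m)) => // /(split_only_dvd (dvdn_div dm)) ->.
    by [].
  rewrite (@dirichlet_sum (fun d e => (split_only e)%:R * mangoldt x.+1 d)).
  rewrite (exchange_big_dep xpredT) //= /split_harm mulr_sumr [leRHS]big_mkcond /=.
  apply: ler_sum_nat => e /andP[e0 ex].
  case: (boolP (split_only e)) => _; last by rewrite big1 // => d _; rewrite mul0r.
  have ep : 0 < e%:R :> R by rewrite ltr0n.
  have := @chebyshev x.+1 (x %/ e); rewrite ltnS leq_div => /(_ isT) H.
  apply: (@le_trans _ _ (6 * (x %/ e)%:R)); last first.
    by rewrite -mulrA ler_pM2l // ler_pdivlMr // -natrM ler_nat leq_trunc_div.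
  apply: le_trans H; rewrite le_eqVlt; apply/orP; left; apply/eqP.
  rewrite [RHS](@big_nat_widen _ _ _ 1 _ x.+1) /=; last by rewrite ltnS leq_div.
  apply: eq_big => [d|d _]; last by rewrite mul1r.
  by rewrite ltnS leq_divRL.
move: h1; rewrite -mulr_sumr -/(split_harm x); rlra.
Qed.

(** The nonprincipal character modulo 4. *)
Definition chi n : R := if odd n then (-1) ^+ n./2 else 0.

Lemma chiM m n : chi (m * n) = chi m * chi n.
Proof.
rewrite /chi oddM; case: (boolP (odd m)) => om; case: (boolP (odd n)) => on /=;
  rewrite ?mul0r ?mulr0 //.
rewrite -exprD -signr_odd -[RHS]signr_odd; congr (_ ^+ nat_of_bool _).
have em := odd_double_half m; have en := odd_double_half n.
rewrite om in em; rewrite on in en.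
have -> : ((m * n)./2 = (2 * (m./2 * n./2)) + (m./2 + n./2))%N.
  by rewrite -{1}em -{1}en -!muln2; set a := m./2; set b := n./2; lia.
by rewrite oddD oddM.
Qed.

Lemma chi1 : chi 1 = 1. Proof. by rewrite /chi. Qed.

Lemma chi_split m : split_only m -> chi m = 1.
Proof.
elim/ltn_ind: m => m IH sm; have [m1|m1] := leqP m 1.
  by case: m m1 IH sm => [|[|]] //= _ _ _; rewrite chi1.
have pm := pdiv_dvd m; have pp := pdiv_prime m1.
have m0 : (0 < m)%N by lia.
have p4 : (pdiv m %% 4 = 1)%N.
  by move: sm => /andP[_ /allP/(_ (pdiv m))]; rewrite mem_primes pp m0 pm => /(_ isT) /eqP.
rewrite -(divnK pm) chiM IH ?mul1r.
- rewrite /chi; have -> : odd (pdiv m) by lia.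
  rewrite -signr_odd; have -> : odd (pdiv m)./2 = false by lia.
  by [].
- by rewrite ltn_Pdiv // prime_gt1.
- exact: split_only_dvd (dvdn_div pm) sm.
Qed.

Definition Fchi n : R := \sum_(d <- divisors n) chi d.

Lemma Fchi_range Z n (F : nat -> R) : (1 <= n <= Z)%N ->
  \sum_(1 <= d < Z.+1 | (d %| n)%N) F d = \sum_(d <- divisors n) F d.
Proof.
move=> /andP[n0 nZ]; rewrite -big_filter; apply: perm_big; apply: uniq_perm.
- by rewrite filter_uniq // iota_uniq.
- exact: divisors_uniq.
move=> d; rewrite mem_filter mem_index_iota -dvdn_divisors //.
case: (boolP (d %| n)%N) => //= dn; rewrite (dvdn_gt0 n0 dn) /= ltnS.
exact: leq_trans (dvdn_leq n0 dn) nZ.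
Qed.

(** The divisors gained in passing from [p^a r] to [p^(a+1) r] are exactly [p^(a+1)] times a divisor
    of [r]. *)
Lemma FchiS p a r : prime p -> (0 < r)%N -> ~~ (p %| r)%N ->
  Fchi (p ^ a.+1 * r) = Fchi (p ^ a * r) + chi p ^+ a.+1 * Fchi r.
Proof.
move=> pp r0 pr.
have p0 : (0 < p)%N by exact: prime_gt0.
have pa0 k : (0 < p ^ k * r)%N by rewrite muln_gt0 expn_gt0 p0.
have pak k : (0 < p ^ k)%N by rewrite expn_gt0 p0.
have chiX k : chi (p ^ k) = chi p ^+ k.
  by elim: k => [|k IH]; rewrite ?expn0 ?chi1 // expnS chiM IH exprS.
have -> : chi p ^+ a.+1 * Fchi r = \sum_(d <- map (muln (p ^ a.+1)) (divisors r)) chi d.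
  by rewrite big_map mulr_sumr; apply: eq_bigr => d _; rewrite chiM chiX.
rewrite /Fchi -big_cat; apply: perm_big; apply: uniq_perm.
- exact: divisors_uniq.
- rewrite cat_uniq divisors_uniq /= map_inj_uniq ?divisors_uniq ?andbT; last first.
    by move=> x y /eqP; rewrite eqn_pmul2l // => /eqP.
  apply/hasPn => d /mapP[e _ ->]; rewrite /= -dvdn_divisors //.
  apply: contra pr => h; have : (p ^ a.+1 %| p ^ a * r)%N by exact: dvdn_trans (dvdn_mulr _ _) h.
  by rewrite expnSr dvdn_pmul2l.
move=> d; rewrite mem_cat -!dvdn_divisors //; apply/idP/orP.
  move=> h; have d0 : (0 < d)%N by exact: dvdn_gt0 h.
  have [/dvdnP[e E]|nd] := boolP (p ^ a.+1 %| d)%N.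
    right; apply/mapP; exists e; last by rewrite E mulnC.
    by move: h; rewrite E -dvdn_divisors // mulnC dvdn_pmul2l.
  left; have [f cf E] := pfactor_coprime pp d0.
  have la : (logn p d <= a)%N by move: nd; rewrite pfactor_dvdn // -leqNgt.
  rewrite E mulnC; apply: dvdn_mul; first exact: dvdn_exp2l.
  move: h; rewrite E => h.
  have : (f %| p ^ a.+1 * r)%N by exact: dvdn_trans (dvdn_mulr _ _) h.
  by rewrite Gauss_dvdr // coprimeXr // coprime_sym.
case=> [h|/mapP[e]]; first by rewrite expnS -mulnA dvdn_mull.
by rewrite -dvdn_divisors // => er ->; rewrite dvdn_pmul2l.
Qed.

Lemma chi_geo_ge0 p a : 0 <= \sum_(i < a) chi p ^+ i.
Proof.
have : chi p = 1 \/ chi p = 0 \/ chi p = -1.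
  rewrite /chi; case: odd; last by right; left.
  by rewrite -signr_odd; case: odd; [right; right; rewrite expr1|left].
move=> [->|[->|->]]; [by apply: sumr_ge0 => i _; rewrite expr1n| |].
  by apply: sumr_ge0 => i _; rewrite exprn_ge0.
suff -> : \sum_(i < a) (-1) ^+ i = (odd a)%:R :> R by [].
elim: a => [|a IH]; first by rewrite big_ord0.
by rewrite big_ord_recr /= IH -signr_odd; case: (odd a); rewrite /= ?expr1 ?expr0 ?subrr ?add0r.
Qed.

(** By [FchiS] each prime power contributes a factor [1 + chi p + ... + chi p^a], which is
    nonnegative since [chi p] is 1, 0 or -1. The induction removes the smallest prime. *)
Lemma Fchi_ge0 n : (0 < n)%N -> 0 <= Fchi n.
Proof.
elim/ltn_ind: n => n IH n0; have [n1|n1] := leqP n 1.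
  have -> : n = 1%N by lia.
  by rewrite /Fchi /= big_seq1 chi1.
have pp := pdiv_prime n1; set p := pdiv n in pp.
have [r cr E] := pfactor_coprime pp n0.
have r0 : (0 < r)%N by move: n0; rewrite E; case: (r).
have pr : ~~ (p %| r)%N by rewrite -prime_coprime.
have FE a : Fchi (p ^ a * r) = Fchi r * \sum_(i < a.+1) chi p ^+ i.
  elim: a => [|a IHa]; first by rewrite expn0 mul1n big_ord1 expr0 mulr1.
  by rewrite FchiS // IHa [in RHS]big_ord_recr /= mulrDr (mulrC (chi p ^+ _)).
rewrite E mulnC FE mulr_ge0 ?chi_geo_ge0 // IH //.
rewrite [ltnRHS]E -{1}[r]muln1 ltn_pmul2l // -(expn0 p) ltn_exp2l ?prime_gt1 //.
by rewrite logn_gt0 mem_primes pp n0 pdiv_dvd.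
Qed.

(** Partial sums of the alternating series [1 - 1/3 + 1/5 - ...]. The stronger bound [1 - 1/(4k+1)]
    at multiples of 4 carries the induction. *)
Lemma chi_sum_le1 D : \sum_(1 <= d < D.+1) chi d / d%:R <= 1.
Proof.
have step k : chi k.*2.*2.+1 = 1 /\ chi k.*2.*2.+2 = 0 /\ chi k.*2.*2.+3 = -1 /\ chi k.*2.*2.+4 = 0.
  rewrite /chi; split; [|split; [|split]].
  - have -> : odd k.*2.*2.+1 by lia.
    by rewrite -signr_odd; have -> : odd k.*2.*2.+1./2 = false by lia.
  - by have -> : odd k.*2.*2.+2 = false by lia.
  - have -> : odd k.*2.*2.+3 by lia.
    by rewrite -signr_odd; have -> : odd k.*2.*2.+3./2 by lia.
  - by have -> : odd k.*2.*2.+4 = false by lia.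
pose S n : R := \sum_(1 <= d < n.+1) chi d / d%:R.
have SS n : S n.+1 = S n + chi n.+1 / n.+1%:R by rewrite /S big_nat_recr.
have U k : S k.*2.*2 <= 1 - k.*2.*2.+1%:R^-1.
  elim: k => [|k IHk]; first by rewrite /S big_geq // invr1 subrr.
  have [c1 [c2 [c3 c4]]] := step k.
  rewrite !doubleS !SS c1 c2 c3 c4 !mul0r !addr0 mul1r mulN1r.
  have : k.*2.*2.+4.+1%:R^-1 <= k.*2.*2.+3%:R^-1 :> R.
    by rewrite lef_pV2 ?posrE ?ltr0n // ler_nat; lia.
  move: IHk; move: (k.*2.*2.+1%:R^-1) (k.*2.*2.+3%:R^-1) (k.*2.*2.+4.+1%:R^-1) (S k.*2.*2).
  by move=> a b c d *; rlra.
have iv n : 0 <= n%:R^-1 :> R by rewrite invr_ge0.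
change (S D <= 1).
have [k [r [E r4]]] : exists k r, D = (k.*2.*2 + r)%N /\ (r < 4)%N.
  by exists (D %/ 4)%N, (D %% 4)%N; split; lia.
have [c1 [c2 [c3 c4]]] := step k; have := U k.
have := iv k.*2.*2.+1; have := iv k.*2.*2.+3.
case: r E r4 => [|[|[|[|]]]] // -> _; rewrite ?addn0 ?addn1 ?addn2 ?addn3 ?SS ?c1 ?c2 ?c3 ?mul0r ?mul1r ?mulN1r ?addr0;
  move: (k.*2.*2.+1%:R^-1) (k.*2.*2.+3%:R^-1) (S k.*2.*2) => a b c *; rlra.
Qed.

Lemma harmonic_le_ln Z : (1 <= Z)%N -> \sum_(1 <= e < Z.+1) e%:R^-1 <= 1 + ln Z%:R :> R.
Proof.
case: Z => // Z _; elim: Z => [|Z IH]; first by rewrite big_nat1 invr1 ln1 addr0.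
rewrite big_nat_recr //=; apply: le_trans (lerD IH (lexx _)) _.
rewrite -addrA lerD2l.
have z1 : 0 < Z.+1%:R :> R by rewrite ltr0n.
have z2 : 0 < Z.+2%:R :> R by rewrite ltr0n.
have hz : -1 < - Z.+2%:R^-1 :> R by rewrite ltrN2 invf_lt1 // ltr1n.
have := le_ln1Dx hz; rewrite (_ : 1 + - Z.+2%:R^-1 = Z.+1%:R / Z.+2%:R).
  rewrite ln_div ?posrE //; set A := ln Z.+1%:R; set B := ln Z.+2%:R; set I := Z.+2%:R^-1.
  by move=> h; rlra.
have zn : Z.+2%:R != 0 :> R by rewrite gt_eqF.
rewrite -[X in X - _](divff zn) -{2}[Z.+2%:R^-1]mul1r -mulrBl; congr (_ / _).
by rewrite -[X in X - _]natr1 addrK.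
Qed.

(** The square is a sum over products [n = d e <= N^2] of split primes only; for such [n] the value
    [Fchi n] is the number of divisors and bounds the number of factorisations, and for other [n] it
    is nonnegative. The sum of [Fchi n / n] regroups into [1/e] times sums of [chi d / d], each at
    most 1, leaving a harmonic sum. *)
Lemma split_harm_sqr N : (1 <= N)%N -> split_harm N ^+ 2 <= 1 + 2 * ln N%:R.
Proof.
move=> N1; pose Z := (N * N)%N; have Z1 : (1 <= Z)%N by rewrite muln_gt0 N1.
have NZ : (N <= Z)%N by rewrite leq_pmulr.
have -> : 2 * ln N%:R = ln Z%:R :> R.
  by rewrite natrM lnM ?posrE ?ltr0n // mulr_natl mulr2n.
apply: le_trans (harmonic_le_ln Z1).
pose g d e : R := ((split_only d) && (split_only e))%:R / (d%:R * e%:R).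
have g0 d e : 0 <= g d e by rewrite divr_ge0 ?mulr_ge0.
apply: (@le_trans _ _ (\sum_(1 <= d < Z.+1) \sum_(1 <= e < Z.+1 | (d * e <= Z)%N) g d e)).
  rewrite expr2 /split_harm big_distrlr /=.
  apply: (@le_trans _ _ (\sum_(1 <= d < N.+1) \sum_(1 <= e < N.+1 | (d * e <= Z)%N) g d e)).
    rewrite big_mkcond; apply: ler_sum_nat => d /andP[d1 dN].
    rewrite fun_if /=; case: ifP => sd; last by apply: sumr_ge0 => e _.
    rewrite big_mkcond [leRHS]big_mkcond /=; apply: ler_sum_nat => e /andP[e1 eN].
    rewrite leq_mul //; case: ifP => se; last exact: g0.
    by rewrite /g sd se mul1r invfM.
  have NZ1 : (N.+1 <= Z.+1)%N by lia.
  rewrite [leRHS](big_cat_nat (n := N.+1)) //=.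
  apply: (@le_trans _ _ (\sum_(1 <= d < N.+1) \sum_(1 <= e < Z.+1 | (d * e <= Z)%N) g d e)).
    apply: ler_sum_nat => d _; rewrite [leRHS](big_cat_nat (n := N.+1)) //=.
    by rewrite lerDl; apply: sumr_ge0.
  by rewrite lerDl; apply: sumr_ge0 => d _; apply: sumr_ge0.
rewrite -dirichlet_sum.
apply: (@le_trans _ _ (\sum_(1 <= n < Z.+1) Fchi n / n%:R)).
  apply: ler_sum_nat => n /andP[n1 nZ].
  have nr : 0 < n%:R :> R by rewrite ltr0n.
  have gE d : (d %| n)%N -> g d (n %/ d)%N <= (split_only n)%:R / n%:R.
    move=> dn; rewrite /g -natrM mulnC divnK //; apply: ler_wpM2r; first by rewrite invr_ge0.
    rewrite ler_nat; case: (boolP (split_only d)) => // sd; case: (boolP (split_only (n %/ d))) => // se.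
    by have := split_onlyM se sd; rewrite divnK // => ->.
  apply: (@le_trans _ _ (\sum_(1 <= d < Z.+1 | (d %| n)%N) (split_only n)%:R / n%:R)).
    by apply: ler_sum => d; exact: gE.
  rewrite Fchi_range ?n1 //; case: (boolP (split_only n)) => sn.
    rewrite /Fchi mulr_suml le_eqVlt; apply/orP; left; apply/eqP.
    rewrite !big_seq; apply: eq_bigr => d; rewrite -dvdn_divisors // => dn.
    by rewrite (chi_split (split_only_dvd dn sn)).
  by rewrite big1 ?divr_ge0 ?Fchi_ge0 // => d _; rewrite mul0r.
have -> : \sum_(1 <= n < Z.+1) Fchi n / n%:R =
    \sum_(1 <= n < Z.+1) \sum_(1 <= d < Z.+1 | (d %| n)%N) chi d / (d%:R * (n %/ d)%:R).
  apply: eq_big_nat => n nb; rewrite /Fchi -(Fchi_range _ nb) mulr_suml; apply: eq_bigr => d dn.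
  by rewrite -natrM mulnC divnK.
rewrite (@dirichlet_sum (fun d e => chi d / (d%:R * e%:R))) (exchange_big_dep xpredT) //=.
apply: ler_sum_nat => e /andP[e1 eZ].
have er : 0 < e%:R :> R by rewrite ltr0n.
have -> : \sum_(1 <= d < Z.+1 | (d * e <= Z)%N) chi d / (d%:R * e%:R) =
    (\sum_(1 <= d < (Z %/ e).+1) chi d / d%:R) / e%:R.
  rewrite mulr_suml [RHS](@big_nat_widen _ _ _ 1 _ Z.+1) /=; last by rewrite ltnS leq_div.
  apply: eq_big => [d|d _]; first by rewrite ltnS leq_divRL.
  by rewrite invfM mulrA.
by rewrite -[leRHS]mul1r; apply: ler_wpM2r; rewrite ?invr_ge0 ?chi_sum_le1.
Qed.

End two_squares_density.

(** * Sums of two squares up to [N] *)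

Section landau.
Context (R : realType).
Implicit Types (m n d e p x N g k l : nat).

(** Since [(p - 1) / 2] is odd, [k^2 + l^2] divides [k^(p-1) + l^(p-1)], which by Fermat is 2 modulo
    [p] if [p] divides neither number. *)
Lemma prime3_dvd_sqr p k l : prime p -> (p %% 4 = 3)%N -> (p %| k ^ 2 + l ^ 2)%N -> (p %| k)%N.
Proof.
move=> pp p3 h; apply/negPn/negP => pk.
have pl : ~~ (p %| l)%N.
  apply: contra pk => pl; move: h; rewrite dvdn_addl; last by rewrite dvdn_exp.
  by rewrite Euclid_dvdX // => /andP[].
have fl a : ~~ (p %| a)%N -> a ^ p.-1 = 1 %[mod p].
  move=> pa; have := fermat_little a pp; rewrite -{1}(prednK (prime_gt0 pp)) expnS.
  have a0 : (0 < a)%N by case: a pa; rewrite ?dvdn0.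
  have x1 : (1 <= a ^ p.-1)%N by rewrite expn_gt0 a0.
  rewrite -{3}(muln1 a) => /eqP; rewrite eqn_mod_dvd ?leq_mul // -mulnBr.
  rewrite Euclid_dvdM // (negbTE pa) /= => h'.
  by apply/eqP; rewrite eqn_mod_dvd.
have odd_dvd a b j : (a + b %| a ^ j.*2.+1 + b ^ j.*2.+1)%N.
  elim: j => [|j IH]; first by rewrite !expn1.
  have -> : (a ^ j.+1.*2.+1 + b ^ j.+1.*2.+1 =
     (a ^ j.*2.+1 * a ^ 2 + b ^ j.*2.+1 * b ^ 2))%N by rewrite -!expnD doubleS !addn2.
  have [ab|ab] := leqP a b.
    have -> : (a ^ j.*2.+1 * a ^ 2 + b ^ j.*2.+1 * b ^ 2 =
      (a ^ j.*2.+1 + b ^ j.*2.+1) * a ^ 2 + b ^ j.*2.+1 * ((b - a) * (a + b)))%N.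
      rewrite [X in (_ * ((b - a) * X))%N]addnC -subn_sqr.
      have : (a ^ 2 <= b ^ 2)%N by rewrite leq_exp2r.
      by move=> uv; rewrite mulnDl mulnBr -addnA subnKC // leq_mul2l uv orbT.
    by apply: dvdn_add; [exact: dvdn_mulr|rewrite mulnA; exact: dvdn_mull].
  have -> : (a ^ j.*2.+1 * a ^ 2 + b ^ j.*2.+1 * b ^ 2 =
      (a ^ j.*2.+1 + b ^ j.*2.+1) * b ^ 2 + a ^ j.*2.+1 * ((a - b) * (a + b)))%N.
    rewrite -subn_sqr; have : (b ^ 2 <= a ^ 2)%N by rewrite leq_exp2r // ltnW.
    by move=> uv; rewrite mulnDl mulnBr addnAC subnKC // leq_mul2l uv orbT.
  by apply: dvdn_add; [exact: dvdn_mulr|rewrite mulnA; exact: dvdn_mull].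
pose j := (p %/ 4)%N.
have pj : p.-1 = (2 * j.*2.+1)%N by rewrite /j; clear -p3; lia.
have D : (p %| k ^ p.-1 + l ^ p.-1)%N.
  by rewrite pj !expnM; apply: dvdn_trans h (odd_dvd _ _ _).
move: D; rewrite /dvdn -modnDm (fl k pk) (fl l pl) modnDm.
by rewrite modn_small //; clear -p3; lia.
Qed.

(** Descent on a prime divisor that is not 1 modulo 4: a prime 3 modulo 4 divides both [k] and [l]
    and goes into [g], and a factor 2 is removed by halving. *)
Lemma two_squares_split n : (0 < n)%N -> (exists k l, n = (k ^ 2 + l ^ 2)%N) ->
  exists g m, split_only m /\ (n = (g ^ 2 * m)%N \/ n = (2 * (g ^ 2 * m))%N).
Proof.
elim/ltn_ind: n => n IH n0 [k [l E]].
have [sn|sn] := boolP (split_only n); first by exists 1%N, n; split => //; left; rewrite mul1n.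
move: sn; rewrite /split_only n0 /= => /allPn[p]; rewrite mem_primes => /and3P[pp _ pn] p1.
have [p2|p2] := eqVneq (p : nat) 2%N.
  have /IH H : (n %/ 2 < n)%N by rewrite ltn_Pdiv.
  have n2 : (2 * (n %/ 2) = n)%N by rewrite mulnC divnK // -p2.
  have [||g [m [sm Em]]] := H.
  - by lia.
  (* Half of an even [a^2 + b^2] is [((a+b)/2)^2 + ((a-b)/2)^2]. *)
  - have wl a b : (b <= a)%N -> n = (a ^ 2 + b ^ 2)%N -> exists k l, (n %/ 2)%N = (k ^ 2 + l ^ 2)%N.
      move=> ba Eab; exists ((a + b) %/ 2)%N, ((a - b) %/ 2)%N.
      have ev : (2 %| a + b)%N.
        move: pn; rewrite p2 Eab !dvdn2 !oddD !oddX /=; lia.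
      have ev2 : (2 %| a - b)%N by move: ev; rewrite !dvdn2 oddD oddB //.
      have [u Eu] := dvdnP ev; have [v Ev] := dvdnP ev2.
      rewrite Eu Ev !mulnK // ; have : a = (u + v)%N by clear -ba Eu Ev; lia.
      have : b = (u - v)%N by clear -ba Eu Ev; lia.
      move=> Eb Ea; have vu : (v <= u)%N by clear -ba Eu Ev; lia.
      apply/eqP; rewrite -(eqn_pmul2l (isT : 0 < 2)%N) n2 Eab Ea.
      have -> : b = (u - v)%N by [].
      move: vu => /subnKC <-; rewrite addKn !sqrnD; set w := (u - v)%N; apply/eqP; nia.
    have [h|h] := leqP l k; first exact (wl _ _ h E).
    by apply: (wl _ _ (ltnW h)); rewrite addnC.
  move: Em => [Em|Em].
    by exists g, m; split => //; right; rewrite -Em.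
  exists (2 * g)%N, m; split => //; left; rewrite -n2 Em expnMn; lia.
have p3 : (p %% 4 = 3)%N.
  by have [|] := even_prime pp; [move/eqP; rewrite (negbTE p2)|lia].
have pk : (p %| k)%N by apply: (@prime3_dvd_sqr p k l) => //; rewrite -E.
have pl : (p %| l)%N by apply: (@prime3_dvd_sqr p l k) => //; rewrite addnC -E.
have [k' Ek] := dvdnP pk; have [l' El] := dvdnP pl.
have En : n = (p ^ 2 * (k' ^ 2 + l' ^ 2))%N by rewrite E Ek El !expnMn; lia.
have p1' := prime_gt1 pp.
have n'0 : (0 < k' ^ 2 + l' ^ 2)%N by move: n0; rewrite En; case: (k' ^ 2 + l' ^ 2)%N; rewrite ?muln0.
have n'n : (k' ^ 2 + l' ^ 2 < n)%N.
  by rewrite [ltnRHS]En -{1}[(k' ^ 2 + l' ^ 2)%N]mul1n ltn_pmul2r // -(expn0 p) ltn_exp2l.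
have [|g [m [sm Em]]] := IH _ n'n n'0; first by exists k', l'.
exists (p * g)%N, m; split => //; move: Em => [Em|Em]; [left|right]; rewrite En Em expnMn; lia.
Qed.

Definition is_two_squares n := [exists k : 'I_n.+1, [exists l : 'I_n.+1, n == (k ^ 2 + l ^ 2)%N]].

Definition two_squares N := [seq n <- iota 1 N | is_two_squares n].

(** For each [g] at most [split_count (N / g^2)] numbers arise from either of the two shapes in
    [two_squares_split], whence the factor 2. *)
Lemma two_squares_count N :
  (size (two_squares N))%:R <= 2 * \sum_(1 <= g < N.+1) split_count R (N %/ g ^ 2).
Proof.
pose T g m n : R := (split_only m)%:R * ((n == g ^ 2 * m)%N%:R + (n == 2 * (g ^ 2 * m))%N%:R).
have T0 g m n : 0 <= T g m n by rewrite mulr_ge0 // addr_ge0.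
apply: (@le_trans _ _ (\sum_(1 <= n < N.+1) \sum_(1 <= g < N.+1) \sum_(1 <= m < N.+1) T g m n)).
  rewrite /two_squares size_filter -sum1_count natr_sum.
  have -> : iota 1 N = index_iota 1 N.+1 by rewrite /index_iota subn1.
  rewrite big_mkcond; apply: ler_sum_nat => n /andP[n0 nN].
  case: ifP => [|_]; last by apply: sumr_ge0 => g _; apply: sumr_ge0 => m _.
  move=> /existsP[k /existsP[l /eqP E]].
  have [|g [m [sm Em]]] := two_squares_split n0; first by exists k, l.
  have m0 : (0 < m)%N by move: sm => /andP[].
  have g0 : (0 < g)%N by case: g Em => // -[] En; move: n0; rewrite En ?mul0n ?muln0.
  have gn : (g <= n /\ m <= n)%N by case: Em => ->; nia.
  have tm : 1 <= T g m n.
    rewrite /T sm mul1r; case: Em => ->; rewrite eqxx; last by rewrite lerDr.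
    by rewrite lerDl.
  apply: le_trans tm _.
  rewrite (bigD1_seq g) ?iota_uniq ?mem_index_iota //=; last by lia.
  rewrite (bigD1_seq m) ?iota_uniq ?mem_index_iota //=; last by lia.
  rewrite -addrA lerDl addr_ge0 //; first by apply: sumr_ge0.
  by apply: sumr_ge0 => ? _; apply: sumr_ge0.
rewrite exchange_big /= mulr_sumr; apply: ler_sum_nat => g /andP[g0 gN].
rewrite exchange_big /= /split_count mulr_sumr.
have g20 : (0 < g ^ 2)%N by rewrite expn_gt0 g0.
have dle : (N %/ g ^ 2 < N.+1)%N by rewrite ltnS leq_div.
rewrite (big_nat_widen _ _ _ _ _ dle) [leRHS]big_mkcond /=.
apply: ler_sum_nat => m /andP[m0 mN]; rewrite /T -mulr_sumr big_split /=.
case sm : (split_only m) => /=; last by rewrite mul0r.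
have ind a : (0 < a)%N -> \sum_(1 <= n < N.+1) (n == a)%N%:R = ((a <= N)%N)%:R :> R.
  move=> a0; case: (leqP a N) => aN.
    rewrite (bigD1_seq a) ?iota_uniq ?mem_index_iota ?a0 //= eqxx big1 ?addr0 //.
    by move=> i /negbTE ->.
  rewrite big1_seq // => i; rewrite mem_index_iota => /andP[_ /andP[_ iN]].
  by case: eqP => // Ei; move: aN; rewrite -Ei; lia.
have -> : (m < (N %/ g ^ 2).+1)%N = (g ^ 2 * m <= N)%N by rewrite ltnS leq_divRL // mulnC.
have gm0 : (0 < g ^ 2 * m)%N by rewrite muln_gt0 g20.
have gm2 : (0 < 2 * (g ^ 2 * m))%N by rewrite muln_gt0.
rewrite (ind _ gm0) (ind _ gm2).
case: (leqP (g ^ 2 * m) N) => h1; case: (leqP (2 * (g ^ 2 * m)) N) => h2 /=; try rlra.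
by exfalso; lia.
Qed.

Lemma split_count_le x : split_count R x <= x%:R.
Proof.
rewrite /split_count big_mkcond; apply: (@le_trans _ _ (\sum_(1 <= m < x.+1) 1)).
  by apply: ler_sum => m _; case: ifP.
by rewrite sumr_const_nat subn1.
Qed.

Lemma ln2_ge : 1 / 3 <= ln 2 :> R.
Proof.
have h : -1 < - (1 / 2) :> R by rlra.
have := le_ln1Dx h; have -> : 1 + - (1 / 2) = 2^-1 :> R by field.
by rewrite lnV ?posrE //; rlra.
Qed.

Lemma split_count_sqrt_ln x : (2 <= x)%N ->
  split_count R x * Num.sqrt (ln x%:R) <= 21 * x%:R.
Proof.
move=> x2; have x1 : (1 <= x)%N by lia.
have xp : 0 < x%:R :> R by rewrite ltr0n.
have l2 : 1 / 3 <= ln x%:R :> R.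
  by apply: le_trans ln2_ge _; rewrite ler_ln ?posrE // ler_nat.
have l0 : 0 < ln x%:R :> R by rlra.
set s := Num.sqrt _; have s0 : 0 < s by rewrite sqrtr_gt0.
have s2 : s ^+ 2 = ln x%:R by rewrite sqr_sqrtr // ltW.
have H0 : 0 <= split_harm R x by apply: sumr_ge0 => m _; rewrite invr_ge0.
have H : split_harm R x <= 3 * s.
  have : split_harm R x ^+ 2 <= (3 * s) ^+ 2.
    by apply: le_trans (split_harm_sqr R x1) _; rewrite exprMn s2; rlra.
  by rewrite ler_pXn2r // nnegrE mulr_ge0 // ltW.
have := split_count_ln R x1; rewrite -s2 => h.
rewrite -(ler_pM2r s0) -mulrA -expr2; apply: le_trans h _.
have -> : 21 * x%:R * s = 7 * x%:R * (3 * s) by ring.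
by apply: ler_wpM2l => //; rewrite mulr_ge0.
Qed.

Lemma sum_inv_sqr K N : (1 <= K)%N -> \sum_(K.+1 <= g < N.+1) (g%:R ^+ 2)^-1 <= K%:R^-1 :> R.
Proof.
move=> K1; have [h|h] := leqP N K; first by rewrite big_geq ?invr_ge0.
suff : \sum_(K.+1 <= g < N.+1) (g%:R ^+ 2)^-1 <= K%:R^-1 - N%:R^-1 :> R.
  have : 0 <= N%:R^-1 :> R by rewrite invr_ge0.
  by move=> b0 hS; apply: le_trans hS _; rewrite gerBl.
elim: N h => // N IH; rewrite ltnS leq_eqVlt => /orP[/eqP <-|h].
  rewrite big_nat1; have k0 : 0 < K%:R :> R by rewrite ltr0n.
  have k1 : 0 < K.+1%:R :> R by rewrite ltr0n.
  have -> : K%:R^-1 - K.+1%:R^-1 = (K%:R * K.+1%:R)^-1 :> R.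
    by rewrite -natr1; field; rewrite natr1 !gt_eqF.
  rewrite lef_pV2 ?posrE ?mulr_gt0 ?exprn_gt0 // expr2 ler_pM2r //.
  by rewrite ler_nat.
rewrite big_nat_recr //=; last by lia.
have := IH h; have k0 : 0 < N%:R :> R by rewrite ltr0n; lia.

have k1 : 0 < N.+1%:R :> R by rewrite ltr0n.
have : (N.+1%:R ^+ 2)^-1 <= N%:R^-1 - N.+1%:R^-1 :> R.
  have -> : N%:R^-1 - N.+1%:R^-1 = (N%:R * N.+1%:R)^-1 :> R.
    by rewrite -natr1; field; rewrite natr1 !gt_eqF.
  rewrite lef_pV2 ?posrE ?mulr_gt0 ?exprn_gt0 // expr2 ler_pM2r //.
  by rewrite ler_nat.
by move=> h1 h2; apply: le_trans (lerD h2 h1) _; rewrite addrA subrK.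
Qed.

(** The sum over [g] is cut near [sqrt (ln N)]: above the cut the trivial bound [N / g^2] already
    sums to [N / sqrt (ln N)], below it [N / g^2] is still at least [N^(1/4)], so its logarithm is
    comparable to [ln N]. *)
Lemma landau : exists C : R, 0 < C /\ forall N, (2 <= N)%N ->
  (size (two_squares N))%:R * Num.sqrt (ln N%:R) <= C * N%:R.
Proof.
exists 200; split => // N N2.
have Np : 0 < N%:R :> R by rewrite ltr0n; lia.
have lN : 1 / 3 <= ln N%:R :> R.
  by apply: le_trans ln2_ge _; rewrite ler_ln ?posrE // ler_nat.
set s := Num.sqrt (ln N%:R); have s0 : 0 < s by rewrite sqrtr_gt0; rlra.
have s2 : s ^+ 2 = ln N%:R by rewrite sqr_sqrtr //; rlra.
(* The threshold makes [y = N^(1/4)] exceed 6, hence [y + 1 <= y^3 / 16], which is what the rounding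
   in [N %/ g^2] requires. Below it the count is bounded by [N] and [sqrt (ln N)] by 36. *)
have [small|big] := leqP N (6 ^ 4).
  have sz : (size (two_squares N))%:R <= N%:R :> R.
    by rewrite ler_nat /two_squares size_filter -{2}(size_iota 1 N) count_size.
  have : s <= 36.
    have : s ^+ 2 <= 36 ^+ 2.
      rewrite s2; apply: le_trans (ltW (ln_sublinear Np)) _.
      have -> : 36 = (6 ^ 2)%N%:R :> R by rewrite natrX; ring.
      by rewrite -natrX ler_nat -expnM.
    by rewrite ler_pXn2r // nnegrE ltW.
  move=> h; apply: (@le_trans _ _ (N%:R * 36)); first by rewrite ler_pM // ltW.
  by rewrite mulrC; apply: ler_wpM2r; [exact: ltW|rlra].
pose K := (Num.truncn s).+1.
have sK : s < K%:R by exact: truncnS_gt.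
have Ks : K%:R <= s + 1 by rewrite -natr1 lerD2r truncn_le // ltW.
pose y := Num.sqrt (Num.sqrt N%:R : R); have y0 : 0 < y by rewrite !sqrtr_gt0.
have y4 : y ^+ 4 = N%:R by rewrite -[4%N]/(2 * 2)%N exprM !sqr_sqrtr // sqrtr_ge0.
have y6 : 6 < y.
  rewrite ltNge; apply/negP => hy.
  have : y ^+ 4 <= 6 ^+ 4 by rewrite lerXn2r ?nnegrE // ltW.
  rewrite y4 => h; have : ((6 ^ 4)%N%:R < N%:R :> R) by rewrite ltr_nat.
  by rewrite natrX ltNge h.
have ly : ln N%:R <= 4 * y.
  by rewrite -y4 lnXn // -[ln y *+ 4]mulr_natl ler_pM2l // ltW // ln_sublinear.
have sbig : 1 <= s.
  have : 1 ^+ 2 <= s ^+ 2.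
    rewrite s2 expr1n.
    have N8 : (2 ^ 3 <= N)%N by apply: leq_trans (ltnW big).
    have : ln (2 ^+ 3) <= ln N%:R :> R by rewrite ler_ln ?posrE ?exprn_gt0 // -natrX ler_nat.
    by rewrite lnXn // -[ln 2 *+ 3]mulr_natl; have := ln2_ge; rlra.
  by rewrite ler_pXn2r // nnegrE ltW.
have K2 : K%:R ^+ 2 <= 16 * y.
  apply: (@le_trans _ _ ((2 * s) ^+ 2)); first by rewrite lerXn2r ?nnegrE //; rlra.
  by rewrite exprMn s2; rlra.
have K1 : (1 <= K)%N by [].
have KN : (K <= N)%N.
  rewrite -(ler_nat R); have : K%:R ^+ 2 <= N%:R ^+ 2 :> R.
    apply: le_trans K2 _; rewrite -y4.
    have : y ^+ 4 = y * y ^+ 3 by rewrite exprS.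
    have : 16 <= y ^+ 3 by rnra.
    have : 1 <= y ^+ 4 by rewrite y4 ler1n; lia.
    move=> h1 h2 h3; rewrite expr2 h3; rnra.
  by rewrite ler_pXn2r // nnegrE.
have head g : (1 <= g <= K)%N -> split_count R (N %/ g ^ 2) * s <= 42 * N%:R * (g%:R ^+ 2)^-1.
  move=> /andP[g1 gK]; set x := (N %/ g ^ 2)%N.
  have gp : 0 < g%:R ^+ 2 :> R by rewrite exprn_gt0 // ltr0n.
  have g2 : g%:R ^+ 2 <= 16 * y by apply: le_trans K2; rewrite lerXn2r ?nnegrE // ler_nat.
  have xr : x%:R <= N%:R / g%:R ^+ 2 :> R.
    by rewrite ler_pdivlMr // -natrX -natrM ler_nat leq_trunc_div.
  have xl : N%:R / g%:R ^+ 2 < x%:R + 1 :> R.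
    by rewrite ltr_pdivrMr // natr1 -natrX -natrM ltr_nat /x ltn_ceil // expn_gt0 g1.
  have xy : y <= x%:R.
    have : y ^+ 3 / 16 <= N%:R / g%:R ^+ 2.
      rewrite ler_pdivlMr // mulrAC ler_pdivrMr // -y4.
      have -> : y ^+ 4 * 16 = y ^+ 3 * (16 * y) by ring.
      by rewrite ler_wpM2l // exprn_ge0 // ltW.
    have : y + 1 <= y ^+ 3 / 16 by rewrite ler_pdivlMr //; rnra.
    rlra.
  have x2 : (2 <= x)%N by rewrite -(ler_nat R); rlra.
  have xp : 0 < x%:R :> R by rlra.
  have ss : s <= 2 * Num.sqrt (ln x%:R).
    have : s ^+ 2 <= (2 * Num.sqrt (ln x%:R)) ^+ 2.
      rewrite s2 exprMn sqr_sqrtr; last by apply: ln_ge0; apply: le_trans xy; rlra.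
      rewrite -y4 lnXn // -[ln y *+ 4]mulr_natl.
      have : ln y <= ln x%:R by rewrite ler_ln ?posrE.
      rlra.
    by rewrite ler_pXn2r // nnegrE ?mulr_ge0 ?sqrtr_ge0 // ltW.
  have sc0 : 0 <= split_count R x by apply: sumr_ge0.
  apply: (@le_trans _ _ (2 * (split_count R x * Num.sqrt (ln x%:R)))).
    by rewrite mulrCA; apply: ler_wpM2l.
  by have := split_count_sqrt_ln x2; rewrite -mulrA; rlra.
have tail : \sum_(K.+1 <= g < N.+1) split_count R (N %/ g ^ 2) * s <= N%:R.
  rewrite -mulr_suml.
  have : \sum_(K.+1 <= g < N.+1) split_count R (N %/ g ^ 2) <= N%:R * K%:R^-1.
    apply: (@le_trans _ _ (\sum_(K.+1 <= g < N.+1) N%:R * (g%:R ^+ 2)^-1)).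
      apply: ler_sum_nat => g /andP[g1 _]; apply: le_trans (split_count_le _) _.
      have gp : 0 < g%:R ^+ 2 :> R by rewrite exprn_gt0 // ltr0n (leq_ltn_trans _ g1).
      by rewrite ler_pdivlMr // -natrX -natrM ler_nat leq_trunc_div.
    by rewrite -mulr_sumr; apply: ler_wpM2l; [exact: ltW|exact: sum_inv_sqr].
  move=> h; apply: (@le_trans _ _ (N%:R * K%:R^-1 * s)); first by apply: ler_wpM2r; [exact: ltW|].
  rewrite -mulrA -[leRHS]mulr1 ler_pM2l // mulrC ler_pdivrMr ?ltr0n // mul1r; exact: ltW.
have headsum : \sum_(1 <= g < K.+1) split_count R (N %/ g ^ 2) * s <= 84 * N%:R.
  apply: (@le_trans _ _ (\sum_(1 <= g < K.+1) 42 * N%:R * (g%:R ^+ 2)^-1)).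
    by apply: ler_sum_nat => g hg; exact: head.
  rewrite -mulr_sumr big_ltn // expr1n invr1.
  have := @sum_inv_sqr 1 K isT; rewrite invr1 => h; rnra.
have := two_squares_count N; rewrite (big_cat_nat (n := K.+1)) //= => h.
apply: le_trans (ler_wpM2r (ltW s0) h) _.
move: tail headsum; rewrite -!mulr_suml.
set A := \sum_(1 <= g < K.+1) _; set B := \sum_(K.+1 <= g < N.+1) _ => h1 h2; rlra.
Qed.

End landau.

(** * Dirichlet approximation *)

Section dirichlet.
Context (R : realType).

Definition near_int (e x : R) := exists k : int, `|x - k%:~R| <= e.

(** Pigeonhole: [K^n + 1] multiples, [K^n] boxes of fractional parts; the difference of two
    multipliers in the same box is the witness. *)
Lemma dirichlet_simultaneous (n K : nat) (a : 'I_n -> R) : (0 < K)%N ->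
  exists t : nat, [/\ (1 <= t)%N, (t <= K ^ n)%N & forall i, near_int K%:R^-1 (t%:R * a i)].
Proof.
move=> K0; have Kp : 0 < K%:R :> R by rewrite ltr0n.
pose fr (x : R) : R := x - (Num.floor x)%:~R.
have fr0 x : 0 <= fr x by rewrite subr_ge0 floor_le_tmp.
have fr1 x : fr x < 1.
  by rewrite /fr ltrBlDr addrC -intrD1 floorD1_gt.
have cell x : (Num.truncn (fr x * K%:R) < K)%N.
  rewrite -(ltr_nat R); apply: le_lt_trans (_ : fr x * K%:R < _).
    by rewrite truncn_le // mulr_ge0.
  by rewrite -[ltRHS]mul1r ltr_pM2r.
pose box (t : 'I_(K ^ n).+1) : {ffun 'I_n -> 'I_K} := [ffun i => Ordinal (cell (t%:R * a i))].
have /injectivePn[t1 [t2 ne E]] : ~~ injectiveb box.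
  apply/negP => /injectiveP /leq_card; rewrite card_ffun !card_ord; lia.
wlog lt : t1 t2 ne E / (t1 < t2)%N.
  move=> W; have [h|h|h] := ltngtP t1 t2; first exact: W ne E h.
    by apply: (W t2 t1); rewrite 1?eq_sym.
  by move: ne; rewrite (val_inj h) eqxx.
exists (t2 - t1)%N; split; [by lia|by have := ltn_ord t2; lia|].
move=> i; exists (Num.floor (t2%:R * a i) - Num.floor (t1%:R * a i)).
have := congr1 (fun f : {ffun 'I_n -> 'I_K} => f i : nat) E; rewrite !ffunE /= => Ei.
have b x : (Num.truncn (fr x * K%:R))%:R <= fr x * K%:R < (Num.truncn (fr x * K%:R)).+1%:R.
  by rewrite truncn_le ?truncnS_gt // mulr_ge0.
have := b (t1%:R * a i); have := b (t2%:R * a i); rewrite Ei -[_.+1%:R]natr1.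
set m := (Num.truncn _)%:R => /andP[h1 h2] /andP[h3 h4].
have -> : (t2 - t1)%:R * a i - (Num.floor (t2%:R * a i) - Num.floor (t1%:R * a i))%:~R =
    fr (t2%:R * a i) - fr (t1%:R * a i).
  by rewrite /fr natrB 1?ltnW // intrD mulrNz; ring.
rewrite -(ler_pM2r Kp) mulVf ?gt_eqF // -{1}[K%:R]ger0_norm // -normrM mulrBl ler_norml.
by rlra.
Qed.

(** The case of one number, followed by reduction of the fraction; the reduced denominator is not
    larger, so the bound [1 / (Q d)] survives. *)
Lemma dirichlet_approx (y : R) (Q : nat) : (0 < Q)%N ->
  exists (d : nat) (b : int), [/\ (1 <= d)%N, (d <= Q)%N, coprime `|b| d &
    `|y - b%:~R / d%:R| <= (Q%:R * d%:R)^-1].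
Proof.
move=> Q0; have [t [t1 tQ /(_ ord0) [k hk]]] := @dirichlet_simultaneous 1 Q (fun=> y) Q0.
rewrite expn1 in tQ.
pose g := gcdn `|k| t; have g0 : (0 < g)%N by rewrite gcdn_gt0 t1 orbT.
have gt : (g %| t)%N by exact: dvdn_gcdr.
have gk : (g %| `|k|)%N by exact: dvdn_gcdl.
pose d := (t %/ g)%N; pose b : int := (k %/ g%:Z)%Z.
have dE : (d * g = t)%N by rewrite divnK.
have bE : b * g%:Z = k by apply: divzK.
have d0 : (0 < d)%N by rewrite divn_gt0 // dvdn_leq.
have dt : (d <= t)%N by rewrite -dE leq_pmulr.
have tr : 0 < t%:R :> R by rewrite ltr0n.
have dr : 0 < d%:R :> R by rewrite ltr0n.
have gr : 0 < g%:R :> R by rewrite ltr0n.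
have Qr : 0 < Q%:R :> R by rewrite ltr0n.
exists d, b; split => //; first exact: leq_trans dt tQ.
  rewrite /coprime -(eqn_pmul2r g0) mul1n muln_gcdl dE.
  by have -> : (`|b| * g = `|k|)%N by rewrite -bE abszM.
have -> : b%:~R / d%:R = k%:~R / t%:R :> R.
  rewrite -bE -dE natrM intrM -pmulrn; field.
  by rewrite !gt_eqF.
have -> : y - k%:~R / t%:R = (t%:R * y - k%:~R) / t%:R by field; rewrite gt_eqF.
rewrite normrM normfV (ger0_norm (ltW tr)) invfM; apply: ler_pM => //.
by rewrite lef_pV2 ?posrE // ler_nat.
Qed.

End dirichlet.

(** * Weyl sums *)

Section integer_ranges.

(** The integers of absolute value at most [n]; [locked] keeps the list from being unfolded in
    proofs. *)
Definition zr (n : nat) : seq int := locked [seq i%:Z - n%:Z | i <- iota 0 n.*2.+1].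

Lemma mem_zr n (j : int) : (j \in zr n) = (`|j| <= n)%N.
Proof.
rewrite /zr -lock; apply/mapP/idP => [ [k] | h ]; first by rewrite mem_iota => hi ->; lia.
by exists (absz (j + n%:Z)); rewrite ?mem_iota; lia.
Qed.

Lemma zr_uniq n : uniq (zr n).
Proof. by rewrite /zr -lock map_inj_uniq ?iota_uniq // => a b; lia. Qed.

Lemma size_zr n : size (zr n) = n.*2.+1.
Proof. by rewrite /zr -lock size_map size_iota. Qed.

Lemma big_zr (V : nmodType) n (F : int -> V) :
  \sum_(j <- zr n) F j = \sum_(i < n.*2.+1) F (i%:Z - n%:Z).
Proof. by rewrite /zr -lock big_map -(big_mkord xpredT (fun i => F (i%:Z - n%:Z))) /index_iota subn0. Qed.

Lemma big_supp (V : zmodType) (T : eqType) (s1 s2 : seq T) (F : T -> V) :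
  uniq s1 -> uniq s2 -> (forall x, F x != 0 -> (x \in s1) = (x \in s2)) ->
  \sum_(x <- s1) F x = \sum_(x <- s2) F x.
Proof.
move=> u1 u2 h.
have cond s : \sum_(x <- s) F x = \sum_(x <- [seq x <- s | F x != 0]) F x.
  rewrite big_filter [LHS](bigID (fun x => F x != 0)) /= [X in _ + X]big1 ?addr0 //.
  by move=> x; rewrite negbK => /eqP.
rewrite (cond s1) (cond s2); apply: perm_big; apply: uniq_perm; rewrite ?filter_uniq //.
by move=> x; rewrite !mem_filter; case: (boolP (F x != 0)) => //= /h.
Qed.

Lemma zr_sum_abs (V : comNzRingType) n (F : nat -> V) :
  \sum_(j <- zr n) F `|j|%N = F 0%N + (\sum_(1 <= i < n.+1) F i) *+ 2.
Proof.
elim: n => [|n IH]; first by rewrite big_zr /= big_ord1 big_geq // mul0rn addr0.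
have P : perm_eq (zr n.+1) (n.+1%:Z :: - n.+1%:Z :: zr n).
  apply: uniq_perm; rewrite ?zr_uniq //=.
    by rewrite zr_uniq !inE !mem_zr andbT; apply/andP; split; lia.
  by move=> j; rewrite !inE !mem_zr; lia.
have E : \sum_(1 <= i < n.+2) F i = \sum_(1 <= i < n.+1) F i + F n.+1 by rewrite big_nat_recr.
rewrite E (perm_big _ P) !big_cons IH.
have -> : absz (- n.+1%:Z) = n.+1 by lia.
by rewrite /=; ring.
Qed.

Lemma zr_shift (V : zmodType) n m (a : int) (F : int -> V) :
  (forall j, F j != 0 -> (`|j| <= m)%N && (`|j - a| <= n)%N) ->
  \sum_(j <- zr n) F (j + a) = \sum_(j <- zr m) F j.
Proof.
move=> h; have -> : \sum_(j <- zr n) F (j + a) = \sum_(j <- map (+%R^~ a) (zr n)) F j.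
  by rewrite [RHS]big_map.
apply: big_supp; [by rewrite map_inj_uniq ?zr_uniq //; exact: addIr|exact: zr_uniq|].
move=> j /h /andP[h1 h2]; rewrite mem_zr h1; apply/mapP; exists (j - a); rewrite ?mem_zr //.
by rewrite subrK.
Qed.

End integer_ranges.

(** * Differencing of a smoothed theta sum *)

Section weyl.
Context (R : realType).
Implicit Types (B n m d : nat) (j k a : int) (x y t : R).

(* [2 * B - |j|] is truncated, so this is the trapezoid equal to 1 on [|j| <= B] and to 0 off [|j| < 2B]. *)
Definition trap B j : R := (minn B (2 * B - `|j|))%:R / B%:R.

Lemma trap_ge0 B j : 0 <= trap B j.
Proof. by rewrite divr_ge0. Qed.

Lemma trap_le1 B j : trap B j <= 1.
Proof.
case: B => [|B]; first by rewrite /trap min0n mul0r.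
by rewrite ler_pdivrMr ?ltr0n // mul1r ler_nat geq_minl.
Qed.

Lemma trap1 B j : (0 < B)%N -> (`|j| <= B)%N -> trap B j = 1.
Proof.
move=> B0 h; rewrite /trap; have -> : minn B (2 * B - `|j|) = B by lia.
by rewrite divff // pnatr_eq0 -lt0n.
Qed.

Lemma trap0 B j : (2 * B <= `|j|)%N -> trap B j = 0.
Proof. 
move=> h; rewrite /trap; have -> : minn B (2 * B - `|j|) = 0%N by lia.
by rewrite mul0r.
 Qed.

Lemma trap_diff B j : `|trap B (j + 1) - trap B j| <= B%:R^-1.
Proof.
rewrite /trap -mulrBl normrM normfV (@ger0_norm _ B%:R) // -[leRHS]mul1r.
apply: ler_wpM2r; first by rewrite invr_ge0.
have : (minn B (2 * B - `|(j + 1)%R|) <= (minn B (2 * B - `|j|)).+1)%N /\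
  (minn B (2 * B - `|j|) <= (minn B (2 * B - `|(j + 1)%R|)).+1)%N by lia.
set u := minn _ _; set v := minn _ _ => -[h1 h2].
move: h1 h2; rewrite -!(ler_nat R) -!natr1 ler_norml => *; rlra.
Qed.

(** The trapezoid is piecewise linear and bends only at [|j| = B] and [|j| = 2 B]. *)
Lemma trap_diff2 B j : (0 < B)%N ->
  `|trap B (j + 1) - 2 * trap B j + trap B (j - 1)| <=
   ((`|j| == B)%N || (`|j| == 2 * B)%N)%:R / B%:R.
Proof.
move=> B0; have Bp : 0 < B%:R :> R by rewrite ltr0n.
have -> : trap B (j + 1) - 2 * trap B j + trap B (j - 1) =
  ((minn B (2 * B - `|(j + 1)%R|))%:R - 2 * (minn B (2 * B - `|j|))%:R
    + (minn B (2 * B - `|(j - 1)%R|))%:R) / B%:R.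
  by rewrite /trap; field; rewrite gt_eqF.
rewrite normrM normfV (@ger0_norm _ B%:R) //.
apply: ler_wpM2r; first by rewrite invr_ge0.
set u := minn _ _; set v := minn _ (_ - `|j|)%N; set w := minn _ (_ - `|(j - 1)%R|)%N.
set c := ((`|j| == B)%N || (`|j| == 2 * B)%N).
have [h1 h2] : (u + w <= v + v + c /\ v + v <= u + w + c)%N.
  by rewrite /u /v /w /c; case: (altP (`|j|%N =P B)); case: (altP (`|j|%N =P (2 * B)%N)); lia.
move: h1 h2; rewrite -!(ler_nat R) !natrD ler_norml => *; rlra.
Qed.

(** A theta sum cut off by the trapezoid. A sharp cut-off would give linear sums of size [1 / |t|]
    after differencing and cost a logarithm; the trapezoid gives [1 / (B t^2)]. *)
Definition wsum B y : R[i] := \sum_(j <- zr (2 * B)) (trap B j)%:C%C * ce (y * j%:~R ^+ 2).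

Lemma wsum_periodic B y (k : int) : wsum B (y + k%:~R) = wsum B y.
Proof.
apply: eq_bigr => j _; congr (_ * _); rewrite mulrDl.
by rewrite -(ceDint (y * j%:~R ^+ 2) (k * j ^+ 2)) intrM rmorphXn.
Qed.

Lemma cabs_wsum_le B y : (0 < B)%N -> cabs (wsum B y) <= 5 * B%:R.
Proof.
move=> B0; apply: le_trans (cabs_sum _ _ _) _.
apply: (@le_trans _ _ (\sum_(j <- zr (2 * B)) 1)).
  apply: ler_sum => j _; rewrite cabsM cabs_ce mulr1 cabs_real ger0_norm ?trap_ge0 //.
  exact: trap_le1.
rewrite big_const_seq count_predT size_zr iter_addr_0 -[5]/(5%:R) -natrM ler_nat; lia.
Qed.

Definition corr B a t : R[i] :=
  \sum_(j <- zr (2 * B)) (trap B j * trap B (j + a))%:C%C * ce (j%:~R * t).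

(** Weyl differencing: in the product of the sum with its conjugate, [(k + a)^2 - k^2] is linear in
    [k], with frequency [2 a y]. *)
Lemma wsum_sqr B y : cabs (wsum B y) ^+ 2 <= \sum_(a <- zr (4 * B)) cabs (corr B a (2 * a%:~R * y)).
Proof.
have -> : cabs (wsum B y) ^+ 2 =
   cabs (\sum_(a <- zr (4 * B)) ce (y * a%:~R ^+ 2) * corr B a (2 * a%:~R * y)).
  have -> : \sum_(a <- zr (4 * B)) ce (y * a%:~R ^+ 2) * corr B a (2 * a%:~R * y) =
     wsum B y * (wsum B y)^*%C.
    rewrite /corr.
    under eq_bigr do rewrite mulr_sumr.
    have cj (r z : R) : (r%:C%C * ce z)^*%C = r%:C%C * ce (- z).
      by rewrite /ce mulrN cosN sinN; simpc.
    rewrite exchange_big [in RHS]mulrC rmorph_sum mulr_suml !big_seq.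
    apply: eq_bigr => k; rewrite mem_zr => hk.
    transitivity (\sum_(a <- zr (4 * B)) (((trap B k)%:C%C * ce (- (y * k%:~R ^+ 2))) *
        ((trap B (a + k))%:C%C * ce (y * (a + k)%:~R ^+ 2)))).
      apply: eq_bigr => a _; rewrite (addrC a k) [RHS]mulrACA -rmorphM -ceD mulrCA -ceD.
      congr (_ * ce _); rewrite intrD; ring.
    rewrite -mulr_sumr; congr (_ * _); first by rewrite -cj.
    apply: (@zr_shift _ (4 * B) (2 * B) k (fun j => (trap B j)%:C%C * ce (y * j%:~R ^+ 2))).
    move=> j hj; have hj2 : (`|j| <= 2 * B)%N.
      rewrite leqNgt; apply: contra hj => h; rewrite trap0 ?mul0r //; lia.
    by rewrite hj2 /=; lia.
  by rewrite -cabs_sqrE cabs_real ger0_norm // exprn_ge0 // cabs_ge0.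
apply: le_trans (cabs_sum _ _ _) _; apply: ler_sum => a _.
by rewrite cabsM cabs_ce mul1r.
Qed.

Lemma corr_le B a t : (0 < B)%N -> cabs (corr B a t) <= 5 * B%:R.
Proof.
move=> B0; apply: le_trans (cabs_sum _ _ _) _.
apply: (@le_trans _ _ (\sum_(j <- zr (2 * B)) 1)).
  apply: ler_sum => j _; rewrite cabsM cabs_ce mulr1 cabs_real.
  rewrite ger0_norm ?mulr_ge0 ?trap_ge0 // -[leRHS]mulr1.
  by apply: ler_pM; rewrite ?trap_ge0 ?trap_le1.
rewrite big_const_seq count_predT size_zr iter_addr_0 -[5]/(5%:R) -natrM ler_nat; lia.
Qed.

Lemma count_zr_abs (n m : nat) : \sum_(j <- zr n) ((`|j| == m)%N%:R : R) <= 2.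
Proof.
apply: (@le_trans _ _ (\sum_(j <- zr n) ((j == m%:Z)%:R + (j == - m%:Z)%:R))).
  apply: ler_sum => j _; rewrite -natrD ler_nat.
  by case: eqP => //; case: eqP => //; case: eqP => //; lia.
have one k : \sum_(j <- zr n) ((j == k)%:R : R) <= 1.
  have [kn|kn] := boolP (k \in zr n).
    rewrite (bigD1_seq k) ?zr_uniq //= eqxx big1 ?addr0 // => j /negbTE -> //.
  rewrite big1_seq // => j /andP[_ jn]; case: eqP => // E; by rewrite -E jn in kn.
rewrite big_split /=; have := one m%:Z; have := one (- m%:Z); rlra.
Qed.

(** Multiplying by [e(t) - 1] twice is summing by parts twice. The second difference of the product
    of trapezoids consists of terms of size [1/B] at boundedly many corners and of terms of size
    [1/B^2] at [O(B)] points. *)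
Lemma corr_decay B a t : (0 < B)%N -> cabs (corr B a t) * cabs (ce t - 1) ^+ 2 <= 30 / B%:R.
Proof.
move=> B0; have Bp : 0 < B%:R :> R by rewrite ltr0n.
pose psi (j : int) : R := trap B j * trap B (j + a).
have psi0 j : (2 * B <= `|j|)%N -> psi j = 0 by move=> h; rewrite /psi trap0 ?mul0r.
pose n := (2 * B + 1)%N.
have E : corr B a t * (ce t - 1) ^+ 2 =
   \sum_(j <- zr n) (psi (j + 1) - 2 * psi j + psi (j - 1))%:C%C * ce ((j + 1)%:~R * t).
  have sh (c : int) (u : int) : (`|c| <= 1)%N ->
     \sum_(j <- zr n) (psi (j + c))%:C%C * ce ((j + u)%:~R * t) =
     corr B a t * ce ((u - c)%:~R * t).
    move=> hc; rewrite /corr mulr_suml.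
    transitivity (\sum_(j <- zr n) (fun j => (psi j)%:C%C * ce ((j - c + u)%:~R * t)) (j + c)).
      by apply: eq_bigr => j _; rewrite addrK.
    rewrite (@zr_shift _ n (2 * B) c (fun j => (psi j)%:C%C * ce ((j - c + u)%:~R * t))).
      apply: eq_bigr => j _; rewrite -mulrA -ceD -mulrDl -intrD; do 3 f_equal; ring.
    move=> j hj; have hj2 : (`|j| <= 2 * B)%N.
      rewrite leqNgt; apply: contra hj => h; rewrite psi0 ?mul0r //; lia.
    by rewrite hj2 /n /=; lia.
  have := sh 1 1; have := sh 0 1; have := sh (-1) 1.
  rewrite /= => /(_ isT) s3 /(_ isT) s2 /(_ isT) s1.
  rewrite subrr mul0r ce0 mulr1 in s1; rewrite subr0 mul1r in s2.
  rewrite opprK in s3.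
  transitivity (\sum_(j <- zr n) ((psi (j + 1))%:C%C * ce ((j + 1)%:~R * t)
      - 2%:R * ((psi (j + 0))%:C%C * ce ((j + 1)%:~R * t))
      + (psi (j - 1))%:C%C * ce ((j + 1)%:~R * t))); last first.
    apply: eq_bigr => j _; rewrite addr0; move: (psi (j + 1)) (psi j) (psi (j - 1)) => u v w.
    have -> : (u - 2 * v + w)%:C%C = u%:C%C - 2%:R * v%:C%C + w%:C%C :> R[i].
      by apply/eqP; rewrite eq_complex /=; apply/andP; split; apply/eqP; ring.
    ring.
  rewrite big_split /= sumrB -mulr_sumr s1 s2 s3.
  have -> : ce ((1 + 1)%:~R * t) = ce t ^+ 2 by rewrite ceX.
  by ring.
rewrite -cabsX -cabsM E; apply: le_trans (cabs_sum _ _ _) _.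
have key j : `|psi (j + 1) - 2 * psi j + psi (j - 1)| <=
   (((`|j| == B)%N)%:R + ((`|j| == 2 * B)%N)%:R + ((`|(j + a)%R| == B)%N)%:R
     + ((`|(j + a)%R| == 2 * B)%N)%:R) / B%:R + 2 / B%:R ^+ 2.
  have d1 := trap_diff2 j B0; have d2 := trap_diff2 (j + a) B0.
  have e1 := trap_diff B j; have e2 := trap_diff B (j - 1).
  have e3 := trap_diff B (j + a); have e4 := trap_diff B (j + a - 1).
  rewrite subrK in e2; rewrite subrK in e4.
  rewrite /psi (addrAC j 1 a) (addrAC j (-1) a).
  have v1 := trap_le1 B (j + a); have v0 := trap_ge0 B (j + a).
  have u1 := trap_le1 B j; have u0 := trap_ge0 B j.
  set U2 := trap B (j + 1) in d1 e1 *; set U1 := trap B j in d1 e1 e2 u1 u0 *.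
  set U0 := trap B (j - 1) in d1 e2 *.
  set V2 := trap B (j + a + 1) in d2 e3 *; set V1 := trap B (j + a) in d2 e3 e4 v1 v0 *.
  set V0 := trap B (j + a - 1) in d2 e4 *.
  (* The discrete Leibniz rule for a second difference. *)
  have -> : U2 * V2 - 2 * (U1 * V1) + U0 * V0 = V1 * (U2 - 2 * U1 + U0)
     + U1 * (V2 - 2 * V1 + V0) + (U2 - U1) * (V2 - V1) + (U1 - U0) * (V1 - V0) by ring.
  have or_le (p q : bool) : (p || q)%:R <= p%:R + q%:R :> R by case: p; case: q => /=; rlra.
  have o1 := or_le (`|j| == B)%N (`|j| == 2 * B)%N.
  have o2 := or_le (`|(j + a)%R| == B)%N (`|(j + a)%R| == 2 * B)%N.
  have iB : 0 <= B%:R^-1 :> R by rewrite invr_ge0.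
  have p1 : `|V1 * (U2 - 2 * U1 + U0)| <= (((`|j| == B)%N)%:R + ((`|j| == 2 * B)%N)%:R) / B%:R.
    rewrite normrM (ger0_norm v0); apply: le_trans (_ : 1 * `|U2 - 2 * U1 + U0| <= _).
      exact: ler_wpM2r.
    by rewrite mul1r; apply: le_trans d1 _; apply: ler_wpM2r.
  have p2 : `|U1 * (V2 - 2 * V1 + V0)| <= (((`|(j + a)%R| == B)%N)%:R + ((`|(j + a)%R| == 2 * B)%N)%:R) / B%:R.
    rewrite normrM (ger0_norm u0); apply: le_trans (_ : 1 * `|V2 - 2 * V1 + V0| <= _).
      exact: ler_wpM2r.
    by rewrite mul1r; apply: le_trans d2 _; apply: ler_wpM2r.
  have p3 : `|(U2 - U1) * (V2 - V1)| <= (B%:R ^+ 2)^-1.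
    by rewrite normrM -exprVn expr2; apply: ler_pM.
  have p4 : `|(U1 - U0) * (V1 - V0)| <= (B%:R ^+ 2)^-1.
    by rewrite normrM -exprVn expr2; apply: ler_pM.
  apply: le_trans (ler_normD _ _) _; apply: le_trans (lerD (ler_normD _ _) (lexx _)) _.
  apply: le_trans (lerD (lerD (ler_normD _ _) (lexx _)) (lexx _)) _.
  apply: le_trans (lerD (lerD (lerD p1 p2) p3) p4) _.
  by rewrite le_eqVlt; apply/orP; left; apply/eqP; ring.
apply: (@le_trans _ _ (\sum_(j <- zr n) ((((`|j| == B)%N)%:R + ((`|j| == 2 * B)%N)%:R
   + ((`|(j + a)%R| == B)%N)%:R + ((`|(j + a)%R| == 2 * B)%N)%:R) / B%:R + 2 / B%:R ^+ 2))).
  by apply: ler_sum => j _; rewrite cabsM cabs_ce mulr1 cabs_real; exact: key.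
rewrite big_split /= -mulr_suml !big_split /=.
have c1 := count_zr_abs n B; have c2 := count_zr_abs n (2 * B).
have csh m : \sum_(j <- zr n) ((`|(j + a)%R| == m)%N%:R : R) <= 2.
  pose F (j : int) : R := (`|j| == m)%N%:R * (`|(j - a)%R| <= n)%N%:R.
  have -> : \sum_(j <- zr n) ((`|(j + a)%R| == m)%N%:R : R) = \sum_(j <- zr n) F (j + a).
    by rewrite !big_seq; apply: eq_bigr => j; rewrite mem_zr /F addrK => ->; rewrite mulr1.
  rewrite (@zr_shift _ n m a F); last first.
    move=> j; rewrite /F; case: (altP (`|j|%N =P m)) => [->|_]; last by rewrite mul0r eqxx.
    by case: (absz (j - a) <= n)%N; rewrite ?mulr0 ?eqxx ?leqnn.
  apply: le_trans (count_zr_abs m m); apply: ler_sum => j _; rewrite /F.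
  by case: (_ == m); case: (_ <= n)%N; rewrite ?mul0r ?mulr0 ?mulr1.
have c3 := csh B; have c4 := csh (2 * B)%N.
rewrite big_const_seq count_predT size_zr iter_addr_0 -[_ *+ n.*2.+1]mulr_natl.
have s1 : n.*2.+1%:R * (2 / B%:R ^+ 2) <= 14 / B%:R :> R.
  rewrite mulrA ler_pdivrMr ?exprn_gt0 // expr2 mulrA divfK ?gt_eqF //.
  by rewrite -!natrM ler_nat /n; lia.
have := ler_wpM2r (_ : 0 <= B%:R^-1) (lerD (lerD (lerD c1 c2) c3) c4).
rewrite invr_ge0 ler0n => /(_ isT) s2.
have -> : 30 / B%:R = 16 / B%:R + 14 / B%:R :> R by rewrite -mulrDl; congr (_ / _); rlra.
apply: lerD s1; apply: le_trans s2 _; apply: ler_wpM2r; [by rewrite invr_ge0|rlra].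
Qed.

End weyl.

(** * Weyl's bound without logarithms *)

Section weyl_bound.
Context (R : realType).
Implicit Types (B n m d : nat) (x y t : R).

Lemma abs_sin_pi_ge3 x : `|x| <= 3 / 4 -> `|x| / 3 <= `|sin (pi * x)|.
Proof.
move=> hx; have [h|h] := leP `|x| (1 / 2).
  by apply: le_trans (abs_sin_pi_ge h); have := normr_ge0 x; rlra.
have key (z : R) : 1 / 2 < z -> z <= 3 / 4 -> z / 3 <= `|sin (pi * z)|.
  move=> h1 h2; have -> : pi * z = - (pi * (1 - z)) + pi by ring.
  rewrite sinDpi sinN opprK; apply: le_trans (abs_sin_pi_ge _); rewrite ger0_norm; rlra.
have [x0|x0] := leP 0 x; first by move: hx h; rewrite (ger0_norm x0) => *; exact: key.
rewrite -[sin _]opprK -sinN -mulrN.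
have nx : 0 <= - x by rlra.
have nxx : `|x| = - x by rewrite -normrN ger0_norm.
by rewrite normrN; move: hx h; rewrite nxx => *; exact: key.
Qed.

(** The two bounds cross at [i = sqrt (Q / P)]; the sum is cut there. *)
Lemma sum_min_inv_sqr (P Q : R) n : 0 < P -> 0 < Q ->
  \sum_(1 <= i < n.+1) Num.min P (Q / i%:R ^+ 2) <= P + 2 * Num.sqrt (P * Q).
Proof.
move=> P0 Q0; pose s := Num.sqrt (Q / P).
have QP : 0 < Q / P by rewrite divr_gt0.
have s0 : 0 < s by rewrite sqrtr_gt0.
have s2 : s ^+ 2 = Q / P by rewrite sqr_sqrtr // ltW.
have PQ : Num.sqrt (P * Q) = P * s.
  have -> : P * Q = (P * s) ^+ 2 by rewrite exprMn s2; field; rewrite gt_eqF.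
  by rewrite sqrtr_sqr ger0_norm // mulr_ge0 // ltW.
have QE : Q = P * s * s by rewrite -mulrA -expr2 s2; field; rewrite gt_eqF.
pose k := (Num.truncn s).+1.
have sk : s < k%:R by exact: truncnS_gt.
have ks : k%:R <= s + 1 by rewrite -natr1 lerD2r truncn_le // ltW.
have kp : 0 < k%:R :> R by rlra.
apply: (@le_trans _ _ (\sum_(1 <= i < k.+1) P + \sum_(k.+1 <= i < n.+1) Q * (i%:R ^+ 2)^-1)).
  have [nk|kn] := leqP n k.
    have nk1 : (n.+1 <= k.+1)%N by rewrite ltnS.
    rewrite [X in _ + X]big_geq ?addr0 //.
    rewrite [leRHS](big_cat_nat (n := n.+1)) //=.
    apply: le_trans (_ : \sum_(1 <= i < n.+1) P <= _).
      by apply: ler_sum => i _; rewrite ge_min lexx.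
    by rewrite lerDl; apply: sumr_ge0 => i _; exact: ltW.
  have kn1 : (k.+1 <= n.+1)%N by rewrite ltnW.
  rewrite (big_cat_nat (n := k.+1)) //=; apply: lerD.
    by apply: ler_sum => i _; rewrite ge_min lexx.
  by apply: ler_sum => i _; rewrite ge_min lexx orbT.
rewrite sumr_const_nat subn1 /= -mulr_sumr -mulr_natr.
have h := @sum_inv_sqr R k n isT.
have : Q * \sum_(k.+1 <= i < n.+1) (i%:R ^+ 2)^-1 <= P * s.
  apply: le_trans (ler_wpM2l (ltW Q0) h) _.
  rewrite ler_pdivrMr // QE; apply: ler_wpM2l; [by rewrite mulr_ge0 // ltW|exact: ltW].
rewrite PQ; rnra.
Qed.

Lemma periodic_sum_le (g : nat -> R) n d : (0 < d)%N -> (forall i, 0 <= g i) ->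
  (forall i, g (i + d)%N = g i) ->
  \sum_(i < n) g i <= (n %/ d).+1%:R * \sum_(i < d) g i.
Proof.
move=> d0 g0 gp.
have E k : \sum_(i < k * d) g i = k%:R * \sum_(i < d) g i.
  elim: k => [|k IH]; first by rewrite big_ord0 mul0r.
  rewrite mulSn -[in LHS](big_mkord xpredT g) (big_cat_nat (n := d)) //=; last by lia.
  have -> : \sum_(d <= i < d + k * d) g i = \sum_(0 <= i < k * d) g (i + d)%N.
    by rewrite -{1}[d]add0n big_addn addKn.
  rewrite !big_mkord.
  rewrite -natr1 mulrDl mul1r -IH addrC; congr (_ + _).
  by apply: eq_bigr => i _; rewrite gp.
rewrite -E.
have le : (n <= (n %/ d).+1 * d)%N by rewrite ltnW // ltn_ceil.
rewrite -(big_mkord xpredT g) -[leRHS](big_mkord xpredT g) [leRHS](big_cat_nat (n := n)) //=.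
by rewrite lerDl; apply: sumr_ge0.
Qed.

(* Term [a] of the differenced sum, bounded both trivially and by the second-difference decay. *)
Definition wterm B y (a : int) (v : R) :=
  v <= 5 * B%:R /\ v * cabs (ce (a%:~R * y) - 1) ^+ 2 <= 30 / B%:R.

(** Differencing produces only the frequencies [2 a y]. Setting [v = 0] at odd integers indexes the
    terms by all [|a| <= 8 B], so that the residues of [a b] modulo [d] are equidistributed whatever
    the parity of [d]. *)
Lemma weyl_reduce B y : (0 < B)%N -> exists v : int -> R,
  (forall a, 0 <= v a /\ wterm B y a (v a)) /\
  cabs (wsum B y) ^+ 2 <= \sum_(a <- zr (8 * B)) v a.
Proof.
move=> B0; have Bp : 0 < B%:R :> R by rewrite ltr0n.
pose v (a : int) : R := if (2 %| a)%Z then cabs (corr B (a %/ 2)%Z (a%:~R * y)) else 0.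
exists v; split.
  move=> a; rewrite /v /wterm; case: ifP => _; last by rewrite mul0r mulr_ge0 // divr_ge0.
  by rewrite cabs_ge0 corr_le // corr_decay.
apply: le_trans (wsum_sqr B y) _.
have -> : \sum_(a <- zr (4 * B)) cabs (corr B a (2 * a%:~R * y)) =
    \sum_(a <- map (fun a => 2 * a) (zr (4 * B))) v a.
  rewrite [RHS]big_map; apply: eq_bigr => a _; rewrite /v dvdz_mulr // mulKz //.
  by rewrite intrM.
have u1 : uniq (map (fun a : int => 2 * a) (zr (4 * B))).
  by rewrite map_inj_uniq ?zr_uniq // => a b; lia.
rewrite [leRHS](bigID (fun a => a \in map (fun a : int => 2 * a) (zr (4 * B)))) /=.
have -> : \sum_(i <- zr (8 * B) | i \in [seq 2 * a | a <- zr (4 * B)]) v i =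
  \sum_(a <- [seq 2 * a | a <- zr (4 * B)]) v a.
  rewrite -big_filter; apply: perm_big; apply: uniq_perm; rewrite ?filter_uniq ?zr_uniq //.
  move=> a; rewrite mem_filter; case: (boolP (a \in [seq _ | _ <- _])) => //=.
  by move=> /mapP[b]; rewrite !mem_zr => hb ->; lia.
rewrite lerDl; apply: sumr_ge0 => a _; rewrite /v; case: ifP => // _; exact: cabs_ge0.
Qed.

(** The differenced terms are split according to whether [d] divides [a]. If not, [a b / d] keeps
    away from the integers and the quadratic decay sums to [O(d)]. If [a = n d], the frequency is
    [n d be] modulo 1; the trivial bound then gives the first estimate and the decay the second. *)
Lemma weyl : exists C : R, 0 < C /\ forall B d (b : int) (be : R),
  (0 < B)%N -> (0 < d)%N -> (d <= 16 * B)%N ->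
  coprime `|b| d -> `|be| <= (16 * B%:R * d%:R)^-1 ->
  cabs (wsum B (b%:~R / d%:R + be)) ^+ 2 * d%:R <= C * B%:R ^+ 2 /\
  cabs (wsum B (b%:~R / d%:R + be)) ^+ 2 * d%:R * `|be| <= C.
Proof.
pose C1 : R := (30 * 10) * (34 * 4); exists ((30 * 10) * C1); split.
  by rewrite !mulr_gt0 // ltr0n.
move=> B d b be B0 d0 dB cbd hbe; set y := _ + be.
have Bp : 0 < B%:R :> R by rewrite ltr0n.
have dp : 0 < d%:R :> R by rewrite ltr0n.
have dBr : d%:R <= 16 * B%:R :> R by rewrite -[16]/(16%:R) -natrM ler_nat.
have B1 : 1 <= B%:R :> R by rewrite ler1n.
have [v [hv hf]] := weyl_reduce y B0.
have v0 a : 0 <= v a by case: (hv a).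
have v5 a : v a <= 5 * B%:R by case: (hv a) => _ [].
have vd a : v a * cabs (ce (a%:~R * y) - 1) ^+ 2 <= 30 / B%:R by case: (hv a) => _ [].
have abe a : (`|a| <= 8 * B)%N -> `|a%:~R * be| <= (2 * d%:R)^-1.
  move=> ha; rewrite normrM; have : `|a%:~R| <= 8 * B%:R :> R.
    by rewrite -intr_norm -abszE -pmulrn -[8]/(8%:R) -natrM ler_nat.
  move=> h; apply: le_trans (ler_pM _ _ h hbe) _ => //.
  by rewrite le_eqVlt; apply/orP; left; apply/eqP; field; rewrite !gt_eqF.
pose h (x : nat) : R := if x == 0%N then 0 else (x%:R ^+ 2)^-1 + ((d - x)%:R ^+ 2)^-1.
have h0 (x : nat) : 0 <= h x by rewrite /h; case: ifP => // _; rewrite addr_ge0 ?invr_ge0 ?sqr_ge0.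
pose res (a : int) : nat := absz ((a * b) %% d%:Z)%Z.
have resE a : (res a)%:Z = ((a * b) %% d%:Z)%Z.
  by rewrite /res gez0_abs // modz_ge0 // -lt0n.
have resd a : (res a < d)%N.
  by rewrite -ltz_nat resE ltz_pmod.
(* The distance of [a b / d] to the integers is [n / d] with [n] the smaller of [x] and [d - x]; the
   perturbation [a be] is at most [1 / (2 d)], so at least half of that distance remains. *)
have nonmult a : (`|a| <= 8 * B)%N -> res a != 0%N -> v a <= (30 * 10) * d%:R ^+ 2 / B%:R * h (res a).
  move=> ha r0; set x := res a in r0 *.
  have x0 : (0 < x)%N by rewrite lt0n.
  have xd : (x < d)%N by exact: resd.
  pose q := ((a * b) %/ d%:Z)%Z.
  have abE : a%:~R * b%:~R = q%:~R * d%:R + x%:R :> R.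
    have := congr1 (fun z : int => z%:~R : R) (divz_eq (a * b) d%:Z).
    by rewrite -resE /= intrM => ->; rewrite intrD intrM -!pmulrn.
  have hab := abe a ha.
  have fin z (k : int) (n : nat) : (0 < n)%N -> `|z| = n%:R / d%:R :> R -> n%:R / d%:R <= 1 / 2 :> R ->
      a%:~R * y = z + a%:~R * be + k%:~R -> v a <= (30 * 10) * d%:R ^+ 2 / B%:R * (n%:R ^+ 2)^-1.
    move=> n0 zE zh aE; have np : 0 < n%:R :> R by rewrite ltr0n.
    have n1 : 1 <= n%:R :> R by rewrite ler1n.
    have := vd a; rewrite aE ceDint cabs_ce_sub1; set w := z + a%:~R * be.
    have id : 0 < d%:R^-1 :> R by rewrite invr_gt0.
    have d2 : (2 * d%:R)^-1 = d%:R^-1 / 2 :> R by rewrite invfM mulrC.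
    rewrite d2 in hab.
    have hn : d%:R^-1 <= n%:R / d%:R :> R by rewrite -{1}[d%:R^-1]mul1r ler_pM2r.
    have w1 : `|w| <= 3 / 4.
      by apply: le_trans (ler_normD _ _) _; rewrite zE; rlra.
    have w2 : n%:R / d%:R / 2 <= `|w|.
      have := ler_normB w (a%:~R * be); rewrite /w addrK zE -/w; rlra.
    have s1 := abs_sin_pi_ge3 w1; set S := `|sin _| in s1 *.
    have s2 : n%:R / d%:R / 3 <= 2 * S by rlra.
    have s3 : (n%:R / d%:R / 3) ^+ 2 <= (2 * S) ^+ 2.
      by rewrite lerXn2r ?nnegrE // ?mulr_ge0 ?divr_ge0 ?invr_ge0 //; rewrite /S.
    move=> hv1; have hv2 := le_trans (ler_wpM2l (v0 a) s3) hv1.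
    have -> : (30 * 10) * d%:R ^+ 2 / B%:R * (n%:R ^+ 2)^-1 = (30 * 10 / B%:R) / (n%:R / d%:R) ^+ 2 :> R.
      by field; rewrite !gt_eqF.
    rewrite ler_pdivlMr ?exprn_gt0 ?divr_gt0 //.
    have e9 : (n%:R / d%:R / 3) ^+ 2 = (n%:R / d%:R) ^+ 2 / 9 :> R by rewrite expr_div_n; congr (_ / _); ring.
    have iB : 0 <= B%:R^-1 :> R by rewrite invr_ge0.
    rewrite e9 mulrA in hv2; rlra.
  have yE : a%:~R * y = x%:R / d%:R + a%:~R * be + q%:~R.
    rewrite /y mulrDr mulrA abE; field; by rewrite gt_eqF.
  have hx : h x = (x%:R ^+ 2)^-1 + ((d - x)%:R ^+ 2)^-1 by rewrite /h (negbTE r0).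
  have c0 : 0 <= (30 * 10) * d%:R ^+ 2 / B%:R :> R by rewrite divr_ge0 // mulr_ge0 // sqr_ge0.
  rewrite hx mulrDr.
  have [xh|xh] := leP (x%:R / d%:R) (1 / 2 : R).
    have := fin (x%:R / d%:R) q x x0; rewrite ger0_norm ?divr_ge0 // => /(_ erefl xh yE) H.
    by apply: le_trans H _; rewrite lerDl mulr_ge0 // invr_ge0 sqr_ge0.
  have dx : (d - x)%:R / d%:R = 1 - x%:R / d%:R :> R.
    by rewrite natrB 1?ltnW // mulrBl divff // gt_eqF.
  have dx0 : (0 < d - x)%N by rewrite subn_gt0.
  have := fin (- ((d - x)%:R / d%:R)) (q + 1) (d - x)%N dx0.
  rewrite normrN ger0_norm ?divr_ge0 // => /(_ erefl).
  rewrite dx => H; apply: le_trans (H _ _) _.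
  - by rlra.
  - by rewrite yE intrD; ring.
  by rewrite lerDr mulr_ge0 // invr_ge0 sqr_ge0.
have hsum : \sum_(x < d) h x <= 4.
  have d1 : (1 <= d)%N by [].
  rewrite -(big_mkord xpredT h) big_ltn // {1}/h eqxx add0r.
  have -> : \sum_(1 <= x < d) h x = \sum_(1 <= x < d) (x%:R ^+ 2)^-1 + \sum_(1 <= x < d) ((d - x)%:R ^+ 2)^-1.
    rewrite -big_split /=; apply: eq_big_nat => x /andP[x1 _].
    by rewrite /h; have -> : (x == 0)%N = false by lia.
  have -> : \sum_(1 <= x < d) ((d - x)%:R ^+ 2)^-1 = \sum_(1 <= x < d) (x%:R ^+ 2)^-1 :> R.
    rewrite [RHS]big_nat_rev /=; apply: eq_big_nat => x _.
    by congr (_ ^-1); congr (_%:R ^+ 2); lia.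
  have : \sum_(1 <= x < d) (x%:R ^+ 2)^-1 <= 2 :> R.
    case: (d) d1 => // -[_|d' _]; first by rewrite big_geq.
    by rewrite big_ltn // expr1n invr1; have := @sum_inv_sqr R 1 d'.+1 isT; rewrite invr1; rlra.
  rlra.
(* Each block of [d] consecutive [a] runs through all residues, because [b] is prime to [d], and
   contributes at most 4. *)
have resum : \sum_(a <- zr (8 * B)) h (res a) <= (34 * B%:R / d%:R) * 4.
  rewrite big_zr.
  pose g (i : nat) : R := h (res (i%:Z - (8 * B)%:Z)).
  have gp i : g (i + d)%N = g i.
    rewrite /g; congr h; rewrite /res; congr absz; rewrite PoszD addrAC mulrDl.
    have -> : (i%:Z - (8 * B)%:Z) * b + d%:Z * b = b * d%:Z + (i%:Z - (8 * B)%:Z) * b by ring.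
    by rewrite modzMDl.
  apply: le_trans (@periodic_sum_le g _ _ d0 (fun i => h0 _) gp) _.
  have bij : \sum_(i < d) g i = \sum_(x < d) h x.
    pose f (i : 'I_d) : 'I_d := Ordinal (resd (i%:Z - (8 * B)%:Z)).
    have finj : injective f.
      move=> i j /(congr1 val) /= E; apply/val_inj => /=.
      have : ((i%:Z - (8 * B)%:Z) * b = (j%:Z - (8 * B)%:Z) * b %[mod d%:Z])%Z by rewrite -!resE E.
      move/eqP; rewrite eqz_mod_dvd -mulrBl Gauss_dvdzl; last by rewrite /coprimez /gcdz /= gcdnC.
      have -> : i%:Z - (8 * B)%:Z - (j%:Z - (8 * B)%:Z) = i%:Z - j%:Z by ring.
      have := ltn_ord i; have := ltn_ord j => h1 h2 /dvdzP[k Ek].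
      have [k0|k0] := eqVneq k 0; first by move: Ek; rewrite k0 mul0r; lia.
      by exfalso; nia.
    rewrite [RHS](reindex_inj finj) /=; apply: eq_bigr => i _; by [].
  rewrite bij; apply: ler_pM => //; first by apply: sumr_ge0.
  rewrite ler_pdivlMr // -!natrM ler_nat.
  have := leq_trunc_div (8 * B).*2.+1 d; lia.
have d2 : 0 <= (30 * 10) * d%:R ^+ 2 / B%:R :> R by rewrite divr_ge0 // mulr_ge0 // sqr_ge0.
have NM : \sum_(a <- zr (8 * B) | res a != 0%N) v a <= C1 * d%:R.
  apply: (@le_trans _ _ ((30 * 10) * d%:R ^+ 2 / B%:R * \sum_(a <- zr (8 * B)) h (res a))).
    rewrite mulr_sumr big_mkcond; rewrite !big_seq; apply: ler_sum => a; rewrite mem_zr => ha.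
    by case: ifP => [r0|_]; [exact: nonmult|rewrite mulr_ge0].
  apply: le_trans (ler_wpM2l d2 resum) _.
  by rewrite /C1 le_eqVlt; apply/orP; left; apply/eqP; field; rewrite !gt_eqF.
have multE a : (res a == 0%N) -> exists n : int, a = n * d%:Z.
  move=> /eqP r0; have : (d%:Z %| a * b)%Z by apply/dvdz_mod0P; rewrite -(resE a) r0.
  rewrite Gauss_dvdzl; last by rewrite /coprimez /gcdz /= gcdnC.
  by move=> /dvdzP.
pose K := (8 * B %/ d)%N.
have Kd : (K * d <= 8 * B)%N by exact: leq_trunc_div.
have ME : \sum_(a <- zr (8 * B) | ~~ (res a != 0%N)) v a = \sum_(n <- zr K) v (n * d%:Z).
  have -> : \sum_(n <- zr K) v (n * d%:Z) = \sum_(a <- map (fun n : int => n * d%:Z) (zr K)) v a.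
    by rewrite [RHS]big_map.
  rewrite -big_filter; apply: perm_big; apply: uniq_perm.
  - by rewrite filter_uniq // zr_uniq.
  - rewrite map_inj_uniq ?zr_uniq // => n1 n2; move/eqP.
    by rewrite (inj_eq (mulIf _)) ?eqz_nat -?lt0n // => /eqP.
  move=> a; rewrite mem_filter negbK mem_zr; apply/idP/mapP.
    move=> /andP[/multE[n ->] ha]; exists n => //; rewrite mem_zr /K leq_divRL //.
    by move: ha; rewrite abszM.
  move=> [n]; rewrite mem_zr => hn ->; apply/andP; split.
    by rewrite /res mulrAC modzMl.
  by rewrite abszM /=; apply: leq_trans Kd; rewrite leq_mul2r hn orbT.
have split_le : cabs (wsum B y) ^+ 2 <= C1 * d%:R + \sum_(n <- zr K) v (n * d%:Z).
  apply: le_trans hf _; rewrite (bigID (fun a => res a != 0%N)) /= ME; exact: lerD.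
have C1p : 0 < C1 by rewrite !mulr_gt0.
have C1b : 1 <= C1 by rewrite /C1; rlra.
split.
  have T1 : \sum_(n <- zr K) v (n * d%:Z) * d%:R <= 160 * B%:R ^+ 2.
    apply: (@le_trans _ _ (\sum_(n <- zr K) (5 * B%:R * d%:R))).
      by apply: ler_sum => n _; apply: ler_wpM2r.
    rewrite big_const_seq count_predT size_zr iter_addr_0 -[leLHS]mulr_natl.
    have kd : K.*2.+1%:R * d%:R <= 32 * B%:R :> R.
      have KR : K%:R * d%:R <= 8 * B%:R :> R by rewrite -!natrM ler_nat.
      have -> : K.*2.+1%:R * d%:R = 2 * (K%:R * d%:R) + d%:R :> R.
        by rewrite -addn1 -muln2 natrD natrM; ring.
      move: (K%:R * d%:R) KR dBr => u; rlra.
    have -> : K.*2.+1%:R * (5 * B%:R * d%:R) = 5 * B%:R * (K.*2.+1%:R * d%:R) :> R by ring.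
    have -> : 160 * B%:R ^+ 2 = 5 * B%:R * (32 * B%:R) :> R by ring.
    by apply: ler_wpM2l => //; rewrite mulr_ge0.
  rewrite -mulr_suml in T1.
  apply: le_trans (ler_wpM2r (ltW dp) split_le) _; rewrite mulrDl.
  have dd : C1 * d%:R * d%:R <= C1 * (256 * B%:R ^+ 2).
    rewrite -mulrA; apply: ler_wpM2l; first exact: ltW.
    have -> : 256 * B%:R ^+ 2 = (16 * B%:R) * (16 * B%:R) :> R by ring.
    by apply: ler_pM.
  have : 160 * B%:R ^+ 2 <= 44 * C1 * B%:R ^+ 2.
    by apply: ler_wpM2r; [exact: sqr_ge0|rewrite /C1; rlra].
  rlra.
have [->|be0] := eqVneq be 0; first by rewrite normr0 mulr0 mulr_ge0 // ltW.
have nb : 0 < `|be| by rewrite normr_gt0.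
(* The term of index [n d] is at most [min P (Q / n^2)]; the factor [B] cancels in [sqrt (P Q)],
   which is of order [1 / (d |be|)]. *)
pose Q : R := 30 / (4 * B%:R * (d%:R * `|be|) ^+ 2).
have db : 0 < d%:R * `|be| by rewrite mulr_gt0.
have db2 : 0 < (d%:R * `|be|) ^+ 2 by rewrite exprn_gt0.
have Q0 : 0 < Q by rewrite divr_gt0 // mulr_gt0 // mulr_gt0.
pose P : R := 5 * B%:R; have P0 : 0 < P by rewrite mulr_gt0.
have vn (n : int) : (`|n| <= K)%N -> v (n * d%:Z) <=
    (fun i : nat => if i == 0%N then P else Num.min P (Q / i%:R ^+ 2)) `|n|%N.
  move=> hn /=; case: ifP => [_|/negbT n0]; first exact: v5.
  rewrite le_min v5 /=.
  have ip : 0 < `|n|%N%:R :> R by rewrite ltr0n lt0n.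
  have nd : (absz (n * d%:Z)%R <= 8 * B)%N.
    by rewrite abszM /=; apply: leq_trans Kd; rewrite leq_mul2r hn orbT.
  have := abe _ nd; set z := _ * be => hz.
  have zE : (n * d%:Z)%:~R * y = z + (n * b)%:~R.
    rewrite /z /y mulrDr !intrM -pmulrn addrC; congr (_ + _); field; by rewrite gt_eqF.
  have := vd (n * d%:Z); rewrite zE ceDint cabs_ce_sub1.
  have zh : `|z| <= 1 / 2.
    apply: le_trans hz _; rewrite -[1 / 2]/(1 * 2^-1) mul1r lef_pV2 ?posrE ?mulr_gt0 //.
    by rewrite -[leLHS]mulr1 ler_pM2l // ler1n.
  have s1 := abs_sin_pi_ge zh.
  have zn : `|z| = `|n|%N%:R * (d%:R * `|be|).
    rewrite /z normrM intrM normrM -!pmulrn (@ger0_norm _ d%:R) // mulrA.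
    by rewrite -intr_norm -abszE -pmulrn.
  move=> hv1.
  have : v (n * d%:Z) * (2 * `|z|) ^+ 2 <= 30 / B%:R.
    apply: le_trans hv1; apply: ler_wpM2l => //.
    by rewrite lerXn2r ?nnegrE ?mulr_ge0 //; rlra.
  rewrite zn => hv2; rewrite /Q.
  have -> : 30 / (4 * B%:R * (d%:R * `|be|) ^+ 2) / `|n|%N%:R ^+ 2 =
    30 / B%:R / (2 * (`|n|%N%:R * (d%:R * `|be|))) ^+ 2.
    by field; rewrite !gt_eqF.
  by rewrite ler_pdivlMr // exprn_gt0 // mulr_gt0 // mulr_gt0.
have T2 : \sum_(n <- zr K) v (n * d%:Z) <= P + 2 * (P + 2 * Num.sqrt (P * Q)).
  apply: (@le_trans _ _ (\sum_(n <- zr K)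
     (fun i : nat => if i == 0%N then P else Num.min P (Q / i%:R ^+ 2)) `|n|%N)).
    by rewrite !big_seq; apply: ler_sum => n; rewrite mem_zr; exact: vn.
  rewrite (@zr_sum_abs _ K (fun i : nat => if i == 0%N then P else Num.min P (Q / i%:R ^+ 2))) eqxx lerD2l -[leLHS]mulr_natl; apply: ler_wpM2l => //.
  apply: le_trans (sum_min_inv_sqr K P0 Q0).
  rewrite le_eqVlt; apply/orP; left; apply/eqP; apply: eq_big_nat => i /andP[i1 _].
  by rewrite gtn_eqF.
have sq : Num.sqrt (P * Q) <= 7 / (d%:R * `|be|).
  have h7 : 0 <= 7 / (d%:R * `|be|) by rewrite divr_ge0 // ltW.
  rewrite -(ger0_norm h7) -sqrtr_sqr ler_sqrt ?sqr_ge0 // expr_div_n.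
  have -> : P * Q = (75 / 2) / (d%:R * `|be|) ^+ 2.
    by rewrite /P /Q; field; rewrite !gt_eqF.
  by apply: ler_wpM2r; [rewrite invr_ge0 sqr_ge0|rlra].
have key1 : 16 * B%:R * (d%:R * `|be|) <= 1.
  rewrite mulrA; have := hbe; rewrite -[X in _ <= X]mul1r ler_pdivlMr ?mulr_gt0 //.
  by rewrite mulrC.
rewrite -mulrA; apply: le_trans (ler_wpM2r (ltW db) split_le) _.
have e1 : 7 / (d%:R * `|be|) * (d%:R * `|be|) = 7 by rewrite divfK // gt_eqF.
set S := \sum_(n <- zr K) _ in T2 *.
have hS : S * (d%:R * `|be|) <= 3 * (5 * (B%:R * (d%:R * `|be|))) + 28.
  apply: le_trans (ler_wpM2r (ltW db) T2) _.
  have : Num.sqrt (P * Q) * (d%:R * `|be|) <= 7 by rewrite -e1; apply: ler_wpM2r; [exact: ltW|].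
  rewrite /P; rnra.
have h2 : d%:R * (d%:R * `|be|) <= 1.
  by apply: le_trans key1; apply: ler_wpM2r; [exact: ltW|].
have h3 : C1 * d%:R * (d%:R * `|be|) <= C1.
  by rewrite -mulrA -[leRHS]mulr1; apply: ler_wpM2l; [exact: ltW|].
rewrite mulrDl; rlra.
Qed.

End weyl_bound.

(** * Gauss sums *)

Section gauss_sums.
Context (R : realType).
Implicit Types (B n m d q : nat) (x y t : R).

(** The quadratic Gauss sum as a mean value, which is the factor by which a theta sum shrinks near
    [b / d]. *)
Definition gsum d (b : int) : R[i] := (d%:R^-1)%:C%C * \sum_(r < d) ce (b%:~R * r%:R ^+ 2 / d%:R).

Lemma sum_ce_full d (k : int) : (0 < d)%N ->
  \sum_(s < d) ce (k%:~R * s%:R / d%:R) = (if (d%:Z %| k)%Z then d%:R else 0 : R)%:C%C.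
Proof.
move=> d0; have dn : d%:R != 0 :> R by rewrite pnatr_eq0 -lt0n.
case: ifP => [/dvdzP[m ->]|ndk].
  rewrite (eq_bigr (fun=> 1)); last first.
    move=> s _; have -> : (m * d%:Z)%:~R * s%:R / d%:R = (m * s%:Z)%:~R :> R.
      by rewrite !intrM -!pmulrn; field.
    exact: ce_int.
  by rewrite sumr_const card_ord rmorph_nat.
pose z := ce (k%:~R / d%:R : R).
have E : \sum_(s < d) ce (k%:~R * s%:R / d%:R) = \sum_(s < d) z ^+ s.
  by apply: eq_bigr => s _; rewrite /z ceX; congr ce; ring.
have zd : z ^+ d = 1 by rewrite /z ceX mulrC divfK // ce_int.
have z1 : z - 1 != 0.
  apply/negP => /eqP z1; have := cabs_ce_sub1 (k%:~R / d%:R : R); rewrite -/z z1 cabs0.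
  pose r := (k %% d%:Z)%Z; pose m := (k %/ d%:Z)%Z.
  have kE : k%:~R / d%:R = r%:~R / d%:R + m%:~R :> R.
    rewrite {1}(divz_eq k d%:Z) -/r -/m intrD intrM -pmulrn; field; exact: dn.
  have r0 : r != 0 by apply/negP => /eqP r0; move: ndk; rewrite (_ : (d%:Z %| k)%Z) //; apply/dvdz_mod0P.
  have rge : (0 <= r)%R by apply: modz_ge0; rewrite -lt0n.
  have rlt : (r < d%:Z)%R by apply: ltz_pmod.
  have pi0 := pi_gt0 R.
  move/esym/eqP; rewrite mulf_eq0 pnatr_eq0 /= normr_eq0.
  have := congr1 (@complex.Re R) z1; rewrite /z kE ceDint /= => c1 _.
  have h1 : (0 < r%:~R / d%:R :> R) && (r%:~R / d%:R < 1 :> R).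
    have rp : 0 < r by rewrite lt_neqAle rge eq_sym r0.
    rewrite divr_gt0 ?ltr0n ?ltr0z //=.
    by rewrite ltr_pdivrMr ?ltr0n // mul1r pmulrn ltr_int.
  have := cos_half (2 * pi * (r%:~R / d%:R) : R).
  have -> : 2 * pi * (r%:~R / d%:R) / 2 = pi * (r%:~R / d%:R) :> R by field.
  have : 0 < sin (pi * (r%:~R / d%:R) : R).
    apply: sin_gt0_pi; rewrite mulr_gt0 ?(andP h1).1 //=.
    by rewrite -[ltRHS]mulr1 ltr_pM2l // (andP h1).2.
  set s := sin _ => s0.
  have -> : cos (2 * pi * (r%:~R / d%:R)) = 1 :> R by rlra.
  rewrite subrr => /esym/eqP; rewrite mulf_eq0 sqrf_eq0 pnatr_eq0 /= gt_eqF //.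
apply: (mulfI z1); rewrite E mulrC; rewrite mulrC -subrX1 zd subrr.
by rewrite mulr0.
Qed.

Lemma modn_ce d (b : int) (r : nat) : (0 < d)%N ->
  ce (b%:~R * (r %% d)%:R ^+ 2 / d%:R) = ce (b%:~R * r%:R ^+ 2 / d%:R : R).
Proof.
move=> d0; have dn : d%:R != 0 :> R by rewrite pnatr_eq0 -lt0n.
pose u := (r %/ d)%N; pose v := (r %% d)%N.
have rE : r%:R = u%:R * d%:R + v%:R :> R by rewrite {1}(divn_eq r d) natrD natrM.
have -> : b%:~R * r%:R ^+ 2 / d%:R = b%:~R * v%:R ^+ 2 / d%:R
   + (b * (u%:Z * (u%:Z * d%:Z) + 2%N%:Z * (u%:Z * v%:Z)))%:~R :> R.
  rewrite rE !(intrM, intrD) -!pmulrn; field; exact: dn.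
by rewrite ceDint.
Qed.

(** Replacing one variable by [a + s], the dependence on [s] is the character of frequency
    [2 a b / d], whose full sum vanishes unless [d] divides [2 a]. *)
Lemma gsum_sqr d (b : int) : (0 < d)%N -> coprime `|b| d ->
  (cabs (gsum d b) ^+ 2)%:C%C =
  (d%:R^-1)%:C%C * \sum_(a < d | (d %| 2 * a)%N) ce (b%:~R * a%:R ^+ 2 / d%:R).
Proof.
move=> d0 cbd; have dn : d%:R != 0 :> R by rewrite pnatr_eq0 -lt0n.
rewrite /gsum cabsM cabs_real ger0_norm ?invr_ge0 // exprMn rmorphM /=.
rewrite cabs_sqrE.
have -> : (\sum_(r < d) ce (b%:~R * r%:R ^+ 2 / d%:R)) * (\sum_(r < d) ce (b%:~R * r%:R ^+ 2 / d%:R))^*%C =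
   d%:R%:C%C * \sum_(a < d | (d %| 2 * a)%N) ce (b%:~R * a%:R ^+ 2 / d%:R : R).
  rewrite mulrC rmorph_sum mulr_suml.
  transitivity (\sum_(s < d) \sum_(a < d) ce (b%:~R * a%:R ^+ 2 / d%:R) *
      ce ((b * (2 * a%:Z))%:~R * s%:R / d%:R : R)).
    apply: eq_bigr => s _.
    have -> : (complex_conjc__canonical__GRing_RMorphism R (ce (b%:~R * s%:R ^+ 2 / d%:R)) : R[i]) =
       ce (- (b%:~R * s%:R ^+ 2 / d%:R)) by rewrite ceN.
    pose f (a : 'I_d) : 'I_d := Ordinal (ltn_pmod (a + s) d0).
    have finj : injective f.
      move=> a1 a2 /(congr1 val) /= /eqP; rewrite eqn_modDr => /eqP.
      by rewrite !modn_small // => h; apply: val_inj.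
    rewrite (reindex_inj finj) mulr_sumr; apply: eq_bigr => a _.
    rewrite /= modn_ce // -!ceD; congr ce; rewrite natrD !intrM -!pmulrn; field; exact: dn.
  rewrite exchange_big /= mulr_sumr [RHS]big_mkcond /=; apply: eq_bigr => a _.
  rewrite -mulr_sumr sum_ce_full // mulrC.
  have -> : (d%:Z %| b * (2 * a%:Z))%Z = (d %| 2 * a)%N.
    rewrite Gauss_dvdzr; last by rewrite /coprimez /gcdz /= gcdnC; exact: cbd.
    by rewrite /dvdz -PoszM.
  by case: ifP => //; rewrite mul0r.
rewrite mulrA -rmorphM; congr (_ %:C%C * _).
by rewrite expr2 -mulrA mulVf ?mulr1.
Qed.

(** In [gsum_sqr] only [a = 0] remains for odd [d]. For even [d] also [a = d/2] occurs, with the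
    value [e(b d / 4)]: it is at most 1 in modulus, and it is -1 when [d] is 2 modulo 4, where the
    two terms cancel. *)
Lemma gsum_le d (b : int) : (0 < d)%N -> coprime `|b| d ->
  cabs (gsum d b) ^+ 2 <= (if odd d then 1 else if (4 %| d)%N then 2 else 0) / d%:R.
Proof.
move=> d0 cbd; have dp : 0 < d%:R :> R by rewrite ltr0n.
have := congr1 (@complex.Re R) (gsum_sqr d0 cbd); rewrite ReZ [complex.Re _]/= => ->.
rewrite mulrC; apply: ler_wpM2r; first by rewrite invr_ge0 ltW.
rewrite (bigD1 (Ordinal d0)) /=; last by rewrite muln0 dvdn0.
rewrite expr0n /= mulr0 mul0r ce0.
case: ifP => od.
  rewrite big1 ?addr0 // => a /andP[da a0]; exfalso.
  have : (d %| a)%N by move: da; rewrite Gauss_dvdr // coprimen2.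
  move=> /dvdnP[k E]; have := ltn_ord a; move: a0; rewrite -val_eqE /= E.
  by case: k {E} => [|k]; rewrite ?mul0n ?eqxx // mulSn; lia.
have d2 : (d./2 < d)%N by lia.
have d2E : (2 * d./2 = d)%N by lia.
rewrite (bigD1 (Ordinal d2)) /=; last first.
  by rewrite d2E dvdnn /= -val_eqE /=; lia.
rewrite [X in _ + (_ + X)]big1 ?addr0; last first.
  move=> a /andP[/andP[/dvdnP[k E] a0] a1]; exfalso; have := ltn_ord a.
  move: a0 a1; rewrite -!val_eqE /= => a0 a1 al.
  have [k0|k0] : (k = 0 \/ k = 1)%N by nia.
    by move: E; rewrite k0 mul0n; lia.
  by move: E; rewrite k0 mul1n; lia.
rewrite ReD; case: ifP => d4.
  by rewrite [complex.Re 1]/= [complex.Re (ce _)]/=; set u := (X in cos X); have := cos_le1 u; rlra.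
rewrite [complex.Re 1]/= [complex.Re (ce _)]/=.
pose e := (d./2)./2; have dE : (d = 4 * e + 2)%N by rewrite /e; lia.
have ob : odd `|b|.
  apply/negPn/negP => eb; move: cbd; rewrite /coprime => /eqP g1.
  have : (2 %| gcdn `|b| d)%N by rewrite dvdn_gcd !dvdn2 eb od.
  by rewrite g1.
pose f := `|b|./2; have bE : `|b|%N = (2 * f + 1)%N by rewrite /f; lia.
have hd : (d./2 = 2 * e + 1)%N by lia.
have [s [sE bs]] : exists s : R, (s = 1 \/ s = -1) /\ b%:~R = s * `|b|%N%:R.
  case: (b) => m; [exists 1|exists (-1)]; split; [by left| |by right|].
    by rewrite mul1r -pmulrn.
  by rewrite NegzE mulrNz mulN1r -pmulrn.
have key : cos (2 * pi * (`|b|%N%:R * d./2%:R ^+ 2 / d%:R)) = -1 :> R.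
  have -> : 2 * pi * (`|b|%N%:R * d./2%:R ^+ 2 / d%:R) =
     2 * pi * ((2 * (e * f) + e + f)%N%:R) + pi :> R.
    rewrite hd dE bE !natrD !natrM; field.
    by rewrite gt_eqF //; have : 0 <= e%:R :> R by []; move: (e%:R) => u u0; rlra.
  rewrite cosDpi; have /(congr1 (@complex.Re R)) /= -> := ce_nat R (2 * (e * f) + e + f)%N.
  by [].
have -> : cos (2 * pi * (b%:~R * d./2%:R ^+ 2 / d%:R)) = -1 :> R.
  rewrite bs; case: sE => ->; first by rewrite mul1r.
  by rewrite mulN1r !mulNr mulrN cosN.
by rewrite subrr.
Qed.

Definition peak_mass d : R := if odd d then (d%:R ^+ 2)^-1 else if (4 %| d)%N then 4 * (d%:R ^+ 2)^-1 else 0.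

(** Each squared modulus is at most 1, so [q] may be lowered to 3. There are at most [d] numerators
    for odd [d], and at most [d / 2] for even [d] since they are odd. *)
Lemma gsum_pow_sum q d : (3 <= q)%N -> (2 <= d)%N ->
  \sum_(b < d | coprime b d) cabs (gsum d b%:Z) ^+ (2 * q) <= peak_mass d.
Proof.
move=> q3 d2; have d0 : (0 < d)%N by lia.
have dp : 0 < d%:R :> R by rewrite ltr0n.
have d1 : 2 <= d%:R :> R by rewrite ler_nat.
have pw (b : 'I_d) : coprime b d -> cabs (gsum d b%:Z) ^+ (2 * q) <=
   ((if odd d then 1 else if (4 %| d)%N then 2 else 0) / d%:R) ^+ 3.
  move=> cb; have h := @gsum_le d b%:Z d0 cb; rewrite exprM.
  set z := cabs _ ^+ 2 in h *; have z0 : 0 <= z by exact: exprn_ge0 (cabs_ge0 _).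
  have z1 : z <= 1.
    apply: le_trans h _; rewrite ler_pdivrMr // mul1r; case: odd; first rlra.
    by case: (4 %| d)%N; rlra.
  apply: (@le_trans _ _ (z ^+ 3)); last by rewrite lerXn2r ?nnegrE // (le_trans z0 h).
  have -> : z ^+ q = z ^+ (q - 3) * z ^+ 3 by rewrite -exprD subnK.
  by apply: ler_piMl; [exact: exprn_ge0|exact: exprn_ile1].
apply: le_trans (ler_sum _ (fun b cb => pw b cb)) _.
rewrite sumr_const -[leLHS]mulr_natl /peak_mass.
case: (boolP (odd d)) => od.
  apply: (@le_trans _ _ (d%:R * (1 / d%:R) ^+ 3)).
    apply: ler_wpM2r; first by rewrite exprn_ge0 // divr_ge0.
    by rewrite ler_nat; apply: leq_trans (max_card _) _; rewrite card_ord.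
  by rewrite le_eqVlt; apply/orP; left; apply/eqP; field; rewrite gt_eqF.
case: ifP => d4; last by rewrite mul0r expr0n mulr0.
have cnt : (#|[pred b : 'I_d | coprime b d]| <= d./2)%N.
  have od2 : forall b : 'I_d, coprime b d -> odd b.
    move=> b cb; apply/negPn/negP => eb; move: cb; rewrite /coprime => /eqP g1.
    have : (2 %| gcdn b d)%N by rewrite dvdn_gcd !dvdn2 eb od.
    by rewrite g1.
  pose hf (b : 'I_d) : nat := b./2.
  have : (size (map hf (enum [pred b : 'I_d | coprime b d])) <= size (iota 0 d./2))%N.
    apply: uniq_leq_size.
      rewrite map_inj_in_uniq ?enum_uniq // => b c; rewrite !mem_enum !inE => cb cc E.
      have := od2 b cb; have := od2 c cc => oc ob; apply: val_inj => /=.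
      by rewrite -(odd_double_half b) -(odd_double_half c) ob oc; move: E; rewrite /hf => ->.
    move=> k /mapP[b _ ->]; rewrite mem_iota /hf /=; have := ltn_ord b; lia.
  by rewrite size_map size_iota -cardE.
apply: (@le_trans _ _ ((d%:R / 2) * (2 / d%:R) ^+ 3)).
  apply: ler_wpM2r; first by rewrite exprn_ge0 // divr_ge0.
  by rewrite ler_pdivlMr // -natrM ler_nat; apply: (@leq_trans (d./2 * 2)); [rewrite leq_mul2r; exact: cnt|lia].
by rewrite le_eqVlt; apply/orP; left; apply/eqP; field; rewrite gt_eqF.
Qed.

(** What matters is that the total stays clearly below 99/100. *)
Lemma peak_mass_sum D : \sum_(2 <= d < D) peak_mass d <= 7 / 10.
Proof.
have m0 d : 0 <= peak_mass d.
  rewrite /peak_mass; case: odd; first by rewrite invr_ge0 sqr_ge0.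
  by case: ifP => // _; rewrite mulr_ge0 // invr_ge0 sqr_ge0.
(* A block of four denominators starting at [4 X] has mass at most [(1/4 + 1/16 + 1/16) / X^2], and
   [1 / X^2 <= 1 / (X - 1/2) - 1 / (X + 1/2)] telescopes. *)
have U n : \sum_(2 <= d < 4 * n.+2) peak_mass d <= 7 / 10 - (3 / 8) / (n.+1%:R + 1 / 2).
  elim: n => [|n IH].
    rewrite unlock /= /peak_mass /= !addr0 !add0r.
    rewrite -[3 / 8 / _]/((3 / 8) / (1 + 1 / 2)).
    have -> : (3 / 8) / (1 + 1 / 2) = 1 / 4 :> R by field.
    have -> : (3%:R ^+ 2)^-1 = 1 / 9 :> R by field.
    have -> : 4 * (4%:R ^+ 2)^-1 = 1 / 4 :> R by field.
    have -> : (5%:R ^+ 2)^-1 = 1 / 25 :> R by field.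
    have -> : (7%:R ^+ 2)^-1 = 1 / 49 :> R by field.
    rlra.
  have -> : (4 * n.+3 = (4 * n.+2).+4)%N by lia.
  rewrite (@big_nat_recr _ _ _ (4 * n.+2).+3) ?(@big_nat_recr _ _ _ (4 * n.+2).+2) ?(@big_nat_recr _ _ _ (4 * n.+2).+1) ?(@big_nat_recr _ _ _ (4 * n.+2)) /=; [|lia..].
  have o0 : peak_mass (4 * n.+2) = 4 * ((4 * n.+2)%:R ^+ 2)^-1.
    rewrite /peak_mass; have -> : odd (4 * n.+2) = false by lia.
    by rewrite dvdn_mulr.
  have o1 : peak_mass (4 * n.+2).+1 = ((4 * n.+2).+1%:R ^+ 2)^-1.
    by rewrite /peak_mass; have -> : odd (4 * n.+2).+1 by lia.
  have o2 : peak_mass (4 * n.+2).+2 = 0.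
    rewrite /peak_mass; have -> : odd (4 * n.+2).+2 = false by lia.
    by have -> : (4 %| (4 * n.+2).+2)%N = false by lia.
  have o3 : peak_mass (4 * n.+2).+3 = ((4 * n.+2).+3%:R ^+ 2)^-1.
    by rewrite /peak_mass; have -> : odd (4 * n.+2).+3 by lia.
  rewrite o0 o1 o2 o3 addr0.
  have x0 : 2 <= n.+2%:R :> R by rewrite ler_nat.
  have i1 : ((4 * n.+2).+1%:R ^+ 2)^-1 <= (1 / 16) * (n.+2%:R ^+ 2)^-1 :> R.
    have -> : (1 / 16) * (n.+2%:R ^+ 2)^-1 = ((4 * n.+2)%:R ^+ 2)^-1 :> R.
      by rewrite natrM; field; rewrite gt_eqF //; rlra.
    by rewrite lef_pV2 ?posrE ?exprn_gt0 ?ltr0n // lerXn2r ?nnegrE // ler_nat.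
  have i3 : ((4 * n.+2).+3%:R ^+ 2)^-1 <= (1 / 16) * (n.+2%:R ^+ 2)^-1 :> R.
    have -> : (1 / 16) * (n.+2%:R ^+ 2)^-1 = ((4 * n.+2)%:R ^+ 2)^-1 :> R.
      by rewrite natrM; field; rewrite gt_eqF //; rlra.
    by rewrite lef_pV2 ?posrE ?exprn_gt0 ?ltr0n // lerXn2r ?nnegrE // ler_nat; lia.
  have i0 : 4 * ((4 * n.+2)%:R ^+ 2)^-1 = (1 / 4) * (n.+2%:R ^+ 2)^-1 :> R.
    by rewrite natrM; field; rewrite gt_eqF //; rlra.
  have n1 : n.+1%:R = n.+2%:R - 1 :> R by rewrite -[n.+2%:R]natr1 addrK.
  rewrite n1 in IH; rewrite i0; move: IH i1 i3 x0; set X := n.+2%:R => IH i1 i3 x0.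
  have key : (3 / 8) * (X ^+ 2)^-1 <= (3 / 8) / (X - 1 + 1 / 2) - (3 / 8) / (X + 1 / 2).
    have -> : (3 / 8) / (X - 1 + 1 / 2) - (3 / 8) / (X + 1 / 2) = (3 / 8) * (X ^+ 2 - 1 / 4)^-1.
      by field; rewrite !gt_eqF //; rnra.
    rewrite ler_pM2l; last rlra.
    by rewrite lef_pV2 ?posrE; rnra.
  set P := \sum_(_ <= _ < _) _ in IH *.
  move: key IH i1 i3; set a := (X ^+ 2)^-1; set b := (3 / 8) / _; set c := (3 / 8) / _.
  move: a b c => a b c; move: ((_.+1)%:R ^- 2) ((_.+3)%:R ^- 2) => e f; rlra.
have := U D; have : \sum_(2 <= d < D) peak_mass d <= \sum_(2 <= d < 4 * D.+2) peak_mass d.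
  have [D2|D2] := leqP D 2; first by rewrite big_geq // sumr_ge0.
  by rewrite [leRHS](big_cat_nat (n := D)) //=; [rewrite lerDl sumr_ge0|lia|lia].
have : 0 <= (3 / 8) / (D.+1%:R + 1 / 2) :> R.
  by apply: divr_ge0; [rlra|have : 0 <= D.+1%:R :> R by []; rlra].
set a := (3 / 8) / _; rlra.
Qed.

End gauss_sums.

Ltac pos :=
  lazymatch goal with
  | |- is_true (0 <= _ + _) => first [assumption | refine (addr_ge0 _ _); pos]
  | |- is_true (0 <= _ * _) => first [assumption | refine (mulr_ge0 _ _); pos]
  | |- is_true (0 <= _ ^+ _) => first [assumption | exact: sqr_ge0 | refine (exprn_ge0 _ _); pos]
  | |- is_true (0 <= _ ^-1) => first [assumption | rewrite invr_ge0; pos]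
  | |- is_true (0 <= `|_|) => exact: normr_ge0
  | |- is_true (0 <= Num.sqrt _) => exact: sqrtr_ge0
  | |- is_true (0 <= _%:R) => exact: ler0n
  | |- is_true (0 < _ + _) => first [assumption | refine (addr_gt0 _ _); pos]
  | |- is_true (0 < _ * _) => first [assumption | refine (mulr_gt0 _ _); pos]
  | |- is_true (0 < _ ^+ _) => first [assumption | refine (exprn_gt0 _ _); pos]
  | |- is_true (0 < _ ^-1) => first [assumption | rewrite invr_gt0; pos]
  | |- is_true (0 < _%:R) => first [exact: ltr0Sn | assumption | by rewrite ltr0n]
  | |- is_true (0 <= _) => first [assumption | exact: ltW | by [] | rlra]
  | |- _ => first [assumption | by [] | rlra]
  end.

(** * The difference functional *)

Section differences.
Context (R : realType).
Implicit Types (c h e x y t : R) (f g : R -> R).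

Definition D2 f c h : R := f (c + h) - 2 * f c + f (c - h).
Definition D4 f c h : R := f (c + 2 * h) - 4 * f (c + h) + 6 * f c - 4 * f (c - h) + f (c - 2 * h).
Definition Lop e f c h : R := D4 f c h - e * D2 f c h.

Lemma D4_D2 f c h : D4 f c h = D2 (fun x => D2 f x h) c h.
Proof.
rewrite /D2 /D4 addrK subrK.
have -> : c + h + h = c + 2 * h by ring.
have -> : c - h - h = c - 2 * h by ring.
ring.
Qed.

Lemma der_shift f c x (a : R) : is_derive (x + c) 1 f a -> is_derive x 1 (fun y : R => f (y + c)) a.
Proof.
move=> hf; have A : is_derive x 1 (fun s : R => s + c) 1.
  by apply: der_eq (derD (der_id _) (der_cst _ _)) _; rewrite addr0.
by apply: der_eq (@der_comp R f (fun s : R => s + c) x a 1 hf A) _; rewrite mulr1.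
Qed.

Lemma der_reflect f c x (a : R) : is_derive (c - x) 1 f a -> is_derive x 1 (fun y : R => f (c - y)) (- a).
Proof.
move=> hf; have A : is_derive x 1 (fun s : R => c - s) (-1).
  by apply: der_eq (derD (der_cst _ _) (derN (der_id _))) _; rewrite add0r.
by apply: der_eq (@der_comp R f (fun s : R => c - s) x a (-1) hf A) _; rewrite mulrN1.
Qed.

Lemma D2_ge0 f f1 f2 c h : 0 <= h ->
  (forall x, c - h <= x <= c + h -> is_derive x 1 f (f1 x)) ->
  (forall x, c - h <= x <= c + h -> is_derive x 1 f1 (f2 x)) ->
  (forall x, c - h <= x <= c + h -> 0 <= f2 x) -> 0 <= D2 f c h.
Proof.
move=> h0 d1 d2 p2.
have : (fun s => f (c + s) + f (c - s)) 0 <= (fun s => f (c + s) + f (c - s)) h.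
  apply: (@derive_le _ (fun s => f (c + s) + f (c - s)) (fun s => f1 (c + s) - f1 (c - s)) 0 h) => // s /andP[s0 sh].
    apply: derD; last by apply: der_reflect; apply: d1; apply/andP; split; rlra.
    have -> : (fun t => f (c + t)) = (fun t => f (t + c)) by apply/funext => t; rewrite addrC.
    by rewrite addrC; apply: der_shift; apply: d1; apply/andP; split; rlra.
  rewrite subr_ge0; apply: (@derive_le _ _ f2) => [|x /andP[x1 x2]|x /andP[x1 x2]]; first by rlra.
  - by apply: d2; apply/andP; split; rlra.
  - by apply: p2; apply/andP; split; rlra.
rewrite /= /D2 addr0 subr0; rlra.
Qed.

Lemma derD2 f f1 x h : is_derive (x + h) 1 f (f1 (x + h)) -> is_derive x 1 f (f1 x) ->
  is_derive (x - h) 1 f (f1 (x - h)) -> is_derive x 1 (fun y => D2 f y h) (D2 f1 x h).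
Proof.
move=> a1 a2 a3; rewrite /D2.
have B1 := der_shift a1; have B3 := der_shift a3.
apply: der_eq (derD (derD B1 (derN (derM (der_cst 2 _) a2))) B3) _.
ring.
Qed.

Lemma D4_ge0 f f1 f2 f3 f4 c h : 0 <= h ->
  (forall x, c - 2 * h <= x <= c + 2 * h -> is_derive x 1 f (f1 x)) ->
  (forall x, c - 2 * h <= x <= c + 2 * h -> is_derive x 1 f1 (f2 x)) ->
  (forall x, c - 2 * h <= x <= c + 2 * h -> is_derive x 1 f2 (f3 x)) ->
  (forall x, c - 2 * h <= x <= c + 2 * h -> is_derive x 1 f3 (f4 x)) ->
  (forall x, c - 2 * h <= x <= c + 2 * h -> 0 <= f4 x) -> 0 <= D4 f c h.
Proof.
move=> h0 d1 d2 d3 d4 p4; rewrite D4_D2.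
apply: (@D2_ge0 _ (fun x => D2 f1 x h) (fun x => D2 f2 x h)) => // x /andP[x1 x2].
- by apply: derD2; apply: d1; apply/andP; split; rlra.
- by apply: derD2; apply: d2; apply/andP; split; rlra.
apply: (@D2_ge0 _ f3 f4) => // y /andP[y1 y2]; [apply: d3|apply: d4|apply: p4];
  by apply/andP; split; rlra.
Qed.

Lemma der_pow n x : is_derive x 1 (fun t : R => t ^+ n) (n%:R * x ^+ n.-1).
Proof.
case: n => [|n]; first by apply: der_eq (der_cst 1 x) _; rewrite mul0r.
by apply: der_eq (derX _ (der_id _)) _; rewrite mulr1.
Qed.

Definition eps p c h : R := D4 (fun x => x ^+ p) c h / D2 (fun x => x ^+ p) c h.

(** On the range of the differences the variable stays between [c / 2] and [2 c]; hence [D4] of the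
    power is at most of order [c^m h^4] and [D2] at least of order [c^(m+2) h^2], and the correction
    is a small multiple of the second difference. *)
Lemma epsP m : exists C : R, 0 < C /\ forall c h, 4 <= c -> 0 < h <= 1 ->
  [/\ 0 <= eps m.+4 c h, eps m.+4 c h <= C * h ^+ 2 / c ^+ 2 & Lop (eps m.+4 c h) (fun x => x ^+ m.+4) c h = 0].
Proof.
pose a2 : R := m.+4%:R * m.+3%:R; pose A : R := a2 * (m.+2%:R * m.+1%:R).
have a20 : 0 < a2 by rewrite mulr_gt0.
have A0 : 0 < A by rewrite !mulr_gt0.
exists (A * 2 ^+ m / (a2 * 2^-1 ^+ m.+2)); split.
  by rewrite divr_gt0 // mulr_gt0 // exprn_gt0 // invr_gt0.
move=> c h c4 /andP[h0 h1].
have c0 : 0 < c by rlra.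
have dk k (b : R) x : is_derive x 1 (fun t : R => b * t ^+ k) (b * (k%:R * x ^+ k.-1)).
  by apply: der_eq (derM (der_cst _ _) (der_pow _ _)) _; rewrite mulr0 addr0.
have dk2 k (b b' : R) x : is_derive x 1 (fun t : R => b * (b' * t ^+ k)) (b * (b' * (k%:R * x ^+ k.-1))).
  by apply: der_eq (derM (der_cst _ _) (dk _ _ _)) _; rewrite mulr0 addr0.
have dk3 k (b b' b'' : R) x : is_derive x 1 (fun t : R => b * (b' * (b'' * t ^+ k))) (b * (b' * (b'' * (k%:R * x ^+ k.-1)))).
  by apply: der_eq (derM (der_cst _ _) (dk2 _ _ _ _)) _; rewrite mulr0 addr0.
have P4 : 0 <= D4 (fun x => x ^+ m.+4) c h.
  apply: (@D4_ge0 _ (fun x => m.+4%:R * x ^+ m.+3) (fun x => m.+4%:R * (m.+3%:R * x ^+ m.+2))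
     (fun x => m.+4%:R * (m.+3%:R * (m.+2%:R * x ^+ m.+1)))
     (fun x => m.+4%:R * (m.+3%:R * (m.+2%:R * (m.+1%:R * x ^+ m)))) _ _ (ltW h0) (fun x _ => der_pow _ _)
     (fun x _ => dk _ _ _) (fun x _ => dk2 _ _ _ _) (fun x _ => dk3 _ _ _ _ _)) => x /andP[x1 _].
  by rewrite !mulr_ge0 // exprn_ge0 //; rlra.
have U4 : D4 (fun x => x ^+ m.+4) c h <= A * 2 ^+ m * c ^+ m * h ^+ 4.
  (* A bound for the fourth derivative; the comparison function [M / 24 * x^4] has fourth difference
     exactly [M h^4]. *)
  pose M := A * (2 * c) ^+ m.
  have : 0 <= D4 (fun x => M / 24 * x ^+ 4 - x ^+ m.+4) c h.
    pose g1 (x : R) : R := M / 24 * (4 * x ^+ 3) - m.+4%:R * x ^+ m.+3.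
    pose g2 (x : R) : R := M / 24 * (4 * (3 * x ^+ 2)) - m.+4%:R * (m.+3%:R * x ^+ m.+2).
    pose g3 (x : R) : R := M / 24 * (4 * (3 * (2 * x ^+ 1))) - m.+4%:R * (m.+3%:R * (m.+2%:R * x ^+ m.+1)).
    pose g4 (x : R) : R := M / 24 * (4 * (3 * (2 * (1 * x ^+ 0)))) - m.+4%:R * (m.+3%:R * (m.+2%:R * (m.+1%:R * x ^+ m))).
    have d1 x : is_derive x 1 (fun x => M / 24 * x ^+ 4 - x ^+ m.+4) (g1 x) := derD (dk _ _ _) (derN (der_pow _ _)).
    have d2 x : is_derive x 1 g1 (g2 x) := derD (dk2 _ _ _ _) (derN (dk _ _ _)).
    have d3 x : is_derive x 1 g2 (g3 x) := derD (dk3 _ _ _ _ _) (derN (dk2 _ _ _ _)).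
    have d4 x : is_derive x 1 g3 (g4 x).
      apply: der_eq (derD (derM (der_cst (M / 24) x) (dk3 1%N 4 3 2 x)) (derN (dk3 m.+1 _ _ _ x))) _.
      by rewrite /g4 mulr0 addr0.
    apply: (@D4_ge0 _ g1 g2 g3 g4 _ _ (ltW h0) (fun x _ => d1 x) (fun x _ => d2 x) (fun x _ => d3 x) (fun x _ => d4 x)) => x /andP[x1 x2].
    rewrite /g4 subr_ge0.
    have -> : M / 24 * (4 * (3 * (2 * (1 * x ^+ 0)))) = M by rewrite expr0; field.
    have -> : m.+4%:R * (m.+3%:R * (m.+2%:R * (m.+1%:R * x ^+ m))) = A * x ^+ m by rewrite /A /a2 !mulrA.
    by rewrite /M ler_pM2l // lerXn2r ?nnegrE //; rlra.
  have -> : D4 (fun x => M / 24 * x ^+ 4 - x ^+ m.+4) c h = M * h ^+ 4 - D4 (fun x => x ^+ m.+4) c h.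
    by rewrite /D4; field.
  by rewrite subr_ge0 /M exprMn !mulrA.
have L2 : a2 * 2^-1 ^+ m.+2 * c ^+ m.+2 * h ^+ 2 <= D2 (fun x => x ^+ m.+4) c h.
  pose M := a2 * (2^-1 * c) ^+ m.+2.
  have : 0 <= D2 (fun x => x ^+ m.+4 - M / 2 * x ^+ 2) c h.
    pose g1 (x : R) : R := m.+4%:R * x ^+ m.+3 - M / 2 * (2 * x ^+ 1).
    pose g2 (x : R) : R := m.+4%:R * (m.+3%:R * x ^+ m.+2) - M / 2 * (2 * (1 * x ^+ 0)).
    have d1 x : is_derive x 1 (fun x => x ^+ m.+4 - M / 2 * x ^+ 2) (g1 x) := derD (der_pow _ _) (derN (dk _ _ _)).
    have d2 x : is_derive x 1 g1 (g2 x) := derD (dk _ _ _) (derN (dk2 _ _ _ _)).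
    apply: (@D2_ge0 _ g1 g2 _ _ (ltW h0) (fun x _ => d1 x) (fun x _ => d2 x)) => x /andP[x1 x2].
    rewrite /g2 subr_ge0.
    have -> : M / 2 * (2 * (1 * x ^+ 0)) = M by rewrite expr0; field.
    by rewrite mulrA -/a2 /M ler_pM2l // lerXn2r ?nnegrE //; rlra.
  have -> : D2 (fun x => x ^+ m.+4 - M / 2 * x ^+ 2) c h = D2 (fun x => x ^+ m.+4) c h - M * h ^+ 2.
    by rewrite /D2; field.
  by rewrite subr_ge0 /M exprMn !mulrA.
have L20 : 0 < a2 * 2^-1 ^+ m.+2 * c ^+ m.+2 * h ^+ 2.
  by pos.
have D20 := lt_le_trans L20 L2.
split.
- by rewrite /eps divr_ge0 // ltW.
- rewrite /eps ler_pdivrMr //; apply: le_trans U4 _.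
  have -> : A * 2 ^+ m * c ^+ m * h ^+ 4 = A * 2 ^+ m / (a2 * 2^-1 ^+ m.+2) * h ^+ 2 / c ^+ 2 *
     (a2 * 2^-1 ^+ m.+2 * c ^+ m.+2 * h ^+ 2).
    have -> : c ^+ m.+2 = c ^+ m * c ^+ 2 by rewrite -exprD addn2.
    have : 2^-1 ^+ m.+2 != 0 :> R by rewrite expf_neq0 // invr_eq0.
    move: (2^-1 ^+ m.+2) (2 ^+ m) => u v u0; field; rewrite gt_eqF //= u0 /=; rewrite gt_eqF //.
  apply: ler_wpM2l => //.
  by pos.
- by rewrite /Lop /eps divfK ?subrr // gt_eqF.
Qed.

(** The primitive [F] comes from repeated integration by parts. The cube vanishes to third order at
    both ends, so the boundary terms start with [c^3 / (2 pi t)^4]. *)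
Lemma I3E c t : t != 0 -> I3 c t = 2 *
  (48 * c ^+ 3 * cos (2 * pi * t * c) / (2 * pi * t) ^+ 4 - (12 * 24) * c ^+ 2 * sin (2 * pi * t * c) / (2 * pi * t) ^+ 5
   - (12 * 60) * c * cos (2 * pi * t * c) / (2 * pi * t) ^+ 6 + (12 * 60) * sin (2 * pi * t * c) / (2 * pi * t) ^+ 7).
Proof.
move=> t0; rewrite /I3; pose T := 2 * pi * t; have T0 : T != 0.
  by rewrite !mulf_neq0 ?pnatr_eq0 // gt_eqF // pi_gt0.
pose F (u : R) : R := ((c ^+ 2 - u ^+ 2) ^+ 3 * T^-1 - (24 * u ^+ 2 * (c ^+ 2 - u ^+ 2) - 6 * (c ^+ 2 - u ^+ 2) ^+ 2) * T^-1 ^+ 3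
    + (72 * c ^+ 2 - (12 * 30) * u ^+ 2) * T^-1 ^+ 5 + (12 * 60) * T^-1 ^+ 7) * sin (T * u)
  + (- 6 * u * (c ^+ 2 - u ^+ 2) ^+ 2 * T^-1 ^+ 2 - (72 * u * (c ^+ 2 - u ^+ 2) - 48 * u ^+ 3) * T^-1 ^+ 4
    - (12 * 60) * u * T^-1 ^+ 6) * cos (T * u).
have H (u : R) : is_derive u 1 F ((c ^+ 2 - u ^+ 2) ^+ 3 * cos (2 * pi * (t * u))).
  have -> : 2 * pi * (t * u) = T * u by rewrite /T; ring.
  by apply: der_eq; rewrite /GRing.scale /=; field.
rewrite (Int_eq _ _ H) /F mulrN sinN cosN -/T; field.
exact: T0.
Qed.

Lemma Int_Lop e (F : R -> R -> R) c h a b : (forall x, continuous (F x)) ->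
  Lop e (fun x => Int (F x) a b) c h = Int (fun u => Lop e (fun x => F x u) c h) a b.
Proof.
move=> cF; have A x u := antiderivativeP (cF x) u.
have H (u : R) : is_derive u 1 (fun u => Lop e (fun x => antiderivative (F x) u) c h) (Lop e (fun x => F x u) c h).
  rewrite /Lop /D4 /D2; apply: der_eq.
  by rewrite /GRing.scale /=; ring.
rewrite (Int_eq _ _ H) /Lop /D4 /D2 /Int; ring.
Qed.

Lemma Lop_bound e f c h M : 0 <= h -> 0 <= e ->
  (forall x, c - 2 * h <= x <= c + 2 * h -> `|f x| <= M) -> `|Lop e f c h| <= (16 + 4 * e) * M.
Proof.
move=> h0 e0 hf; rewrite /Lop /D4 /D2.
have f1 := hf (c + 2 * h); have f2 := hf (c + h); have f3 := hf c; have f4 := hf (c - h); have f5 := hf (c - 2 * h).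
have {f1}/ler_normlP[a1 b1] : `|f (c + 2 * h)| <= M by apply: f1; apply/andP; split; rlra.
have {f2}/ler_normlP[a2 b2] : `|f (c + h)| <= M by apply: f2; apply/andP; split; rlra.
have {f3}/ler_normlP[a3 b3] : `|f c| <= M by apply: f3; apply/andP; split; rlra.
have {f4}/ler_normlP[a4 b4] : `|f (c - h)| <= M by apply: f4; apply/andP; split; rlra.
have {f5}/ler_normlP[a5 b5] : `|f (c - 2 * h)| <= M by apply: f5; apply/andP; split; rlra.
move: (f _) (f _) (f _) (f _) (f _) a1 b1 a2 b2 a3 b3 a4 b4 a5 b5 => x1 x2 x3 x4 x5 *.
apply/ler_normlP; split; rnra.
Qed.

Definition Uker e c h t : R := Lop e (fun x => I3 x t) c h.

(** Needed for small [t], where [I3E] is singular. On [|u| <= c - 2 h], common to all five shifts,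
    the difference acts on a polynomial and is [O(c^2 h^4)] pointwise; the remaining edges have
    length [O(h)] and an integrand [O((c h)^3)]. *)
Lemma Uker_small (C : R) : 0 < C -> exists C' : R, 0 < C' /\ forall e c h t, 4 <= c -> 0 < h <= 1 ->
  0 <= e <= C * h ^+ 2 / c ^+ 2 -> `|Uker e c h t| <= C' * c ^+ 3 * h ^+ 4.
Proof.
move=> C0; exists (2 ^+ 20 * (1 + C)); split; first by rewrite mulr_gt0 ?exprn_gt0 //; rlra.
move=> e c h t c4 /andP[h0 h1] /andP[e0 eC].
have c0 : 0 < c by rlra.
have c20 : 0 < c ^+ 2 by rewrite exprn_gt0.
have ec : e * c ^+ 2 <= C * h ^+ 2 by rewrite -ler_pdivlMr.
pose F (x u : R) := (x ^+ 2 - u ^+ 2) ^+ 3 * cos (2 * pi * (t * u)).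
have cF x : continuous (F x) by rewrite /F; cont.
pose a := c - 2 * h.
have a0 : 0 < a by rewrite /a; rlra.
have edge x : a <= x <= c + 2 * h -> `|I3 x t - Int (F x) (- a) a| <= 2 ^+ 15 * c ^+ 3 * h ^+ 4.
  move=> /andP[ax xc]; rewrite /I3 -/(F x).
  have -> : Int (F x) (- x) x - Int (F x) (- a) a = Int (F x) (- x) (- a) + Int (F x) a x.
    by rewrite -(Int_chasles _ (- x) (- a) x) -(Int_chasles _ (- a) a x); ring.
  have pt u : a <= `|u| <= x -> `|F x u| <= (8 * h * c * 2) ^+ 3.
    move=> /andP[u1 u2]; rewrite /F normrM -[leRHS]mulr1; apply: ler_pM => //.
      rewrite normrX lerXn2r ?nnegrE //; first by rewrite !mulr_ge0 //; rlra.
      have -> : x ^+ 2 - u ^+ 2 = (x - `|u|) * (x + `|u|) by rewrite -[u ^+ 2]real_normK ?num_real //; ring.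
      rewrite ger0_norm ?mulr_ge0 ?subr_ge0 //; last by rlra.
      have -> : 8 * h * c * 2 = (4 * h) * (4 * c) by ring.
      apply: ler_pM; rewrite ?subr_ge0 //; rewrite /a in u1 ax *; rlra.
    by rewrite ler_norml cos_geN1 cos_le1.
  have b1 : `|Int (F x) (- x) (- a)| <= (8 * h * c * 2) ^+ 3 * (- a - - x).
    apply: Int_abs => //; first rlra.
    by move=> u /andP[u1 u2]; apply: pt; rewrite ler0_norm; [apply/andP; split|]; rlra.
  have b2 : `|Int (F x) a x| <= (8 * h * c * 2) ^+ 3 * (x - a).
    apply: Int_abs => //.
    by move=> u /andP[u1 u2]; apply: pt; rewrite ger0_norm; [apply/andP; split|]; rlra.
  apply: le_trans (ler_normD _ _) _; apply: le_trans (lerD b1 b2) _.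
  have xa : x - a <= 4 * h by rewrite /a; rlra.
  have -> : (8 * h * c * 2) ^+ 3 * (- a - - x) + (8 * h * c * 2) ^+ 3 * (x - a) =
    (2 ^+ 13 * c ^+ 3 * h ^+ 3) * (x - a) by ring.
  apply: le_trans (ler_wpM2l _ xa) _; first by rewrite !mulr_ge0 ?exprn_ge0 //; rlra.
  by rewrite le_eqVlt; apply/orP; left; apply/eqP; ring.
have e1 : e <= C.
  apply: le_trans eC _; rewrite ler_pdivrMr // ler_pM2l //; rnra.
pose X := c ^+ 3 * h ^+ 4.
have X0 : 0 <= X by rewrite mulr_ge0 // exprn_ge0 //; rlra.
have dec : Uker e c h t = Lop e (fun x => I3 x t - Int (F x) (- a) a) c h
    + Int (fun u => Lop e (fun x => F x u) c h) (- a) a.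
  by rewrite -Int_Lop // /Uker /Lop /D4 /D2; ring.
have b1 : `|Lop e (fun x => I3 x t - Int (F x) (- a) a) c h| <= (16 + 4 * e) * (2 ^+ 15 * c ^+ 3 * h ^+ 4).
  by apply: Lop_bound (ltW h0) e0 _ => x; exact: edge.
have b2 : `|Int (fun u => Lop e (fun x => F x u) c h) (- a) a| <=
    (((5 * 100) + 80 * C) * (c ^+ 2 * h ^+ 4)) * (a - - a).
  apply: Int_abs; [by rewrite /Lop /D4 /D2; cont; exact: cF|rlra|].
  move=> u /andP[u1 u2].
  have u20 : 0 <= u ^+ 2 by exact: sqr_ge0.
  have uc : u ^+ 2 <= c ^+ 2.
    by rewrite /a in u1 u2; rnra.
  have h20 : 0 <= h ^+ 2 by exact: sqr_ge0.
  have h2c : h ^+ 2 <= c ^+ 2 by rnra.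
  have -> : Lop e (fun x => F x u) c h = Lop e (fun x => (x ^+ 2 - u ^+ 2) ^+ 3) c h * cos (2 * pi * (t * u)).
    by rewrite /F /Lop /D4 /D2; ring.
  rewrite normrM -[leRHS]mulr1; apply: ler_pM => //; last by rewrite ler_norml cos_geN1 cos_le1.
  have -> : Lop e (fun x => (x ^+ 2 - u ^+ 2) ^+ 3) c h =
     h ^+ 4 * ((12 * 30) * c ^+ 2 + 120 * h ^+ 2 - 72 * u ^+ 2) -
     e * (h ^+ 2 * (30 * c ^+ 4 + 30 * c ^+ 2 * h ^+ 2 + 2 * h ^+ 4 - 36 * c ^+ 2 * u ^+ 2 - 6 * h ^+ 2 * u ^+ 2 + 6 * u ^+ 4)).
    by rewrite /Lop /D4 /D2; ring.
  apply: le_trans (ler_normB _ _) _; rewrite [leRHS]mulrDl; apply: lerD.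
    rewrite normrM ger0_norm ?exprn_ge0 ?(ltW h0) //.
    have -> : 5 * 100 * (c ^+ 2 * h ^+ 4) = h ^+ 4 * (5 * 100 * c ^+ 2) by ring.
    apply: ler_wpM2l; first by rewrite exprn_ge0 // ltW.
    by rewrite ler_norml; apply/andP; split; rnra.
  rewrite normrM ger0_norm // normrM (ger0_norm h20).
  set P := (X in `|X|); have hP : `|P| <= 80 * c ^+ 4.
    have -> : 80 * c ^+ 4 = 80 * (c ^+ 2) ^+ 2 by ring.
    have -> : P = 30 * (c ^+ 2) ^+ 2 + 30 * c ^+ 2 * h ^+ 2 + 2 * (h ^+ 2) ^+ 2 - 36 * c ^+ 2 * u ^+ 2 - 6 * h ^+ 2 * u ^+ 2 + 6 * (u ^+ 2) ^+ 2.
      by rewrite /P; ring.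
    move: (c ^+ 2) (h ^+ 2) (u ^+ 2) h2c uc u20 h20 => x y z yx zx z0 y0.
    by rewrite ler_norml; apply/andP; split; rnra.
  apply: le_trans (ler_wpM2l e0 (ler_wpM2l h20 hP)) _.
  have -> : e * (h ^+ 2 * (80 * c ^+ 4)) = (e * c ^+ 2) * (80 * c ^+ 2 * h ^+ 2) by ring.
  have -> : 80 * C * (c ^+ 2 * h ^+ 4) = (C * h ^+ 2) * (80 * c ^+ 2 * h ^+ 2) by ring.
  by apply: ler_wpM2r => //; rewrite !mulr_ge0 // ltW.
rewrite dec; apply: le_trans (ler_normD _ _) _; apply: le_trans (lerD b1 b2) _.
have -> : (16 + 4 * e) * (2 ^+ 15 * c ^+ 3 * h ^+ 4) = (16 + 4 * e) * 2 ^+ 15 * X by rewrite /X; ring.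
have aa : a - - a <= 2 * c by rewrite /a; rlra.
have : ((5 * 100) + 80 * C) * (c ^+ 2 * h ^+ 4) * (a - - a) <= ((5 * 100) + 80 * C) * 2 * X.
  apply: le_trans (ler_wpM2l _ aa) _; first by rewrite mulr_ge0 ?mulr_ge0 ?exprn_ge0 //; rlra.
  by rewrite le_eqVlt; apply/orP; left; apply/eqP; rewrite /X; ring.
have : (16 + 4 * e) * 2 ^+ 15 * X <= (16 + 4 * C) * 2 ^+ 15 * X.
  by apply: ler_wpM2r => //; apply: ler_wpM2r; [exact: exprn_ge0|rlra].
have : ((5 * 100) + 80 * C) * 2 * X <= 2 ^+ 15 * (1 + C) * X.
  apply: ler_wpM2r => //; have : 2 ^+ 10 <= 2 ^+ 15 :> R by rewrite ler_eXn2l //; rlra.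
  have -> : 2 ^+ 10 = 32 * 32 :> R by ring.
  move: (2 ^+ 15) => v; rnra.
have -> : 2 ^+ 20 * (1 + C) * c ^+ 3 * h ^+ 4 = 32 * (2 ^+ 15 * (1 + C) * X) by rewrite /X; ring.
have : (16 + 4 * C) * 2 ^+ 15 * X <= 16 * (2 ^+ 15 * (1 + C) * X).
  have -> : 16 * (2 ^+ 15 * (1 + C) * X) = (16 + 16 * C) * 2 ^+ 15 * X by ring.
  by apply: ler_wpM2r => //; apply: ler_wpM2r; [exact: exprn_ge0|rlra].
have : 0 <= 2 ^+ 15 * (1 + C) * X by rewrite mulr_ge0 // mulr_ge0 ?exprn_ge0 //; rlra.
move: (2 ^+ 15 * (1 + C) * X) ((16 + 4 * C) * 2 ^+ 15 * X) => ? ?; rlra.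
Qed.

(** By [D4_cos], the amplitude of the fourth difference of the leading term
    [96 c^3 cos (2 pi t c) / (2 pi t)^4] of [I3E]. *)
Definition wker c h t : R := 96 * c ^+ 3 * (sin (pi * t * h) / (pi * t)) ^+ 4.

Lemma D4_cos (T c h : R) : D4 (fun x => cos (T * x)) c h = 16 * sin (T * h / 2) ^+ 4 * cos (T * c).
Proof.
rewrite /D4 !mulrDr !mulrN.
have -> : T * (2 * h) = T * h + T * h by ring.
rewrite !cosD !sinN !cosN !cosD !sinD.
have h1 := cos_half (T * h); have h2 := cos2Dsin2 (T * h).
have -> : 16 * sin (T * h / 2) ^+ 4 = 4 * (1 - cos (T * h)) ^+ 2 by rewrite h1; ring.
have -> : sin (T * h) * sin (T * h) = 1 - cos (T * h) ^+ 2 by rewrite -h2; ring.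
ring.
Qed.

(** One power of [c] is gained: the later terms of [I3E] carry at most [c^2], freezing [x^3] at
    [c^3] costs [O(c^2)], and the second difference comes with [e = O(c^-2)]. The factor [1 + t^-3]
    absorbs the inverse powers of [t] up to the seventh. *)
Lemma Uker_asym (C : R) : 0 < C -> exists C' : R, 0 < C' /\ forall e c h t, 4 <= c -> 0 < h <= 1 ->
  0 <= e <= C * h ^+ 2 / c ^+ 2 -> 0 < t ->
  `|Uker e c h t - wker c h t * cos (2 * pi * t * c)| <= C' * c ^+ 2 * (t^-1 ^+ 4 * (1 + t^-1 ^+ 3)).
Proof.
move=> C0; exists ((200 * 100) * (16 + 4 * C)); split; first by rewrite mulr_gt0 //; rlra.
move=> e c h t c4 /andP[h0 h1] /andP[e0 eC] t0.
have c0 : 0 < c by rlra.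
have c20 : 0 < c ^+ 2 by rewrite exprn_gt0.
have e1 : e <= C by apply: le_trans eC _; rewrite ler_pdivrMr // ler_pM2l //; rnra.
have pi1 := pi_ge2 R.
pose T := 2 * pi * t; pose ta := T^-1; pose s := t^-1.
have tT : t <= T by rewrite /T; rnra.
have T0 : 0 < T by rlra.
have s0 : 0 < s by rewrite invr_gt0.
have ta0 : 0 < ta by rewrite invr_gt0.
have tas : ta <= s by rewrite /ta /s lef_pV2 ?posrE.
have ep k : ta ^+ k <= s ^+ k by rewrite lerXn2r ?nnegrE // ltW.
pose Z := s ^+ 4 * (1 + s ^+ 3).
have s40 : 0 <= s ^+ 4 by rewrite exprn_ge0 // ltW.
have Z4 : ta ^+ 4 <= Z by apply: le_trans (ep _) _; rewrite /Z -[leLHS]mulr1 ler_wpM2l // lerDl exprn_ge0 // ltW.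
have Z5 : ta ^+ 5 <= Z.
  apply: le_trans (ep _) _; rewrite /Z [s ^+ 5]exprSr ler_wpM2l //.
  have : s ^+ 3 = s * s * s by ring.
  by move=> ->; case: (leP s 1) => hs; rnra.
have Z6 : ta ^+ 6 <= Z.
  apply: le_trans (ep _) _; have -> : s ^+ 6 = s ^+ 4 * s ^+ 2 by rewrite -exprD.
  rewrite /Z ler_wpM2l //; have -> : s ^+ 3 = s ^+ 2 * s by ring.
  by case: (leP s 1) => hs; rnra.
have Z7 : ta ^+ 7 <= Z.
  apply: le_trans (ep _) _; have -> : s ^+ 7 = s ^+ 4 * s ^+ 3 by rewrite -exprD.
  by rewrite /Z ler_wpM2l // lerDr.
have Z0 : 0 <= Z by apply: le_trans Z4; rewrite exprn_ge0 // ltW.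
pose rest x : R := 2 * (- ((12 * 24) * x ^+ 2 * sin (T * x) * ta ^+ 5) - (12 * 60) * x * cos (T * x) * ta ^+ 6
   + (12 * 60) * sin (T * x) * ta ^+ 7).
have IE x : I3 x t = 96 * ta ^+ 4 * (c ^+ 3 * cos (T * x) + (x ^+ 3 - c ^+ 3) * cos (T * x)) + rest x.
  by rewrite I3E ?gt_eqF // -/T /rest /ta !exprVn; ring.
have restb x : c - 2 * h <= x <= c + 2 * h -> `|rest x| <= (80 * 100) * (c ^+ 2 * Z).
  move=> /andP[x1 x2]; have x0 : 0 <= x by rlra.
  have xc : x <= (3 / 2) * c by rlra.
  have x2c : x ^+ 2 <= (9 / 4) * c ^+ 2 by rnra.
  have xc2 : x <= c ^+ 2 by rnra.
  have c21 : 1 <= c ^+ 2 by rnra.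
  have sb : `|sin (T * x)| <= 1 by rewrite ler_norml sin_geN1 sin_le1.
  have cb : `|cos (T * x)| <= 1 by rewrite ler_norml cos_geN1 cos_le1.
  have g (k y z w : R) : 0 <= k -> 0 <= y -> y <= (9 / 4) * c ^+ 2 -> `|z| <= 1 -> 0 <= w -> w <= Z ->
     `|k * y * z * w| <= (9 / 4) * k * (c ^+ 2 * Z).
    move=> k0 y0 yc z1 w0 wZ; rewrite !normrM (ger0_norm k0) (ger0_norm y0) (ger0_norm w0).
    have -> : 9 / 4 * k * (c ^+ 2 * Z) = k * (9 / 4 * c ^+ 2) * 1 * Z by ring.
    apply: ler_pM => //; first by rewrite !mulr_ge0.
    apply: ler_pM => //; first by rewrite !mulr_ge0.
    by rewrite ler_wpM2l.
  have tp k : 0 <= ta ^+ k by rewrite exprn_ge0 // ltW.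
  have kp : 0 <= 12 * 24 :> R by rlra.
  have kp2 : 0 <= 12 * 60 :> R by rlra.
  have xq : x <= (9 / 4) * c ^+ 2 by rlra.
  have oq : 1 <= (9 / 4) * c ^+ 2 by rlra.
  have g1 := g (12 * 24) (x ^+ 2) (sin (T * x)) (ta ^+ 5) kp (sqr_ge0 _) x2c sb (tp _) Z5.
  have g2 := g (12 * 60) x (cos (T * x)) (ta ^+ 6) kp2 x0 xq cb (tp _) Z6.
  have g3 := g (12 * 60) 1 (sin (T * x)) (ta ^+ 7) kp2 ler01 oq sb (tp _) Z7.
  rewrite mulr1 in g3; rewrite /rest normrM (ger0_norm (ler0n _ 2)).
  have := ler_normD (- ((12 * 24) * x ^+ 2 * sin (T * x) * ta ^+ 5) - (12 * 60) * x * cos (T * x) * ta ^+ 6) ((12 * 60) * sin (T * x) * ta ^+ 7).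
  have := ler_normB (- ((12 * 24) * x ^+ 2 * sin (T * x) * ta ^+ 5)) ((12 * 60) * x * cos (T * x) * ta ^+ 6).
  rewrite normrN; have : 0 <= c ^+ 2 * Z by rewrite mulr_ge0 // ltW.
  move: g1 g2 g3; set A := `|_|; set B := `|_|; set D := `|_|; set E := `|_|; set F := `|_|.
  move: A B D E F (c ^+ 2 * Z) => A B D E F G; rlra.
have dec : Uker e c h t - wker c h t * cos (T * c) =
   - (96 * ta ^+ 4 * c ^+ 3 * (e * D2 (fun x => cos (T * x)) c h))
   + 96 * ta ^+ 4 * Lop e (fun x => (x ^+ 3 - c ^+ 3) * cos (T * x)) c h + Lop e rest c h.
  have -> : wker c h t = 96 * ta ^+ 4 * c ^+ 3 * (16 * sin (T * h / 2) ^+ 4).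
    have -> : T * h / 2 = pi * t * h by rewrite /T; field.
    rewrite /wker /ta /T; field; rewrite !gt_eqF //; rlra.
  rewrite -[_ * cos (T * c)]mulrA -D4_cos /Uker /Lop /D4 /D2 !IE; ring.
have b1 : `|96 * ta ^+ 4 * c ^+ 3 * (e * D2 (fun x => cos (T * x)) c h)| <= (4 * 100) * C * (c ^+ 2 * Z).
  have d2 : `|D2 (fun x => cos (T * x)) c h| <= 4.
    rewrite /D2 ler_norml; have := cos_geN1 (T * (c + h)); have := cos_le1 (T * (c + h)).
    have := cos_geN1 (T * c); have := cos_le1 (T * c); have := cos_geN1 (T * (c - h)); have := cos_le1 (T * (c - h)).
    by move=> *; apply/andP; split; rlra.
  have ec : e * c ^+ 2 <= C.
    by apply: (@le_trans _ _ (C * h ^+ 2)); [rewrite -ler_pdivlMr|rewrite -[leRHS]mulr1 ler_wpM2l ?(ltW C0) //; rnra].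
  have -> : `|96 * ta ^+ 4 * c ^+ 3 * (e * D2 (fun x => cos (T * x)) c h)| =
     96 * ((e * c ^+ 2) * (c * (ta ^+ 4 * `|D2 (fun x => cos (T * x)) c h|))).
    have -> : 96 * ta ^+ 4 * c ^+ 3 * (e * D2 (fun x => cos (T * x)) c h) =
      (96 * ta ^+ 4 * c ^+ 3 * e) * D2 (fun x => cos (T * x)) c h by ring.
    rewrite normrM (@ger0_norm _ (96 * ta ^+ 4 * c ^+ 3 * e)).
      by move: `|D2 _ _ _| => ?; ring.
    by pos.
  have -> : (4 * 100) * C * (c ^+ 2 * Z) = 100 * (C * (c ^+ 2 * (Z * 4))) by ring.
  have tp : 0 <= ta ^+ 4 by rewrite exprn_ge0 // ltW.
  apply: ler_pM => //; first by rewrite !mulr_ge0 // ltW.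
    by rewrite ler_nat.
  apply: ler_pM => //; [by rewrite mulr_ge0 // ltW|by rewrite !mulr_ge0 // ltW|].
  apply: ler_pM => //; [exact: ltW|by rewrite mulr_ge0|rnra|].
  by apply: ler_pM.
have b2 : `|96 * ta ^+ 4 * Lop e (fun x => (x ^+ 3 - c ^+ 3) * cos (T * x)) c h| <= 100 * (16 + 4 * C) * 20 * (c ^+ 2 * Z).
  have : `|Lop e (fun x => (x ^+ 3 - c ^+ 3) * cos (T * x)) c h| <= (16 + 4 * e) * (20 * c ^+ 2).
    apply: Lop_bound (ltW h0) e0 _ => x /andP[x1 x2]; rewrite normrM -[leRHS]mulr1; apply: ler_pM => //.
      have -> : x ^+ 3 - c ^+ 3 = (x - c) * (x ^+ 2 + x * c + c ^+ 2) by ring.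
      rewrite normrM; have -> : 20 * c ^+ 2 = 2 * (10 * c ^+ 2) by ring.
      apply: ler_pM => //; first by rewrite ler_norml; apply/andP; split; rlra.
      by rewrite ger0_norm; rnra.
    by rewrite ler_norml cos_geN1 cos_le1.
  move=> hb; rewrite normrM (@ger0_norm _ (96 * ta ^+ 4)); last by pos.
  have -> : 100 * (16 + 4 * C) * 20 * (c ^+ 2 * Z) = 100 * Z * ((16 + 4 * C) * (20 * c ^+ 2)) by ring.
  have tp : 0 <= ta ^+ 4 by rewrite exprn_ge0 // ltW.
  apply: ler_pM => //; first by rewrite mulr_ge0.
    by apply: ler_pM => //; rewrite ler_nat.
  by apply: le_trans hb _; apply: ler_wpM2r; [rewrite mulr_ge0 // ltW|rlra].
have b3 : `|Lop e rest c h| <= (16 + 4 * C) * (80 * 100 * (c ^+ 2 * Z)).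
  apply: (@le_trans _ _ ((16 + 4 * e) * (80 * 100 * (c ^+ 2 * Z)))).
    by apply: Lop_bound (ltW h0) e0 _ => x /restb.
  by apply: ler_wpM2r; [pos|rlra].
have -> : 2 * pi * t * c = T * c by [].
rewrite dec; apply: le_trans (ler_normD _ _) _; apply: le_trans (lerD (ler_normD _ _) (lexx _)) _.
rewrite normrN; apply: le_trans (lerD (lerD b1 b2) b3) _.
have : 0 <= c ^+ 2 * Z by rewrite mulr_ge0 // ltW.
have -> : 200 * 100 * (16 + 4 * C) * c ^+ 2 * (t^-1 ^+ 4 * (1 + t^-1 ^+ 3)) = (200 * 100) * (16 + 4 * C) * (c ^+ 2 * Z) by rewrite /Z /s; ring.
move: (c ^+ 2 * Z) => G G0.
rewrite !mulrA -!mulrDl; apply: ler_wpM2r => //; rlra.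
Qed.

End differences.

(** * Total variation of the radial kernel *)

Section radial_variation.
Context (R : realType).
Implicit Types (c h e x y X : R).

(** The profile of [Gdisc] as a function of the radius [X]; again [Num.sqrt] supplies the positive
    part. *)
Definition Grad c X : R := Num.sqrt (c ^+ 2 - X ^+ 2) ^+ 5.
Definition Kker e c h X : R := Lop e (fun z => Grad z X) c h.

Lemma Grad_le c x y : 0 <= x -> x <= y -> Grad c y <= Grad c x.
Proof.
move=> x0 xy; rewrite /Grad lerXn2r ?nnegrE ?sqrtr_ge0 //; apply: ler_wsqrtr.
by rewrite lerD2l lerN2 lerXn2r ?nnegrE //; rlra.
Qed.

Lemma Grad_ge0 c x : 0 <= Grad c x. Proof. by rewrite /Grad; pos. Qed.

Lemma Grad_eq0 c x : 0 <= c -> c <= x -> Grad c x = 0.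
Proof.
move=> c0 cx; rewrite /Grad ler0_sqrtr ?expr0n // subr_le0 lerXn2r ?nnegrE //; rlra.
Qed.

Lemma Grad_lip c x y : 0 <= c -> 0 <= x -> x <= y -> Grad c x - Grad c y <= 10 * c ^+ 3 * y * (y - x).
Proof.
move=> c0 x0 xy; rewrite /Grad.
set s := Num.sqrt _; set t := Num.sqrt _.
have t0 : 0 <= t by exact: sqrtr_ge0.
have ts : t <= s.
  by apply: ler_wsqrtr; rewrite lerD2l lerN2 lerXn2r ?nnegrE //; rlra.
have sc : s <= c.
  rewrite -[leRHS]ger0_norm // -sqrtr_sqr; apply: ler_wsqrtr.
  by rewrite lerBlDr lerDl sqr_ge0.
have st : s ^+ 2 - t ^+ 2 <= 2 * y * (y - x).
  have [h1|h1] := leP (c ^+ 2 - x ^+ 2) 0.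
    have -> : s = 0 by rewrite /s ler0_sqrtr.
    rewrite expr0n /= sub0r; apply: (@le_trans _ _ 0); first by rewrite oppr_le0; pos.
    by apply: mulr_ge0; [pos|rlra].
  rewrite /s sqr_sqrtr; last exact: ltW.
  have : c ^+ 2 - y ^+ 2 <= t ^+ 2.
    have [h2|h2] := leP (c ^+ 2 - y ^+ 2) 0; first by apply: le_trans h2 _; pos.
    by rewrite /t sqr_sqrtr // ltW.
  rnra.
have -> : s ^+ 5 - t ^+ 5 = (s - t) * (s ^+ 4 + s ^+ 3 * t + s ^+ 2 * t ^+ 2 + s * t ^+ 3 + t ^+ 4) by ring.
have s0 : 0 <= s by rlra.
apply: (@le_trans _ _ ((s ^+ 2 - t ^+ 2) * (5 * c ^+ 3))).
  have -> : (s ^+ 2 - t ^+ 2) * (5 * c ^+ 3) = (s - t) * ((s + t) * (5 * c ^+ 3)) by ring.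
  apply: ler_wpM2l; first rlra.
  have c3 : s ^+ 3 <= c ^+ 3 by rewrite lerXn2r ?nnegrE //; rlra.
  apply: (@le_trans _ _ ((s + t) * (5 * s ^+ 3))); last by apply: ler_wpM2l; [pos|rlra].
  have a1 : s ^+ 2 * t ^+ 2 <= s ^+ 3 * t.
    have -> : s ^+ 2 * t ^+ 2 = s ^+ 2 * t * t by ring.
    have -> : s ^+ 3 * t = s ^+ 2 * t * s by ring.
    by apply: ler_wpM2l => //; pos.
  have a2 : s * t ^+ 3 <= s ^+ 3 * t.
    have -> : s * t ^+ 3 = s * t * t ^+ 2 by ring.
    have -> : s ^+ 3 * t = s * t * s ^+ 2 by ring.
    by apply: ler_wpM2l; [pos|rewrite lerXn2r ?nnegrE].
  have a3 : t ^+ 4 <= s ^+ 3 * t.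
    have -> : t ^+ 4 = t ^+ 3 * t by ring.
    by apply: ler_wpM2r => //; rewrite lerXn2r ?nnegrE.
  have -> : (s + t) * (5 * s ^+ 3) = 5 * s ^+ 4 + 5 * (s ^+ 3 * t) by ring.
  have : 0 <= s ^+ 4 by pos.
  have : 0 <= s ^+ 3 * t by pos.
  move: (s ^+ 4) (s ^+ 3 * t) (s ^+ 2 * t ^+ 2) (s * t ^+ 3) (t ^+ 4) a1 a2 a3 => v1 v2 v3 v4 v5; rlra.
have -> : 10 * c ^+ 3 * y * (y - x) = (2 * y * (y - x)) * (5 * c ^+ 3) by ring.
by apply: ler_wpM2r => //; pos.
Qed.

Definition Srad (w z : R) : R := Num.sqrt (z ^+ 2 - w ^+ 2).
Definition Grad1 (w z : R) : R := 5 * z * Srad w z ^+ 3.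
Definition Grad2 (w z : R) : R := 5 * Srad w z ^+ 3 + 15 * z ^+ 2 * Srad w z.
Definition Grad3 (w z : R) : R := 45 * z * Srad w z + 15 * z ^+ 3 * (Srad w z)^-1.
Definition Grad4 (w z : R) : R := 45 * Srad w z + 90 * z ^+ 2 * (Srad w z)^-1 - 15 * z ^+ 4 * (Srad w z)^-1 ^+ 3.

Lemma Srad_gt0 (w z : R) : 0 <= w -> w < z -> 0 < Srad w z.
Proof. by move=> w0 wz; rewrite sqrtr_gt0 subr_gt0 ltrXn2r ?nnegrE //; rlra. Qed.

Lemma der_Srad (w z : R) : 0 <= w -> w < z -> is_derive z 1 (Srad w) (z * (Srad w z)^-1).
Proof.
move=> w0 wz; have s0 := Srad_gt0 w0 wz.
have D : is_derive z 1 (fun z : R => z ^+ 2 - w ^+ 2) (2 * z).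
  by apply: der_eq (derD (derX 1 (der_id z)) (derN (der_cst _ _))) _; ring.
have g0 : 0 < z ^+ 2 - w ^+ 2 by rewrite -sqrtr_gt0.
apply: der_eq (@der_sqrt _ (fun z : R => z ^+ 2 - w ^+ 2) z _ g0 D) _.
by rewrite -/(Srad w z); field; rewrite gt_eqF.
Qed.

Lemma der_Grad0 (w z : R) : 0 <= w -> w < z -> is_derive z 1 (fun z => Grad z w) (Grad1 w z).
Proof.
move=> w0 wz; have s0 := Srad_gt0 w0 wz.
apply: der_eq (derX 4 (der_Srad w0 wz)) _; rewrite /Grad1; field; by rewrite gt_eqF.
Qed.

Lemma der_Grad1 (w z : R) : 0 <= w -> w < z -> is_derive z 1 (Grad1 w) (Grad2 w z).
Proof.
move=> w0 wz; have s0 := Srad_gt0 w0 wz.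
apply: der_eq (derM (derM (der_cst 5 z) (der_id z)) (derX 2 (der_Srad w0 wz))) _.
rewrite /Grad2; field; by rewrite gt_eqF.
Qed.

Lemma der_Grad2 (w z : R) : 0 <= w -> w < z -> is_derive z 1 (Grad2 w) (Grad3 w z).
Proof.
move=> w0 wz; have s0 := Srad_gt0 w0 wz.
apply: der_eq (derD (derM (der_cst 5 z) (derX 2 (der_Srad w0 wz)))
  (derM (derM (der_cst 15 z) (derX 1 (der_id z))) (der_Srad w0 wz))) _.
rewrite /Grad3; field; by rewrite gt_eqF.
Qed.

Lemma der_Grad3 (w z : R) : 0 <= w -> w < z -> is_derive z 1 (Grad3 w) (Grad4 w z).
Proof.
move=> w0 wz; have s0 := Srad_gt0 w0 wz.
have D := der_inv (lt0r_neq0 s0) (der_Srad w0 wz).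
apply: der_eq (derD (derM (derM (der_cst 45 z) (der_id z)) (der_Srad w0 wz))
  (derM (derM (der_cst 15 z) (derX 2 (der_id z))) D)) _.
rewrite /Grad4; field; by rewrite gt_eqF.
Qed.

Lemma Srad_le (x y z : R) : 0 <= x -> x <= y -> y < z -> Srad y z <= Srad x z.
Proof. by move=> x0 xy yz; apply: ler_wsqrtr; rewrite lerD2l lerN2 lerXn2r ?nnegrE //; rlra. Qed.

Lemma D2_Grad_le c h x y : 0 < h -> 0 <= x -> x <= y -> y <= c - 4 * h ->
  D2 (fun z => Grad z y) c h <= D2 (fun z => Grad z x) c h.
Proof.
move=> h0 x0 xy yc; have y0 : 0 <= y by rlra.
have -> : D2 (fun z => Grad z x) c h = D2 (fun z => Grad z x - Grad z y) c h + D2 (fun z => Grad z y) c h.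
  by rewrite /D2; ring.
rewrite lerDr.
have b z : c - h <= z <= c + h -> x < z /\ y < z by move=> /andP[? ?]; rlra.
apply: (@D2_ge0 _ _ (fun z => Grad1 x z - Grad1 y z) (fun z => Grad2 x z - Grad2 y z) _ _ (ltW h0)
  (fun z hz => derD (der_Grad0 x0 (b z hz).1) (derN (der_Grad0 y0 (b z hz).2)))
  (fun z hz => derD (der_Grad1 x0 (b z hz).1) (derN (der_Grad1 y0 (b z hz).2)))) => z /b[xz yz].
have s1 := Srad_gt0 y0 yz; have s2 := Srad_le x0 xy yz; rewrite subr_ge0 /Grad2; apply: lerD.
  by rewrite ler_pM2l // lerXn2r ?nnegrE //; rlra.
by apply: ler_wpM2l => //; pos.
Qed.

(** The fourth derivative in [z] of [(z^2 - w^2)^(5/2)] decreases in [w], so the difference of the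
    two profiles has a nonnegative fourth derivative. *)
Lemma D4_Grad_le c h x y : 0 < h -> 0 <= x -> x <= y -> y <= c - 4 * h ->
  D4 (fun z => Grad z y) c h <= D4 (fun z => Grad z x) c h.
Proof.
move=> h0 x0 xy yc; have y0 : 0 <= y by rlra.
have -> : D4 (fun z => Grad z x) c h = D4 (fun z => Grad z x - Grad z y) c h + D4 (fun z => Grad z y) c h.
  by rewrite /D4; ring.
rewrite lerDr.
have b z : c - 2 * h <= z <= c + 2 * h -> x < z /\ y < z by move=> /andP[? ?]; rlra.
apply: (@D4_ge0 _ _ (fun z => Grad1 x z - Grad1 y z) (fun z => Grad2 x z - Grad2 y z)
  (fun z => Grad3 x z - Grad3 y z) (fun z => Grad4 x z - Grad4 y z) _ _ (ltW h0)
  (fun z hz => derD (der_Grad0 x0 (b z hz).1) (derN (der_Grad0 y0 (b z hz).2)))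
  (fun z hz => derD (der_Grad1 x0 (b z hz).1) (derN (der_Grad1 y0 (b z hz).2)))
  (fun z hz => derD (der_Grad2 x0 (b z hz).1) (derN (der_Grad2 y0 (b z hz).2)))
  (fun z hz => derD (der_Grad3 x0 (b z hz).1) (derN (der_Grad3 y0 (b z hz).2)))) => z /b[xz yz].
have s1 := Srad_gt0 y0 yz; have s2 := Srad_le x0 xy yz; have s3 := Srad_gt0 x0 xz; rewrite /Grad4.
move: (Srad x z) (Srad y z) s1 s2 s3 => a b' b0 ba a0.
(* Completing squares isolates the nonnegative factor [a - b'] times a sum of nonnegative terms. *)
have -> : 45 * a + 90 * z ^+ 2 / a - 15 * z ^+ 4 * a^-1 ^+ 3 - (45 * b' + 90 * z ^+ 2 / b' - 15 * z ^+ 4 * b'^-1 ^+ 3)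
  = (a - b') * (45 * (1 - z ^+ 2 * (a^-1 * b'^-1)) ^+ 2 + 15 * z ^+ 4 * (a^-1 * b'^-1) * (a^-1 - b'^-1) ^+ 2).
  by field; rewrite !gt_eqF.
apply: mulr_ge0; [rlra|pos].
Qed.

(** Away from the edge the two differences are monotone in the radius, so their variation is read
    off at the ends; near the edge each profile is itself only of size [(c h)^(5/2)]. The function
    [P] majorises the variation still to come, in a form fit for summation by parts. *)
Lemma Kker_variation (C : R) : 0 < C -> exists C' : R, 0 < C' /\ forall e c h, 4 <= c -> 0 < h <= 1 / 4 -> 1 <= c * h ->
  0 <= e <= C * h ^+ 2 / c ^+ 2 -> exists P : R -> R,
  [/\ forall x y, 0 <= x -> x <= y -> `|Kker e c h x - Kker e c h y| <= P x - P y,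
      forall x, 0 <= x -> 0 <= P x & P 0 <= C' * Num.sqrt (c * h) ^+ 5].
Proof.
move=> C0; exists (120 + 30 * C + 2 * (16 + 4 * C) * 4 ^+ 5); split; first by pos.
move=> e c h c4 /andP[h0 h1] ch /andP[e0 eC].
have c0 : 0 < c by rlra.
have c20 : 0 < c ^+ 2 by pos.
have ec : e * c ^+ 2 <= C * h ^+ 2 by rewrite -ler_pdivlMr.
have e1 : e <= C by apply: le_trans eC _; rewrite ler_pdivrMr // ler_pM2l //; rnra.
(* Up to [Z] the radius stays inside all five profiles, so [D4_Grad_le] and [D2_Grad_le] apply. *)
pose Z := c - 4 * h; have Z0 : 0 <= Z by rewrite /Z; rlra.
pose k4 x := D4 (fun z => Grad z x) c h; pose k2 x := D2 (fun z => Grad z x) c h.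
(* The decreasing profiles with the absolute values of the coefficients in [Lop]: the decrease of
   [W] bounds the variation beyond [Z]. *)
pose W x := Grad (c + 2 * h) x + (4 + e) * Grad (c + h) x + (6 + 2 * e) * Grad c x
   + (4 + e) * Grad (c - h) x + Grad (c - 2 * h) x.
have W0 x : 0 <= W x.
  have G0 := Grad_ge0; rewrite /W; have := G0 (c + 2 * h) x; have := G0 (c + h) x.
  by have := G0 c x; have := G0 (c - h) x; have := G0 (c - 2 * h) x => *; pos.
have Wle x y : 0 <= x -> x <= y -> `|Kker e c h x - Kker e c h y| <= W x - W y.
  move=> x0 xy; have G z := Grad_le z x0 xy.
  have := G (c + 2 * h); have := G (c + h); have := G c; have := G (c - h); have := G (c - 2 * h).
  rewrite /Kker /Lop /D4 /D2 /W ler_norml => g1 g2 g3 g4 g5.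
  move: (Grad _ x) (Grad _ x) (Grad _ x) (Grad _ x) (Grad _ x) (Grad _ y) (Grad _ y) (Grad _ y) (Grad _ y) (Grad _ y) g1 g2 g3 g4 g5.
  move=> a1 a2 a3 a4 a5 b1 b2 b3 b4 b5 g1 g2 g3 g4 g5.
  have k2' : 0 <= e * (a2 - b2) by apply: mulr_ge0 => //; rlra.
  have k3' : 0 <= e * (a3 - b3) by apply: mulr_ge0 => //; rlra.
  have k4' : 0 <= e * (a4 - b4) by apply: mulr_ge0 => //; rlra.
  by apply/andP; split; rnra.
have Wle' x y : 0 <= x -> x <= y -> W y <= W x.
  by move=> x0 xy; rewrite -subr_ge0; apply: le_trans (Wle x y x0 xy).
have Kle x y : 0 <= x -> x <= y -> y <= Z -> `|Kker e c h x - Kker e c h y| <= (k4 x - k4 y) + e * (k2 x - k2 y).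
  move=> x0 xy yZ; have a4 := D4_Grad_le h0 x0 xy yZ; have a2 := D2_Grad_le h0 x0 xy yZ.
  rewrite /Kker /Lop -/(k4 x) -/(k4 y) -/(k2 x) -/(k2 y) ler_norml.
  rewrite -/(k4 x) -/(k4 y) in a4; rewrite -/(k2 x) -/(k2 y) in a2.
  have : 0 <= e * (k2 x - k2 y) by apply: mulr_ge0 => //; rlra.
  by move=> ?; apply/andP; split; rnra.
pose mi x := Num.min x Z; pose ma x := Num.max x Z.
pose P x := (k4 (mi x) - k4 Z) + e * (k2 (mi x) - k2 Z) + W (ma x).
exists P.
have k4Z x : 0 <= x -> x <= Z -> k4 Z <= k4 x by move=> x0 xZ; exact: (D4_Grad_le h0 x0 xZ (lexx _)).
have k2Z x : 0 <= x -> x <= Z -> k2 Z <= k2 x by move=> x0 xZ; exact: (D2_Grad_le h0 x0 xZ (lexx _)).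
have mi0 x : 0 <= x -> 0 <= mi x by move=> x0; rewrite /mi le_min x0.
have miZ x : mi x <= Z by rewrite /mi ge_min lexx orbT.
split.
- move=> x y x0 xy; have [yZ|yZ] := leP y Z.
    have mx : mi x = x by rewrite /mi; apply/min_idPl; rlra.
    have my : mi y = y by rewrite /mi; apply/min_idPl.
    have Mx : ma x = Z by rewrite /ma; apply/max_idPr; rlra.
    have My : ma y = Z by rewrite /ma; apply/max_idPr.
    rewrite /P mx my Mx My; have := Kle x y x0 xy yZ; rlra.
  have [xZ|xZ] := leP x Z.
    have mx : mi x = x by rewrite /mi; apply/min_idPl; rlra.
    have my : mi y = Z by rewrite /mi; apply/min_idPr; rlra.
    have Mx : ma x = Z by rewrite /ma; apply/max_idPr; rlra.
    have My : ma y = y by rewrite /ma; apply/max_idPl; rlra.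
    rewrite /P mx my Mx My; have := Kle x Z x0 xZ (lexx _); have := Wle Z y Z0 (ltW yZ).
    have := ler_distD (Kker e c h Z) (Kker e c h x) (Kker e c h y); rlra.
  have mx : mi x = Z by rewrite /mi; apply/min_idPr; rlra.
  have my : mi y = Z by rewrite /mi; apply/min_idPr; rlra.
  have Mx : ma x = x by rewrite /ma; apply/max_idPl; rlra.
  have My : ma y = y by rewrite /ma; apply/max_idPl; rlra.
  rewrite /P mx my Mx My; have := Wle x y x0 xy; rlra.
- move=> x x0; rewrite /P; have := k4Z _ (mi0 x x0) (miZ x); have := k2Z _ (mi0 x x0) (miZ x).
  have := W0 (ma x) => w0 a2 a4; have : 0 <= e * (k2 (mi x) - k2 Z) by apply: mulr_ge0 => //; rlra.
  rlra.
have g5 z : c - 2 * h <= z <= c + 2 * h -> `|Grad z Z| <= 4 ^+ 5 * Num.sqrt (c * h) ^+ 5.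
  move=> /andP[z1 z2]; rewrite ger0_norm ?Grad_ge0 // /Grad -exprMn; apply: lerXn2r; rewrite ?nnegrE; [by pos|by pos|].
  have -> : 4 * Num.sqrt (c * h) = Num.sqrt (16 * (c * h)).
    have -> : 16 = 4 ^+ 2 :> R by ring.
    by rewrite [RHS]sqrtrM ?sqr_ge0 // sqrtr_sqr ger0_norm.
  by apply: ler_wsqrtr; rewrite /Z; rnra.
set g := Num.sqrt (c * h) ^+ 5 in g5 *.
have g1 : c * h <= g.
  have s1 : 1 <= Num.sqrt (c * h) by rewrite -sqrtr1; apply: ler_wsqrtr.
  have s2 : c * h = Num.sqrt (c * h) ^+ 2 by rewrite sqr_sqrtr //; rlra.
  rewrite {1}s2 /g; rewrite ler_weXn2l //.
have m0 : mi 0 = 0 by rewrite /mi; apply/min_idPl.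
have M0 : ma 0 = Z by rewrite /ma; apply/max_idPr.
rewrite /P m0 M0.
have Gr0 z : 0 <= z -> Grad z 0 = z ^+ 5 by move=> z0; rewrite /Grad expr0n /= subr0 sqrtr_sqr ger0_norm.
(* At radius 0 the profile is [z^5], whose differences are exact polynomials; the leading powers of
   [c] are gone in the fourth one. *)
have -> : k4 0 = 120 * (c * h) * h ^+ 3.
  by rewrite /k4 /D4 !Gr0; [ring|rlra..].
have -> : k2 0 = 20 * c ^+ 3 * h ^+ 2 + 10 * c * h ^+ 4.
  by rewrite /k2 /D2 !Gr0; [ring|rlra..].
have KZ : `|k4 Z + e * k2 Z| <= (16 + 4 * e) * (4 ^+ 5 * g).
  have -> : k4 Z + e * k2 Z = Lop (- e) (fun z => Grad z Z) c h by rewrite /Lop -/(k4 Z) -/(k2 Z); ring.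
  have a1 := g5 (c + 2 * h); have a2 := g5 (c + h); have a3 := g5 c; have a4 := g5 (c - h); have a5 := g5 (c - 2 * h).
  have {a1}/ler_normlP[a1 b1] : `|Grad (c + 2 * h) Z| <= 4 ^+ 5 * g by apply: a1; apply/andP; split; rlra.
  have {a2}/ler_normlP[a2 b2] : `|Grad (c + h) Z| <= 4 ^+ 5 * g by apply: a2; apply/andP; split; rlra.
  have {a3}/ler_normlP[a3 b3] : `|Grad c Z| <= 4 ^+ 5 * g by apply: a3; apply/andP; split; rlra.
  have {a4}/ler_normlP[a4 b4] : `|Grad (c - h) Z| <= 4 ^+ 5 * g by apply: a4; apply/andP; split; rlra.
  have {a5}/ler_normlP[a5 b5] : `|Grad (c - 2 * h) Z| <= 4 ^+ 5 * g by apply: a5; apply/andP; split; rlra.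
  rewrite /Lop /D4 /D2; move: (4 ^+ 5 * g) a1 b1 a2 b2 a3 b3 a4 b4 a5 b5 => M.
  move: (Grad _ Z) (Grad _ Z) (Grad _ Z) (Grad _ Z) (Grad _ Z) => x1 x2 x3 x4 x5 *.
  apply/ler_normlP; split; rnra.
have WZ : W Z <= (16 + 4 * e) * (4 ^+ 5 * g).
  have a1 := g5 (c + 2 * h); have a2 := g5 (c + h); have a3 := g5 c; have a4 := g5 (c - h); have a5 := g5 (c - 2 * h).
  have {a1}/ler_normlP[a1 b1] : `|Grad (c + 2 * h) Z| <= 4 ^+ 5 * g by apply: a1; apply/andP; split; rlra.
  have {a2}/ler_normlP[a2 b2] : `|Grad (c + h) Z| <= 4 ^+ 5 * g by apply: a2; apply/andP; split; rlra.
  have {a3}/ler_normlP[a3 b3] : `|Grad c Z| <= 4 ^+ 5 * g by apply: a3; apply/andP; split; rlra.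
  have {a4}/ler_normlP[a4 b4] : `|Grad (c - h) Z| <= 4 ^+ 5 * g by apply: a4; apply/andP; split; rlra.
  have {a5}/ler_normlP[a5 b5] : `|Grad (c - 2 * h) Z| <= 4 ^+ 5 * g by apply: a5; apply/andP; split; rlra.
  rewrite /W; move: (4 ^+ 5 * g) b1 b2 b3 b4 b5 => M.
  move: (Grad _ Z) (Grad _ Z) (Grad _ Z) (Grad _ Z) (Grad _ Z) => x1 x2 x3 x4 x5 *.
  rnra.
have h31 : h ^+ 3 <= 1 by rewrite exprn_ile1 //; rlra.
have t1 : 120 * (c * h) * h ^+ 3 <= 120 * g.
  apply: (@le_trans _ _ (120 * (c * h))); last rlra.
  by rewrite -[leRHS]mulr1; apply: ler_wpM2l => //; rlra.
have t2 : e * (20 * c ^+ 3 * h ^+ 2 + 10 * c * h ^+ 4) <= 30 * C * g.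
  have -> : e * (20 * c ^+ 3 * h ^+ 2 + 10 * c * h ^+ 4) = (e * c ^+ 2) * (c * h) * (20 * h) + e * (c * h) * (10 * h ^+ 3) by ring.
  have : e * c ^+ 2 * (c * h) * (20 * h) <= C * g * 20.
    apply: ler_pM; [by pos|by pos| |rlra].
    apply: ler_pM; [by pos|by pos| |by []].
    by apply: le_trans ec _; rewrite -[leRHS]mulr1 ler_pM2l //; rnra.
  have : e * (c * h) * (10 * h ^+ 3) <= C * g * 10.
    apply: ler_pM; [by pos|by pos| |rlra].
    by apply: ler_pM => //; pos.
  rlra.
move/ler_normlP: KZ => [KZ _].
have g0 : 0 <= g by rewrite /g; pos.
have e4 : (16 + 4 * e) * (4 ^+ 5 * g) <= (16 + 4 * C) * (4 ^+ 5 * g) by apply: ler_wpM2r; [pos|rlra].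
move: (4 ^+ 5) t1 t2 KZ WZ e4 => M; rnra.
Qed.

End radial_variation.

(** * Upper bound of the functional by the counting error *)

Section functional_bound.
Context (R : realType).
Implicit Types (c h e x y X : R).

Lemma Kker_lip e c h : 0 <= e -> 0 <= h -> 2 * h <= c -> exists Lp : R, 0 <= Lp /\
  forall x y, 0 <= x -> x <= y -> y <= c + 2 * h -> `|Kker e c h x - Kker e c h y| <= Lp * (y - x).
Proof.
move=> e0 h0 hc; pose R0 := c + 2 * h.
exists ((16 + 4 * e) * (10 * R0 ^+ 3 * R0)); split; first by rewrite /R0; pos.
move=> x y x0 xy yR.
have -> : Kker e c h x - Kker e c h y = Lop e (fun z => Grad z x - Grad z y) c h.
  by rewrite /Kker /Lop /D4 /D2; ring.
rewrite -mulrA; apply: Lop_bound => // z /andP[z1 z2].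
have z0 : 0 <= z by rlra.
rewrite ger0_norm ?subr_ge0 ?Grad_le //; apply: le_trans (Grad_lip z0 x0 xy) _.
apply: ler_wpM2r; first rlra.
have zR : z ^+ 3 <= R0 ^+ 3 by rewrite lerXn2r ?nnegrE // /R0; rlra.
by apply: ler_pM => //; [pos|rlra|apply: ler_wpM2l].
Qed.

Lemma Kker_eq0 e c h X : 0 <= h -> 2 * h <= c -> c + 2 * h <= X -> Kker e c h X = 0.
Proof.
by move=> h0 hc hX; rewrite /Kker /Lop /D4 /D2 !Grad_eq0 //; [ring|rlra..].
Qed.

(** Homogeneity: scaling the radius by [c] gives [c^5] from the profile, [c^m] from the power and
    [c] from the differential. *)
Lemma Int_Grad_pow c m r : 0 <= c -> c <= r ->
  Int (fun X => Grad c X * X ^+ m) 0 r = c ^+ (m + 6) * Int (fun X => Grad 1 X * X ^+ m) 0 1.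
Proof.
move=> c0 cr; have cG d : continuous (fun X => Grad d X * X ^+ m) by rewrite /Grad; cont.
rewrite -(Int_chasles _ 0 c r).
have -> : Int (fun X => Grad c X * X ^+ m) c r = 0.
  have <- : Int (fun=> 0 : R) c r = 0 by rewrite Int_cst mul0r.
  apply: Int_eq_in => //; first by cont.
  by move=> X /andP[cX _]; rewrite Grad_eq0 // mul0r.
rewrite addr0; have := @Int_affine R (fun X => Grad c X * X ^+ m) c 0 0 1 (cG c).
rewrite mulr0 mulr1 !addr0 => <-.
have -> : (fun x => Grad c (c * x + 0) * (c * x + 0) ^+ m) = (fun x => c ^+ (m + 5) * (Grad 1 x * x ^+ m)).
  apply/funext => x; rewrite addr0 /Grad.
  have -> : c ^+ 2 - (c * x) ^+ 2 = c ^+ 2 * (1 ^+ 2 - x ^+ 2) by ring.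
  rewrite sqrtrM ?sqr_ge0 // sqrtr_sqr ger0_norm // !exprMn exprD; ring.
rewrite IntZ // mulrA; congr (_ * _).
by rewrite -exprS -addnS.
Qed.

(** As a function of [c] the integral of the profile is a multiple of [c^(m+6)], which [Lop]
    annihilates: this is the disappearance of the volume term. *)
Lemma Int_Kker_pow e c h m : 0 <= h -> 2 * h <= c -> Lop e (fun x => x ^+ (m + 6)) c h = 0 ->
  Int (fun X => Kker e c h X * X ^+ m) 0 (c + 2 * h) = 0.
Proof.
move=> h0 hc hL.
have -> : (fun X => Kker e c h X * X ^+ m) = (fun X => Lop e (fun z => Grad z X * X ^+ m) c h).
  by apply/funext => X; rewrite /Kker /Lop /D4 /D2; ring.
rewrite -(@Int_Lop R e (fun z X => Grad z X * X ^+ m)); last by move=> z; rewrite /Grad; cont.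
set A := Int (fun X => Grad 1 X * X ^+ m) 0 1.
transitivity (Lop e (fun x => x ^+ (m + 6)) c h * A); last by rewrite hL mul0r.
have E z : 0 <= z -> z <= c + 2 * h -> Int (fun X => Grad z X * X ^+ m) 0 (c + 2 * h) = z ^+ (m + 6) * A.
  by move=> z0 zc; rewrite Int_Grad_pow.
rewrite /Lop /D4 /D2 (E (c + 2 * h)) ?(E (c + h)) ?(E c) ?(E (c - h)) ?(E (c - 2 * h)); [|rlra..].
move: (_ ^+ _) (_ ^+ _) (_ ^+ _) (_ ^+ _) (_ ^+ _) => x1 x2 x3 x4 x5; ring.
Qed.

Lemma telescope_ord (n : nat) (f : nat -> R) : \sum_(j < n) (f j - f j.+1) = f 0%N - f n.
Proof. by elim: n => [|n IH]; rewrite ?big_ord0 ?subrr // big_ord_recr /= IH; ring. Qed.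

Lemma Int_grid (f : R -> R) (x : nat -> R) n : \sum_(j < n) Int f (x j) (x j.+1) = Int f (x 0%N) (x n).
Proof. by elim: n => [|n IH]; rewrite ?big_ord0 ?Intxx // big_ord_recr /= IH Int_chasles. Qed.

Lemma first_index (P : nat -> bool) n : exists j, [/\ (j <= n)%N, (forall i, (i < j)%N -> ~~ P i) & (j < n)%N -> P j].
Proof.
exists (find P (iota 0 n)); split.
- by rewrite -[X in (_ <= X)%N](size_iota 0 n) find_size.
- move=> i hi; have := before_find 0%N hi; rewrite nth_iota ?add0n; first by move=> ->.
  by rewrite (leq_trans hi) // -[X in (_ <= X)%N](size_iota 0 n) find_size.
- move=> hj; have : has P (iota 0 n) by rewrite has_find size_iota.
  by move/(nth_find 0%N); rewrite nth_iota.
Qed.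

(** Summation by parts against the counting function of the radii, whose deviation from [V X^(m+1)]
    is at most [M]. It is carried out on a grid of [n] steps: rounding costs [A / n], and [n] is
    arbitrary. *)
Lemma radial_functional_bound m e c h V M (P : R -> R) (T : finType) (rho : T -> R) :
  0 <= e -> 0 < h -> 2 * h <= c -> 0 <= M -> Lop e (fun x => x ^+ (m + 6)) c h = 0 ->
  (forall p, 0 <= rho p) ->
  (forall X, 0 <= X <= c + 2 * h -> `|#|[pred p | rho p <= X]|%:R - V * X ^+ m.+1| <= M) ->
  (forall x y, 0 <= x -> x <= y -> `|Kker e c h x - Kker e c h y| <= P x - P y) ->
  (forall x, 0 <= x -> 0 <= P x) ->
  `|\sum_p Kker e c h (rho p)| <= M * P 0.
Proof.
move=> e0 h0 hc M0 hL rho0 hN hP P0.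
have [Lp [Lp0 lip]] := Kker_lip e0 (ltW h0) hc.
set K := Kker e c h in hP lip *; pose R0 := c + 2 * h.
have R00 : 0 < R0 by rewrite /R0; rlra.
have KR X : R0 <= X -> K X = 0 by move=> hX; apply: Kker_eq0 => //; exact: ltW.
pose A := #|T|%:R * (Lp * R0) + `|V| * (Lp * R0 * R0 ^+ m.+1).
have A0 : 0 <= A by rewrite /A; pos.
suff main n : (0 < n)%N -> `|\sum_p K (rho p)| <= M * P 0 + A / n%:R.
  apply/ler_addgt0Pr => z z0.
  pose n := Num.bound (A / z).
  have hn : A / z < n%:R by exact: archi_boundP (divr_ge0 A0 (ltW z0)).
  have n0 : (0 < n)%N by rewrite -(ltr0n R); apply: le_lt_trans hn; exact: divr_ge0 A0 (ltW z0).
  apply: le_trans (main n n0) _; rewrite lerD2l.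
  by rewrite ler_pdivrMr ?ltr0n // mulrC -ler_pdivrMr // ltW.
move=> n0; have np : 0 < n%:R :> R by rewrite ltr0n.
pose d := R0 / n%:R; have d0 : 0 < d by rewrite divr_gt0.
pose x (j : nat) : R := j%:R * d.
have x0 j : 0 <= x j by rewrite /x; pos.
have xS j : x j.+1 = x j + d by rewrite /x -natr1; ring.
have xn : x n = R0 by rewrite /x /d mulrC divfK // gt_eqF.
have x00 : x 0%N = 0 by rewrite /x mul0r.
have xle i j : (i <= j)%N -> x i <= x j by move=> ij; rewrite /x ler_wpM2r ?ler_nat // ltW.
have xR j : (j <= n)%N -> x j <= R0 by move=> jn; rewrite -xn; exact: xle.
have xxS j : x j <= x j.+1 by exact: xle.
have KxR : K (x n) = 0 by rewrite xn; exact: KR.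
pose dK j := K (x j) - K (x j.+1).
pose N X : R := #|[pred p | rho p <= X]|%:R.
(* The variation of the kernel times the counting error; the increments of [P] telescope. *)
have part1 : `|\sum_(j < n) dK j * N (x j) - V * \sum_(j < n) dK j * x j ^+ m.+1| <= M * P 0.
  rewrite mulr_sumr -sumrB; apply: le_trans (ler_norm_sum _ _ _) _.
  apply: (@le_trans _ _ (\sum_(j < n) (P (x j) - P (x j.+1)) * M)).
    apply: ler_sum => j _.
    have -> : dK j * N (x j) - V * (dK j * x j ^+ m.+1) = dK j * (N (x j) - V * x j ^+ m.+1) by ring.
    rewrite normrM; apply: ler_pM => //; first exact: hP.
    by apply: hN; rewrite x0 xR // ltnW.
  rewrite -mulr_suml (telescope_ord n (fun j => P (x j))) x00 mulrC; apply: ler_wpM2l => //.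
  by have := P0 _ (x0 n); rlra.
have part2 : `|\sum_p K (rho p) - \sum_(j < n) dK j * N (x j)| <= #|T|%:R * (Lp * d).
  have -> : \sum_(j < n) dK j * N (x j) = \sum_p \sum_(j < n) (if rho p <= x j then dK j else 0).
    rewrite exchange_big /=; apply: eq_bigr => j _.
    by rewrite -big_mkcond /= sumr_const -[RHS]mulr_natr.
  rewrite -sumrB; apply: le_trans (ler_norm_sum _ _ _) _.
  have -> : #|T|%:R * (Lp * d) = \sum_(p : T) (Lp * d) by rewrite sumr_const mulr_natl.
  apply: ler_sum => p _.
  have [j [jn lo hi]] := first_index (fun j => rho p <= x j) n.
  have -> : \sum_(j < n) (if rho p <= x j then dK j else 0) = K (x j) - K (x n).
    rewrite -(big_mkord xpredT (fun j => if rho p <= x j then dK j else 0)) (big_cat_nat (n := j)) //=.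
    rewrite big_nat big1 ?add0r; last by move=> i /andP[_ ij]; rewrite (negbTE (lo i ij)).
    have -> : \sum_(j <= i < n) (if rho p <= x i then dK i else 0) = \sum_(j <= i < n) dK i.
      apply: eq_big_nat => i /andP[ji iN]; have jN := leq_ltn_trans ji iN.
      by rewrite (le_trans (hi jN) (xle _ _ ji)).
    rewrite (@telescope_sumr_eq _ j n (fun i => - K (x i)) dK) //; [ring|move=> i _; rewrite /dK; ring].
  rewrite KxR subr0.
  have [rR|rR] := leP (rho p) R0; last first.
    rewrite (KR (rho p) (ltW rR)) (_ : j = n) ?KxR ?subrr ?normr0; first by pos.
    apply/eqP; rewrite eqn_leq jn leqNgt; apply/negP => jn'.
    have := hi jn'; have := xR j jn; rlra.
  have rj : rho p <= x j.
    by move: jn; rewrite leq_eqVlt => /orP[/eqP ->|]; [rewrite xn|exact: hi].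
  apply: le_trans (lip _ _ (rho0 p) rj (xR _ jn)) _; apply: ler_wpM2l => //.
  case: j jn lo {hi} rj => [|j] jn lo rj.
    by have := rho0 p; rewrite x00; rlra.
  have := lo j (ltnSn j); rewrite -ltNge xS; rlra.
(* After summation by parts this is a Riemann sum for the integral that vanishes by
   [Int_Kker_pow]. *)
have part3 : `|\sum_(j < n) dK j * x j ^+ m.+1| <= Lp * d * R0 ^+ m.+1.
  have -> : \sum_(j < n) dK j * x j ^+ m.+1 = \sum_(j < n) K (x j.+1) * (x j.+1 ^+ m.+1 - x j ^+ m.+1).
    have : \sum_(j < n) (K (x j) * x j ^+ m.+1 - K (x j.+1) * x j.+1 ^+ m.+1) = 0.
      by rewrite (telescope_ord n (fun j => K (x j) * x j ^+ m.+1)) x00 KxR expr0n mulr0 mul0r subrr.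
    move=> t0; apply/eqP; rewrite -subr_eq0 -sumrB; apply/eqP; rewrite -[RHS]t0; apply: eq_bigr => j _; rewrite /dK; ring.
  pose f X := K X * (m.+1%:R * X ^+ m).
  have cK : continuous K by rewrite /K /Kker /Lop /D4 /D2 /Grad; cont.
  have cf : continuous f by rewrite /f; cont.
  have I0 : Int f 0 R0 = 0.
    have -> : f = (fun X => m.+1%:R * (K X * X ^+ m)) by apply/funext => X; rewrite /f; ring.
    by rewrite IntZ ?Int_Kker_pow ?mulr0 //; [exact: ltW|cont].
  have Ip a b : Int (fun X => m.+1%:R * X ^+ m) a b = b ^+ m.+1 - a ^+ m.+1.
    have H X : is_derive X 1 (fun X : R => X ^+ m.+1) (m.+1%:R * X ^+ m).
      by apply: der_eq (derX m (der_id X)) _; rewrite mulr1.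
    by rewrite (Int_eq _ _ H).
  have -> : \sum_(j < n) K (x j.+1) * (x j.+1 ^+ m.+1 - x j ^+ m.+1) =
     \sum_(j < n) (K (x j.+1) * (x j.+1 ^+ m.+1 - x j ^+ m.+1) - Int f (x j) (x j.+1)).
    by rewrite sumrB Int_grid x00 xn I0 subr0.
  apply: le_trans (ler_norm_sum _ _ _) _.
  have -> : Lp * d * R0 ^+ m.+1 = \sum_(j < n) Lp * d * (x j.+1 ^+ m.+1 - x j ^+ m.+1).
    rewrite -mulr_sumr; congr (_ * _).
    have := telescope_ord n (fun j => - x j ^+ m.+1); rewrite x00 xn expr0n /= oppr0 sub0r opprK => <-.
    by apply: eq_bigr => j _; ring.
  apply: ler_sum => j _.
  have -> : K (x j.+1) * (x j.+1 ^+ m.+1 - x j ^+ m.+1) - Int f (x j) (x j.+1) =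
     Int (fun X => (K (x j.+1) - K X) * (m.+1%:R * X ^+ m)) (x j) (x j.+1).
    rewrite -Ip -IntZ; last by cont.
    rewrite -IntB; [|cont|by []].
    by congr Int; apply/funext => X; rewrite /f; ring.
  have b X : x j <= X <= x j.+1 -> `|(K (x j.+1) - K X) * (m.+1%:R * X ^+ m)| <= Lp * d * (m.+1%:R * X ^+ m).
    move=> /andP[h1 h2]; have X0 : 0 <= X := le_trans (x0 _) h1.
    rewrite normrM (@ger0_norm _ (m.+1%:R * X ^+ m)); last by pos.
    apply: ler_wpM2r; first by pos.
    rewrite distrC; apply: le_trans (lip X (x j.+1) X0 h2 (xR _ _)) _ => //.
    by apply: ler_wpM2l => //; move: h1; rewrite xS; rlra.
  have -> : Lp * d * (x j.+1 ^+ m.+1 - x j ^+ m.+1) = Int (fun X => Lp * d * (m.+1%:R * X ^+ m)) (x j) (x j.+1).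
    by rewrite IntZ ?Ip //; cont.
  rewrite ler_norml; apply/andP; split.
    have -> : - Int (fun X => Lp * d * (m.+1%:R * X ^+ m)) (x j) (x j.+1) =
      Int (fun X => - 1 * (Lp * d * (m.+1%:R * X ^+ m))) (x j) (x j.+1).
      by rewrite (@IntZ _ (fun X => Lp * d * (m.+1%:R * X ^+ m)) (-1)) ?mulN1r //; cont.
    apply: Int_le; [by cont|by cont|exact: xxS|].
    by move=> X /b; rewrite ler_norml mulN1r => /andP[].
  apply: Int_le; [by cont|by cont|exact: xxS|].
  by move=> X /b; rewrite ler_norml => /andP[].
have dE : d = R0 * n%:R^-1 by [].
have AE : A / n%:R = #|T|%:R * (Lp * d) + `|V| * (Lp * d * R0 ^+ m.+1).
  by rewrite /A dE; ring.
rewrite AE; set S := \sum_p _ in part2 *; set S1 := \sum_(j < n) dK j * N _ in part1 part2.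
set S2 := \sum_(j < n) dK j * _ in part1 part3.
have : `|V * S2| <= `|V| * (Lp * d * R0 ^+ m.+1) by rewrite normrM; apply: ler_wpM2l.
have -> : S = (S - S1) + ((S1 - V * S2) + V * S2) by ring.
move=> hV; apply: le_trans (ler_normD _ _) _; have := ler_normD (S1 - V * S2) (V * S2); rlra.
Qed.

End functional_bound.

(** * The circle method *)

Section difference_sums.

Lemma zrS (V : zmodType) n (F : int -> V) :
  \sum_(j <- zr n.+1) F j = F n.+1%:Z + F (- n.+1%:Z) + \sum_(j <- zr n) F j.
Proof.
have P : perm_eq (zr n.+1) (n.+1%:Z :: - n.+1%:Z :: zr n).
  apply: uniq_perm; rewrite ?zr_uniq //=.
    by rewrite zr_uniq !inE !mem_zr andbT; apply/andP; split; lia.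
  by move=> j; rewrite !inE !mem_zr; lia.
by rewrite (perm_big _ P) /= 2!big_cons /= addrA.
Qed.

Lemma zr0 (V : zmodType) (F : int -> V) : \sum_(j <- zr 0) F j = F 0.
Proof. by rewrite big_zr /= big_ord1. Qed.

Lemma zr_symmetric (V : zmodType) n (F : int -> V) :
  \sum_(j <- zr n) F j = F 0 + \sum_(i < n) F (n%:Z - i%:Z) + \sum_(i < n) F (i%:Z - n%:Z).
Proof.
elim: n => [|n IH]; first by rewrite zr0 !big_ord0 !addr0.
rewrite zrS IH !big_ord_recl /= subr0 sub0r.
have E1 : \sum_(i < n) F (n.+1%:Z - (bump 0 i)%:Z) = \sum_(i < n) F (n%:Z - i%:Z).
  by apply: eq_bigr => i _; congr F; rewrite /bump /=; lia.
have E2 : \sum_(i < n) F ((bump 0 i)%:Z - n.+1%:Z) = \sum_(i < n) F (i%:Z - n%:Z).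
  by apply: eq_bigr => i _; congr F; rewrite /bump /=; lia.
rewrite E1 E2; move: (F _) (F _) (F _) (\sum_(i < n) _) (\sum_(i < n) _) => a b c d e.
by rewrite [LHS](AC (2*3) (3*(1*4)*(2*5))).
Qed.

Lemma diff_sum (V : zmodType) L (F : int -> V) :
  \sum_(p : 'I_L * 'I_L) F (p.1%:Z - p.2%:Z) = \sum_(x <- zr L) F x *+ (L - `|x|).
Proof.
rewrite -(pair_bigA _ (fun i j : 'I_L => F (i%:Z - j%:Z))) /=.
elim: L => [|L IH]; first by rewrite big_ord0 zr0 mulr0n.
rewrite big_ord_recr /=.
have -> : \sum_(i < L) \sum_(j < L.+1) F (i%:Z - j%:Z) =
    \sum_(i < L) \sum_(j < L) F (i%:Z - j%:Z) + \sum_(i < L) F (i%:Z - L%:Z).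
  by rewrite -big_split /=; apply: eq_bigr => i _; rewrite big_ord_recr.
rewrite big_ord_recr /= IH subrr.
have -> : \sum_(x <- zr L.+1) F x *+ (L.+1 - `|x|) = \sum_(x <- zr L) F x *+ (L - `|x|) + \sum_(x <- zr L) F x.
  rewrite zrS (_ : (L.+1 - absz (L.+1%:Z))%N = 0%N); last by lia.
  rewrite !mulr0n !add0r -big_split /= !big_seq; apply: eq_bigr => x; rewrite mem_zr => xL.
  by rewrite (_ : (L.+1 - `|x| = (L - `|x|).+1)%N) ?mulrSr //; lia.
rewrite (zr_symmetric L F) -!addrA; congr (_ + _).
by rewrite [LHS](AC (1*2) (3*(2*1))).
Qed.

End difference_sums.

Section circle_method.
Context (R : realType).
Implicit Types (B n m d q k J Q W : nat) (x y t mu : R).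

Definition tent J (x : int) : R := (J - `|x|)%:R / J%:R.

Lemma tent_ge0 J (x : int) : 0 <= tent J x. Proof. by rewrite /tent divr_ge0. Qed.

Lemma tent_le1 J (x : int) : (0 < J)%N -> tent J x <= 1.
Proof. by move=> J0; rewrite /tent ler_pdivrMr ?ltr0n // mul1r ler_nat leq_subr. Qed.

Lemma diff_sum_tent J (F : int -> R) : (0 < J)%N ->
  J%:R^-1 * \sum_(p : 'I_J * 'I_J) F (p.1%:Z - p.2%:Z) = \sum_(x <- zr J) tent J x * F x.
Proof.
move=> J0; rewrite diff_sum mulr_sumr; apply: eq_bigr => x _.
by rewrite /tent -[F x *+ _]mulr_natl; ring.
Qed.

Lemma fejer_tent J t : (0 < J)%N -> (fejer J t)%:C%C = \sum_(x <- zr J) (tent J x)%:C%C * ce (x%:~R * t).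
Proof.
move=> J0; have Jn : J%:R != 0 :> R by rewrite pnatr_eq0 -lt0n.
have -> : (fejer J t)%:C%C = (J%:R^-1)%:C%C * (J%:R * fejer J t)%:C%C.
  by rewrite -rmorphM mulrA mulVf // mul1r.
rewrite -fejer_ce //.
have -> : \sum_(p : 'I_J * 'I_J) ce ((p.1%:R - p.2%:R) * t) = \sum_(p : 'I_J * 'I_J) (fun x : int => ce (x%:~R * t)) (p.1%:Z - p.2%:Z).
  by apply: eq_bigr => p _; rewrite intrB -!pmulrn.
rewrite (diff_sum J (fun x : int => ce (x%:~R * t))) mulr_sumr; apply: eq_bigr => x _.
by rewrite /tent rmorphM /= rmorph_nat -[ce _ *+ _]mulr_natl; ring.
Qed.

(** Integer vectors with coordinates of absolute value at most [2 B], shifted to ordinals so that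
    they form a finite type; [coord] undoes the shift. *)
Definition boxv B k := {ffun 'I_k -> 'I_((2 * B).*2.+1)}.
Definition coord B (i : 'I_((2 * B).*2.+1)) : int := i%:Z - (2 * B)%:Z.
Definition sqn B k (v : boxv B k) : nat := \sum_(i < k) (absz (coord (v i)) ^ 2)%N.
Definition wgt B k (v : boxv B k) : R := \prod_(i < k) trap R B (coord (v i)).

Lemma wgt_ge0 B k (v : boxv B k) : 0 <= wgt v.
Proof. by apply: prodr_ge0 => i _; exact: trap_ge0. Qed.

Lemma wgt1 B k (v : boxv B k) : (0 < B)%N -> (sqn v <= B ^ 2)%N -> wgt v = 1.
Proof.
move=> B0 h; apply: big1 => i _; apply: trap1 => //.
rewrite -leq_sqr; apply: leq_trans h; rewrite /sqn (bigD1 i) //=; exact: leq_addr.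
Qed.

Lemma sqn_le B k (v : boxv B k) : (sqn v <= k * (2 * B) ^ 2)%N.
Proof.
apply: (@leq_trans (\sum_(i < k) (2 * B) ^ 2)); last by rewrite sum_nat_const card_ord.
by apply: leq_sum => i _; rewrite leq_sqr /coord; have := ltn_ord (v i); lia.
Qed.

Lemma wsum_pow B k y : wsum B y ^+ k = \sum_(v : boxv B k) (wgt v)%:C%C * ce (y * (sqn v)%:R).
Proof.
have -> : wsum B y ^+ k = \prod_(i < k) wsum B y by rewrite prodr_const card_ord.
rewrite /wsum; under eq_bigr do rewrite big_zr.
rewrite bigA_distr_bigA /=; apply: eq_bigr => v _.
rewrite big_split /= /wgt rmorph_prod /=; congr (_ * _).
rewrite -ce_sum -mulr_sumr /sqn natr_sum; congr (ce (_ * _)); apply: eq_bigr => i _.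
by rewrite -/(coord (v i)) natrX natr_absz intr_norm real_normK // realz.
Qed.

Lemma cos_orth Q (z : int) : (0 < Q)%N -> (absz z < Q)%N ->
  \sum_(j < Q) cos (2 * pi * (j%:R / Q%:R * z%:~R)) = (if z == 0 then Q%:R else 0) :> R.
Proof.
move=> Q0 zQ; have := congr1 (@complex.Re R) (@sum_ce_full R Q z Q0).
rewrite Re_sum => E.
transitivity (\sum_(s < Q) complex.Re (ce (z%:~R * s%:R / Q%:R : R))).
  by apply: eq_bigr => j _; rewrite /=; congr cos; ring.
rewrite E; have -> : (Q%:Z %| z)%Z = (z == 0).
  apply/idP/idP => [/dvdzP[n zE]|/eqP ->]; last exact: dvdz0.
  have := zQ; rewrite zE abszM; case: (n =P 0) => [-> //|/eqP n0].
  by rewrite ltnNge leq_pmull // lt0n absz_eq0.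
by case: ifP.
Qed.

(** Orthogonality of characters modulo [Q]. No wrap-around occurs because [Q] exceeds [sqn v + W];
    since [a] is even, cosines and the real part are enough. *)
Lemma circle_mean B k W Q (a : R -> R) : (0 < Q)%N -> (forall v : boxv B k, (sqn v + W < Q)%N) ->
  (forall x, a (- x) = a x) -> (forall n, (W < n)%N -> a n%:R = 0) ->
  \sum_(v : boxv B k) wgt v * a (sqn v)%:R = Q%:R^-1 *
   \sum_(j < Q) complex.Re (wsum B (j%:R / Q%:R) ^+ k) *
     \sum_(m < W.*2.+1) a (m%:R - W%:R) * cos (2 * pi * (j%:R / Q%:R * (m%:R - W%:R))).
Proof.
move=> Q0 hQ ev a0; have Qn : Q%:R != 0 :> R by rewrite pnatr_eq0 -lt0n.
have E : \sum_(j < Q) complex.Re (wsum B (j%:R / Q%:R) ^+ k) *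
     \sum_(m < W.*2.+1) a (m%:R - W%:R) * cos (2 * pi * (j%:R / Q%:R * (m%:R - W%:R))) =
  \sum_(v : boxv B k) wgt v * \sum_(m < W.*2.+1) a (m%:R - W%:R) *
    \sum_(j < Q) cos (2 * pi * (j%:R / Q%:R * (sqn v)%:R)) * cos (2 * pi * (j%:R / Q%:R * (m%:R - W%:R))).
  under eq_bigr => j _ do rewrite wsum_pow Re_sum mulr_suml.
  rewrite exchange_big /=; apply: eq_bigr => v _; rewrite mulr_sumr.
  under eq_bigr => j _ do rewrite mulr_sumr.
  rewrite exchange_big /=; apply: eq_bigr => m _; rewrite mulr_sumr mulr_sumr; apply: eq_bigr => j _.
  by ring.
rewrite E mulr_sumr; apply: eq_bigr => v _; rewrite mulrCA; congr (_ * _).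
set n := sqn v.
(* A product of cosines detects both signs, each with weight 1/2. *)
have inner (m : 'I_W.*2.+1) : \sum_(j < Q) cos (2 * pi * (j%:R / Q%:R * n%:R)) * cos (2 * pi * (j%:R / Q%:R * (m%:R - W%:R))) =
   Q%:R / 2 * ((n%:Z + (m%:Z - W%:Z) == 0)%:R + (n%:Z - (m%:Z - W%:Z) == 0)%:R) :> R.
  have hv := hQ v; have hm := ltn_ord m.
  have c1 := @cos_orth Q (n%:Z + (m%:Z - W%:Z)) Q0; have c2 := @cos_orth Q (n%:Z - (m%:Z - W%:Z)) Q0.
  have {}c1 := c1 ltac:(rewrite -/n in hv; lia); have {}c2 := c2 ltac:(rewrite -/n in hv; lia).
  transitivity (2^-1 * (\sum_(j < Q) cos (2 * pi * (j%:R / Q%:R * (n%:Z + (m%:Z - W%:Z))%:~R)) +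
     \sum_(j < Q) cos (2 * pi * (j%:R / Q%:R * (n%:Z - (m%:Z - W%:Z))%:~R))) : R).
    rewrite -big_split /= mulr_sumr; apply: eq_bigr => j _.
    rewrite !(intrD, intrN) -!pmulrn.
    have -> : 2 * pi * (j%:R / Q%:R * (n%:R + (m%:R - W%:R))) = 2 * pi * (j%:R / Q%:R * n%:R) + 2 * pi * (j%:R / Q%:R * (m%:R - W%:R)) :> R by ring.
    have -> : 2 * pi * (j%:R / Q%:R * (n%:R - (m%:R - W%:R))) = 2 * pi * (j%:R / Q%:R * n%:R) - 2 * pi * (j%:R / Q%:R * (m%:R - W%:R)) :> R by ring.
    by rewrite cosD cosB; field.
  by rewrite c1 c2; do 2!case: eqP => _ /=; field.
under eq_bigr => m _ do rewrite inner mulrCA mulrDr.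
rewrite -mulr_sumr mulrA (_ : Q%:R^-1 * (Q%:R / 2) = 2^-1); last by field.
rewrite big_split /=.
have [nW|nW] := leqP n W; last first.
  rewrite a0 // !big1 ?addr0 ?mulr0 // => m _; have := ltn_ord m => hm.
    by rewrite (_ : (_ == 0) = false) ?mulr0 //; lia.
  by rewrite (_ : (_ == 0) = false) ?mulr0 //; lia.
have m1 : (W - n < W.*2.+1)%N by lia.
have m2 : (W + n < W.*2.+1)%N by lia.
rewrite (bigD1 (Ordinal m1)) //= [X in _ + X + _]big1 ?addr0; last first.
  by move=> m; rewrite -val_eqE /= => hm; rewrite (_ : (_ == 0) = false) ?mulr0 //; lia.
rewrite [X in _ = _ * (_ + X)](bigD1 (Ordinal m2)) //= [X in _ = _ * (_ + (_ + X))]big1 ?addr0; last first.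
  by move=> m; rewrite -val_eqE /= => hm; rewrite (_ : (_ == 0) = false) ?mulr0 //; lia.
have -> : (n%:Z + ((W - n)%N%:Z - W%:Z) == 0) by lia.
have -> : (n%:Z - ((W + n)%N%:Z - W%:Z) == 0) by lia.
have -> : (W - n)%:R - W%:R = - n%:R :> R by rewrite natrB //; ring.
have -> : (W + n)%:R - W%:R = n%:R :> R by rewrite natrD; ring.
by rewrite ev !mulr1; move: (a n%:R) => z; field.
Qed.

(** A weighted count of the vectors with square norm near [mu] at scale [Q / J]. It is visibly
    nonnegative, and by [fmeanE] it is also the tent-weighted sum of a power of the theta sum over
    the arc at 0. *)
Definition fmean B k J Q mu : R := \sum_(v : boxv B k) wgt v * fejer J (((sqn v)%:R - mu) / Q%:R).

Lemma fmean_ge0 B k J Q mu : 0 <= fmean B k J Q mu.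
Proof. by apply: sumr_ge0 => v _; rewrite mulr_ge0 ?wgt_ge0 ?fejer_ge0. Qed.

Lemma fmeanE B k J Q mu : (0 < J)%N -> (fmean B k J Q mu)%:C%C =
  \sum_(x <- zr J) (tent J x)%:C%C * (wsum B (x%:~R / Q%:R) ^+ k * ce (- (x%:~R / Q%:R * mu))).
Proof.
move=> J0; rewrite /fmean rmorph_sum /=.
under [RHS]eq_bigr => x _ do rewrite wsum_pow mulr_suml mulr_sumr.
rewrite exchange_big /=; apply: eq_bigr => v _; rewrite rmorphM /= fejer_tent // mulr_sumr.
apply: eq_bigr => x _; rewrite mulrCA -!mulrA; congr (_ * (_ * _)).
by rewrite -ceD; congr ce; ring.
Qed.

Lemma abel_bound (E F : nat -> R[i]) (M V : R) n :
  (forall i, (i <= n.+1)%N -> cabs (\sum_(j < i) E j) <= M) ->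
  cabs (F n) + \sum_(i < n) cabs (F i.+1 - F i) <= V ->
  cabs (\sum_(i < n.+1) E i * F i) <= M * V.
Proof.
move=> hE hV; pose P i := \sum_(j < i) E j.
have id m : \sum_(i < m.+1) E i * F i = P m.+1 * F m - \sum_(i < m) P i.+1 * (F i.+1 - F i).
  elim: m => [|m IH]; first by rewrite big_ord1 big_ord0 /P big_ord1 subr0.
  by rewrite big_ord_recr /= IH [\sum_(i < m.+1) _]big_ord_recr /= /P [\sum_(j < m.+2) _]big_ord_recr /=; ring.
have M0 : 0 <= M by apply: le_trans (hE 0%N _) => //; exact: cabs_ge0.
rewrite id; apply: le_trans (cabsB _ _) _; apply: le_trans (ler_wpM2l M0 hV).
rewrite mulrDr; apply: lerD.
  by rewrite cabsM; apply: ler_wpM2r; [exact: cabs_ge0|exact: hE].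
apply: le_trans (cabs_sum _ _ _) _; rewrite mulr_sumr; apply: ler_sum => i _.
rewrite cabsM; apply: ler_wpM2r; first exact: cabs_ge0.
by apply: hE; rewrite ltnS ltnW.
Qed.

Lemma periodic_partial_sums (E : nat -> R[i]) d n (M : R) : (0 < d)%N -> (forall i, E (i + d)%N = E i) ->
  \sum_(i < d) E i = 0 -> (forall i, cabs (E i) <= M) -> cabs (\sum_(i < n) E i) <= M * d%:R.
Proof.
move=> d0 per z hM; have M0 : 0 <= M by apply: le_trans (hM 0%N); exact: cabs_ge0.
elim/ltn_ind : n => n IH; have [nd|dn] := ltnP n d.
  apply: le_trans (cabs_sum _ _ _) _.
  apply: (@le_trans _ _ (\sum_(i < n) M)); first by apply: ler_sum => i _.
  by rewrite sumr_const card_ord -[leLHS]mulr_natr; apply: ler_wpM2l; rewrite // ler_nat ltnW.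
rewrite -(subnKC dn) big_split_ord /= z add0r.
under eq_bigr => i _ do rewrite addnC per.
by apply: IH; lia.
Qed.

(** Summation by parts: the character minus its mean is periodic modulo [d] with sum 0 over a
    period, so its partial sums are at most [2 d], while the remaining factor has variation
    [O(1 + B^2 |x|)]. *)
Lemma wsum_gsum B d (b : int) x : (0 < B)%N -> (0 < d)%N ->
  cabs (wsum B (b%:~R / d%:R + x) - gsum R d b * wsum B x) <= 2 * d%:R * (5 + 160 * (B%:R ^+ 2 * `|x|)).
Proof.
move=> B0 d0; have dn : d%:R != 0 :> R by rewrite pnatr_eq0 -lt0n.
have Bp : 0 < B%:R :> R by rewrite ltr0n.
have B1 : 1 <= B%:R :> R by rewrite ler1n.
pose cz (i : nat) : int := i%:Z - (2 * B)%:Z.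
pose e0 (i : nat) : R[i] := ce (b%:~R * (cz i)%:~R ^+ 2 / d%:R).
pose E i := e0 i - gsum R d b.
pose F (i : nat) : R[i] := (trap R B (cz i))%:C%C * ce (x * (cz i)%:~R ^+ 2).
have -> : wsum B (b%:~R / d%:R + x) - gsum R d b * wsum B x = \sum_(i < (2 * B).*2.+1) E i * F i.
  rewrite /wsum !big_zr mulr_sumr -sumrB; apply: eq_bigr => i _.
  rewrite -/(cz i) /E /F /e0.
  have -> : (b%:~R / d%:R + x) * (cz i)%:~R ^+ 2 = b%:~R * (cz i)%:~R ^+ 2 / d%:R + x * (cz i)%:~R ^+ 2 by ring.
  by rewrite ceD; ring.
(* A natural number congruent to [-2 B] modulo [d], so that the shifted coordinate can be reduced
   with [modn]. *)
pose s := (2 * B * d.-1)%N.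
have e0E i : e0 i = ce (b%:~R * ((i + s) %% d)%:R ^+ 2 / d%:R).
  rewrite modn_ce // /e0.
  have -> : (i + s)%:R = (cz i)%:~R + (2 * B)%:R * d%:R :> R.
    rewrite /cz intrB -!pmulrn /s natrD [(2 * B * d.-1)%:R]natrM.
    have -> : d%:R = d.-1%:R + 1 :> R by rewrite natr1 prednK.
    by ring.
  have -> : b%:~R * ((cz i)%:~R + (2 * B)%:R * d%:R) ^+ 2 / d%:R =
    b%:~R * (cz i)%:~R ^+ 2 / d%:R + (b * (2%:Z * cz i * (2 * B)%:Z + (2 * B)%:Z * (2 * B)%:Z * d%:Z))%:~R :> R.
    by rewrite !(intrM, intrD) -!pmulrn; field.
  by rewrite ceDint.
have per i : E (i + d)%N = E i by rewrite /E !e0E addnAC modnDr.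
have z : \sum_(i < d) E i = 0.
  rewrite /E sumrB sumr_const card_ord -[gsum _ _ _ *+ _]mulr_natl /gsum.
  have -> : \sum_(i < d) e0 i = \sum_(r < d) ce (b%:~R * r%:R ^+ 2 / d%:R).
    pose f (a : 'I_d) : 'I_d := Ordinal (ltn_pmod (a + s) d0).
    have finj : injective f.
      move=> a1 a2 /(congr1 val) /= /eqP; rewrite eqn_modDr => /eqP.
      by rewrite !modn_small // => h; apply: val_inj.
    by rewrite [RHS](reindex_inj finj); apply: eq_bigr => i _; rewrite e0E.
  by rewrite mulrA -(rmorph_nat (real_complex R)) -rmorphM mulfV // mul1r subrr.
have g1 : cabs (gsum R d b) <= 1.
  rewrite /gsum cabsM cabs_real ger0_norm ?invr_ge0 // mulrC ler_pdivrMr ?ltr0n // mul1r.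
  apply: le_trans (cabs_sum _ _ _) _; under eq_bigr do rewrite cabs_ce.
  by rewrite sumr_const card_ord.
have hE i : cabs (E i) <= 2 by apply: le_trans (cabsB _ _) _; rewrite cabs_ce; rlra.
apply: abel_bound => [i _|]; first exact: periodic_partial_sums.
have Fn : cabs (F (2 * B).*2) <= 1.
  by rewrite /F cabsM cabs_ce mulr1 cabs_real ger0_norm ?trap_ge0 ?trap_le1.
have dF (i : 'I_(2 * B).*2) : cabs (F i.+1 - F i) <= B%:R^-1 + 40 * (B%:R * `|x|).
  have czS : cz i.+1 = cz i + 1 by rewrite /cz; lia.
  rewrite /F czS; set t1 := trap _ _ _; set t0 := trap _ _ _; set c1 := ce _; set c0 := ce _.
  have -> : t1%:C%C * c1 - t0%:C%C * c0 = (t1 - t0)%:C%C * c1 + t0%:C%C * (c1 - c0) by rewrite rmorphB /=; ring.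
  apply: le_trans (cabsD _ _) _; apply: lerD.
    by rewrite cabsM cabs_ce mulr1 cabs_real; exact: trap_diff.
  rewrite cabsM cabs_real ger0_norm ?trap_ge0 //.
  apply: (@le_trans _ _ (1 * cabs (c1 - c0))); first by apply: ler_wpM2r; [exact: cabs_ge0|exact: trap_le1].
  rewrite mul1r; apply: le_trans (cabs_ceB _ _) _.
  have -> : x * (cz i + 1)%:~R ^+ 2 - x * (cz i)%:~R ^+ 2 = x * (2 * (cz i)%:~R + 1) by rewrite intrD; ring.
  have cb : `|2 * (cz i)%:~R + 1| <= 5 * B%:R :> R.
    have : (`|2 * cz i + 1| <= 5 * B%:Z)%R by rewrite /cz; have := ltn_ord i; lia.
    by rewrite -(ler_int R) intr_norm !(intrM, intrD) -!pmulrn.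
  have := pi_lt4 R; have := pi_ge2 R => p1 p2.
  rewrite normrM; have -> : 40 * (B%:R * `|x|) = 8 * (`|x| * (5 * B%:R)) :> R by ring.
  apply: ler_pM; [rlra|pos|rlra|].
  by apply: ler_wpM2l.
apply: (@le_trans _ _ (1 + \sum_(i < (2 * B).*2) (B%:R^-1 + 40 * (B%:R * `|x|)))).
  by apply: lerD => //; apply: ler_sum => i _; exact: dF.
rewrite sumr_const card_ord -[(_ + _) *+ _]mulr_natl.
have -> : (2 * B).*2%:R = 4 * B%:R :> R by rewrite -muln2 !natrM; ring.
rewrite mulrDr -mulrA mulfV ?gt_eqF // mulr1.
by rewrite le_eqVlt; apply/orP; left; apply/eqP; ring.
Qed.

End circle_method.

Lemma int_between (b : int) (d : nat) : -1 < b -> b < d%:Z + 1 -> exists b0 : nat, b = b0%:Z /\ (b0 <= d)%N.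
Proof. by move=> h1 h2; exists (absz b); split; lia. Qed.

(** * The minor arcs *)

Section remainder.
Context (R : realType).
Implicit Types (B n m d q k J Q W D : nat) (x y t s : R).

Lemma shifted_sum_le (g : nat -> R) n s (P K : R) : 0 < P -> 0 < K -> (forall j, 0 <= g j <= P) ->
  (forall j, g j * (j%:R - s) ^+ 2 <= K) -> \sum_(j < n) g j <= 4 * P + 4 * Num.sqrt (P * K).
Proof.
move=> P0 K0 hP hK; pose j0 := Num.truncn s.
have up j : (j0.+2 <= j)%N -> (j - j0.+1)%:R <= j%:R - s.
  move=> hj; have : s < j0.+1%:R by exact: truncnS_gt.
  by rewrite natrB; [rlra|lia].
have dn j : (j < j0)%N -> (j0 - j)%:R <= s - j%:R.
  move=> hj; have : j0%:R <= s.
    have [s0|s0] := leP 0 s; first by have /andP[] := truncn_itv s0.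
    have h0 : ~~ (1 <= s) by rewrite -ltNge; rlra.
    by move: hj; rewrite /j0 (elimT (truncn0Pn _) h0).
  by rewrite natrB; [rlra|lia].
have term (i j : nat) : (0 < i)%N -> i%:R <= `|j%:R - s| -> g j <= Num.min P (K / i%:R ^+ 2).
  move=> i0 hi; have ip : 0 < i%:R :> R by rewrite ltr0n.
  rewrite le_min; have /andP[gj0 ->] := hP j => /=.
  rewrite ler_pdivlMr ?exprn_gt0 //; apply: le_trans (hK j); apply: ler_wpM2l => //.
  by rewrite -[leRHS]real_normK ?num_real // lerXn2r ?nnegrE.
have g0 j : 0 <= g j by have /andP[] := hP j.
pose N := (n + j0.+2)%N.
apply: (@le_trans _ _ (\sum_(0 <= j < N) g j)).
  rewrite -(big_mkord xpredT g) [leRHS](big_cat_nat (n := n)) //=; last by rewrite /N leq_addr.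
  by rewrite lerDl sumr_ge0.
rewrite (big_cat_nat (n := j0)) //=; last by rewrite /N; lia.
rewrite [X in _ + X](big_cat_nat (n := j0.+2)) //=; [|by lia|by rewrite /N; lia].
have s2 : \sum_(j0 <= j < j0.+2) g j <= 2 * P.
  rewrite big_nat_recr ?leqnSn //= big_nat1.
  by have /andP[_ ?] := hP j0; have /andP[_ ?] := hP j0.+1; rlra.
have s1 : \sum_(0 <= j < j0) g j <= P + 2 * Num.sqrt (P * K).
  apply: le_trans (sum_min_inv_sqr j0 P0 K0); rewrite big_nat_rev /= [leRHS]big_add1 /= !big_nat; apply: ler_sum => j /andP[_ hj].
  apply: term => //; rewrite add0n; have h1 := dn (j0 - j.+1)%N; rewrite distrC.
  apply: le_trans (ler_norm _); apply: le_trans (h1 _); [|by lia].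
  by rewrite ler_nat; lia.
have s3 : \sum_(j0.+2 <= j < N) g j <= P + 2 * Num.sqrt (P * K).
  apply: le_trans (sum_min_inv_sqr n P0 K0); rewrite [leRHS]big_add1 /= /N -{1}(add0n j0.+2) big_addn addnK !big_nat.
  apply: ler_sum => j /andP[_ hj]; apply: term => //.
  apply: le_trans (ler_norm _); apply: le_trans (up (j + j0.+2)%N _); [|by lia].
  by rewrite ler_nat; lia.
rlra.
Qed.

(** Put [F = f^2 d]. Three factors [f^2] give [F^3 / d^3]: two factors [F] are spent on summability
    over [j], and the third carries the smallness, either through [W] or through [d > D]. The
    [d + 1] numerators leave the convergent sum of [d^-2]. *)
Lemma minor_arcs q : (3 <= q)%N -> exists C : R, 0 < C /\ forall B Q D (C0 : R) (W : nat -> R),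
  (0 < B)%N -> (B ^ 2 <= Q)%N -> (0 < D)%N -> 0 < C0 ->
  (forall j, 0 <= W j <= 1) ->
  (forall j d (b : int), (j < Q)%N -> (0 < d <= D)%N -> coprime `|b| d ->
     C0 * W j <= B%:R ^+ 2 * `|j%:R / Q%:R - b%:~R / d%:R|) ->
  \sum_(j < Q) W j * cabs (wsum B (j%:R / Q%:R)) ^+ (2 * q) <= C * (D%:R^-1 + C0^-1) * B%:R ^+ (2 * q - 2) * Q%:R.
Proof.
move=> q3; have q1 : (2 * q)%N = (2 * (q - 3) + 2 * 3)%N by lia.
have q4 : (2 * q - 4)%N = (2 * (q - 3) + 2)%N by lia.
have q2 : (2 * q - 2)%N = (2 * q - 4 + 2)%N by lia.
have [C1 [C10 hw]] := weyl R; pose C := C1 + 1.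
have Cp : 0 < C by rewrite /C; rlra.
exists (C ^+ q * (30 * 10)); split; first by pos.
move=> B Q D C0 W B0 BQ D0 C00 hW hT.
have Bp : 0 < B%:R :> R by rewrite ltr0n.
have B1 : 1 <= B%:R :> R by rewrite ler1n.
have Q0 : (0 < Q)%N by apply: leq_trans BQ; rewrite expn_gt0 B0.
have Qp : 0 < Q%:R :> R by rewrite ltr0n.
have BQr : B%:R ^+ 2 <= Q%:R :> R by rewrite -natrX ler_nat.
have C0i : 0 < C0^-1 by rewrite invr_gt0.
(* A Cauchy kernel combining the two bounds of [weyl]: [F <= C B^2] and [F |be| <= C] give
   [F^2 <= 2 C^2 lam]. *)
pose lam (b d j : nat) : R := B%:R ^+ 4 / (1 + B%:R ^+ 4 * (j%:R / Q%:R - b%:R / d%:R) ^+ 2).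
have den x : 0 < 1 + B%:R ^+ 4 * x ^+ 2 :> R.
  have : 0 <= B%:R ^+ 4 * x ^+ 2 :> R by pos.
  rlra.
have lam0 b d j : 0 <= lam b d j by rewrite /lam divr_ge0 ?ltW //; pos.
(* For small denominators the gain comes from the smallness of [W] near the arc centre; for large
   ones it comes from the tail of the sum of [d^-2]. *)
pose co d : R := if (d <= D)%N then C0^-1 else 1.
have co0 d : 0 <= co d by rewrite /co; case: ifP => // _; exact: ltW.
pose M := 2 * C ^+ q * B%:R ^+ (2 * q - 4).
have M0 : 0 <= M by rewrite /M; pos.
have pt j : (j < Q)%N -> W j * cabs (wsum B (j%:R / Q%:R)) ^+ (2 * q) <=
    \sum_(1 <= d < (16 * B).+1) \sum_(b < d.+1) M * co d * (d%:R ^+ 3)^-1 * lam b d j.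
  move=> jQ; have [d [b [d1 dB cbd hb]]] := @dirichlet_approx R (j%:R / Q%:R) (16 * B) ltac:(lia).
  have dp : 0 < d%:R :> R by rewrite ltr0n.
  set be := j%:R / Q%:R - b%:~R / d%:R in hb.
  have {}hb : `|be| <= (16 * B%:R * d%:R)^-1 by rewrite natrM in hb.
  have [w1 w2] := hw B d b be B0 d1 dB cbd hb.
  have yE : b%:~R / d%:R + be = j%:R / Q%:R by rewrite /be addrC subrK.
  rewrite yE in w1 w2.
  (* Since [j / Q] lies in [[0, 1]] and [|d be| <= 1/16], the numerator lies between 0 and [d]; the
     unknown fraction can then be majorised by a sum over all of them. *)
  have [b0 E] : exists b0 : nat, b = b0%:Z /\ (b0 <= d)%N.
    have y0 : 0 <= j%:R / Q%:R :> R by rewrite divr_ge0.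
    have y1 : j%:R / Q%:R <= 1 :> R by rewrite ler_pdivrMr // mul1r ler_nat ltnW.
    have bd : `|d%:R * be| <= 1 / 16.
      rewrite normrM (ger0_norm (ltW dp)); apply: le_trans (ler_wpM2l (ltW dp) hb) _.
      rewrite invfM mulrCA mulfV ?gt_eqF // mulr1 invfM mul1r -[leRHS]mulr1 ler_pM2l ?invr_gt0 //.
      by rewrite invf_le1.
    have dE : b%:~R = d%:R * (j%:R / Q%:R) - d%:R * be.
      by rewrite /be; field; rewrite !gt_eqF.
    have h1 : 0 <= d%:R * (j%:R / Q%:R) :> R by pos.
    have h2 : d%:R * (j%:R / Q%:R) <= d%:R :> R by rewrite -[leRHS]mulr1 ler_pM2l.
    move: bd; rewrite ler_norml => /andP[bd1 bd2].
    have c1 : (-1)%:~R < b%:~R :> R by rewrite dE mulrN1z; rlra.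
    have c2 : b%:~R < (d%:Z + 1)%:~R :> R by rewrite dE intrD -pmulrn; rlra.
    move: c1 c2; rewrite !ltr_int => c1 c2.
    exact: int_between.
  have [bE b0d] := E.
  have dI : d \in index_iota 1 (16 * B).+1 by rewrite mem_index_iota d1 ltnS.
  have b0d' : (b0 < d.+1)%N by rewrite ltnS.
  have nn d' (b' : 'I_d'.+1) : 0 <= M * co d' * (d'%:R ^+ 3)^-1 * lam b' d' j.
    by have := co0 d'; have := lam0 b' d' j => ? ?; pos.
  rewrite (big_rem d) //= (bigD1 (Ordinal b0d')) //= -addrA.
  apply: ler_wpDr; first by rewrite addr_ge0 // sumr_ge0 // => i _; rewrite ?sumr_ge0.
  have lamE : lam b0 d j = B%:R ^+ 4 / (1 + B%:R ^+ 4 * be ^+ 2) by rewrite /lam /be bE -pmulrn.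
  set f := cabs _ in w1 w2 *.
  have f0 : 0 <= f by exact: cabs_ge0.
  pose F := f ^+ 2 * d%:R.
  have F0 : 0 <= F by rewrite /F; pos.
  have F1 : F <= C * B%:R ^+ 2 by apply: le_trans w1 _; apply: ler_wpM2r; [pos|rewrite /C; rlra].
  have F2 : F * `|be| <= C by apply: le_trans w2 _; rewrite /C; rlra.
  have Fsq : F ^+ 2 <= C ^+ 2 * 2 * lam b0 d j.
    rewrite lamE mulrA ler_pdivlMr // mulrDr mulr1.
    have : F ^+ 2 <= C ^+ 2 * B%:R ^+ 4.
      have -> : C ^+ 2 * B%:R ^+ 4 = (C * B%:R ^+ 2) ^+ 2 by ring.
      by rewrite lerXn2r ?nnegrE //; pos.
    have : F ^+ 2 * (B%:R ^+ 4 * be ^+ 2) <= C ^+ 2 * B%:R ^+ 4.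
      have -> : F ^+ 2 * (B%:R ^+ 4 * be ^+ 2) = (F * `|be|) ^+ 2 * B%:R ^+ 4.
        by rewrite -[be ^+ 2]real_normK ?num_real //; ring.
      by apply: ler_wpM2r; [pos|rewrite lerXn2r ?nnegrE //; pos].
    rlra.
  have /andP[Wj0 Wj1] := hW j.
  have WF : W j * F <= co d * C * B%:R ^+ 2.
    rewrite /co; case: ifP => dD.
      have := hT j d b jQ (introT andP (conj d1 dD)) cbd; rewrite -/be => hj.
      have -> : C0^-1 * C * B%:R ^+ 2 = C0^-1 * (B%:R ^+ 2 * C) by ring.
      have C0n : C0 != 0 by rewrite gt_eqF.
      have -> : W j = C0^-1 * (C0 * W j) by rewrite mulKf.
      rewrite -[C0^-1 * _ * F]mulrA ler_pM2l //.
      apply: le_trans (ler_wpM2r F0 hj) _; rewrite -mulrA; apply: ler_wpM2l; first by pos.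
      by rewrite mulrC.
    by rewrite mul1r -[leRHS]mul1r; apply: ler_pM.
  have -> : f ^+ (2 * q) = (f ^+ 2) ^+ (q - 3) * (f ^+ 2) ^+ 3 by rewrite -!exprM -exprD -q1.
  have f2 : f ^+ 2 = F / d%:R by rewrite /F mulfK // gt_eqF.
  have f2le : f ^+ 2 <= C * B%:R ^+ 2.
    rewrite f2 ler_pdivrMr //; apply: le_trans F1 _; rewrite -[leLHS]mulr1.
    by apply: ler_wpM2l; [pos|rewrite ler1n].
  have fq : (f ^+ 2) ^+ (q - 3) <= (C * B%:R ^+ 2) ^+ (q - 3) by rewrite lerXn2r ?nnegrE //; pos.
  have f3 : (f ^+ 2) ^+ 3 = F ^+ 2 * F * (d%:R ^+ 3)^-1 by rewrite f2; field; rewrite gt_eqF.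
  rewrite mulrCA f3.
  have -> : M * co d * (d%:R ^+ 3)^-1 * lam b0 d j = (C * B%:R ^+ 2) ^+ (q - 3) *
      ((C ^+ 2 * 2 * lam b0 d j) * (co d * C * B%:R ^+ 2) * (d%:R ^+ 3)^-1).
    rewrite /M exprMn -exprM.
    have -> : C ^+ q = C ^+ (q - 3) * C ^+ 3 by rewrite -exprD subnK.
    have -> : B%:R ^+ (2 * q - 4) = B%:R ^+ (2 * (q - 3)) * B%:R ^+ 2 :> R by rewrite -exprD -q4.
    by ring.
  have -> : W j * (F ^+ 2 * F / d%:R ^+ 3) = F ^+ 2 * (W j * F) / d%:R ^+ 3 by ring.
  apply: ler_pM => //; [by pos|by pos|].
  apply: ler_wpM2r; first by pos.
  by apply: ler_pM => //; pos.
apply: (@le_trans _ _ (\sum_(j < Q) \sum_(1 <= d < (16 * B).+1) \sum_(b < d.+1) M * co d * (d%:R ^+ 3)^-1 * lam b d j)).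
  by apply: ler_sum => j _; exact: pt.
have lamsum b d : \sum_(j < Q) lam b d j <= 8 * (B%:R ^+ 2 * Q%:R).
  apply: (@le_trans _ _ (4 * B%:R ^+ 4 + 4 * Num.sqrt (B%:R ^+ 4 * Q%:R ^+ 2))).
    apply: (@shifted_sum_le _ _ (b%:R / d%:R * Q%:R)); [by pos|by pos| |].
      move=> j; rewrite lam0 /= /lam ler_pdivrMr // -[leLHS]mulr1 ler_pM2l; last by pos.
      by rewrite lerDl; pos.
    move=> j; rewrite /lam mulrAC ler_pdivrMr //.
    have -> : (j%:R - b%:R / d%:R * Q%:R) ^+ 2 = Q%:R ^+ 2 * (j%:R / Q%:R - b%:R / d%:R) ^+ 2 :> R.
      rewrite -exprMn; congr (_ ^+ 2).
      by rewrite mulrBr [Q%:R * (j%:R / _)]mulrC divfK ?gt_eqF //; ring.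
    set z := (_ - _) ^+ 2; have : 0 <= Q%:R ^+ 2 :> R by pos.
    have -> : B%:R ^+ 4 * (Q%:R ^+ 2 * z) = Q%:R ^+ 2 * (B%:R ^+ 4 * z) :> R by ring.
    by rewrite mulrDr mulr1 lerDr.
  have -> : Num.sqrt (B%:R ^+ 4 * Q%:R ^+ 2) = B%:R ^+ 2 * Q%:R :> R.
    have -> : B%:R ^+ 4 * Q%:R ^+ 2 = (B%:R ^+ 2 * Q%:R) ^+ 2 :> R by ring.
    by rewrite sqrtr_sqr ger0_norm //; pos.
  have : B%:R ^+ 4 <= B%:R ^+ 2 * Q%:R :> R.
    have -> : B%:R ^+ 4 = B%:R ^+ 2 * B%:R ^+ 2 :> R by ring.
    by apply: ler_wpM2l => //; pos.
  rlra.
have swap : \sum_(j < Q) \sum_(1 <= d < (16 * B).+1) \sum_(b < d.+1) M * co d * (d%:R ^+ 3)^-1 * lam b d j =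
   \sum_(1 <= d < (16 * B).+1) \sum_(b < d.+1) M * co d * (d%:R ^+ 3)^-1 * \sum_(j < Q) lam b d j.
  rewrite exchange_big /=; apply: eq_bigr => d _; rewrite exchange_big /=; apply: eq_bigr => b _.
  by rewrite mulr_sumr.
rewrite swap.
have dsum d : (1 <= d)%N -> \sum_(b < d.+1) M * co d * (d%:R ^+ 3)^-1 * (\sum_(j < Q) lam b d j) <=
   16 * M * (B%:R ^+ 2 * Q%:R) * (co d * (d%:R ^+ 2)^-1).
  move=> d1; have dp : 0 < d%:R :> R by rewrite ltr0n.
  apply: (@le_trans _ _ (\sum_(b < d.+1) M * co d * (d%:R ^+ 3)^-1 * (8 * (B%:R ^+ 2 * Q%:R)))).
    by apply: ler_sum => b _; apply: ler_wpM2l => //; have := co0 d => ?; pos.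
  rewrite sumr_const card_ord -[leLHS]mulr_natl.
  have -> : 16 * M * (B%:R ^+ 2 * Q%:R) * (co d * (d%:R ^+ 2)^-1) = (2 * d%:R) * (M * co d / d%:R ^+ 3 * (8 * (B%:R ^+ 2 * Q%:R))).
    by field; rewrite gt_eqF.
  apply: ler_wpM2r; first by have := co0 d => ?; pos.
  have d1r : 1 <= d%:R :> R by rewrite ler1n.
  by rewrite -natr1; rlra.
apply: (@le_trans _ _ (\sum_(1 <= d < (16 * B).+1) 16 * M * (B%:R ^+ 2 * Q%:R) * (co d * (d%:R ^+ 2)^-1))).
  by rewrite !big_nat; apply: ler_sum => d /andP[d1 _]; exact: dsum.
rewrite -mulr_sumr.
have cosum : \sum_(1 <= d < (16 * B).+1) co d * (d%:R ^+ 2)^-1 <= 2 * (D%:R^-1 + C0^-1).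
  pose N := (16 * B + D)%N.
  apply: (@le_trans _ _ (\sum_(1 <= d < N.+1) co d * (d%:R ^+ 2)^-1)).
    rewrite [leRHS](big_cat_nat (n := (16 * B).+1)) //=; last by rewrite /N ltnS leq_addr.
    by rewrite lerDl sumr_ge0 // => d _; have := co0 d => ?; pos.
  rewrite (big_cat_nat (n := D.+1)) //=; last by rewrite /N ltnS leq_addl.
  have t2 : \sum_(D.+1 <= d < N.+1) co d * (d%:R ^+ 2)^-1 <= D%:R^-1.
    apply: le_trans (@sum_inv_sqr R D N D0); rewrite !big_nat; apply: ler_sum => d /andP[d1 _].
    by rewrite /co leqNgt d1 /= mul1r.
  have t1 : \sum_(1 <= d < D.+1) co d * (d%:R ^+ 2)^-1 <= 2 * C0^-1.
    have -> : \sum_(1 <= d < D.+1) co d * (d%:R ^+ 2)^-1 = C0^-1 * \sum_(1 <= d < D.+1) (d%:R ^+ 2)^-1.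
      rewrite mulr_sumr !big_nat; apply: eq_bigr => d /andP[_ d1].
      by rewrite /co -ltnS d1.
    rewrite mulrC ler_pM2r // big_ltn // expr1n invr1.
    have := @sum_inv_sqr R 1 D (leqnn _); rewrite invr1; rlra.
  have : 0 < D%:R^-1 :> R by rewrite invr_gt0 ltr0n.
  rlra.
apply: (@le_trans _ _ (16 * M * (B%:R ^+ 2 * Q%:R) * (2 * (D%:R^-1 + C0^-1)))).
  by apply: ler_wpM2l => //; pos.
have -> : 16 * M * (B%:R ^+ 2 * Q%:R) * (2 * (D%:R^-1 + C0^-1)) = 64 * (C ^+ q * (D%:R^-1 + C0^-1) * B%:R ^+ (2 * q - 2) * Q%:R).
  have -> : B%:R ^+ (2 * q - 2) = B%:R ^+ (2 * q - 4) * B%:R ^+ 2 :> R by rewrite -exprD -q2.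
  by rewrite /M; ring.
have -> : C ^+ q * (30 * 10) * (D%:R^-1 + C0^-1) * B%:R ^+ (2 * q - 2) * Q%:R = (30 * 10) * (C ^+ q * (D%:R^-1 + C0^-1) * B%:R ^+ (2 * q - 2) * Q%:R) by ring.
apply: ler_wpM2r; last by rlra.
have : 0 < D%:R^-1 :> R by rewrite invr_gt0 ltr0n.
by move=> ?; pos.
Qed.

End remainder.

(** * Partition of the residues into major arcs and a remainder *)

Section peaks.
Context (R : realType).
Implicit Types (B n m d q k J Q W D : nat).

(** The first component is the denominator, the second the numerator; 0 appears as the fraction
    [0/1]. *)
Definition peak D (p : 'I_D.+1 * 'I_D.+1) : bool := (p.2 < p.1)%N && coprime p.2 p.1.
Definition ppos Q D (p : 'I_D.+1 * 'I_D.+1) : int := (Q %/ p.1 * p.2)%N%:Z.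

Lemma periodic_int (V : Type) Q (F : int -> V) : (forall z, F (z + Q%:Z) = F z) ->
  forall (n : int) z, F (z + n * Q%:Z) = F z.
Proof.
move=> per; have pn (n : nat) z : F (z + n%:Z * Q%:Z) = F z.
  by elim: n => [|n IH]; rewrite ?mul0r ?addr0 // -addn1 PoszD mulrDl mul1r addrA per.
move=> n z; case: (intP n) => [|m|m]; first exact: (pn 0%N).
  exact: pn.
by rewrite mulNr -[z in RHS](subrK (m.+1%:Z * Q%:Z)) pn.
Qed.

Lemma periodic_residue Q (F : int -> R) z : (0 < Q)%N -> (forall z, F (z + Q%:Z) = F z) ->
  F z = \sum_(j < Q) (Q%:Z %| j%:Z - z)%Z%:R * F j%:Z.
Proof.
move=> Q0 per; pose r := absz (z %% Q%:Z)%Z.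
have rE : r%:Z = (z %% Q%:Z)%Z by rewrite /r gez0_abs // modz_ge0 // -lt0n.
have rQ : (r < Q)%N by rewrite -ltz_nat rE ltz_pmod.
have zE : z = r%:Z + (z %/ Q%:Z)%Z * Q%:Z by rewrite rE addrC -divz_eq.
rewrite (bigD1 (Ordinal rQ)) //= big1 ?addr0 => [|j].
  have -> : (Q%:Z %| r%:Z - z)%Z.
    by rewrite {1}zE opprD addNKr -mulNr dvdz_mull.
  by rewrite mul1r {1}zE periodic_int.
rewrite -val_eqE /= => jr; suff -> : (Q%:Z %| j%:Z - z)%Z = false by rewrite mul0r.
apply/negP => /dvdzP[n hn]; move: jr; apply/negP; rewrite negbK.
have qE : (z %/ Q%:Z)%Z * Q%:Z = z - r%:Z by rewrite [X in _ = X - _]zE addrC addKr.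
have : j%:Z - r%:Z = (n + (z %/ Q%:Z)%Z) * Q%:Z by rewrite mulrDl -hn qE; ring.
move: (n + _) => k hk; have jQ := ltn_ord j.
case: (k =P 0) => [k0|/eqP k0]; first by move: hk; rewrite k0 mul0r => /eqP; rewrite subr_eq0 eqz_nat.
have : (absz (j%:Z - r%:Z) < Q)%N by lia.
by rewrite hk abszM /= ltnNge leq_pmull // lt0n absz_eq0.
Qed.

Lemma ppos_mul Q D (p : 'I_D.+1 * 'I_D.+1) : (p.1 %| Q)%N -> ppos Q p * p.1%:Z = Q%:Z * p.2%:Z.
Proof. by move=> h; rewrite /ppos -!PoszM; congr Posz; rewrite mulnAC divnK. Qed.

(** Distinct fractions with denominators at most [D] are at least [Q / D^2] apart after scaling by
    [Q], while both offsets are below [J] and [2 J D^2 < Q]. *)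
Lemma peak_unique Q D J (j : int) (p p' : 'I_D.+1 * 'I_D.+1) (x x' : int) :
  (forall d, (0 < d <= D)%N -> (d %| Q)%N) -> (2 * J * D ^ 2 < Q)%N ->
  peak p -> peak p' -> (absz x < J)%N -> (absz x' < J)%N ->
  (Q%:Z %| j - (ppos Q p + x))%Z -> (Q%:Z %| j - (ppos Q p' + x'))%Z -> p = p' /\ x = x'.
Proof.
move=> dQ JQ /andP[pb pc] /andP[pb' pc'] xJ xJ' h h'.
have d0 : (0 < p.1 <= D)%N by have := ltn_ord p.1; lia.
have d0' : (0 < p'.1 <= D)%N by have := ltn_ord p'.1; lia.
have pm := ppos_mul (dQ _ d0); have pm' := ppos_mul (dQ _ d0').
have /dvdzP[n hn] : (Q%:Z %| (ppos Q p + x) - (ppos Q p' + x'))%Z.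
  have -> : ppos Q p + x - (ppos Q p' + x') = (j - (ppos Q p' + x')) - (j - (ppos Q p + x)) by ring.
  exact: rpredB.
move: (ppos Q p) (ppos Q p') pm pm' hn {h h'} => P P'.
case: p p' pb pb' pc pc' d0 d0' => [d b] [d' b'] /= pb pb' pc pc' d0 d0' pm pm' hn.
have key : d%:Z * d'%:Z * (x - x') = Q%:Z * (n * (d%:Z * d'%:Z) - b%:Z * d'%:Z + b'%:Z * d%:Z).
  have : (P + x - (P' + x')) * (d%:Z * d'%:Z) = n * Q%:Z * (d%:Z * d'%:Z) by rewrite hn.
  have -> : (P + x - (P' + x')) * (d%:Z * d'%:Z) = (P * d%:Z) * d'%:Z - (P' * d'%:Z) * d%:Z + d%:Z * d'%:Z * (x - x') by ring.
  rewrite pm pm' => E; have -> : d%:Z * d'%:Z * (x - x') = (Q%:Z * b%:Z * d'%:Z - Q%:Z * b'%:Z * d%:Z + d%:Z * d'%:Z * (x - x')) - Q%:Z * b%:Z * d'%:Z + Q%:Z * b'%:Z * d%:Z by ring.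
  by rewrite E; ring.
have z0 : n * (d%:Z * d'%:Z) - b%:Z * d'%:Z + b'%:Z * d%:Z = 0.
  apply/eqP/negPn/negP => nz; move: (congr1 absz key); rewrite !abszM /= => E.
  have : (d * d' * absz (x - x') < Q)%N.
    apply: leq_ltn_trans JQ; rewrite mulnC; apply: leq_mul; first by lia.
    by rewrite expnS expn1; apply: leq_mul; lia.
  by rewrite E ltnNge leq_pmulr // lt0n absz_eq0.
have xx : x = x'.
  move: key; rewrite z0 mulr0 => /eqP; rewrite mulf_eq0 mulf_eq0 !eqz_nat subr_eq0.
  by case/orP => [h|/eqP //]; lia.
have dd : (d %| d')%N.
  have : (d%:Z %| b%:Z * d'%:Z)%Z.
    apply/dvdzP; exists (n * d'%:Z + b'%:Z).
    by apply/eqP; rewrite -subr_eq0 -oppr_eq0 -[X in _ == X]z0; apply/eqP; ring.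
  rewrite Gauss_dvdzr; first by rewrite /dvdz.
  by rewrite /coprimez /gcdz /= gcdnC.
have dd' : (d' %| d)%N.
  have : (d'%:Z %| b'%:Z * d%:Z)%Z.
    apply/dvdzP; exists (b%:Z - n * d%:Z).
    by apply/eqP; rewrite -subr_eq0 -[X in _ == X]z0; apply/eqP; ring.
  rewrite Gauss_dvdzr; first by rewrite /dvdz.
  by rewrite /coprimez /gcdz /= gcdnC.
have dE : nat_of_ord d = d' by apply/eqP; rewrite eqn_dvd dd dd'.
split=> //; congr pair; apply: val_inj => //=.
move: z0; rewrite -dE.
have -> : n * (d%:Z * d%:Z) - b%:Z * d%:Z + b'%:Z * d%:Z = (n * d%:Z - b%:Z + b'%:Z) * d%:Z by ring.
move=> /eqP; rewrite mulf_eq0 eqz_nat => /orP[/eqP nd|]; last by lia.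
have [n0|n0] : n = 0 \/ (1 <= absz n)%N by lia.
  by move: nd; rewrite n0 mul0r; lia.
have : n * d%:Z = b%:Z - b'%:Z by lia.
move/(congr1 absz); rewrite abszM /= => E.
have : (d <= absz n * d)%N by rewrite leq_pmull.
by rewrite E; rewrite -dE in pb'; lia.
Qed.

Lemma tent_eq0 J (x : int) : (J <= absz x)%N -> tent R J x = 0.
Proof. by rewrite /tent -subn_eq0 => /eqP ->; rewrite mul0r. Qed.

(** Every [d <= D] divides [Q], so the arc centres [Q b / d] are integers and carry integer tents,
    which never overlap. The complement [W] of the tents grows only linearly from each centre:
    [W <= |x| / J] at offset [x], which is the condition of [minor_arcs] because [C0 Q <= B^2 J]. *)
Lemma peak_partition B Q D J (C0 : nat) : (0 < J)%N ->
  (forall d, (0 < d <= D)%N -> (d %| Q)%N) -> (2 * J * D ^ 2 < Q)%N -> (C0 * Q <= B ^ 2 * J)%N ->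
  exists W : nat -> R, [/\ forall j, 0 <= W j <= 1,
   forall j d (b : int), (j < Q)%N -> (0 < d <= D)%N -> coprime `|b| d ->
     C0%:R * W j <= B%:R ^+ 2 * `|j%:R / Q%:R - b%:~R / d%:R| &
   forall F : int -> R, (forall z, F (z + Q%:Z) = F z) ->
     \sum_(j < Q) F j%:Z = \sum_(p : 'I_D.+1 * 'I_D.+1 | peak p) \sum_(x <- zr J) tent R J x * F (ppos Q p + x)
       + \sum_(j < Q) W j * F j%:Z].
Proof.
move=> J0 dQ JQ CQ; have Q0 : (0 < Q)%N by apply: leq_ltn_trans JQ.
have Jp : 0 < J%:R :> R by rewrite ltr0n.
have Qp : 0 < Q%:R :> R by rewrite ltr0n.
pose tm (j : nat) (p : 'I_D.+1 * 'I_D.+1) (x : int) : R := tent R J x * (Q%:Z %| j%:Z - (ppos Q p + x))%Z%:R.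
have tm0 j p x : 0 <= tm j p x by rewrite /tm mulr_ge0 ?tent_ge0.
pose T j := \sum_(p | peak p) \sum_(x <- zr J) tm j p x.
have T0 j : 0 <= T j by apply: sumr_ge0 => p _; apply: sumr_ge0.
have T1 j : T j <= 1.
  have [[p [x [pp xJ tx]]]|no] := pselect (exists p x, [/\ peak p, x \in zr J & tm j p x != 0]); last first.
    rewrite /T big1 // => p pp; rewrite big_seq big1 // => x xJ; apply/eqP/negPn/negP => tx.
    by apply: no; exists p, x.
  have nz p' x' : tm j p' x' != 0 -> (absz x' < J)%N /\ (Q%:Z %| j%:Z - (ppos Q p' + x'))%Z.
    rewrite /tm mulf_eq0 negb_or pnatr_eq0 eqb0 negbK => /andP[t1 t2]; split=> //.
    by rewrite ltnNge; apply: contra t1 => h; rewrite tent_eq0.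
  have [xJ' xq] := nz _ _ tx.
  have u p' x' : peak p' -> tm j p' x' != 0 -> p = p' /\ x = x'.
    by move=> pp' /nz[h1 h2]; exact: (@peak_unique Q D J j%:Z).
  rewrite /T (bigD1 p) //= [X in _ + X]big1 ?addr0; last first.
    move=> p' /andP[pp' pne]; apply: big1_seq => x' _; apply/eqP/negPn/negP => /(u _ _ pp')[E _].
    by move: pne; rewrite E eqxx.
  rewrite (bigD1_seq x) ?zr_uniq //= [X in _ + X]big1 ?addr0; last first.
    move=> x' xne; apply/eqP/negPn/negP => /(u _ _ pp)[_ E]; by move: xne; rewrite E eqxx.
  by rewrite /tm xq mulr1 tent_le1.
exists (fun j => 1 - T j); split.
- by move=> j; have := T0 j; have := T1 j => *; apply/andP; split; rlra.
- move=> j d b jQ d0 cbd.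
  have dp : 0 < d%:R :> R by rewrite ltr0n; lia.
  pose b0 := absz (b %% d%:Z)%Z; pose n := (b %/ d%:Z)%Z.
  have b0E : b0%:Z = (b %% d%:Z)%Z by rewrite /b0 gez0_abs // modz_ge0 // eqz_nat; lia.
  have b0d : (b0 < d)%N by rewrite -ltz_nat b0E ltz_pmod //; lia.
  have bE : b = n * d%:Z + b0%:Z by rewrite b0E -divz_eq.
  have cb0 : coprime b0 d.
    move: cbd; rewrite -[coprime `|b| d]/(coprimez b d%:Z) bE addrC.
    by rewrite /coprimez gcdzC addrC gcdzMDl gcdzC.
  have dD : (d < D.+1)%N by lia.
  have bD : (b0 < D.+1)%N by lia.
  pose p : 'I_D.+1 * 'I_D.+1 := (Ordinal dD, Ordinal bD).
  have pp : peak p by rewrite /peak /= b0d.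
  pose x := j%:Z - ppos Q p - n * Q%:Z.
  have pm : ppos Q p * d%:Z = Q%:Z * b0%:Z by apply: (@ppos_mul Q D p); exact: dQ.
  have xE : j%:R / Q%:R - b%:~R / d%:R = x%:~R / Q%:R :> R.
    rewrite /x; move: (ppos Q p) pm => P pm.
    have /(congr1 (fun z : int => z%:~R : R)) := pm; rewrite !intrM -!pmulrn => pmR.
    rewrite bE !(intrD, intrN, intrM) -!pmulrn.
    have -> : P%:~R = Q%:R * b0%:R / d%:R :> R by rewrite -pmR mulfK // gt_eqF.
    by field; rewrite !gt_eqF.
  rewrite xE normrM (@ger0_norm _ Q%:R^-1) ?invr_ge0 // -intr_norm -abszE -pmulrn mulrA ler_pdivlMr //.
  have CQr : C0%:R * Q%:R <= B%:R ^+ 2 * J%:R :> R by rewrite -natrX -!natrM ler_nat.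
  rewrite mulrAC; have [xJ|xJ] := ltnP (absz x) J; last first.
    apply: (@le_trans _ _ (B%:R ^+ 2 * J%:R)).
      apply: le_trans CQr; rewrite -[leRHS]mulr1; apply: ler_wpM2l; first by pos.
      by have := T0 j; rlra.
    by apply: ler_wpM2l; [pos|rewrite ler_nat].
  have tT : tent R J x <= T j.
    have q1 : (Q%:Z %| j%:Z - (ppos Q p + x))%Z.
      by apply/dvdzP; exists n; rewrite /x; ring.
    apply: (@le_trans _ _ (tm j p x)); first by rewrite /tm q1 mulr1.
    rewrite /T (bigD1 p) //= (bigD1_seq x) ?zr_uniq //=; last by rewrite mem_zr ltnW.
    by rewrite -addrA lerDl addr_ge0 // sumr_ge0 // => i _; apply: sumr_ge0.
  have tE : tent R J x = 1 - (absz x)%:R / J%:R.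
    by rewrite /tent natrB ?(ltnW xJ) // mulrBl mulfV // gt_eqF.
  apply: (@le_trans _ _ (B%:R ^+ 2 * J%:R * ((absz x)%:R / J%:R))).
    by apply: ler_pM; [by pos|by have := T1 j; rlra|by []|by rlra].
  by rewrite mulrA mulrAC mulfK // gt_eqF.
- move=> F per.
  have -> : \sum_(p : 'I_D.+1 * 'I_D.+1 | peak p) \sum_(x <- zr J) tent R J x * F (ppos Q p + x) = \sum_(j < Q) T j * F j%:Z.
    under eq_bigr => p _ do under eq_bigr => x _ do rewrite (periodic_residue _ Q0 per) mulr_sumr.
    under eq_bigr => p _ do rewrite exchange_big /=.
    rewrite exchange_big /=; apply: eq_bigr => j _; rewrite /T mulr_suml; apply: eq_bigr => p _.
    by rewrite mulr_suml; apply: eq_bigr => x _; rewrite /tm mulrA.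
  by rewrite -big_split /=; apply: eq_bigr => j _; ring.
Qed.

End peaks.

(** * The dual sum of the corrected difference *)

Section dual_sums.
Context (R : realType).
Local Open Scope classical_set_scope.
Implicit Types (a c h e l s t x y : R) (L W n : nat).

(** A smooth substitute for [min (h^2, s^-2)]. *)
Definition lam h s : R := h ^+ 2 / (1 + h ^+ 2 * s ^+ 2).

Lemma lam_den h s : 0 < 1 + h ^+ 2 * s ^+ 2.
Proof. have : 0 <= h ^+ 2 * s ^+ 2 by pos. rlra. Qed.

Lemma lam_ge0 h s : 0 <= lam h s.
Proof. by rewrite /lam divr_ge0 ?sqr_ge0 // ltW // lam_den. Qed.

Lemma lam_sum h y L : 0 < h <= 1 -> \sum_(p <- zr L) lam h (y + p%:~R) <= 8 * h.
Proof.
move=> /andP[h0 h1]; rewrite big_zr; pose s := L%:R - y.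
have -> : \sum_(i < L.*2.+1) lam h (y + (i%:Z - L%:Z)%:~R) = \sum_(i < L.*2.+1) (fun j : nat => lam h (j%:R - s)) i.
  by apply: eq_bigr => i _; congr lam; rewrite intrB -!pmulrn /s; ring.
apply: (@le_trans _ _ (4 * h ^+ 2 + 4 * Num.sqrt (h ^+ 2 * 1))).
  apply: (@shifted_sum_le R (fun j : nat => lam h (j%:R - s)) _ s) => //; first by pos.
    move=> j; rewrite lam_ge0 /= /lam ler_pdivrMr ?lam_den // -[leLHS]mulr1; apply: ler_wpM2l; first by pos.
    by rewrite lerDl; pos.
  by move=> j; rewrite /lam mulrAC ler_pdivrMr ?lam_den // mul1r lerDr.
rewrite mulr1 sqrtr_sqr gtr0_norm //; rnra.
Qed.

(** Bounds the radial majorant [min (h^4, t^-4)] by a product in the two coordinates, so that sums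
    over the dual lattice factor into two one-dimensional ones. *)
Lemma lam_prod h a l t : t ^+ 2 = a ^+ 2 + l ^+ 2 ->
  h ^+ 4 <= 2 * (1 + h ^+ 4 * t ^+ 4) * (lam h a * lam h l).
Proof.
move=> tE; have d1 := lam_den h a; have d2 := lam_den h l.
have -> : lam h a * lam h l = h ^+ 4 / ((1 + h ^+ 2 * a ^+ 2) * (1 + h ^+ 2 * l ^+ 2)).
  by rewrite /lam; move: (1 + _) (1 + _) d1 d2 => x y x0 y0; field; rewrite !gt_eqF.
rewrite mulrA ler_pdivlMr ?mulr_gt0 // [leRHS]mulrC; apply: ler_wpM2l; first by rewrite exprn_even_ge0.
have -> : t ^+ 4 = (a ^+ 2 + l ^+ 2) ^+ 2 by rewrite -tE; ring.
have -> : h ^+ 4 = (h ^+ 2) ^+ 2 by ring.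
have : 0 <= h ^+ 2 by pos.
have : 0 <= a ^+ 2 by pos.
have : 0 <= l ^+ 2 by pos.
move: (h ^+ 2) (a ^+ 2) (l ^+ 2) => H A L L0 A0 H0.
have -> : H ^+ 2 * (A + L) ^+ 2 = (H * A) ^+ 2 + 2 * ((H * A) * (H * L)) + (H * L) ^+ 2 by ring.
have : 0 <= H * A by pos.
have : 0 <= H * L by pos.
move: (H * A) (H * L) => x y y0 x0; rnra.
Qed.

Definition sinc h t : R := sin (pi * t * h) / (pi * t).

Lemma wkerE c h t : wker c h t = 96 * c ^+ 3 * sinc h t ^+ 4. Proof. by []. Qed.

Lemma sinc_le_h h t : 0 <= h -> 0 < t -> `|sinc h t| <= h.
Proof.
move=> h0 t0; have p0 : 0 < pi * t by rewrite mulr_gt0 ?pi_gt0.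
rewrite /sinc normrM (@ger0_norm _ (pi * t)^-1) ?invr_ge0 ?(ltW p0) // ler_pdivrMr //.
apply: le_trans (abs_sin_le _) _; rewrite ger0_norm; first by rewrite mulrC.
by rewrite mulr_ge0 // ltW.
Qed.

Lemma sinc_le_inv h t : 0 < t -> `|sinc h t| <= t^-1.
Proof.
move=> t0; have p2 := pi_ge2 R; have p0 : 0 < pi * t by rewrite mulr_gt0 ?pi_gt0.
rewrite /sinc normrM (@ger0_norm _ (pi * t)^-1) ?invr_ge0 ?(ltW p0) //.
apply: (@le_trans _ _ (1 * (pi * t)^-1)).
  by apply: ler_wpM2r; [rewrite invr_ge0 ltW|rewrite ler_norml sin_geN1 sin_le1].
by rewrite mul1r lef_pV2 ?posrE //; rnra.
Qed.

Lemma sincB h t t' : 0 <= h -> 0 < t -> 0 < t' -> `|sinc h t' - sinc h t| <= 2 * h * `|t' - t| / t'.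
Proof.
move=> h0 t0 t0'; have p0 := pi_gt0 R.
have -> : sinc h t' - sinc h t = (sin (pi * t' * h) - sin (pi * t * h)) / (pi * t') - sinc h t * ((t' - t) / t').
  have pn : pi != 0 :> R by rewrite gt_eqF.
  have tn : t != 0 by rewrite gt_eqF.
  have tn' : t' != 0 by rewrite gt_eqF.
  rewrite /sinc; move: (sin _) (sin _) => A B.
  move: (@pi R) pn {p0} => P pn.
  by field; rewrite pn tn tn'.
apply: le_trans (ler_normB _ _) _.
have -> : 2 * h * `|t' - t| / t' = h * `|t' - t| / t' + h * `|t' - t| / t' by ring.
apply: lerD.
  rewrite normrM (@ger0_norm _ (pi * t')^-1); last by pos.
  rewrite ler_pdivrMr ?mulr_gt0 //; apply: le_trans (sin_lip _ _) _.
  have -> : pi * t' * h - pi * t * h = pi * h * (t' - t) by ring.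
  rewrite normrM (@ger0_norm _ (pi * h)); last by pos.
  by rewrite le_eqVlt; apply/orP; left; apply/eqP; field; rewrite gt_eqF.
rewrite normrM [X in _ * X]normrM (@ger0_norm _ t'^-1); last by pos.
rewrite [X in X <= _]mulrA.
by apply: ler_wpM2r; [rewrite invr_ge0 ltW|apply: ler_wpM2r => //; exact: sinc_le_h].
Qed.

Lemma pow4B (x y m : R) : `|x| <= m -> `|y| <= m -> `|x ^+ 4 - y ^+ 4| <= 4 * m ^+ 3 * `|x - y|.
Proof.
move=> xm ym; have m0 : 0 <= m := le_trans (normr_ge0 _) xm.
have -> : x ^+ 4 - y ^+ 4 = (x ^+ 3 + x ^+ 2 * y + x * y ^+ 2 + y ^+ 3) * (x - y) by ring.
rewrite normrM; apply: ler_wpM2r => //.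
have b1 : `|x ^+ 3| <= m ^+ 3 by rewrite normrX lerXn2r ?nnegrE.
have b2 : `|x ^+ 2 * y| <= m ^+ 3.
  by rewrite normrM normrX (_ : m ^+ 3 = m ^+ 2 * m); [apply: ler_pM => //; rewrite lerXn2r ?nnegrE|ring].
have b3 : `|x * y ^+ 2| <= m ^+ 3.
  by rewrite normrM normrX (_ : m ^+ 3 = m * m ^+ 2); [apply: ler_pM => //; rewrite lerXn2r ?nnegrE|ring].
have b4 : `|y ^+ 3| <= m ^+ 3 by rewrite normrX lerXn2r ?nnegrE.
have := ler_normD (x ^+ 3 + x ^+ 2 * y + x * y ^+ 2) (y ^+ 3).
have := ler_normD (x ^+ 3 + x ^+ 2 * y) (x * y ^+ 2).
have := ler_normD (x ^+ 3) (x ^+ 2 * y).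
move: (m ^+ 3) b1 b2 b3 b4 => M; rlra.
Qed.

(** Combines [O(c^3 h^4)] for all [t] with [O(c^3 t^-4)] into the product majorant. *)
Lemma Uker_lam (Ce : R) : 0 < Ce -> exists C : R, 0 < C /\ forall e c h a l, 4 <= c -> 0 < h <= 1 ->
  0 <= e <= Ce * h ^+ 2 / c ^+ 2 ->
  `|Uker e c h (Num.sqrt (a ^+ 2 + l ^+ 2))| <= C * c ^+ 3 * (lam h a * lam h l).
Proof.
move=> Ce0; have [C1 [C10 hs]] := Uker_small Ce0; have [C2 [C20 ha]] := Uker_asym Ce0.
exists (2 * (2 * C1 + 96 + 2 * C2)); split; first by pos.
move=> e c h a l c4 hh he; set t := Num.sqrt _; have /andP[h0 h1] := hh.
have t0 : 0 <= t by exact: sqrtr_ge0.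
have tE : t ^+ 2 = a ^+ 2 + l ^+ 2 by rewrite sqr_sqrtr //; pos.
have c0 : 0 < c by rlra.
have c30 : 0 < c ^+ 3 by pos.
have U1 := hs e c h t c4 hh he.
have U2 : `|Uker e c h t| * t ^+ 4 <= (C1 + 96 + 2 * C2) * c ^+ 3.
  have [t1|t1] := leP t 1.
    apply: (@le_trans _ _ (C1 * c ^+ 3)).
      rewrite -[leRHS]mulr1; apply: ler_pM => //; first by pos.
        apply: le_trans U1 _; rewrite -[leRHS]mulr1; apply: ler_wpM2l; first by pos.
        by rewrite exprn_ile1 //; rlra.
      by rewrite exprn_ile1.
    by apply: ler_wpM2r; [exact: ltW|rlra].
  have tp : 0 < t by rlra.
  have A := ha e c h t c4 hh he tp.
  have tV : t^-1 <= 1 by rewrite invf_le1 // ltW.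
  have tV0 : 0 <= t^-1 by rewrite invr_ge0.
  have w4 : `|wker c h t * cos (2 * pi * t * c)| * t ^+ 4 <= 96 * c ^+ 3.
    rewrite wkerE normrM; apply: (@le_trans _ _ (`|96 * c ^+ 3 * sinc h t ^+ 4| * 1 * t ^+ 4)).
      apply: ler_wpM2r; first by pos.
      by apply: ler_wpM2l => //; rewrite ler_norml cos_geN1 cos_le1.
    rewrite mulr1 normrM (@ger0_norm _ (96 * c ^+ 3)); last by pos.
    rewrite -mulrA -[leRHS]mulr1; apply: ler_wpM2l; first by pos.
    rewrite normrX -exprMn exprn_ile1 //; first by pos.
    by rewrite -ler_pdivlMr // mul1r; exact: sinc_le_inv.
  have e4 : C2 * c ^+ 2 * (t^-1 ^+ 4 * (1 + t^-1 ^+ 3)) * t ^+ 4 <= 2 * C2 * c ^+ 3.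
    have -> : C2 * c ^+ 2 * (t^-1 ^+ 4 * (1 + t^-1 ^+ 3)) * t ^+ 4 = C2 * c ^+ 2 * (1 + t^-1 ^+ 3).
      by rewrite exprVn; field; rewrite gt_eqF.
    have : t^-1 ^+ 3 <= 1 by rewrite exprn_ile1.
    have -> : 2 * C2 * c ^+ 3 = C2 * c ^+ 2 * (2 * c) by ring.
    by move=> ?; apply: ler_wpM2l; [pos|rlra].
  have : `|Uker e c h t| <= `|wker c h t * cos (2 * pi * t * c)| + C2 * c ^+ 2 * (t^-1 ^+ 4 * (1 + t^-1 ^+ 3)).
    apply: le_trans (lerD (lexx _) A); rewrite -{1}(subrK (wker c h t * cos (2 * pi * t * c)) (Uker e c h t)) addrC.
    exact: ler_normD.
  move=> hU; have t40 : 0 <= t ^+ 4 by pos.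
  apply: le_trans (ler_wpM2r t40 hU) _; rewrite mulrDl.
  have : 0 <= C1 * c ^+ 3 by pos.
  move: (c ^+ 3) w4 e4 => X w4 e4 ?; apply: le_trans (lerD w4 e4) _; rlra.
have LP := lam_prod h tE; set LL := lam h a * lam h l in LP *.
have LL0 : 0 <= LL by rewrite mulr_ge0 ?lam_ge0.
have h40 : 0 < h ^+ 4 by pos.
have e1 : 0 < 1 + h ^+ 4 * t ^+ 4 by have : 0 <= h ^+ 4 * t ^+ 4 by [pos]; rlra.
rewrite -(ler_pM2r h40); apply: le_trans (ler_wpM2l (normr_ge0 _) LP) _.
have -> : `|Uker e c h t| * (2 * (1 + h ^+ 4 * t ^+ 4) * LL) = 2 * LL * (`|Uker e c h t| + h ^+ 4 * (`|Uker e c h t| * t ^+ 4)) by ring.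
have -> : 2 * (2 * C1 + 96 + 2 * C2) * c ^+ 3 * LL * h ^+ 4 = 2 * LL * (C1 * c ^+ 3 * h ^+ 4 + h ^+ 4 * ((C1 + 96 + 2 * C2) * c ^+ 3)) by ring.
apply: ler_wpM2l; first by pos.
by apply: lerD => //; apply: ler_wpM2l => //; exact: ltW.
Qed.

(** The Fejer-weighted dual sum after the corrected difference; working at finite [L] allows
    rearrangements, and all bounds are uniform in [L]. *)
Definition Adual e c h L y : R := \sum_(p <- zr L) \sum_(l <- zr L)
  tent R L p * tent R L l * (kappa R * Uker e c h (Num.sqrt ((y + p%:~R) ^+ 2 + l%:~R ^+ 2))).

Lemma AdualE e c h L y : (0 < L)%N -> Adual e c h L y = Lop e (fun z => dual_sum L z y) c h.
Proof.
move=> L0; have Ln : L%:R != 0 :> R by rewrite pnatr_eq0 -lt0n.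
have dE z : dual_sum L z y = \sum_(p <- zr L) \sum_(l <- zr L)
    tent R L p * tent R L l * (kappa R * I3 z (Num.sqrt ((y + p%:~R) ^+ 2 + l%:~R ^+ 2))).
  rewrite /dual_sum.
  rewrite -(pair_bigA _ (fun p q : 'I_L * 'I_L => kappa R * I3 z (Num.sqrt ((y + (p.1%:R - p.2%:R)) ^+ 2 + (q.1%:R - q.2%:R) ^+ 2)))) /=.
  pose G (x w : int) := kappa R * I3 z (Num.sqrt ((y + x%:~R) ^+ 2 + w%:~R ^+ 2)).
  have -> : \sum_(i : 'I_L * 'I_L) \sum_(j : 'I_L * 'I_L) kappa R * I3 z (Num.sqrt ((y + (i.1%:R - i.2%:R)) ^+ 2 + (j.1%:R - j.2%:R) ^+ 2)) =
     L%:R * (L%:R * \sum_(p <- zr L) tent R L p * \sum_(l <- zr L) tent R L l * G p l).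
    have i1 (p : int) : \sum_(l <- zr L) tent R L l * G p l = L%:R^-1 * \sum_(j : 'I_L * 'I_L) G p (j.1%:Z - j.2%:Z).
      by rewrite -diff_sum_tent.
    rewrite (eq_bigr (fun p => L%:R^-1 * (tent R L p * \sum_(j : 'I_L * 'I_L) G p (j.1%:Z - j.2%:Z)))); last first.
      by move=> p _; rewrite i1 mulrCA.
    rewrite -mulr_sumr [L%:R * (L%:R^-1 * _)]mulrA mulfV // mul1r.
    rewrite -(@diff_sum_tent R L (fun p => \sum_(j : 'I_L * 'I_L) G p (j.1%:Z - j.2%:Z))) // mulrA mulfV // mul1r.
    apply: eq_bigr => i _; apply: eq_bigr => j _.
    by rewrite /G !intrB -!pmulrn.
  rewrite mulrA -expr2 mulrA mulVf ?expf_neq0 // mul1r; apply: eq_bigr => p _.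
  by rewrite mulr_sumr; apply: eq_bigr => l _; rewrite mulrA.
rewrite /Lop /D4 /D2 !dE /Adual !mulr_sumr -!(sumrB, big_split) /= mulr_sumr -sumrB; apply: eq_bigr => p _.
rewrite !mulr_sumr -!(sumrB, big_split) /= mulr_sumr -sumrB; apply: eq_bigr => l _.
by rewrite /Uker /Lop /D4 /D2; ring.
Qed.

Lemma Adual_cvg e c h W y : 0 <= h -> 2 * h <= c -> c + 2 * h <= W%:R ->
  Adual e c h L y @[L --> \oo] --> Lop e (fun z => disc_sum W z y) c h.
Proof.
move=> h0 hc hW.
have cv z : 0 <= z -> z <= W%:R -> dual_sum L z y @[L --> \oo] --> disc_sum W z y by move=> *; exact: poisson_disc.
have c1 := cv (c + 2 * h) ltac:(rlra) ltac:(rlra); have c2 := cv (c + h) ltac:(rlra) ltac:(rlra).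
have c3 := cv c ltac:(rlra) ltac:(rlra); have c4 := cv (c - h) ltac:(rlra) ltac:(rlra); have c5 := cv (c - 2 * h) ltac:(rlra) ltac:(rlra).
have H : Lop e (fun z => dual_sum L z y) c h @[L --> \oo] --> Lop e (fun z => disc_sum W z y) c h.
  rewrite /Lop /D4 /D2; apply: cvgB; last first.
    apply: cvgM; first exact: cvg_cst.
    by apply: cvgD => //; apply: cvgB => //; apply: cvgM => //; exact: cvg_cst.
  apply: cvgD => //; apply: cvgB; last by apply: cvgM => //; exact: cvg_cst.
  apply: cvgD; last by apply: cvgM => //; exact: cvg_cst.
  by apply: cvgB => //; apply: cvgM => //; exact: cvg_cst.
apply: cvg_trans H; apply: near_eq_cvg; near=> L; rewrite AdualE //.
by near: L; exists 1%N.
Unshelve. all: by end_near.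
Qed.

Lemma Adual_le (Ce : R) : 0 < Ce -> exists C : R, 0 < C /\ forall e c h L y, 4 <= c -> 0 < h <= 1 ->
  0 <= e <= Ce * h ^+ 2 / c ^+ 2 -> (0 < L)%N -> `|Adual e c h L y| <= C * c ^+ 3 * h ^+ 2.
Proof.
move=> Ce0; have [C [C0 hU]] := Uker_lam Ce0; have k0 := kappa_gt0 R.
exists (64 * (kappa R * C)); split; first by pos.
move=> e c h L y c4 hh he L0; have /andP[h0 h1] := hh.
have c0 : 0 < c by rlra.
apply: le_trans (ler_norm_sum _ _ _) _.
apply: (@le_trans _ _ (\sum_(p <- zr L) \sum_(l <- zr L) (kappa R * C * c ^+ 3) * (lam h (y + p%:~R) * lam h (0 + l%:~R)))).
  apply: ler_sum => p _; apply: le_trans (ler_norm_sum _ _ _) _; apply: ler_sum => l _.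
  have t0 := @tent_ge0 R L; have t1 (x : int) := @tent_le1 R L x L0.
  rewrite normrM ger0_norm ?mulr_ge0 // normrM (ger0_norm (ltW k0)) add0r.
  rewrite -[leRHS]mul1r; apply: ler_pM; [by rewrite mulr_ge0|by pos| |].
    by rewrite -[leRHS]mulr1; apply: ler_pM.
  have -> : kappa R * C * c ^+ 3 * (lam h (y + p%:~R) * lam h l%:~R) = kappa R * (C * c ^+ 3 * (lam h (y + p%:~R) * lam h l%:~R)) by ring.
  by apply: ler_wpM2l; [exact: ltW|exact: hU].
have -> : \sum_(p <- zr L) \sum_(l <- zr L) (kappa R * C * c ^+ 3) * (lam h (y + p%:~R) * lam h (0 + l%:~R)) =
  (kappa R * C * c ^+ 3) * ((\sum_(p <- zr L) lam h (y + p%:~R)) * (\sum_(l <- zr L) lam h (0 + l%:~R))).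
  rewrite big_distrlr /= mulr_sumr; apply: eq_bigr => p _; by rewrite mulr_sumr.
have -> : 64 * (kappa R * C) * c ^+ 3 * h ^+ 2 = (kappa R * C * c ^+ 3) * ((8 * h) * (8 * h)) by ring.
apply: ler_wpM2l; first by pos.
have s0 z : 0 <= \sum_(p <- zr L) lam h (z + p%:~R) by apply: sumr_ge0 => p _; exact: lam_ge0.
by apply: ler_pM => //; exact: lam_sum.
Qed.

(** With [s = a / t], the shifted norm [t'] and the linearisation [r = t + d s] satisfy
    [t'^2 - r^2 = d^2 (1 - s^2)], which lies between 0 and [d^2]. *)
Lemma norm_shift (a l d t : R) : 0 < t -> t ^+ 2 = a ^+ 2 + l ^+ 2 -> `|d| <= t / 2 ->
  [/\ t / 2 <= Num.sqrt ((a + d) ^+ 2 + l ^+ 2),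
    `|Num.sqrt ((a + d) ^+ 2 + l ^+ 2) - (t + d * (a / t))| <= d ^+ 2 / t &
    `|Num.sqrt ((a + d) ^+ 2 + l ^+ 2) - t| <= 2 * `|d| ].
Proof.
move=> t0 tE hd; set t' := Num.sqrt _.
have t'0 : 0 <= t' by exact: sqrtr_ge0.
have t'E : t' ^+ 2 = (a + d) ^+ 2 + l ^+ 2 by rewrite sqr_sqrtr //; pos.
have at1 : `|a| <= t.
  rewrite -(ger0_norm (ltW t0)) -sqrtr_sqr -[X in _ <= X]sqrtr_sqr; apply: ler_wsqrtr.
  by rewrite tE lerDl; pos.
pose s := a / t.
have s1 : `|s| <= 1 by rewrite /s normrM (@ger0_norm _ t^-1) ?invr_ge0 ?(ltW t0) // ler_pdivrMr // mul1r.
have aE : a = s * t by rewrite /s divfK // gt_eqF.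
have ds : `|d * s| <= `|d| by rewrite normrM -[leRHS]mulr1; apply: ler_wpM2l.
pose r := t + d * s.
have r0 : t / 2 <= r by move: ds hd; rewrite /r => /ler_normlP[? _] hd; rlra.
have s21 : s ^+ 2 <= 1 by rewrite -[s ^+ 2]real_normK ?num_real // exprn_ile1.
have E : t' ^+ 2 - r ^+ 2 = d ^+ 2 * (1 - s ^+ 2).
  have -> : t' ^+ 2 = t ^+ 2 + 2 * a * d + d ^+ 2 by rewrite t'E tE; ring.
  by rewrite aE /r; ring.
have d20 : 0 <= d ^+ 2 by pos.
have lo : r <= t'.
  have : 0 <= t' ^+ 2 - r ^+ 2 by rewrite E; apply: mulr_ge0 => //; rlra.
  by rewrite subr_ge0 ler_sqr ?nnegrE //; rlra.
have hi : t' - r <= d ^+ 2 / t.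
  rewrite ler_pdivlMr //; apply: (@le_trans _ _ ((t' - r) * (t' + r))).
    by apply: ler_wpM2l; rlra.
  have -> : (t' - r) * (t' + r) = t' ^+ 2 - r ^+ 2 by ring.
  rewrite E -[leRHS]mulr1; apply: ler_wpM2l => //.
  by have : 0 <= s ^+ 2 by [pos]; rlra.
split; first by rlra.
  by rewrite ger0_norm // subr_ge0.
have dt : d ^+ 2 / t <= `|d|.
  rewrite ler_pdivrMr // -[d ^+ 2]real_normK ?num_real // expr2; apply: ler_wpM2l => //; rlra.
have -> : t' - t = (t' - r) + d * s by rewrite /r; ring.
apply: le_trans (ler_normD _ _) _; rewrite ger0_norm ?subr_ge0 //; rlra.
Qed.

(** On an arc of width [O(1/c)] the phase [c t'] may be linearised in the offset [d]: the quadratic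
    error [c d^2 / t] is [O(1/c)]. The dependence on [d] becomes a pure character, which later turns
    the arc into a Fejer mean. *)
Lemma Uker_linear (Ce D C0 : R) : 0 < Ce -> 1 <= D -> 0 < C0 -> exists C : R, 0 < C /\ forall e c h a l d,
  4 <= c -> 0 < h <= 1 -> 0 <= e <= Ce * h ^+ 2 / c ^+ 2 -> 2 * C0 * D <= c ->
  D^-1 <= Num.sqrt (a ^+ 2 + l ^+ 2) -> `|d| <= C0 / c ->
  `|Uker e c h (Num.sqrt ((a + d) ^+ 2 + l ^+ 2)) - wker c h (Num.sqrt (a ^+ 2 + l ^+ 2)) *
     cos (2 * pi * (c * Num.sqrt (a ^+ 2 + l ^+ 2) + c * (a / Num.sqrt (a ^+ 2 + l ^+ 2)) * d))|
  <= C * c ^+ 2 * (lam 1 a * lam 1 l).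
Proof.
move=> Ce0 D1 C00; have [C2 [C20 ha]] := Uker_asym Ce0.
pose A1 := C2 * (16 * (1 + 8 * D ^+ 3)).
pose A2 : R := 96 * (128 * (1 + D) * C0).
pose A3 : R := 96 * (8 * C0 ^+ 2 * D).
have D0 : 0 < D by rlra.
exists ((A1 + A2 + A3) * (4 * D ^+ 4)); split; first by rewrite /A1 /A2 /A3; pos.
move=> e c h a l d c4 hh he cD tD dc; have /andP[h0 h1] := hh.
move: tD; set t := Num.sqrt (a ^+ 2 + l ^+ 2) => tD.
have tE : t ^+ 2 = a ^+ 2 + l ^+ 2 by rewrite sqr_sqrtr //; pos.
have c0 : 0 < c by rlra.
have t0 : 0 < t by apply: lt_le_trans tD; rewrite invr_gt0.
have Dt : 1 <= D * t by rewrite -(mulfV (lt0r_neq0 D0)); apply: ler_wpM2l => //; exact: ltW.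
have dt : `|d| <= t / 2.
  apply: le_trans dc _; rewrite ler_pdivrMr //; rnra.
have [t'2 t'l t't] := norm_shift t0 tE dt.
move: t'2 t'l t't; set t' := Num.sqrt _ => t'2 t'l t't.
have t'0 : 0 < t' by rlra.
pose z := t^-1; have z0 : 0 < z by rewrite invr_gt0.
have zD : z <= D by rewrite /z -[D]invrK lef_pV2 ?posrE ?invr_gt0.
have z' : t'^-1 <= 2 * z.
  rewrite /z -[2]invrK -invfM lef_pV2 ?posrE //; [by rewrite mulrC|by rewrite mulr_gt0 ?invr_gt0].
have z'0 : 0 < t'^-1 by rewrite invr_gt0.
pose X := c ^+ 2 * z ^+ 4.
have X0 : 0 <= X by rewrite /X; pos.
have E1 : `|Uker e c h t' - wker c h t' * cos (2 * pi * t' * c)| <= A1 * X.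
  apply: le_trans (ha e c h t' c4 hh he t'0) _.
  have -> : A1 * X = C2 * c ^+ 2 * ((16 * z ^+ 4) * (1 + 8 * D ^+ 3)) by rewrite /A1 /X; ring.
  apply: ler_wpM2l; first by pos.
  apply: ler_pM; [by pos|by pos| |].
    have -> : 16 * z ^+ 4 = (2 * z) ^+ 4 by ring.
    by rewrite lerXn2r ?nnegrE // ?ltW //; pos.
  rewrite lerD2l (_ : 8 * D ^+ 3 = (2 * D) ^+ 3); last by ring.
  by rewrite lerXn2r ?nnegrE //; [exact: ltW|pos|rlra].
have E2 : `|wker c h t' - wker c h t| <= A2 * X.
  rewrite !wkerE -mulrBr normrM (@ger0_norm _ (96 * c ^+ 3)); last by pos.
  have m1 : `|sinc h t'| <= 2 * z by apply: le_trans (sinc_le_inv _ t'0) _.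
  have m2 : `|sinc h t| <= 2 * z by apply: le_trans (sinc_le_inv _ t0) _; rewrite -/z; rlra.
  have sB : `|sinc h t' - sinc h t| <= 8 * (C0 / c) * z.
    apply: le_trans (sincB (ltW h0) t0 t'0) _.
    have -> : 8 * (C0 / c) * z = (2 * (2 * (C0 / c))) * (2 * z) by ring.
    apply: ler_pM => //; [by pos|exact: ltW|].
    have -> : 2 * h * `|t' - t| = 2 * (h * `|t' - t|) by ring.
    apply: ler_wpM2l => //; rewrite -[leRHS]mul1r; apply: ler_pM => //; first exact: ltW.
    by apply: le_trans t't _; apply: ler_wpM2l.
  apply: (@le_trans _ _ (96 * c ^+ 3 * (4 * (2 * z) ^+ 3 * (8 * (C0 / c) * z)))).
    apply: ler_wpM2l; first by pos.
    by apply: le_trans (pow4B m1 m2) _; apply: ler_wpM2l; [pos|].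
  have -> : 96 * c ^+ 3 * (4 * (2 * z) ^+ 3 * (8 * (C0 / c) * z)) = 96 * (128 * 2 * C0) * X.
    by rewrite /X; field; rewrite gt_eqF.
  apply: ler_wpM2r => //; rewrite /A2; apply: ler_wpM2l => //; apply: ler_wpM2r; first exact: ltW.
  by apply: ler_wpM2l => //; rlra.
have w1 : `|wker c h t| <= 96 * c ^+ 3 * z ^+ 4.
  rewrite wkerE normrM (@ger0_norm _ (96 * c ^+ 3)); last by pos.
  by apply: ler_wpM2l; [pos|rewrite normrX lerXn2r ?nnegrE //; [exact: ltW|exact: sinc_le_inv]].
have E3 : `|wker c h t * (cos (2 * pi * t' * c) - cos (2 * pi * (c * t + c * (a / t) * d)))| <= A3 * X.
  rewrite normrM; apply: (@le_trans _ _ ((96 * c ^+ 3 * z ^+ 4) * (8 * c * ((C0 / c) ^+ 2 * D)))).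
    apply: ler_pM => //; apply: le_trans (cos_lip _ _) _.
    have -> : 2 * pi * t' * c - 2 * pi * (c * t + c * (a / t) * d) = 2 * pi * c * (t' - (t + d * (a / t))) by ring.
    have pp := pi_gt0 R; have p4 := pi_lt4 R.
    rewrite normrM (@ger0_norm _ (2 * pi * c)); last by pos.
    apply: ler_pM => //; first by pos.
      by apply: ler_wpM2r; [exact: ltW|rlra].
    apply: le_trans t'l _; apply: ler_pM => //; [by pos|exact: ltW|].
    by rewrite -[d ^+ 2]real_normK ?num_real // lerXn2r ?nnegrE //; pos.
  by rewrite le_eqVlt; apply/orP; left; apply/eqP; rewrite /A3 /X; field; rewrite gt_eqF.
have XL : X <= c ^+ 2 * (4 * D ^+ 4 * (lam 1 a * lam 1 l)).
  rewrite /X; apply: ler_wpM2l; first by pos.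
  have := lam_prod 1 tE; rewrite expr1n mul1r; set LL := lam 1 a * _ => LP.
  have LL0 : 0 <= LL by rewrite mulr_ge0 ?lam_ge0.
  have z4 : 0 <= z ^+ 4 by pos.
  apply: (@le_trans _ _ (z ^+ 4 * (2 * (1 + t ^+ 4) * LL))); first by rewrite -[leLHS]mulr1; apply: ler_wpM2l.
  have zt : z ^+ 4 * t ^+ 4 = 1 by rewrite -exprMn /z mulVf ?gt_eqF // expr1n.
  have -> : z ^+ 4 * (2 * (1 + t ^+ 4) * LL) = 2 * (z ^+ 4 + z ^+ 4 * t ^+ 4) * LL by ring.
  apply: ler_wpM2r => //; rewrite zt.
  have : z ^+ 4 <= D ^+ 4 by rewrite lerXn2r ?nnegrE //; exact: ltW.
  have : 1 <= D ^+ 4 by rewrite exprn_ege1.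
  rlra.
have -> : Uker e c h t' - wker c h t * cos (2 * pi * (c * t + c * (a / t) * d)) =
  (Uker e c h t' - wker c h t' * cos (2 * pi * t' * c)) + (wker c h t' - wker c h t) * cos (2 * pi * t' * c)
  + wker c h t * (cos (2 * pi * t' * c) - cos (2 * pi * (c * t + c * (a / t) * d))) by ring.
have E2' : `|(wker c h t' - wker c h t) * cos (2 * pi * t' * c)| <= A2 * X.
  rewrite normrM -[leRHS]mulr1; apply: ler_pM => //.
  by rewrite ler_norml cos_geN1 cos_le1.
apply: le_trans (ler_normD _ _) _; apply: le_trans (lerD (ler_normD _ _) (lexx _)) _.
apply: le_trans (lerD (lerD E1 E2') E3) _; rewrite -!mulrDl.
have -> : (A1 + A2 + A3) * (4 * D ^+ 4) * c ^+ 2 * (lam 1 a * lam 1 l) = (A1 + A2 + A3) * (c ^+ 2 * (4 * D ^+ 4 * (lam 1 a * lam 1 l))) by ring.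
by apply: ler_wpM2l => //; rewrite /A1 /A2 /A3; pos.
Qed.

End dual_sums.

(** * Fejer means and the mass of an arc *)

Section fejer_means.
Context (R : realType).
Implicit Types (a c h l s t u mu x y : R) (B k J Q L n : nat).

Lemma tent_sum J : (0 < J)%N -> \sum_(x <- zr J) tent R J x <= 3 * J%:R.
Proof.
move=> J0; apply: (@le_trans _ _ (\sum_(x <- zr J) 1)).
  by apply: ler_sum => x _; exact: tent_le1.
rewrite big_const_seq count_predT size_zr iter_addr_0 -[3 * _]natrM ler_nat; lia.
Qed.

(** Trivial size of a Fejer mean: total tent weight times the trivial bound for the theta sum. All
    errors are measured against it. *)
Definition fbound B k J : R := 3 * J%:R * (5 * B%:R) ^+ k.

Lemma fbound_ge0 B k J : 0 <= fbound B k J. Proof. by rewrite /fbound; pos. Qed.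

Lemma fmean_le B k J Q mu : (0 < B)%N -> (0 < J)%N -> fmean B k J Q mu <= fbound B k J.
Proof.
move=> B0 J0; rewrite -[leLHS]ger0_norm ?fmean_ge0 // -cabs_real fmeanE //.
apply: le_trans (cabs_sum _ _ _) _; rewrite /fbound.
apply: (@le_trans _ _ (\sum_(x <- zr J) tent R J x * (5 * B%:R) ^+ k)).
  apply: ler_sum => x _; rewrite !cabsM cabs_ce mulr1 cabs_real ger0_norm ?tent_ge0 // cabsX.
  apply: ler_wpM2l; first exact: tent_ge0.
  by rewrite lerXn2r ?nnegrE ?cabs_ge0 ?cabs_wsum_le //; pos.
by rewrite -mulr_suml; apply: ler_wpM2r; [pos|exact: tent_sum].
Qed.

Lemma fmean_lip B k J Q mu mu' : (0 < B)%N -> (0 < J)%N -> (0 < Q)%N ->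
  `|fmean B k J Q mu - fmean B k J Q mu'| <= fbound B k J * (8 * (J%:R / Q%:R) * `|mu - mu'|).
Proof.
move=> B0 J0 Q0; have Qp : 0 < Q%:R :> R by rewrite ltr0n.
rewrite -cabs_real rmorphB /= !fmeanE // -sumrB.
apply: le_trans (cabs_sum _ _ _) _; rewrite /fbound.
apply: (@le_trans _ _ (\sum_(x <- zr J) tent R J x * ((5 * B%:R) ^+ k * (8 * (J%:R / Q%:R) * `|mu - mu'|)))).
  rewrite !big_seq; apply: ler_sum => x; rewrite mem_zr => xJ.
  rewrite -!mulrBr !cabsM cabs_real ger0_norm ?tent_ge0 // cabsX.
  apply: ler_wpM2l; first exact: tent_ge0.
  apply: ler_pM; [by rewrite exprn_ge0 ?cabs_ge0|exact: cabs_ge0| |].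
    by rewrite lerXn2r ?nnegrE ?cabs_ge0 ?cabs_wsum_le //; pos.
  apply: le_trans (cabs_ceB _ _) _.
  have -> : - (x%:~R / Q%:R * mu) - - (x%:~R / Q%:R * mu') = - (x%:~R / Q%:R * (mu - mu')) by ring.
  rewrite normrN normrM normrM (@ger0_norm _ Q%:R^-1) ?invr_ge0 // -intr_norm -abszE -pmulrn.
  have p4 := pi_lt4 R; have p0 := pi_gt0 R.
  have -> : 2 * pi * ((absz x)%:R / Q%:R * `|mu - mu'|) = 2 * pi * ((absz x)%:R / Q%:R) * `|mu - mu'| :> R by ring.
  apply: ler_wpM2r => //; apply: ler_pM; [by pos|by pos|rlra|].
  by apply: ler_wpM2r; [rewrite invr_ge0|rewrite ler_nat].
rewrite -mulr_suml -[leRHS]mulrA; apply: ler_wpM2r; [by pos|exact: tent_sum].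
Qed.

Definition fsm B k J Q c s : R := 2^-1 * (fmean B k J Q (c * s) + fmean B k J Q (- (c * s))).

Lemma fsm_ge0 B k J Q c s : 0 <= fsm B k J Q c s.
Proof. by rewrite /fsm mulr_ge0 ?invr_ge0 // addr_ge0 ?fmean_ge0. Qed.

Lemma fsm_le B k J Q c s : (0 < B)%N -> (0 < J)%N -> fsm B k J Q c s <= fbound B k J.
Proof.
move=> B0 J0; have := fmean_le k Q (c * s) B0 J0; have := fmean_le k Q (- (c * s)) B0 J0.
by rewrite /fsm; move: (fmean _ _ _ _ _) (fmean _ _ _ _ _) => x y; rlra.
Qed.

Lemma fsm_lip B k J Q c s s' : (0 < B)%N -> (0 < J)%N -> (0 < Q)%N -> 0 <= c ->
  `|fsm B k J Q c s - fsm B k J Q c s'| <= fbound B k J * (8 * (J%:R / Q%:R) * (c * `|s - s'|)).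
Proof.
move=> B0 J0 Q0 c0; have h1 := fmean_lip k (c * s) (c * s') B0 J0 Q0; have h2 := fmean_lip k (- (c * s)) (- (c * s')) B0 J0 Q0.
have e1 : `|c * s - c * s'| = c * `|s - s'| by rewrite -mulrBr normrM ger0_norm.
have e2 : `|- (c * s) - - (c * s')| = c * `|s - s'| by rewrite -opprD normrN.
rewrite e1 in h1; rewrite e2 in h2; rewrite /fsm -mulrBr opprD addrACA normrM ger0_norm ?invr_ge0 //.
have := ler_normD (fmean B k J Q (c * s) - fmean B k J Q (c * s')) (fmean B k J Q (- (c * s)) - fmean B k J Q (- (c * s'))).
move: h1 h2; set X := _ * (_ * _); move: `|_| `|_| `|_| X => x y z X; rlra.
Qed.

Definition nrm a l : R := Num.sqrt (a ^+ 2 + l ^+ 2).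

Lemma nrm_sqr a l : nrm a l ^+ 2 = a ^+ 2 + l ^+ 2.
Proof. by rewrite sqr_sqrtr //; pos. Qed.

Lemma nrm_ge0 a l : 0 <= nrm a l. Proof. exact: sqrtr_ge0. Qed.

(** The contribution of the dual frequency [(a, l)] without its oscillation. The mean is taken near
    [c a / t], the first coordinate of the point of the circle of radius [c] with normal direction
    [(a, l)]. *)
Definition lterm B k J Q c h a l : R := wker c h (nrm a l) * fsm B k J Q c (a / nrm a l).

Definition Lam B k J Q c h L u : R := \sum_(p <- zr L) \sum_(l <- zr L)
  tent R L p * tent R L l * lterm B k J Q c h (u + p%:~R) l%:~R.

Lemma wker_ge0 c h t : 0 <= c -> 0 <= wker c h t.
Proof. by move=> c0; rewrite wkerE mulr_ge0 ?exprn_even_ge0 //; pos. Qed.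

Lemma lterm_ge0 B k J Q c h a l : 0 <= c -> 0 <= lterm B k J Q c h a l.
Proof. by move=> c0; rewrite /lterm mulr_ge0 ?wker_ge0 ?fsm_ge0. Qed.

Lemma wker_le_h c h t : 0 <= c -> 0 <= h -> 0 <= t -> wker c h t <= 96 * c ^+ 3 * h ^+ 4.
Proof.
move=> c0 h0; rewrite le_eqVlt => /orP[/eqP <-|t0].
  by rewrite wkerE /sinc mulr0 invr0 mulr0 expr0n mulr0; pos.
rewrite wkerE; apply: ler_wpM2l; first by pos.
by rewrite (le_trans (ler_norm _)) // normrX lerXn2r ?nnegrE ?sinc_le_h.
Qed.

Lemma lterm_le B k J Q c h a l : (0 < B)%N -> (0 < J)%N -> 0 <= c -> 0 <= h ->
  lterm B k J Q c h a l <= 96 * c ^+ 3 * h ^+ 4 * fbound B k J.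
Proof.
move=> B0 J0 c0 h0; rewrite /lterm; apply: ler_pM; rewrite ?wker_ge0 ?fsm_ge0 ?fsm_le //.
by rewrite wker_le_h ?nrm_ge0.
Qed.

Lemma wker_lam_le c h a l : 0 <= c -> 0 <= h -> 0 < nrm a l ->
  wker c h (nrm a l) <= 96 * c ^+ 3 * (4 * (lam h a * lam h l)).
Proof.
move=> c0 h0 t0; rewrite wkerE; apply: ler_wpM2l; first by pos.
have LP := lam_prod h (nrm_sqr a l); set LL := lam h a * _ in LP *; set t := nrm a l in t0 LP *.
have LL0 : 0 <= LL by rewrite mulr_ge0 ?lam_ge0.
have h40 : 0 <= h ^+ 4 by pos.
have t40 : 0 < t ^+ 4 by pos.
apply: le_trans (ler_norm _) _; rewrite normrX.
have [ht|ht] := leP (h * t) 1.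
  apply: (@le_trans _ _ (h ^+ 4)); first by rewrite lerXn2r ?nnegrE // ?sinc_le_h.
  apply: le_trans LP _; apply: ler_wpM2r => //.
  have : h ^+ 4 * t ^+ 4 <= 1 by rewrite -exprMn exprn_ile1 // mulr_ge0 // ltW.
  rlra.
apply: (@le_trans _ _ (t^-1 ^+ 4)).
  by rewrite lerXn2r ?nnegrE ?invr_ge0 ?(ltW t0) // sinc_le_inv.
have h4t : 1 <= h ^+ 4 * t ^+ 4 by rewrite -exprMn exprn_ege1 // ltW.
have hp : 0 < h ^+ 4 by rewrite lt_neqAle h40 andbT; apply/eqP => e; move: h4t; rewrite -e mul0r; rlra.
rewrite -(ler_pM2l hp) exprVn ler_pdivrMr //; apply: le_trans LP _.
have -> : h ^+ 4 * (4 * LL) * t ^+ 4 = (4 * (h ^+ 4 * t ^+ 4)) * LL by ring.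
by apply: ler_wpM2r => //; rlra.
Qed.

(** A shift by [u <= 1] moves both the norm and the direction of a frequency of norm [t] little; the
    changes of the amplitude and of the Lipschitz function [fsm] gain a factor [1/t + h] over the
    product majorant. *)
Lemma lterm_shift B k J Q c h a l u (C0 : R) : (0 < B)%N -> (0 < J)%N -> (0 < Q)%N -> 0 <= c -> 0 < h ->
  0 <= C0 -> c * (J%:R / Q%:R) <= C0 -> 0 <= u <= 1 -> 2 <= nrm a l ->
  lterm B k J Q c h (u + a) l <= lterm B k J Q c h a l +
    fbound B k J * c ^+ 3 * ((96 * (16 * 16 * 8) * (1 + C0)) * (((nrm a l)^-1 + h) * (lam h a * lam h l))).
Proof.
move=> B0 J0 Q0 c0 h0 C00 cJ /andP[u0 u1] t2.
rewrite [u + a]addrC /lterm -/(nrm a l); set t := nrm a l in t2 *.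
have t0 : 0 < t by rlra.
have tE : t ^+ 2 = a ^+ 2 + l ^+ 2 := nrm_sqr a l.
have ud : `|u| <= t / 2 by rewrite ger0_norm //; rlra.
have [t'2 _ t't] := norm_shift t0 tE ud; rewrite -/(nrm (a + u) l) in t'2 t't.
set t' := nrm (a + u) l in t'2 t't *.
have t'0 : 0 < t' by rlra.
have tt' : `|t' - t| <= 2 by apply: le_trans t't _; rewrite ger0_norm //; rlra.
set LL := lam h a * lam h l.
have LL0 : 0 <= LL by rewrite mulr_ge0 ?lam_ge0.
have LP := lam_prod h tE; rewrite -/LL in LP.
pose z := t^-1; have z0 : 0 < z by rewrite invr_gt0.
have z' : t'^-1 <= 2 * z.
  rewrite /z -[2]invrK -invfM lef_pV2 ?posrE //; [by rewrite mulrC|by rewrite mulr_gt0 ?invr_gt0].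
have h40 : 0 < h ^+ 4 by pos.
pose m := Num.min h (2 * z).
have m0 : 0 <= m by rewrite le_min (ltW h0) /=; pos.
have mh : m <= h by rewrite ge_min lexx.
have mz : m <= 2 * z by rewrite ge_min lexx orbT.
have s1 : `|sinc h t| <= m.
  by rewrite le_min (sinc_le_h (ltW h0) t0) /=; apply: le_trans (sinc_le_inv _ t0) _; rewrite -/z; rlra.
have s2 : `|sinc h t'| <= m by rewrite le_min (sinc_le_h (ltW h0) t'0) /=; apply: le_trans (sinc_le_inv _ t'0) _.
(* Three factors are bounded by [m = min (h, 2 z)] and the increment by [h z]; whether [h t] is
   below or above 1 decides if [z] or [h] is gained. *)
have key : m ^+ 3 * (h * z) <= 32 * ((z + h) * LL).
  have [ht|ht] := leP (h * t) 1.
    apply: (@le_trans _ _ (h ^+ 4 * z)).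
      have -> : h ^+ 4 * z = h ^+ 3 * (h * z) by ring.
      by apply: ler_wpM2r; [pos|rewrite lerXn2r ?nnegrE // ltW].
    have h4 : h ^+ 4 <= 4 * LL.
      apply: le_trans LP _; apply: ler_wpM2r => //.
      have : h ^+ 4 * t ^+ 4 <= 1 by rewrite -exprMn exprn_ile1 // mulr_ge0 // ltW.
      rlra.
    apply: le_trans (ler_wpM2r (ltW z0) h4) _.
    have : 0 <= h * LL by pos.
    have : 0 <= z * LL by pos.
    rnra.
  have zt : z * t = 1 by rewrite /z mulVf // gt_eqF.
  have h4t : 1 <= h ^+ 4 * t ^+ 4 by rewrite -exprMn exprn_ege1 // ltW.
  have z4 : z ^+ 4 <= 4 * LL.
    rewrite -(ler_pM2l h40).
    have t40 : 0 < t ^+ 4 by pos.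
    rewrite -(ler_pM2r t40) -mulrA -exprMn zt expr1n mulr1; apply: le_trans LP _.
    have -> : h ^+ 4 * (4 * LL) * t ^+ 4 = (4 * (h ^+ 4 * t ^+ 4)) * LL by ring.
    by apply: ler_wpM2r => //; rlra.
  apply: (@le_trans _ _ ((2 * z) ^+ 3 * (h * z))).
    by apply: ler_wpM2r; [pos|rewrite lerXn2r ?nnegrE //; pos].
  have -> : (2 * z) ^+ 3 * (h * z) = 8 * h * z ^+ 4 by ring.
  apply: (@le_trans _ _ (8 * h * (4 * LL))); first by apply: ler_wpM2l => //; pos.
  have : 0 <= z * LL by pos.
  rnra.
have wd : `|wker c h t' - wker c h t| <= 96 * c ^+ 3 * (32 * (32 * ((z + h) * LL))).
  rewrite !wkerE -mulrBr normrM (@ger0_norm _ (96 * c ^+ 3)); last by pos.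
  apply: ler_wpM2l; first by pos.
  apply: le_trans (pow4B s2 s1) _.
  have sB : `|sinc h t' - sinc h t| <= 8 * (h * z).
    apply: le_trans (sincB (ltW h0) t0 t'0) _.
    have -> : 8 * (h * z) = (2 * h * 2) * (2 * z) by ring.
    apply: ler_pM => //; [by pos|by rewrite invr_ge0 ltW|].
    by apply: ler_wpM2l => //; pos.
  apply: (@le_trans _ _ (4 * m ^+ 3 * (8 * (h * z)))); first by apply: ler_wpM2l => //; pos.
  have -> : 4 * m ^+ 3 * (8 * (h * z)) = 32 * (m ^+ 3 * (h * z)) by ring.
  by apply: ler_wpM2l.
have at1 : `|a| <= t.
  rewrite -(ger0_norm (ltW t0)) -sqrtr_sqr -[X in _ <= X]sqrtr_sqr; apply: ler_wsqrtr.
  by rewrite tE lerDl; pos.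
have sd : `|(a + u) / t' - a / t| <= 6 * z.
  have -> : (a + u) / t' - a / t = u / t' - (a / t) * ((t' - t) / t') by field; rewrite !gt_eqF.
  apply: le_trans (ler_normB _ _) _.
  have b1 : `|u / t'| <= 2 * z.
    rewrite normrM (ger0_norm u0) (@ger0_norm _ t'^-1) ?invr_ge0 ?(ltW t'0) // -[leRHS]mul1r.
    by apply: ler_pM => //; rewrite invr_ge0 ltW.
  have b2 : `|a / t * ((t' - t) / t')| <= 4 * z.
    rewrite normrM normrM normrM (@ger0_norm _ t'^-1) ?invr_ge0 ?(ltW t'0) // (@ger0_norm _ t^-1) ?invr_ge0 ?(ltW t0) //.
    have -> : 4 * z = 1 * (2 * (2 * z)) by ring.
    apply: ler_pM; [by pos|by pos| |].
      by rewrite ler_pdivrMr // mul1r.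
    by apply: ler_pM => //; rewrite invr_ge0 ltW.
  rlra.
have fl := fsm_lip k ((a + u) / t') (a / t) B0 J0 Q0 c0.
set F0 := fbound B k J in fl *; have F00 : 0 <= F0 := fbound_ge0 B k J.
set f' := fsm _ _ _ _ _ _ in fl *; set f := fsm _ _ _ _ _ (a / t) in fl *.
have fd : `|f' - f| <= F0 * (48 * C0 * z).
  apply: le_trans fl _; apply: ler_wpM2l => //.
  have -> : 8 * (J%:R / Q%:R) * (c * `|(a + u) / t' - a / t|) = 8 * (c * (J%:R / Q%:R)) * `|(a + u) / t' - a / t| by ring.
  have -> : 48 * C0 * z = 8 * C0 * (6 * z) by ring.
  apply: ler_pM => //; first by pos.
  by apply: ler_wpM2l.
have f'F : f' <= F0 by exact: fsm_le.
have f'0 : 0 <= f' by exact: fsm_ge0.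
have wl : wker c h t <= 96 * c ^+ 3 * (4 * LL) by exact: wker_lam_le c0 (ltW h0) t0.
have w0 : 0 <= wker c h t by exact: wker_ge0.
have zLL : 0 <= z * LL by pos.
have hLL : 0 <= h * LL by pos.
have p1 : (wker c h t' - wker c h t) * f' <= 96 * c ^+ 3 * (32 * (32 * ((z + h) * LL))) * F0.
  apply: le_trans (ler_wpM2r f'0 (ler_norm _)) _.
  by apply: ler_pM => //; exact: le_trans wd (lexx _).
have p2 : wker c h t * (f' - f) <= 96 * c ^+ 3 * (4 * LL) * (F0 * (48 * C0 * z)).
  apply: le_trans (ler_wpM2l w0 (ler_norm _)) _.
  by apply: ler_pM.
have -> : wker c h t' * f' = wker c h t * f + ((wker c h t' - wker c h t) * f' + wker c h t * (f' - f)) by ring.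
rewrite lerD2l; apply: le_trans (lerD p1 p2) _.
have -> : 96 * c ^+ 3 * (32 * (32 * ((z + h) * LL))) * F0 + 96 * c ^+ 3 * (4 * LL) * (F0 * (48 * C0 * z)) =
   (F0 * c ^+ 3) * (96 * (32 * 32 * ((z + h) * LL) + 4 * 48 * C0 * (z * LL))) by ring.
have -> : F0 * c ^+ 3 * (96 * (16 * 16 * 8) * (1 + C0) * ((z + h) * LL)) =
   (F0 * c ^+ 3) * (96 * (16 * 16 * 8 * ((z + h) * LL) + 16 * 16 * 8 * (C0 * (z * LL) + C0 * (h * LL)))) by ring.
apply: ler_wpM2l; first by pos.
apply: ler_wpM2l => //.
have -> : (z + h) * LL = z * LL + h * LL by ring.
have : 0 <= C0 * (z * LL) by pos.
have : 0 <= C0 * (h * LL) by pos.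
rewrite -[4 * 48 * C0 * _]mulrA; move: (C0 * (z * LL)) (C0 * (h * LL)) (z * LL) (h * LL) zLL hLL => x1 x2 x3 x4; rlra.
Qed.

Lemma zr_indicator_sum L n : \sum_(p <- zr L) ((absz p <= n)%N%:R : R) <= 2 * n%:R + 1.
Proof.
rewrite (zr_sum_abs L (fun i => (i <= n)%N%:R : R)) /= addrC -[_ *+ 2]mulr_natl lerD2r; apply: ler_wpM2l => //.
suff -> : \sum_(1 <= i < L.+1) (i <= n)%N%:R = (minn L n)%:R :> R by rewrite ler_nat geq_minr.
elim: L => [|L IH]; first by rewrite big_geq // min0n.
rewrite big_nat_recr //= IH; have [Ln|nL] := ltnP L n.
  by rewrite (minn_idPl Ln) natr1.
by rewrite addr0 (minn_idPr (leqW nL)).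
Qed.

End fejer_means.

Lemma box_bound B n : (n <= B)%N -> (2 * B + n < (2 * B).*2.+1)%N.
Proof. lia. Qed.

Lemma coord_box B n : (n <= B)%N -> @coord B (inord (2 * B + n)) = n%:Z.
Proof. by move=> nB; rewrite /coord inordK ?box_bound //; lia. Qed.

Lemma subn_injective_le r M i i' : (M <= r)%N -> (i < M)%N -> (i' < M)%N -> (r - i = r - i')%N -> i = i'.
Proof. lia. Qed.

(** * Comparison, tail and lower bound for the mass of an arc *)

Section main_term.
Context (R : realType).
Implicit Types (a c h l s t u mu x y : R) (B k J Q L n M E K : nat).

Lemma nrm_gel a l : `|a| <= nrm a l.
Proof. by rewrite /nrm -sqrtr_sqr; apply: ler_wsqrtr; rewrite lerDl; pos. Qed.

Lemma nrm_ger a l : `|l| <= nrm a l.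
Proof. by rewrite /nrm -sqrtr_sqr; apply: ler_wsqrtr; rewrite lerDr; pos. Qed.

Lemma absz_int (p : int) : `|p%:~R| = (absz p)%:R :> R.
Proof. by rewrite -intr_norm -abszE -pmulrn. Qed.

Lemma lam_le h s : lam h s <= h ^+ 2.
Proof.
rewrite /lam ler_pdivrMr ?lam_den // -[leLHS]mulr1; apply: ler_wpM2l; first by pos.
by rewrite lerDl; pos.
Qed.

(** The mass belonging to another fraction [u] is almost at most that at 0. The cut-off [E]
    separates boundedly many low frequencies, each worth [O(h^4)], from the others, where
    [lterm_shift] gains at least [1/E + h]; the total error is small against [h^2]. *)
Lemma Lam_compare B k J Q c h L u (C0 : R) E : (0 < B)%N -> (0 < J)%N -> (0 < Q)%N -> (0 < L)%N -> 0 <= c -> 0 < h <= 1 ->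
  0 <= C0 -> c * (J%:R / Q%:R) <= C0 -> 0 <= u <= 1 -> (2 <= E)%N ->
  Lam B k J Q c h L u <= Lam B k J Q c h L 0 + fbound R B k J * c ^+ 3 * ((96 * (16 * 16 * 8) * (1 + C0)) *
    ((E%:R^-1 + h) * (64 * h ^+ 2) + (2 * E%:R + 1) ^+ 2 * h ^+ 4)).
Proof.
move=> B0 J0 Q0 L0 c0 hh C00 cJ uu E2; have /andP[h0 h1] := hh.
set F0 := fbound R B k J; have F00 : 0 <= F0 := fbound_ge0 R B k J.
set K := 96 * (16 * 16 * 8) * (1 + C0); have K0 : 0 <= K by rewrite /K; pos.
have K96 : 96 <= K.
  rewrite /K -mulrA -[leLHS]mulr1; apply: ler_wpM2l => //.
  by have -> : 16 * 16 * 8 * (1 + C0) = 1 + (16 * 16 * 8 - 1 + 16 * 16 * 8 * C0) by [ring]; rewrite lerDl; rlra.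
have Ei : 0 <= E%:R^-1 :> R by rewrite invr_ge0.
have E0 : 0 < E%:R :> R by rewrite ltr0n (leq_ltn_trans _ E2).
pose rem (p l : int) : R := (E%:R^-1 + h) * (lam h p%:~R * lam h l%:~R) + (absz p <= E)%N%:R * (absz l <= E)%N%:R * h ^+ 4.
have rem0 (p l : int) : 0 <= rem p l.
  by rewrite /rem; have := lam_ge0 h p%:~R; have := lam_ge0 h l%:~R => ? ?; pos.
have pt (p l : int) : lterm B k J Q c h (u + p%:~R) l%:~R <= lterm B k J Q c h (0 + p%:~R) l%:~R + F0 * c ^+ 3 * K * rem p l.
  rewrite [0 + _]add0r; pose t : R := nrm p%:~R l%:~R.
  have [t2|t2] := leP 2 t.
    apply: le_trans (lterm_shift k B0 J0 Q0 c0 h0 C00 cJ uu t2) _; rewrite -/F0 -/K -/t lerD2l.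
    rewrite -[F0 * c ^+ 3 * K * _]mulrA; apply: ler_wpM2l; first by pos.
    apply: ler_wpM2l => //; rewrite /rem; set LL := _ * lam _ _.
    have LL0 : 0 <= LL by rewrite mulr_ge0 ?lam_ge0.
    have tp : 0 < t by exact: lt_le_trans t2.
    have z2 : t^-1 <= 2^-1 by rewrite lef_pV2 ?posrE.
    have LLh : LL <= h ^+ 4.
      rewrite (_ : h ^+ 4 = h ^+ 2 * h ^+ 2); last by ring.
      by apply: ler_pM; rewrite ?lam_ge0 ?lam_le.
    case: (leqP (absz p) E) => [pE|pE]; first case: (leqP (absz l) E) => [lE|lE].
    - rewrite !mul1r !mulrDl.
      have : t^-1 * LL <= h ^+ 4.
        rewrite -[leRHS]mul1r; apply: ler_pM => //; [by rewrite invr_ge0 nrm_ge0|by rlra].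
      by have : 0 <= E%:R^-1 * LL by [pos]; rlra.
    - rewrite mulr0 mul0r addr0; apply: ler_wpM2r => //; rewrite lerD2r lef_pV2 ?posrE //.
      by apply: le_trans (nrm_ger p%:~R l%:~R); rewrite absz_int ler_nat ltnW.
    - rewrite mul0r mul0r addr0; apply: ler_wpM2r => //; rewrite lerD2r lef_pV2 ?posrE //.
      by apply: le_trans (nrm_gel p%:~R l%:~R); rewrite absz_int ler_nat ltnW.
  apply: ler_wpDl; first exact: lterm_ge0.
  apply: le_trans (lterm_le k Q _ _ B0 J0 c0 (ltW h0)) _; rewrite -/F0.
  have pE : (absz p <= E)%N.
    apply: leq_trans E2; rewrite -ltnS -(ltr_nat R) -absz_int.
    by apply: le_lt_trans (nrm_gel _ l%:~R) _; apply: lt_trans t2 _; rewrite ltr_nat.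
  have lE : (absz l <= E)%N.
    apply: leq_trans E2; rewrite -ltnS -(ltr_nat R) -absz_int.
    by apply: le_lt_trans (nrm_ger p%:~R _) _; apply: lt_trans t2 _; rewrite ltr_nat.
  rewrite /rem pE lE !mul1r.
  have -> : 96 * c ^+ 3 * h ^+ 4 * F0 = F0 * c ^+ 3 * 96 * h ^+ 4 by ring.
  apply: ler_pM; [by pos|by pos| |].
    by apply: ler_wpM2l => //; pos.
  by rewrite lerDr; have := lam_ge0 h p%:~R; have := lam_ge0 h l%:~R => ? ?; pos.
apply: (@le_trans _ _ (Lam B k J Q c h L 0 + \sum_(p <- zr L) \sum_(l <- zr L) F0 * c ^+ 3 * K * rem p l)).
  rewrite /Lam -big_split /=; apply: ler_sum => p _; rewrite -big_split /=; apply: ler_sum => l _.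
  have t0 := @tent_ge0 R L; have t1 (x : int) := @tent_le1 R L x L0.
  apply: le_trans (ler_wpM2l (mulr_ge0 (t0 p) (t0 l)) (pt p l)) _; rewrite mulrDr lerD2l.
  rewrite -[leRHS]mul1r; apply: ler_wpM2r; first by have := rem0 p l => ?; pos.
  by rewrite -[leRHS]mulr1; apply: ler_pM.
rewrite lerD2l.
have -> : \sum_(p <- zr L) \sum_(l <- zr L) F0 * c ^+ 3 * K * rem p l = F0 * c ^+ 3 * K * \sum_(p <- zr L) \sum_(l <- zr L) rem p l.
  by rewrite mulr_sumr; apply: eq_bigr => p _; rewrite mulr_sumr.
rewrite -[leRHS]mulrA; rewrite [F0 * (c ^+ 3 * _)]mulrA [F0 * c ^+ 3 * (K * _)]mulrA; apply: ler_wpM2l; first by pos.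
have -> : \sum_(p <- zr L) \sum_(l <- zr L) rem p l =
   (E%:R^-1 + h) * ((\sum_(p <- zr L) lam h (0 + p%:~R)) * (\sum_(l <- zr L) lam h (0 + l%:~R))) +
   (\sum_(p <- zr L) ((absz p <= E)%N%:R : R)) * (\sum_(l <- zr L) ((absz l <= E)%N%:R : R)) * h ^+ 4.
  rewrite !big_distrlr /= mulr_sumr mulr_suml -big_split /=; apply: eq_bigr => p _.
  by rewrite mulr_sumr mulr_suml -big_split /=; apply: eq_bigr => l _; rewrite /rem !add0r.
have s0 : 0 <= \sum_(p <- zr L) lam h (0 + p%:~R) by apply: sumr_ge0 => p _; exact: lam_ge0.
have s1 := lam_sum 0 L hh.
have i0 : 0 <= \sum_(p <- zr L) ((absz p <= E)%N%:R : R) by apply: sumr_ge0.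
have i1 := zr_indicator_sum R L E.
apply: lerD.
  apply: ler_wpM2l; first by pos.
  rewrite (_ : 64 * h ^+ 2 = (8 * h) * (8 * h)); last by ring.
  by apply: ler_pM.
by apply: ler_wpM2r; [pos|rewrite expr2; apply: ler_pM].
Qed.

Lemma inv_sqr_tail_sum L K : (1 <= K)%N ->
  \sum_(p <- zr L) (if (K < absz p)%N then ((absz p)%:R ^+ 2)^-1 else 0 : R) <= 2 * K%:R^-1.
Proof.
move=> K1; rewrite (zr_sum_abs L (fun i => if (K < i)%N then (i%:R ^+ 2)^-1 else 0 : R)) /= add0r -[_ *+ 2]mulr_natl.
apply: ler_wpM2l => //; pose N := (L + K)%N.
apply: (@le_trans _ _ (\sum_(1 <= i < N.+1) (if (K < i)%N then (i%:R ^+ 2)^-1 else 0 : R))).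
  rewrite [leRHS](big_cat_nat (n := L.+1)) //=; last by rewrite /N ltnS leq_addr.
  by rewrite lerDl sumr_ge0 // => i _; case: ifP => // _; rewrite invr_ge0 sqr_ge0.
rewrite (big_cat_nat (n := K.+1)) //=; last by rewrite /N ltnS leq_addl.
rewrite big_nat big1 ?add0r; last by move=> i /andP[_]; rewrite ltnS leqNgt => /negbTE ->.
apply: le_trans (@sum_inv_sqr R K N K1); rewrite !big_nat; apply: ler_sum => i /andP[-> _] //.
Qed.

(** If the norm exceeds [2 K], one coordinate exceeds [K]; it is summed with [1 / p^2], the other
    one with [lam]. The result is of order [h / K], a small part of [h^2] as soon as [K] is a large
    multiple of [1/h], so only finitely many phases need to be aligned. *)
Lemma Lam_tail B k J Q c h L K : (0 < B)%N -> (0 < J)%N -> (0 < L)%N -> 0 <= c -> 0 < h <= 1 ->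
  1 <= h * K%:R -> (1 <= K)%N ->
  \sum_(p <- zr L) \sum_(l <- zr L) tent R L p * tent R L l *
    (if (4 * K ^ 2 < absz p ^ 2 + absz l ^ 2)%N then lterm B k J Q c h p%:~R l%:~R else 0)
  <= fbound R B k J * (96 * c ^+ 3) * (32 * h / K%:R).
Proof.
move=> B0 J0 L0 c0 hh hK K1; have /andP[h0 h1] := hh.
set F0 := fbound R B k J; have F00 : 0 <= F0 := fbound_ge0 R B k J.
pose iv (p : int) : R := if (K < absz p)%N then ((absz p)%:R ^+ 2)^-1 else 0.
have iv0 p : 0 <= iv p by rewrite /iv; case: ifP => // _; rewrite invr_ge0 sqr_ge0.
have t4 (p l : int) : (K < absz p)%N -> ((nrm p%:~R l%:~R)^-1 : R) ^+ 4 <= iv p * lam h l%:~R.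
  move=> Kp; rewrite /iv Kp; set t := nrm _ _.
  have pp : 0 < (absz p)%:R :> R by rewrite ltr0n; lia.
  have tE : t ^+ 2 = (absz p)%:R ^+ 2 + l%:~R ^+ 2 by rewrite /t nrm_sqr -absz_int real_normK ?num_real.
  have l20 : 0 <= l%:~R ^+ 2 :> R by pos.
  have p20 : 0 < (absz p)%:R ^+ 2 :> R by pos.
  have t20 : 0 < t ^+ 2 by rewrite tE; rlra.
  rewrite (_ : t^-1 ^+ 4 = (t ^+ 2)^-1 * (t ^+ 2)^-1); last by rewrite !exprVn -invfM -exprD.
  have i2 : 0 <= (t ^+ 2)^-1 by rewrite invr_ge0 ltW.
  apply: ler_pM => //; first by rewrite lef_pV2 ?posrE // tE lerDl.
  rewrite /lam -[leLHS]mul1r ler_pdivlMr ?lam_den // mulrAC mul1r ler_pdivrMr // tE.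
  have hp : 1 <= h ^+ 2 * (absz p)%:R ^+ 2.
    rewrite -exprMn exprn_ege1 //; apply: le_trans hK _; apply: ler_wpM2l; first exact: ltW.
    by rewrite ler_nat ltnW.
  by rewrite mulrDr; rlra.
have pt (p l : int) : (if (4 * K ^ 2 < absz p ^ 2 + absz l ^ 2)%N then lterm B k J Q c h p%:~R l%:~R else 0)
   <= F0 * (96 * c ^+ 3) * (iv p * lam h l%:~R + iv l * lam h p%:~R).
  have i1 := mulr_ge0 (iv0 p) (lam_ge0 h l%:~R); have i2 := mulr_ge0 (iv0 l) (lam_ge0 h p%:~R).
  case: ifP => hN; last by pos.
  have big : (K < absz p)%N || (K < absz l)%N.
    rewrite -[X in X || _]negbK -[X in _ || X]negbK -negb_and -!leqNgt; apply/negP => /andP[a1 a2].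
    move: hN; rewrite ltnNge => /negP; apply; apply: (@leq_trans (K ^ 2 + K ^ 2)); last by lia.
    by apply: leq_add; rewrite leq_sqr.
  pose t : R := nrm p%:~R l%:~R.
  have t0 : 0 < t.
    case/orP: big => hb.
      by apply: lt_le_trans (nrm_gel _ _); rewrite absz_int ltr0n (leq_ltn_trans _ hb).
    by apply: lt_le_trans (nrm_ger _ _); rewrite absz_int ltr0n (leq_ltn_trans _ hb).
  have w4 : wker c h t <= 96 * c ^+ 3 * t^-1 ^+ 4.
    rewrite wkerE; apply: ler_wpM2l; first by pos.
    apply: le_trans (ler_norm _) _; rewrite normrX lerXn2r ?nnegrE //; first by rewrite invr_ge0 ltW.
    exact: sinc_le_inv.
  rewrite /lterm -/t.
  have -> : F0 * (96 * c ^+ 3) * (iv p * lam h l%:~R + iv l * lam h p%:~R) = 96 * c ^+ 3 * (iv p * lam h l%:~R + iv l * lam h p%:~R) * F0 by ring.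
  apply: ler_pM; [exact: wker_ge0|exact: fsm_ge0| |exact: fsm_le].
  apply: le_trans w4 _; apply: ler_wpM2l; first by pos.
  case/orP: big => hb.
    by apply: le_trans (t4 p l hb) _; rewrite lerDl.
  by rewrite /t /nrm addrC; apply: le_trans (t4 l p hb) _; rewrite lerDr.
apply: (@le_trans _ _ (\sum_(p <- zr L) \sum_(l <- zr L) F0 * (96 * c ^+ 3) * (iv p * lam h (0 + l%:~R) + iv l * lam h (0 + p%:~R)))).
  apply: ler_sum => p _; apply: ler_sum => l _; rewrite !add0r.
  have t0 := @tent_ge0 R L; have t1 (x : int) := @tent_le1 R L x L0.
  apply: le_trans (ler_wpM2l (mulr_ge0 (t0 p) (t0 l)) (pt p l)) _.
  rewrite -[leRHS]mul1r; apply: ler_wpM2r.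
    by have i1 := mulr_ge0 (iv0 p) (lam_ge0 h l%:~R); have i2 := mulr_ge0 (iv0 l) (lam_ge0 h p%:~R); pos.
  by rewrite -[leRHS]mulr1; apply: ler_pM.
have -> : \sum_(p <- zr L) \sum_(l <- zr L) F0 * (96 * c ^+ 3) * (iv p * lam h (0 + l%:~R) + iv l * lam h (0 + p%:~R)) =
  F0 * (96 * c ^+ 3) * (2 * ((\sum_(p <- zr L) iv p) * (\sum_(p <- zr L) lam h (0 + p%:~R)))).
  have -> : \sum_(p <- zr L) \sum_(l <- zr L) F0 * (96 * c ^+ 3) * (iv p * lam h (0 + l%:~R) + iv l * lam h (0 + p%:~R)) =
    F0 * (96 * c ^+ 3) * (\sum_(p <- zr L) \sum_(l <- zr L) iv p * lam h (0 + l%:~R) + \sum_(p <- zr L) \sum_(l <- zr L) iv l * lam h (0 + p%:~R)).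
    rewrite -big_split /= mulr_sumr; apply: eq_bigr => p _; rewrite -big_split /= mulr_sumr; exact: eq_bigr.
  by rewrite [X in _ + X]exchange_big /= -!big_distrlr /=; ring.
apply: ler_wpM2l; first by pos.
have -> : 32 * h / K%:R = 2 * ((2 * K%:R^-1) * (8 * h)) by ring.
apply: ler_wpM2l => //; apply: ler_pM; [by apply: sumr_ge0|by apply: sumr_ge0 => p _; exact: lam_ge0| |exact: lam_sum].
exact: inv_sqr_tail_sum.
Qed.

Lemma zr_sub_sum L m n (F : int -> R) : (forall p, 0 <= F p) -> (m + n <= L)%N ->
  \sum_(i < n) F (m + i)%N%:Z <= \sum_(p <- zr L) F p.
Proof.
move=> F0 mn; have -> : \sum_(i < n) F (m + i)%N%:Z = \sum_(p <- [seq (m + i)%N%:Z | i <- iota 0 n]) F p.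
  by rewrite big_map -(big_mkord xpredT (fun i => F (m + i)%N%:Z)) /index_iota subn0.
have us : uniq [seq (m + i)%N%:Z | i <- iota 0 n] by rewrite map_inj_uniq ?iota_uniq // => a b; lia.
pose s := [seq (m + i)%N%:Z | i <- iota 0 n]; pose G (p : int) : R := if p \in s then F p else 0.
have -> : \sum_(p <- s) F p = \sum_(p <- s) G p by apply: eq_big_seq => p ps; rewrite /G ps.
rewrite (@big_supp _ _ s (zr L) G us (zr_uniq L)); last first.
  move=> p; rewrite /G; case: (boolP (p \in s)) => [/mapP [k]|]; last by rewrite eqxx.
  by rewrite mem_iota => hk -> _; rewrite mem_zr; lia.
by apply: ler_sum => p _; rewrite /G; case: ifP.
Qed.

(** By positivity only frequencies with [6 H <= p < 8 H] and [16 H <= l < 18 H] are kept. There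
    [17 H <= t <= 20 H], so [h t < 1/2] and [sinc >= h / 4], and [p / t] lies in [[3/10, 48/100]].
    These are [4 H^2] terms of order [c^3 h^4]. *)
Lemma Lam_lower B k J Q c H L (m0 : R) : (0 < H)%N -> (36 * H <= L)%N -> 0 <= c -> 0 <= m0 ->
  (forall s, 3 / 10 <= s <= 48 / 100 -> m0 <= fmean B k J Q (c * s)) ->
  c ^+ 3 * ((48 * H%:R)^-1) ^+ 2 * m0 / (2 ^+ 20) <= Lam B k J Q c (48 * H%:R)^-1 L 0.
Proof.
move=> H0 HL c0 m00 hm; set h := (48 * H%:R)^-1.
have Hp : 0 < H%:R :> R by rewrite ltr0n.
have h0 : 0 < h by rewrite /h; pos.
have hH : h * (48 * H%:R) = 1 by rewrite /h mulVf // gt_eqF //; pos.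
have L0 : (0 < L)%N by lia.
have t0 := @tent_ge0 R L.
have pt (i j : 'I_(2 * H)) : 4^-1 * (96 * c ^+ 3 * (h / 4) ^+ 4 * (2^-1 * m0)) <=
   tent R L (6 * H + i)%N%:Z * tent R L (16 * H + j)%N%:Z * lterm B k J Q c h (0 + (6 * H + i)%N%:Z%:~R) (16 * H + j)%N%:Z%:~R.
  have hi := ltn_ord i; have hj := ltn_ord j.
  have tn (p : nat) : (p <= 18 * H)%N -> 2^-1 <= tent R L p%:Z.
    move=> pH; rewrite /tent /= ler_pdivlMr ?ltr0n // natrB; last by lia.
    have : 2 * p%:R <= L%:R :> R by rewrite -natrM ler_nat; lia.
    rlra.
  apply: ler_pM; first by rewrite invr_ge0.
  - by pos.
  - rewrite (_ : 4^-1 = 2^-1 * 2^-1 :> R); last by field.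
    by apply: ler_pM; rewrite ?invr_ge0 //; apply: tn; lia.
  rewrite add0r -!pmulrn; set p : R := (6 * H + i)%:R; set l : R := (16 * H + j)%:R.
  have p1 : 6 * H%:R <= p by rewrite /p -natrM ler_nat; lia.
  have p2 : p <= 8 * H%:R by rewrite /p -natrM ler_nat; lia.
  have l1 : 16 * H%:R <= l by rewrite /l -natrM ler_nat; lia.
  have l2 : l <= 18 * H%:R by rewrite /l -natrM ler_nat; lia.
  have tE := nrm_sqr p l; have t00 := nrm_ge0 p l; rewrite /lterm; set t := nrm p l in tE t00 *.
  have ta : 17 * H%:R <= t by rnra.
  have tb : t <= 20 * H%:R by rnra.
  have tp : 0 < t by rnra.
  have ht0 : 0 <= h * t by pos.
  have ht : h * t <= 1 / 2.
    apply: (@le_trans _ _ (h * (20 * H%:R))); first by apply: ler_wpM2l => //; exact: ltW.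
    have -> : h * (20 * H%:R) = (20 / 48) * (h * (48 * H%:R)) by field.
    by rewrite hH; rlra.
  have sp : 0 <= sin (pi * t * h).
    have -> : pi * t * h = pi * (h * t) by ring.
    have p0 := pi_gt0 R; apply: sin_ge0_pi; apply/andP; split; first by pos.
    by rewrite -[leRHS]mulr1; apply: ler_wpM2l; [exact: ltW|rlra].
  apply: ler_pM; [by pos|by pos| |].
    rewrite wkerE; apply: ler_wpM2l; first by pos.
    apply: lerXn2r; rewrite ?nnegrE; [by pos| |].
      by rewrite /sinc divr_ge0 //; have := pi_gt0 R => ?; pos.
    have x2 : `|h * t| <= 1 / 2 by rewrite ger0_norm.
    have := abs_sin_pi_ge x2; rewrite (@ger0_norm _ (h * t)) //.
    have -> : pi * (h * t) = pi * t * h by ring.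
    rewrite (@ger0_norm _ (sin _)) //.
    move=> sb; have p0 := pi_gt0 R; have p4 := pi_lt4 R.
    rewrite /sinc ler_pdivlMr ?mulr_gt0 //; apply: le_trans sb.
    have -> : h / 4 * (pi * t) = (pi / 4) * (h * t) by ring.
    rewrite -[leRHS]mul1r; apply: ler_wpM2r; [by pos|rlra].
  rewrite /fsm ler_pM2l ?invr_gt0 //; apply: (@le_trans _ _ (fmean B k J Q (c * (p / t)))).
    apply: hm; apply/andP; split.
      by rewrite ler_pdivlMr //; rnra.
    by rewrite ler_pdivrMr //; rnra.
  by rewrite lerDl fmean_ge0.
have s1 : \sum_(i < 2 * H) \sum_(j < 2 * H) 4^-1 * (96 * c ^+ 3 * (h / 4) ^+ 4 * (2^-1 * m0)) <= Lam B k J Q c h L 0.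
  rewrite /Lam.
  apply: le_trans (@zr_sub_sum L (6 * H) (2 * H) (fun p => \sum_(l <- zr L) tent R L p * tent R L l * lterm B k J Q c h (0 + p%:~R) l%:~R) _ _); last first.
  - by lia.
  - by move=> p; apply: sumr_ge0 => l _; apply: mulr_ge0; [exact: mulr_ge0|exact: lterm_ge0].
  apply: ler_sum => i _.
  apply: le_trans (@zr_sub_sum L (16 * H) (2 * H) (fun l : int => tent R L (6 * H + i)%N%:Z * tent R L l * lterm B k J Q c h (0 + (6 * H + i)%N%:Z%:~R) l%:~R) _ _); last first.
  - by lia.
  - by move=> l; apply: mulr_ge0; [exact: mulr_ge0|exact: lterm_ge0].
  by apply: ler_sum => j _.
apply: le_trans s1; rewrite !sumr_const card_ord -mulrnA -[leRHS]mulr_natl.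
have -> : (2 * H * (2 * H))%:R = 4 * H%:R ^+ 2 :> R by rewrite !natrM; ring.
have -> : 4 * H%:R ^+ 2 * (4^-1 * (96 * c ^+ 3 * (h / 4) ^+ 4 * (2^-1 * m0))) =
  c ^+ 3 * h ^+ 2 * m0 * ((H%:R * h) ^+ 2 * (48 / (16 * 16))) by field.
have -> : H%:R * h = 48^-1 :> R by have -> : H%:R * h = h * (48 * H%:R) / 48 by [field]; rewrite hH mul1r.
apply: ler_wpM2l; first by pos.
have -> : 48^-1 ^+ 2 * (48 / (16 * 16)) = (48 * (16 * 16))^-1 :> R by field.
rewrite lef_pV2 ?posrE; [|by pos|by pos].
have -> : 2 ^+ 20 = (2 ^+ 10) * (32 * 32) :> R by ring.
have -> : 2 ^+ 10 = 32 * 32 :> R by ring.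
rlra.
Qed.

(** All phases stay within one radian, so every real part is at least 1/2. *)
Lemma fejer_lower J x : (0 < J)%N -> `|x| * (8 * J%:R) <= 1 -> J%:R / 4 <= fejer J x.
Proof.
move=> J0 hx; have Jp : 0 < J%:R :> R by rewrite ltr0n.
rewrite /fejer ler_pdivlMr //.
have re : J%:R / 2 <= cabs (\sum_(i < J) ce (i%:R * x)).
  apply: le_trans (le_trans (ler_norm _) (Re_le_cabs _)); rewrite Re_sum.
  have -> : J%:R / 2 = \sum_(i < J) 2^-1 :> R by rewrite sumr_const card_ord -[RHS]mulr_natl.
  apply: ler_sum => i _; rewrite /=.
  have ix : `|2 * pi * (i%:R * x)| <= 1.
    rewrite normrM (@ger0_norm _ (2 * pi)); last by have := pi_gt0 R => ?; pos.
    rewrite normrM (@ger0_norm _ i%:R) //.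
    have p4 := pi_lt4 R; have p0 := pi_gt0 R.
    apply: (@le_trans _ _ (8 * (J%:R * `|x|))); last by rewrite (_ : 8 * (J%:R * `|x|) = `|x| * (8 * J%:R)) //; ring.
    apply: ler_pM; [by pos|by pos|rlra|].
    by apply: ler_wpM2r => //; rewrite ler_nat ltnW.
  have := cos_ge_quad (2 * pi * (i%:R * x)).
  have : (2 * pi * (i%:R * x)) ^+ 2 <= 1 by rewrite -[_ ^+ 2]real_normK ?num_real // exprn_ile1.
  rlra.
have -> : J%:R / 4 * J%:R = (J%:R / 2) ^+ 2 :> R by field.
by rewrite lerXn2r ?nnegrE ?cabs_ge0 //; pos.
Qed.

(** Explicit vectors with square norm close to [mu]: [k] coordinates are free below [M], and the
    last one is within [M1] below the square root of what is left. The square norm then misses [mu]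
    by at most [1.4 M1 sqrt Y], inside the window of [fejer_lower]. *)
Lemma fmean_lower B k J Q M M1 (Y C0 mu : R) : (0 < J)%N -> (0 < Q)%N -> (0 < B)%N -> (0 < M1)%N ->
  Y <= B%:R ^+ 2 -> 1 <= C0 -> Y * J%:R <= C0 * Q%:R ->
  16 * (k%:R * M%:R ^+ 2) <= Y -> 12 * C0 * M1%:R <= Num.sqrt Y -> 3 / 10 * Y <= mu <= 48 / 100 * Y ->
  (M ^ k * M1)%:R * (J%:R / 4) <= fmean B k.+1 J Q mu.
Proof.
move=> J0 Q0 B0 M10 YB C01 YJ hM hM1 /andP[mu1 mu2].
have Jp : 0 < J%:R :> R by rewrite ltr0n.
have Qp : 0 < Q%:R :> R by rewrite ltr0n.
have M1p : 1 <= M1%:R :> R by rewrite ler1n.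
pose sY := Num.sqrt Y; have sY0 : 0 < sY.
  have : 0 < 12 * C0 * M1%:R by pos.
  by move=> h; exact: lt_le_trans h hM1.
have Y0 : 0 < Y by rewrite -sqrtr_gt0.
have sYE : sY ^+ 2 = Y by rewrite sqr_sqrtr // ltW.
pose T := ({ffun 'I_k -> 'I_M} * 'I_M1)%type.
pose sq (w : {ffun 'I_k -> 'I_M}) : nat := \sum_(i < k) (w i ^ 2)%N.
have sqY w : (sq w)%:R <= Y / 16.
  rewrite ler_pdivlMr // mulrC; apply: le_trans hM; apply: ler_wpM2l => //.
  rewrite -natrX -natrM ler_nat; apply: (@leq_trans (\sum_(i < k) M ^ 2)); last by rewrite sum_nat_const card_ord.
  by apply: leq_sum => i _; rewrite leq_sqr ltnW.
pose z w : R := mu - (sq w)%:R.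
pose rt w : R := Num.sqrt (z w).
have sq0 w : 0 <= (sq w)%:R :> R by [].
have z1 w : (48 / 100) ^+ 2 * Y <= z w by rewrite /z; have := sqY w; have := sq0 w; rlra.
have z2 w : z w <= (7 / 10) ^+ 2 * Y by rewrite /z; have := sqY w; have := sq0 w; rlra.
have z0 w : 0 <= z w by apply: le_trans (z1 w); pos.
have rt1 w : 48 / 100 * sY <= rt w.
  rewrite -[leLHS]ger0_norm ?mulr_ge0 ?(ltW sY0) // -sqrtr_sqr; apply: ler_wsqrtr.
  by rewrite exprMn sYE.
have rt2 w : rt w <= 7 / 10 * sY.
  rewrite -[leRHS]ger0_norm ?mulr_ge0 ?(ltW sY0) // -sqrtr_sqr; apply: ler_wsqrtr.
  by rewrite exprMn sYE.
have rtE w : rt w ^+ 2 = z w by rewrite sqr_sqrtr.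
have rt0 w : 0 <= rt w by exact: sqrtr_ge0.
pose r w := Num.truncn (rt w).
have rr w : (r w)%:R <= rt w < (r w).+1%:R by exact: truncn_itv.
have M1s : M1%:R <= 48 / 100 * sY.
  apply: (@le_trans _ _ (sY / 12)); last by rlra.
  rewrite ler_pdivlMr //; apply: le_trans hM1; rewrite mulrC -mulrA; apply: ler_wpM2l => //.
  by rewrite -[leLHS]mul1r; apply: ler_wpM2r.
have M1r w : (M1 <= r w)%N.
  by rewrite -ltnS -(ltr_nat R); have /andP[_ h] := rr w; apply: le_lt_trans h; have := rt1 w; rlra.
have sYB : sY <= B%:R.
  by rewrite -[leRHS]ger0_norm // -sqrtr_sqr; apply: ler_wsqrtr.
have rB w : (r w <= B)%N.
  by rewrite -(ler_nat R); have /andP[h _] := rr w; have := rt2 w; rlra.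
have MB (w : {ffun 'I_k -> 'I_M}) i : (w i <= B)%N.
  rewrite -(ler_nat R); apply: le_trans sYB.
  have wq : (w i ^ 2 <= sq w)%N by rewrite /sq (bigD1 i) //= leq_addr.
  rewrite -ler_sqr ?nnegrE ?(ltW sY0) // sYE -natrX.
  apply: (@le_trans _ _ (sq w)%:R); first by rewrite ler_nat.
  by have := sqY w; rlra.
pose ob (n : nat) : 'I_((2 * B).*2.+1) := inord (2 * B + n).
have obE (n : nat) : (n <= B)%N -> coord (ob n) = n%:Z.
  exact: coord_box.
(* Coordinate 0 is the one adapted to [mu]; injectivity needs [M1 <= r], so that the truncated
   subtraction is a genuine one. *)
pose Phi (x : T) : boxv B k.+1 := [ffun i : 'I_k.+1 => if unlift ord0 i is Some j then ob (x.1 j) else ob (r x.1 - x.2)%N].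
have sqnE (x : T) : sqn (Phi x) = ((r x.1 - x.2) ^ 2 + sq x.1)%N.
  rewrite /sqn big_ord_recl /= ffunE unlift_none obE /=; last by apply: leq_trans (rB x.1); exact: leq_subr.
  congr (_ + _)%N; apply: eq_bigr => i _; rewrite ffunE liftK obE //.
have Pinj : injective Phi.
  move=> [w i] [w' i'] E.
  have ww : w = w'.
    apply/ffunP => j; have := congr1 (fun v : boxv B k.+1 => coord (v (lift ord0 j))) E.
    by rewrite /Phi !ffunE liftK /= !obE // => /eqP; rewrite eqz_nat => /eqP; exact: val_inj.
  rewrite -ww in E *; congr pair; have := congr1 (fun v : boxv B k.+1 => coord (v ord0)) E.
  rewrite /Phi !ffunE unlift_none /= !obE; last 2 first.
  - by apply: leq_trans (rB w); exact: leq_subr.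
  - by apply: leq_trans (rB w); exact: leq_subr.
  move=> /eqP; rewrite eqz_nat => /eqP h; apply: val_inj => /=.
  exact: subn_injective_le (M1r w) (ltn_ord i) (ltn_ord i') h.
have term (x : T) : J%:R / 4 <= wgt R (Phi x) * fejer J (((sqn (Phi x))%:R - mu) / Q%:R).
  case: x => w i; have iM := ltn_ord i; have /andP[r1 r2] := rr w.
  have sE : (sqn (Phi (w, i)))%:R = (r w - i)%:R ^+ 2 + (sq w)%:R :> R by rewrite sqnE /= natrD natrX.
  have ir : (i <= r w)%N by apply: leq_trans (M1r w); exact: ltnW.
  set v := (r w - i)%:R in sE; have v0 : 0 <= v by rewrite /v.
  have vr : v <= rt w by apply: le_trans r1; rewrite /v ler_nat leq_subr.
  have vl : rt w - M1%:R <= v.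
    have : rt w < v + i%:R + 1 by rewrite /v natrB // subrK natr1.
    have : i%:R + 1 <= M1%:R :> R by rewrite natr1 ler_nat.
    rlra.
  have d1 : (sqn (Phi (w, i)))%:R - mu = v ^+ 2 - rt w ^+ 2 by rewrite sE rtE /z; ring.
  have d2 : `|v ^+ 2 - rt w ^+ 2| <= 14 / 10 * (M1%:R * sY).
    rewrite ler0_norm; last by rewrite subr_le0 ler_sqr ?nnegrE.
    have -> : - (v ^+ 2 - rt w ^+ 2) = (rt w - v) * (rt w + v) by ring.
    have -> : 14 / 10 * (M1%:R * sY) = M1%:R * (14 / 10 * sY) by ring.
    by have := rt2 w => h; apply: ler_pM; rlra.
  have wg : wgt R (Phi (w, i)) = 1.
    apply: wgt1 => //; rewrite -(ler_nat R) natrX.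
    have : (sqn (Phi (w, i)))%:R <= mu.
      by rewrite -subr_le0 d1 subr_le0 ler_sqr ?nnegrE.
    by move=> h; apply: le_trans h _; apply: le_trans mu2 _; apply: le_trans YB; rlra.
  rewrite wg mul1r; apply: fejer_lower => //.
  rewrite normrM d1 (@ger0_norm _ Q%:R^-1) ?invr_ge0 // mulrAC ler_pdivrMr // mul1r.
  apply: le_trans (ler_wpM2r _ d2) _; first by pos.
  have c1 : 12 * C0 * (M1%:R * sY) <= Y.
    by rewrite mulrA -sYE expr2; apply: ler_wpM2r => //; exact: ltW.
  have C0p : 0 < C0 by rlra.
  rewrite -(ler_pM2l C0p); apply: le_trans YJ.
  have -> : C0 * (14 / 10 * (M1%:R * sY) * (8 * J%:R)) = (14 * 8 / (10 * 12)) * ((12 * C0 * (M1%:R * sY)) * J%:R) by field.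
  apply: (@le_trans _ _ ((14 * 8 / (10 * 12)) * (Y * J%:R))).
    by apply: ler_wpM2l; [pos|apply: ler_wpM2r].
  by rewrite -[leRHS]mul1r; apply: ler_wpM2r; [pos|rlra].
apply: (@le_trans _ _ (\sum_(x : T) J%:R / 4)).
  rewrite sumr_const card_prod card_ffun !card_ord -[leRHS]mulr_natl; exact: lexx.
rewrite /fmean.
apply: (@le_trans _ _ (\sum_(v in Phi @: finset.finset (fun x : T => true)) wgt R v * fejer J (((sqn v)%:R - mu) / Q%:R))).
  rewrite big_imset /=; last by move=> a b _ _; exact: Pinj.
  rewrite [leRHS](eq_bigl xpredT); last by move=> x; rewrite inE.
  by apply: ler_sum => x _; exact: term.
rewrite [leRHS](bigID (mem (Phi @: finset.finset (fun x : T => true)))) /= lerDl sumr_ge0 // => v _.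
by rewrite mulr_ge0 ?wgt_ge0 ?fejer_ge0.
Qed.

End main_term.

(** * The model of a single arc *)

Section peaks.
Context (R : realType).
Implicit Types (a c h e l s t u mu x y : R) (B k J Q L n D : nat).

Lemma cos_ce x : (cos (2 * pi * x))%:C%C = (2^-1)%:C%C * (ce x + ce (- x)) :> R[i].
Proof.
by rewrite ceN /ce; apply/eqP; rewrite eq_complex /=; apply/andP; split; apply/eqP; field.
Qed.

(** The sum over an arc of the theta power against the linearised phase. It splits into two Fejer
    means at [c s] and [-(c s)], so its modulus and its real part are controlled by [fsm]. *)
Definition osc B k J Q c t s : R[i] :=
  \sum_(j <- zr J) (tent R J j)%:C%C *
    (wsum B (j%:~R / Q%:R) ^+ k * (cos (2 * pi * (c * t + c * s * (j%:~R / Q%:R))))%:C%C).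

Lemma oscE B k J Q c t s : (0 < J)%N -> osc B k J Q c t s =
  (2^-1)%:C%C * (ce (c * t) * (fmean B k J Q (- (c * s)))%:C%C + ce (- (c * t)) * (fmean B k J Q (c * s))%:C%C).
Proof.
move=> J0; rewrite !fmeanE // !mulr_sumr -big_split /= mulr_sumr; apply: eq_bigr => j _.
rewrite cos_ce; set y := j%:~R / Q%:R.
have -> : ce (c * t + c * s * y) = ce (c * t) * ce (- (y * - (c * s))) by rewrite -ceD; congr ce; ring.
have -> : ce (- (c * t + c * s * y)) = ce (- (c * t)) * ce (- (y * (c * s))) by rewrite -ceD; congr ce; ring.
ring.
Qed.

Lemma cabs_osc B k J Q c t s : (0 < J)%N -> cabs (osc B k J Q c t s) <= fsm B k J Q c s.
Proof.
move=> J0; rewrite oscE // cabsM cabs_real ger0_norm ?invr_ge0 // /fsm; apply: ler_wpM2l; first by rewrite invr_ge0.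
apply: le_trans (cabsD _ _) _; rewrite !cabsM !cabs_ce !cabs_real !mul1r addrC.
by rewrite !ger0_norm ?fmean_ge0.
Qed.

Lemma Re_osc B k J Q c t s : (0 < J)%N -> complex.Re (osc B k J Q c t s) = cos (2 * pi * (c * t)) * fsm B k J Q c s.
Proof.
move=> J0; rewrite oscE // ReZ ReD [ce (c * t) * _]mulrC [ce (- (c * t)) * _]mulrC !ReZ /fsm /=.
have -> : 2 * pi * - (c * t) = - (2 * pi * (c * t)) by ring.
by rewrite cosN; ring.
Qed.

Lemma Re_scaled (a b : R) (z w : R[i]) : complex.Re (z * (a%:C%C * (w * b%:C%C))) = a * b * complex.Re (z * w).
Proof.
have -> : z * (a%:C%C * (w * b%:C%C)) = a%:C%C * (b%:C%C * (z * w)).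
  by rewrite mulrCA [z * (w * _)]mulrA [z * w * _]mulrC.
by rewrite !ReZ mulrA.
Qed.

(** The arc at [u = b / d] with theta sum and dual sum replaced by their approximations; [z] is a
    power of the Gauss sum. *)
Definition Mpk B k J Q c h L u (z : R[i]) : R :=
  \sum_(p <- zr L) \sum_(l <- zr L) tent R L p * tent R L l *
    (wker c h (nrm (u + p%:~R) l%:~R) *
     complex.Re (z * osc B k J Q c (nrm (u + p%:~R) l%:~R) ((u + p%:~R) / nrm (u + p%:~R) l%:~R))).

Lemma Mpk_le B k J Q c h L u (z : R[i]) : (0 < J)%N -> 0 <= c -> `|Mpk B k J Q c h L u z| <= cabs z * Lam B k J Q c h L u.
Proof.
move=> J0 c0; have t0 := @tent_ge0 R L.
rewrite /Mpk /Lam mulr_sumr; apply: le_trans (ler_norm_sum _ _ _) _; apply: ler_sum => p _.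
rewrite mulr_sumr; apply: le_trans (ler_norm_sum _ _ _) _; apply: ler_sum => l _.
rewrite normrM (@ger0_norm _ (tent R L p * _)) ?mulr_ge0 // [leRHS]mulrCA; apply: ler_wpM2l; first exact: mulr_ge0.
rewrite /lterm; set t := nrm _ _; rewrite normrM (@ger0_norm _ (wker _ _ _)) ?wker_ge0 // [leRHS]mulrCA.
apply: ler_wpM2l; first exact: wker_ge0.
apply: le_trans (Re_le_cabs _) _; rewrite cabsM; apply: ler_wpM2l; first exact: cabs_ge0.
exact: cabs_osc.
Qed.

Lemma cabs_gsum_le1 d b : (0 < d)%N -> coprime b d -> cabs (gsum R d b%:Z) <= 1.
Proof.
move=> d0 co; rewrite -(@expr_le1 _ 2) ?cabs_ge0 //.
apply: le_trans (@gsum_le R d b%:Z d0 co) _; rewrite ler_pdivrMr ?ltr0n // mul1r.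
case: ifP => _; first by rewrite ler1n.
case: ifP => h4; last by [].
by rewrite ler_nat; move/dvdn_leq: h4 => /(_ d0); apply: leq_trans.
Qed.

(** The first coordinate is a fraction with denominator [d <= D], so a norm below [1/D] forces the
    zero frequency. *)
Lemma small_freq (d b : nat) (p l : int) (D : nat) : (0 < d <= D)%N -> (b < d)%N ->
  nrm (b%:R / d%:R + p%:~R) l%:~R < D%:R^-1 :> R -> [/\ b = 0%N, p = 0 & l = 0].
Proof.
move=> /andP[d0 dD] bd ht.
have dp : 0 < d%:R :> R by rewrite ltr0n.
have Dd : D%:R^-1 <= d%:R^-1 :> R by rewrite lef_pV2 ?posrE ?ltr0n ?ler_nat // (leq_trans d0).
have d1 : d%:R^-1 <= 1 :> R by rewrite invf_le1 // ler1n.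
have l0 : l = 0.
  have : `|l%:~R| < 1 :> R by apply: le_lt_trans (nrm_ger (b%:R / d%:R + p%:~R) _) _; rlra.
  by rewrite absz_int ltrn1 => /eqP; lia.
have z0 : b%:Z + p * d%:Z = 0.
  have : `|b%:R / d%:R + p%:~R| < d%:R^-1 :> R by apply: le_lt_trans (nrm_gel _ l%:~R) _; rlra.
  have -> : b%:R / d%:R + p%:~R = (b%:Z + p * d%:Z)%:~R / d%:R :> R by rewrite intrD intrM -!pmulrn; field; rewrite gt_eqF.
  rewrite normrM (@ger0_norm _ d%:R^-1) ?invr_ge0 // ltr_pdivrMr // mulVf ?gt_eqF // absz_int ltrn1.
  by move=> /eqP; lia.
have p0 : p = 0.
  case: p z0 ht => [[|n]|n] //; last by rewrite NegzE; nia.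
  by nia.
by split=> //; move: z0; rewrite p0; lia.
Qed.

(** On an arc [B^2 |y|] is bounded, so [wsum_gsum] has a bounded error, a relative gain [1/B] per
    power. [Uker_linear] gains [1/c] in the dual sum, and the zero frequency costs [h^4]. *)
Lemma peak_error k (Ce : R) D (C0 : nat) : 0 < Ce -> (0 < D)%N -> (0 < C0)%N ->
  exists C : R, 0 < C /\ forall e c h B J Q L (d b : nat), 4 <= c -> 0 < h <= 1 -> 0 <= e <= Ce * h ^+ 2 / c ^+ 2 ->
  2 * C0%:R * D%:R <= c -> (0 < B)%N -> B%:R ^+ 2 <= 4 * c -> (0 < J)%N -> (0 < Q)%N -> c * (J%:R / Q%:R) = C0%:R ->
  (0 < L)%N -> (0 < d <= D)%N -> (b < d)%N -> coprime b d ->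
  `|\sum_(j <- zr J) tent R J j * (complex.Re (wsum B (b%:R / d%:R + j%:~R / Q%:R) ^+ k.+1) * Adual e c h L (b%:R / d%:R + j%:~R / Q%:R))
    - kappa R * Mpk B k.+1 J Q c h L (b%:R / d%:R) (gsum R d b%:Z ^+ k.+1)|
  <= C * (fbound R B k.+1 J * c ^+ 3) * (h ^+ 2 / B%:R + c^-1 + h ^+ 4).
Proof.
move=> Ce0 D0 C00.
have [CA [CA0 hA]] := Adual_le Ce0.
have [CS [CS0 hS]] := Uker_small Ce0.
have C0p : 0 < C0%:R :> R by rewrite ltr0n.
have D1 : 1 <= D%:R :> R by rewrite ler1n.
have [CL [CL0 hL]] := Uker_linear Ce0 D1 C0p.
have kp := kappa_gt0 R.
pose Ew : R := 2 * D%:R * (5 + 160 * (4 * C0%:R)).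
have Ew0 : 0 < Ew by rewrite /Ew; pos.
have kp1 : 0 < k.+1%:R :> R by rewrite ltr0n.
exists (k.+1%:R * Ew * CA + kappa R * (64 * CL) + kappa R * CS); split; first by pos.
move=> e c h B J Q L d b c4 hh he hc B0 Bc J0 Q0 cJ L0 dD bd co.
have /andP[h0 h1] := hh; have /andP[d0 dD'] := dD.
have c0 : 0 < c by rlra.
have Bp : 0 < B%:R :> R by rewrite ltr0n.
have Qp : 0 < Q%:R :> R by rewrite ltr0n.
set u := b%:R / d%:R; set S := gsum R d b%:Z; set z := S ^+ k.+1.
have S1 : cabs S <= 1 by exact: cabs_gsum_le1.
pose w (p l : int) := wker c h (nrm (u + p%:~R) l%:~R).
pose th (p l j : int) : R := cos (2 * pi * (c * nrm (u + p%:~R) l%:~R + c * ((u + p%:~R) / nrm (u + p%:~R) l%:~R) * (j%:~R / Q%:R))).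
pose V (j : int) : R := \sum_(p <- zr L) \sum_(l <- zr L) tent R L p * tent R L l * (w p l * th p l j).
pose f0 (j : int) := wsum B (j%:~R / Q%:R : R).
have ME : kappa R * Mpk B k.+1 J Q c h L u z = \sum_(j <- zr J) tent R J j * (complex.Re (z * f0 j ^+ k.+1) * (kappa R * V j)).
  rewrite /Mpk mulr_sumr.
  transitivity (\sum_(p <- zr L) \sum_(j <- zr J) \sum_(l <- zr L) tent R J j * (complex.Re (z * f0 j ^+ k.+1) * (kappa R * (tent R L p * tent R L l * (w p l * th p l j))))).
    apply: eq_bigr => p _; rewrite mulr_sumr exchange_big /=; apply: eq_bigr => l _.
    rewrite /osc mulr_sumr Re_sum !mulr_sumr; apply: eq_bigr => j _.
    rewrite -/(f0 j) -/(th p l j) -/(w p l).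
    by rewrite Re_scaled; ring.
  rewrite exchange_big /=; apply: eq_bigr => j _; rewrite /V !mulr_sumr; apply: eq_bigr => p _.
  by rewrite !mulr_sumr.
rewrite ME -sumrB.
pose Z : R := k.+1%:R * Ew * CA * (c ^+ 3 * (h ^+ 2 / B%:R)) + kappa R * (64 * CL * c ^+ 2 + CS * c ^+ 3 * h ^+ 4).
have pt (j : int) : j \in zr J -> `|tent R J j * (complex.Re (wsum B (u + j%:~R / Q%:R) ^+ k.+1) * Adual e c h L (u + j%:~R / Q%:R)) -
   tent R J j * (complex.Re (z * f0 j ^+ k.+1) * (kappa R * V j))| <= tent R J j * ((5 * B%:R) ^+ k.+1 * Z).
  rewrite mem_zr => jJ; rewrite -mulrBr normrM (ger0_norm (tent_ge0 R J j)); apply: ler_wpM2l; first exact: tent_ge0.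
  set y := j%:~R / Q%:R.
  have yJ : `|y| <= J%:R / Q%:R.
    rewrite /y normrM (@ger0_norm _ Q%:R^-1) ?invr_ge0 // ler_pM2r ?invr_gt0 // absz_int ler_nat //.
  have yc : `|y| <= C0%:R / c by rewrite -cJ mulrAC divff ?mul1r // gt_eqF.
  set f1 := wsum B (u + y); set A := Adual e c h L (u + y).
  have f1b : cabs f1 <= 5 * B%:R by exact: cabs_wsum_le.
  have f0b : cabs (f0 j) <= 5 * B%:R by exact: cabs_wsum_le.
  have Sf0 : cabs (S * f0 j) <= 5 * B%:R.
    by rewrite cabsM -[leRHS]mul1r; apply: ler_pM; rewrite ?cabs_ge0.
  have dw : cabs (f1 - S * f0 j) <= Ew.
    apply: le_trans (wsum_gsum b%:Z y B0 d0) _; rewrite /Ew.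
    have By : B%:R ^+ 2 * `|y| <= 4 * C0%:R.
      apply: (@le_trans _ _ (4 * c * (C0%:R / c))).
        by apply: ler_pM => //; pos.
      by rewrite mulrCA -!mulrA divff ?mulr1 ?gt_eqF // mulrC.
    have By0 : 0 <= B%:R ^+ 2 * `|y| by pos.
    apply: ler_pM; [by pos|by pos| |by rlra].
    by apply: ler_wpM2l => //; rewrite ler_nat.
  have E1 : `|complex.Re (f1 ^+ k.+1) * A - complex.Re (z * f0 j ^+ k.+1) * A| <= (5 * B%:R) ^+ k.+1 * (k.+1%:R * Ew * CA * (c ^+ 3 * (h ^+ 2 / B%:R))).
    rewrite -mulrBl normrM.
    have -> : z * f0 j ^+ k.+1 = (S * f0 j) ^+ k.+1 by rewrite exprMn.
    rewrite -ReN -ReD.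
    have b1 : `|complex.Re (f1 ^+ k.+1 - (S * f0 j) ^+ k.+1)| <= k.+1%:R * (5 * B%:R) ^+ k * Ew.
      apply: le_trans (Re_le_cabs _) _; apply: le_trans (@cabsXB R f1 (S * f0 j) k _ f1b Sf0) _.
      by apply: ler_wpM2l => //; pos.
    have b2 : `|A| <= CA * c ^+ 3 * h ^+ 2 by exact: hA.
    apply: le_trans (ler_pM _ _ b1 b2) _ => //.
    have -> : (5 * B%:R) ^+ k.+1 * (k.+1%:R * Ew * CA * (c ^+ 3 * (h ^+ 2 / B%:R))) = 5 * (k.+1%:R * (5 * B%:R) ^+ k * Ew * (CA * c ^+ 3 * h ^+ 2)).
      by rewrite exprSr; field; rewrite gt_eqF.
    rewrite -[leLHS]mul1r; apply: ler_wpM2r; last by rlra.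
    by pos.
  have dV : `|A - kappa R * V j| <= kappa R * (64 * CL * c ^+ 2 + CS * c ^+ 3 * h ^+ 4).
    have -> : A - kappa R * V j = kappa R * \sum_(p <- zr L) \sum_(l <- zr L) tent R L p * tent R L l *
        (Uker e c h (nrm (u + p%:~R + y) l%:~R) - w p l * th p l j).
      rewrite /A /Adual /V !mulr_sumr -sumrB; apply: eq_bigr => p _; rewrite !mulr_sumr -sumrB; apply: eq_bigr => l _.
      by rewrite /nrm [u + p%:~R + y]addrAC; ring.
    rewrite normrM (gtr0_norm kp); apply: ler_wpM2l; first exact: ltW.
    apply: (@le_trans _ _ (\sum_(p <- zr L) \sum_(l <- zr L) (CL * c ^+ 2 * (lam 1 (u + p%:~R) * lam 1 (0 + l%:~R)) + CS * c ^+ 3 * h ^+ 4 * ((absz p <= 0)%N%:R * (absz l <= 0)%N%:R)))).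
      apply: le_trans (ler_norm_sum _ _ _) _; apply: ler_sum => p _; apply: le_trans (ler_norm_sum _ _ _) _; apply: ler_sum => l _.
      have t0 := @tent_ge0 R L; have t1 (x : int) := @tent_le1 R L x L0.
      rewrite normrM (@ger0_norm _ (tent R L p * _)) ?mulr_ge0 //.
      have tt : tent R L p * tent R L l <= 1 by rewrite -[leRHS]mulr1; apply: ler_pM.
      apply: (@le_trans _ _ `|Uker e c h (nrm (u + p%:~R + y) l%:~R) - w p l * th p l j|).
        by rewrite -[leRHS]mul1r; apply: ler_wpM2r.
      have ll0 : 0 <= lam 1 (u + p%:~R) * lam 1 l%:~R by rewrite mulr_ge0 ?lam_ge0.
      rewrite add0r; have [tD|tD] := leP (D%:R^-1) (nrm (u + p%:~R) l%:~R).
        apply: le_trans (hL e c h (u + p%:~R) l%:~R y c4 hh he hc tD yc) _.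
        by rewrite lerDl; pos.
      have [b00 p0 l0] := small_freq dD bd tD.
      (* At the zero frequency the division by 0 in [wker] returns 0, so the model has no such term
         and [Uker_small] bounds the true one. *)
      have -> : w p l = 0.
        rewrite /w /wker /u b00 p0 l0 mul0r add0r /nrm expr0n /= addr0 sqrtr0 mulr0 mul0r sin0 mul0r expr0n /= mulr0 //.
      have -> : (absz p <= 0)%N%:R * (absz l <= 0)%N%:R = 1 :> R by rewrite p0 l0 mulr1.
      rewrite mul0r subr0 mulr1; apply: ler_wpDl; first by pos.
      exact: hS.
    have -> : \sum_(p <- zr L) \sum_(l <- zr L) (CL * c ^+ 2 * (lam 1 (u + p%:~R) * lam 1 (0 + l%:~R)) + CS * c ^+ 3 * h ^+ 4 * ((absz p <= 0)%N%:R * (absz l <= 0)%N%:R))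
      = CL * c ^+ 2 * ((\sum_(p <- zr L) lam 1 (u + p%:~R)) * (\sum_(l <- zr L) lam 1 (0 + l%:~R))) +
        CS * c ^+ 3 * h ^+ 4 * ((\sum_(p <- zr L) (absz p <= 0)%N%:R) * (\sum_(l <- zr L) (absz l <= 0)%N%:R)) :> R.
      rewrite !big_distrlr /= !mulr_sumr -big_split /=; apply: eq_bigr => p _.
      by rewrite !mulr_sumr -big_split.
    have h11 : (0 < (1 : R)) && ((1 : R) <= 1) by rewrite ltr01 lexx.
    have s1 := lam_sum u L h11; have s2 := lam_sum 0 L h11; rewrite !mulr1 in s1 s2.
    have i1 := zr_indicator_sum R L 0; rewrite mulr0 add0r in i1.
    apply: lerD.
      have -> : 64 * CL * c ^+ 2 = CL * c ^+ 2 * (8 * 8) by ring.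
      apply: ler_wpM2l; first by pos.
      by apply: ler_pM => //; apply: sumr_ge0 => q _; exact: lam_ge0.
    rewrite -[leRHS]mulr1; apply: ler_wpM2l; first by pos.
    by rewrite -[leRHS]mulr1; apply: ler_pM => //; apply: sumr_ge0.
  have E2 : `|complex.Re (z * f0 j ^+ k.+1) * A - complex.Re (z * f0 j ^+ k.+1) * (kappa R * V j)| <= (5 * B%:R) ^+ k.+1 * (kappa R * (64 * CL * c ^+ 2 + CS * c ^+ 3 * h ^+ 4)).
    rewrite -mulrBr normrM; apply: ler_pM => //; apply: le_trans (Re_le_cabs _) _.
    rewrite /z -exprMn cabsX; apply: lerXn2r; rewrite ?nnegrE ?cabs_ge0 //; by pos.
  have -> : complex.Re (f1 ^+ k.+1) * A - complex.Re (z * f0 j ^+ k.+1) * (kappa R * V j) =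
    (complex.Re (f1 ^+ k.+1) * A - complex.Re (z * f0 j ^+ k.+1) * A) + (complex.Re (z * f0 j ^+ k.+1) * A - complex.Re (z * f0 j ^+ k.+1) * (kappa R * V j)) by ring.
  by apply: le_trans (ler_normD _ _) _; rewrite /Z [leRHS]mulrDr; exact: lerD.
apply: le_trans (ler_norm_sum _ _ _) _.
apply: (@le_trans _ _ (\sum_(j <- zr J) tent R J j * ((5 * B%:R) ^+ k.+1 * Z))).
  by rewrite !big_seq; apply: ler_sum => j jJ; exact: pt.
rewrite -mulr_suml.
have Z0 : 0 <= Z by rewrite /Z; pos.
apply: (@le_trans _ _ (3 * J%:R * ((5 * B%:R) ^+ k.+1 * Z))).
  by apply: ler_wpM2r; [pos|exact: tent_sum].
rewrite mulrA -/(fbound R B k.+1 J).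
have -> : Z = c ^+ 3 * (k.+1%:R * Ew * CA * (h ^+ 2 / B%:R) + kappa R * (64 * CL) * c^-1 + kappa R * CS * h ^+ 4).
  by rewrite /Z; field; rewrite !gt_eqF.
set F0 := fbound _ _ _ _; have F00 : 0 <= F0 := fbound_ge0 R B k.+1 J.
rewrite mulrA [leRHS]mulrAC [leRHS]mulrC; apply: ler_wpM2l; first by pos.
set a1 := k.+1%:R * Ew * CA; set a2 := kappa R * (64 * CL); set a3 := kappa R * CS.
have a10 : 0 <= a1 by rewrite /a1; pos.
have a20 : 0 <= a2 by rewrite /a2; pos.
have a30 : 0 <= a3 by rewrite /a3; pos.
have x1 : 0 <= h ^+ 2 / B%:R by pos.
have x2 : 0 <= c^-1 by pos.
have x3 : 0 <= h ^+ 4 by pos.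
by rewrite !mulrDr !mulrDl; rnra.
Qed.

End peaks.

(** * All arcs together *)

Section peak_sum.
Context (R : realType).
Local Open Scope classical_set_scope.
Implicit Types (a c h e l s t u mu x y : R) (B k J Q L n D q : nat).

Lemma peak_mass_total q D : (3 <= q)%N ->
  \sum_(p : 'I_D.+1 * 'I_D.+1 | peak p && (2 <= p.1)%N) cabs (gsum R p.1 p.2%:Z) ^+ (2 * q) <= 7 / 10.
Proof.
move=> q3.
have -> : \sum_(p : 'I_D.+1 * 'I_D.+1 | peak p && (2 <= p.1)%N) cabs (gsum R p.1 p.2%:Z) ^+ (2 * q) =
  \sum_(d < D.+1 | (2 <= d)%N) \sum_(b < D.+1 | coprime b d && (b < d)%N) cabs (gsum R d b%:Z) ^+ (2 * q).
  by rewrite pair_big_dep /=; apply: eq_bigl => p; rewrite /peak andbC [(p.2 < p.1)%N && _]andbC.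
apply: le_trans (peak_mass_sum R D.+1); rewrite big_geq_mkord /=.
apply: ler_sum => d d2; apply: le_trans (@gsum_pow_sum R q d q3 d2).
by rewrite (@big_ord_widen_cond _ _ _ d D.+1 (fun b => coprime b d) (fun b => cabs (gsum R d b%:Z) ^+ (2 * q))) // ltnW.
Qed.

Lemma gsum1 : gsum R 1 0 = 1.
Proof. by rewrite /gsum big_ord1 !mul0r ce0 invr1 mulr1. Qed.

(** Aligned frequencies have cosine at least 99/100. In the tail the cosine is only at least -1,
    which loses at most twice the tail. *)
Lemma Mpk_main B k J Q c h L K (Tl : R) : (0 < J)%N -> 0 <= c ->
  (forall p l : int, (absz p ^ 2 + absz l ^ 2 <= 4 * K ^ 2)%N -> 99 / 100 <= cos (2 * pi * (c * nrm p%:~R l%:~R))) ->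
  \sum_(p <- zr L) \sum_(l <- zr L) tent R L p * tent R L l *
    (if (4 * K ^ 2 < absz p ^ 2 + absz l ^ 2)%N then lterm B k J Q c h p%:~R l%:~R else 0) <= Tl ->
  99 / 100 * Lam B k J Q c h L 0 - 2 * Tl <= Mpk B k J Q c h L 0 1.
Proof.
move=> J0 c0 al hT.
apply: (@le_trans _ _ (99 / 100 * Lam B k J Q c h L 0 - 2 * \sum_(p <- zr L) \sum_(l <- zr L) tent R L p * tent R L l *
    (if (4 * K ^ 2 < absz p ^ 2 + absz l ^ 2)%N then lterm B k J Q c h p%:~R l%:~R else 0))).
  by rewrite lerD2l lerN2 ler_pM2l.
rewrite /Lam /Mpk !mulr_sumr -sumrB; apply: ler_sum => p _; rewrite !mulr_sumr -sumrB; apply: ler_sum => l _.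
rewrite add0r mul1r Re_osc //; set t := nrm _ _.
have tt : 0 <= tent R L p * tent R L l by rewrite mulr_ge0 ?tent_ge0.
have l0 : 0 <= lterm B k J Q c h p%:~R l%:~R by exact: lterm_ge0.
have -> : wker c h t * (cos (2 * pi * (c * t)) * fsm B k J Q c (p%:~R / t)) = cos (2 * pi * (c * t)) * lterm B k J Q c h p%:~R l%:~R.
  by rewrite /lterm -/t; ring.
have c1 : -1 <= cos (2 * pi * (c * t)) by exact: cos_geN1.
set co := cos _ in c1 *; set lt := lterm _ _ _ _ _ _ _ _ in l0 *; set T := _ * _ in tt *.
have -> : 99 / 100 * (T * lt) = T * (99 / 100 * lt) by ring.
rewrite [2 * (T * _)]mulrCA -mulrBr; apply: ler_wpM2l => //.
case: ltnP => hK; first by rnra.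
by have := al p l hK; rewrite -/t -/co => c2; rewrite mulr0 subr0; apply: ler_wpM2r.
Qed.

Definition peak_sum B k J Q D (A : R -> R) : R :=
  \sum_(p : 'I_D.+1 * 'I_D.+1 | peak p) \sum_(j <- zr J) tent R J j *
    (complex.Re (wsum B (p.2%:R / p.1%:R + j%:~R / Q%:R) ^+ k) * A (p.2%:R / p.1%:R + j%:~R / Q%:R)).

(** No cancellation is used on the other arcs: each is bounded by its Gauss factor times the mass at
    0, together at most 7/10 of it, and 99/100 - 7/10 = 29/100. *)
Lemma peak_sum_lower q D B J Q c h L K (cmp Tl Err : R) (A : R -> R) : (3 <= q)%N -> (0 < J)%N -> 0 <= c -> (0 < D)%N ->
  (forall u, 0 <= u <= 1 -> Lam B (2 * q) J Q c h L u <= Lam B (2 * q) J Q c h L 0 + cmp) ->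
  (forall d b, (0 < d <= D)%N -> (b < d)%N -> coprime b d ->
   `|\sum_(j <- zr J) tent R J j * (complex.Re (wsum B (b%:R / d%:R + j%:~R / Q%:R) ^+ (2 * q)) * A (b%:R / d%:R + j%:~R / Q%:R))
    - kappa R * Mpk B (2 * q) J Q c h L (b%:R / d%:R) (gsum R d b%:Z ^+ (2 * q))| <= Err) ->
  (forall p l : int, (absz p ^ 2 + absz l ^ 2 <= 4 * K ^ 2)%N -> 99 / 100 <= cos (2 * pi * (c * nrm p%:~R l%:~R))) ->
  \sum_(p <- zr L) \sum_(l <- zr L) tent R L p * tent R L l *
    (if (4 * K ^ 2 < absz p ^ 2 + absz l ^ 2)%N then lterm B (2 * q) J Q c h p%:~R l%:~R else 0) <= Tl ->
  kappa R * (29 / 100 * Lam B (2 * q) J Q c h L 0 - 2 * Tl - cmp) - D.+1%:R ^+ 2 * Err <= peak_sum B (2 * q) J Q D A.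
Proof.
move=> q3 J0 c0 D0 hcmp herr al hT.
set L0 := Lam _ _ _ _ _ _ _ _ in hcmp *.
have kp := kappa_gt0 R.
have L00 : 0 <= L0.
  by apply: sumr_ge0 => p _; apply: sumr_ge0 => l _; apply: mulr_ge0; [rewrite mulr_ge0 ?tent_ge0|exact: lterm_ge0].
have cmp0 : 0 <= cmp by have /hcmp : 0 <= (0 : R) <= 1 by [rewrite lexx ler01]; rewrite -/L0; rlra.
have Err0 : 0 <= Err.
  by apply: le_trans (herr 1%N 0%N _ _ _) => //; rewrite D0.
pose M (p : 'I_D.+1 * 'I_D.+1) := Mpk B (2 * q) J Q c h L (p.2%:R / p.1%:R) (gsum R p.1 p.2%:Z ^+ (2 * q)).
have pk (p : 'I_D.+1 * 'I_D.+1) : peak p -> [/\ (0 < p.1 <= D)%N, (p.2 < p.1)%N & coprime p.2 p.1].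
  by move=> /andP[a1 a2]; split=> //; rewrite (leq_ltn_trans _ a1) //= -ltnS.
apply: (@le_trans _ _ (\sum_(p : 'I_D.+1 * 'I_D.+1 | peak p) (kappa R * M p - Err))); last first.
  apply: ler_sum => p /pk[a1 a2 a3].
  by have := herr p.1 p.2 a1 a2 a3; rewrite ler_norml => /andP[+ _]; rewrite -/(M p); rlra.
rewrite sumrB; apply: lerB; last first.
  rewrite sumr_const -[leLHS]mulr_natl; apply: ler_wpM2r => //; rewrite -natrX ler_nat.
  by apply: leq_trans (max_card _) _; rewrite card_prod card_ord.
rewrite -mulr_sumr; apply: ler_wpM2l; first exact: ltW.
(* The arc at 0, with Gauss sum 1; every other peak has denominator at least 2. *)
pose p1 : 'I_D.+1 * 'I_D.+1 := (inord 1, ord0).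
have v1 : (p1.1 = 1 :> nat)%N by rewrite /= inordK.
rewrite (bigD1 p1) /=; last by rewrite /peak v1.
have M1 : 99 / 100 * L0 - 2 * Tl <= M p1.
  rewrite /M v1 /= gsum1 expr1n mul0r; exact: (Mpk_main J0 c0 al hT).
have rest : - (7 / 10 * (L0 + cmp)) <= \sum_(p : 'I_D.+1 * 'I_D.+1 | peak p && (p != p1)) M p.
  rewrite (eq_bigl (fun p : 'I_D.+1 * 'I_D.+1 => peak p && (2 <= p.1)%N)); last first.
    move=> p; case: (boolP (peak p)) => //= /pk[/andP[a1 _] a2 _].
    apply/idP/idP => [ne|p2]; last first.
      by apply/eqP => E; move: p2; rewrite E v1.
    rewrite ltn_neqAle a1 andbT; apply/eqP => E1; move/eqP: ne; apply.
    by case: p a1 a2 E1 => pa pb /= a1 a2 E1; congr pair; apply: val_inj; rewrite /= ?inordK //; move: a2; rewrite -E1; case: (nat_of_ord pb).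
  apply: (@le_trans _ _ (\sum_(p : 'I_D.+1 * 'I_D.+1 | peak p && (2 <= p.1)%N) - (cabs (gsum R p.1 p.2%:Z) ^+ (2 * q) * (L0 + cmp)))).
    rewrite sumrN lerN2 -mulr_suml; apply: ler_wpM2r; first by rlra.
    exact: peak_mass_total.
  apply: ler_sum => p /andP[/pk[/andP[a1 a4] a2 a3] _].
  have := @Mpk_le R B (2 * q) J Q c h L (p.2%:R / p.1%:R) (gsum R p.1 p.2%:Z ^+ (2 * q)) J0 c0.
  rewrite ler_norml => /andP[+ _]; apply: le_trans; rewrite lerN2 cabsX; apply: ler_wpM2l.
    by rewrite exprn_ge0 ?cabs_ge0.
  apply: hcmp; apply/andP; split; first by rewrite divr_ge0.
  by rewrite ler_pdivrMr ?ltr0n // mul1r ler_nat ltnW.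
by rlra.
Qed.

Lemma Lop_sum (I : Type) (s : seq I) (F : I -> R -> R) e c h :
  Lop e (fun z => \sum_(i <- s) F i z) c h = \sum_(i <- s) Lop e (F i) c h.
Proof.
by elim: s => [|i s IH]; rewrite /Lop /D4 /D2 ?big_nil ?big_cons; [ring|rewrite -IH /Lop /D4 /D2; ring].
Qed.

Lemma LopMr (F : R -> R) (k e c h : R) : Lop e (fun z => F z * k) c h = Lop e F c h * k.
Proof. by rewrite /Lop /D4 /D2; ring. Qed.

Lemma disc_sum_periodic W c y : disc_sum W c (y + 1) = disc_sum W c y.
Proof.
rewrite /disc_sum; apply: eq_bigr => m _; apply: eq_bigr => w _; congr (_ * _).
have -> : (y + 1) * (m%:R - W%:R) = y * (m%:R - W%:R) + (m%:Z - W%:Z)%:~R by rewrite mulrDl mul1r intrB -!pmulrn.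
by have := congr1 (@complex.Re R) (ceDint (y * (m%:R - W%:R)) (m%:Z - W%:Z)).
Qed.

Lemma cvg_bigsum (I : Type) (s : seq I) (P : pred I) (F : I -> nat -> R) (l : I -> R) :
  (forall i, F i L @[L --> \oo] --> l i) -> \sum_(i <- s | P i) F i L @[L --> \oo] --> \sum_(i <- s | P i) l i.
Proof.
move=> cv; elim: s => [|i s IH].
  rewrite big_nil (_ : (fun L => _) = fun=> 0); first exact: cvg_cst.
  by apply/funext => L; rewrite big_nil.
rewrite big_cons (_ : (fun L => _) = fun L => (if P i then F i L else 0) + \sum_(i <- s | P i) F i L); last first.
  by apply/funext => L; rewrite big_cons; case: ifP; rewrite ?add0r.
by case: ifP => _; [apply: cvgD|rewrite -[X in _ --> X]add0r; apply: cvgD => //; exact: cvg_cst].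
Qed.

Lemma peak_sum_cvg B k J Q D (A : nat -> R -> R) (Al : R -> R) :
  (forall y, A L y @[L --> \oo] --> Al y) ->
  peak_sum B k J Q D (A L) @[L --> \oo] --> peak_sum B k J Q D Al.
Proof.
move=> cv; rewrite /peak_sum.
apply: cvg_bigsum => p; apply: cvg_bigsum => j.
by apply: cvgM; [exact: cvg_cst|apply: cvgM => //; exact: cvg_cst].
Qed.

End peak_sum.

Lemma dvd_fact_mul (d D Y m : nat) : (0 < d <= D)%N -> (d %| Y * (D`! * m))%N.
Proof. by move=> /dvdn_fact h; apply/dvdn_mull/dvdn_mulr. Qed.

Lemma width_lt (D g Y : nat) : (0 < g)%N -> (2 * D ^ 3 < Y)%N -> (2 * (D * g) * D ^ 2 < Y * g)%N.
Proof.
by move=> g0 h; have -> : (2 * (D * g) * D ^ 2 = 2 * D ^ 3 * g)%N by [ring]; rewrite ltn_pmul2r.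
Qed.

Lemma box_sum_lt (q B Y g s : nat) : (s <= 2 * q * (2 * B) ^ 2)%N -> (B ^ 2 <= 4 * Y)%N -> (0 < Y)%N -> (32 * q + 3 <= g)%N ->
  (s + 2 * Y < Y * g)%N.
Proof.
move=> h1 h2 Y0 h3; apply: (@leq_trans (Y * (32 * q + 3))%N); last by rewrite leq_pmul2l.
apply: (@leq_ltn_trans (2 * q * (4 * (4 * Y)) + 2 * Y)%N); last by lia.
rewrite leq_add2r; apply: leq_trans h1 _; rewrite leq_mul2l; apply/orP; right.
by rewrite expnMn leq_mul2l.
Qed.

(** * Choice of parameters and the lower bound of the functional *)

Section circle_lower.
Context (R : realType).
Local Open Scope classical_set_scope.
Implicit Types (a c h e s t u x y : R) (B J Q L n D E H Y q g : nat).

Lemma nat_large (a d : R) : 0 < d -> exists n : nat, (0 < n)%N /\ forall m : nat, (n <= m)%N -> a / m%:R <= d.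
Proof.
move=> d0; have b0 : 0 <= `|a| / d by rewrite divr_ge0 // ltW.
exists (Num.bound (`|a| / d)).+1; split=> // m hm.
have m0 : 0 < m%:R :> R by rewrite ltr0n (leq_trans _ hm).
rewrite ler_pdivrMr //; apply: le_trans (ler_norm _) _; rewrite mulrC -ler_pdivrMr //.
apply: le_trans (ltW (archi_boundP b0)) _; rewrite ler_nat; exact: ltnW.
Qed.

Lemma truncn_half x : 1 <= x -> (Num.truncn x)%:R <= x /\ x / 2 <= (Num.truncn x)%:R.
Proof.
move=> x1; have /andP[a1 a2] : (Num.truncn x)%:R <= x < (Num.truncn x).+1%:R by apply: truncn_itv; rlra.
split=> //; have n1 : 1 <= (Num.truncn x)%:R :> R.
  by rewrite ler1n -ltnS -(ltr_nat R); rlra.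
by move: a2; rewrite -natr1; rlra.
Qed.

(** The constant does not depend on [D]: a longer arc narrows the window, so the last coordinate has
    only about [sqrt Y / (12 D)] choices, but the Fejer kernel is higher by the factor [D]. This is
    what allows [D] to be chosen in terms of the constant. *)
Lemma Lam_lower_unit q D g H L Y B : (3 <= q)%N -> (0 < D)%N -> (0 < g)%N -> (0 < H)%N -> (36 * H <= L)%N ->
  (Y <= B ^ 2)%N -> ((8 * q) ^ 2 <= Y)%N -> ((12 * D) ^ 2 <= Y)%N -> (0 < B)%N ->
  (2 ^+ 20 * 96 * (16 * q%:R) ^+ (2 * q - 1))^-1 * (g%:R * Y%:R ^+ q * (Y%:R ^+ 3 * (48 * H%:R)^-1 ^+ 2))
    <= Lam B (2 * q) (D * g) (Y * g) Y%:R (48 * H%:R)^-1 L 0 :> R.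
Proof.
move=> q3 D0 g0 H0 HL YB Yq YD B0.
have [k kE] : exists k, (2 * q = k.+1)%N by exists (2 * q).-1; rewrite prednK // muln_gt0 /= (leq_trans _ q3).
have kE' : (2 * q - 1 = k)%N by rewrite kE subSS subn0.
set h := (48 * H%:R)^-1 : R; pose sY : R := Num.sqrt Y%:R.
have qp : 0 < q%:R :> R by rewrite ltr0n (leq_trans _ q3).
have Dp : 0 < D%:R :> R by rewrite ltr0n.
have gp : 0 < g%:R :> R by rewrite ltr0n.
have Hp : 0 < H%:R :> R by rewrite ltr0n.
have h0 : 0 < h by rewrite /h; pos.
have sY0 : 0 <= sY by exact: sqrtr_ge0.
have sYE : sY ^+ 2 = Y%:R by rewrite sqr_sqrtr.
have s1 : 8 * q%:R <= sY.
  by rewrite -ler_sqr ?nnegrE ?mulr_ge0 // sYE -natrM -natrX ler_nat.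
have s2 : 12 * D%:R <= sY.
  by rewrite -ler_sqr ?nnegrE ?mulr_ge0 // sYE -natrM -natrX ler_nat.
have [Ma Mb] : (Num.truncn (sY / (8 * q%:R)))%:R <= sY / (8 * q%:R) /\ sY / (8 * q%:R) / 2 <= (Num.truncn (sY / (8 * q%:R)))%:R :> R.
  by apply: truncn_half; rewrite ler_pdivlMr ?mul1r // mulr_gt0.
have [Na Nb] : (Num.truncn (sY / (12 * D%:R)))%:R <= sY / (12 * D%:R) /\ sY / (12 * D%:R) / 2 <= (Num.truncn (sY / (12 * D%:R)))%:R :> R.
  by apply: truncn_half; rewrite ler_pdivlMr ?mul1r // mulr_gt0.
set M := Num.truncn (sY / (8 * q%:R)) in Ma Mb; set M1 := Num.truncn (sY / (12 * D%:R)) in Na Nb.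
have M10 : (0 < M1)%N.
  rewrite -(ltr_nat R); apply: lt_le_trans Nb; rewrite divr_gt0 // divr_gt0 ?mulr_gt0 //.
  by apply: lt_le_trans s2; rewrite mulr_gt0.
pose m0 : R := (M ^ k * M1)%:R * ((D * g)%:R / 4).
have m00 : 0 <= m0 by rewrite /m0 mulr_ge0 // divr_ge0.
have hm s : 3 / 10 <= s <= 48 / 100 -> m0 <= fmean B k.+1 (D * g) (Y * g) (Y%:R * s).
  move=> /andP[sa sb]; apply: (@fmean_lower R B k (D * g) (Y * g) M M1 Y%:R D%:R).
  - by rewrite muln_gt0 D0.
  - rewrite muln_gt0 g0 andbT; apply: leq_trans Yq; rewrite expn_gt0 muln_gt0 /=.
    by rewrite (leq_trans _ q3).
  - exact: B0.
  - exact: M10.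
  - by rewrite -natrX ler_nat.
  - by rewrite ler1n.
  - by rewrite !natrM mulrCA.
  - have Msq : M%:R ^+ 2 <= (sY / (8 * q%:R)) ^+ 2 by apply: lerXn2r; rewrite ?nnegrE // divr_ge0 // mulr_ge0 // ltW.
    have kq : k%:R <= 2 * q%:R :> R by rewrite -natrM kE ler_nat.
    have q1 : 1 <= q%:R :> R by rewrite ler1n (leq_trans _ q3).
    apply: (@le_trans _ _ (16 * (2 * q%:R * (sY / (8 * q%:R)) ^+ 2))).
      by apply: ler_wpM2l => //; apply: ler_pM => //; exact: sqr_ge0.
    rewrite expr_div_n sYE.
    have -> : 16 * (2 * q%:R * (Y%:R / (8 * q%:R) ^+ 2)) = Y%:R / (2 * q%:R) :> R by field; rewrite gt_eqF.
    by rewrite ler_pdivrMr ?mulr_gt0 // ler_peMr //; rlra.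
  - by move: Na; rewrite ler_pdivlMr ?mulr_gt0 // -/sY; rlra.
  - by apply/andP; split; rewrite [Y%:R * s]mulrC; apply: ler_wpM2r.
have := @Lam_lower R B k.+1 (D * g) (Y * g) Y%:R H L m0 H0 HL (ler0n _ _) m00 hm.
rewrite -kE -/h; apply: le_trans.
have m0l : g%:R * Y%:R ^+ q / (96 * (16 * q%:R) ^+ k) <= m0.
  have Mk : (sY / (8 * q%:R) / 2) ^+ k <= M%:R ^+ k.
    by apply: lerXn2r => //; rewrite ?nnegrE // !divr_ge0 // mulr_ge0 // ltW.
  apply: (@le_trans _ _ ((sY / (8 * q%:R) / 2) ^+ k * (sY / (12 * D%:R) / 2) * ((D * g)%:R / 4))); last first.
    rewrite /m0 [(M ^ k * M1)%:R]natrM natrX; apply: ler_wpM2r; first by rewrite divr_ge0.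
    apply: ler_pM => //; first by rewrite exprn_ge0 // !divr_ge0 // mulr_ge0 // ltW.
    by rewrite !divr_ge0 // mulr_ge0 // ltW.
  have -> : sY / (8 * q%:R) / 2 = sY / (16 * q%:R) by field; rewrite gt_eqF.
  have -> : Y%:R ^+ q = sY ^+ k * sY by rewrite -sYE -exprM kE exprSr.
  have A0 : 0 < (16 * q%:R) ^+ k :> R by rewrite exprn_gt0 // mulr_gt0.
  rewrite expr_div_n natrM; move: ((16 * q%:R) ^+ k) A0 (sY ^+ k) => A A0 P.
  rewrite le_eqVlt; apply/orP; left; apply/eqP; field.
  by rewrite !gt_eqF.
rewrite kE'.
have A0 : 0 < (16 * q%:R) ^+ k :> R by rewrite exprn_gt0 // mulr_gt0.
have -> : (2 ^+ 20 * 96 * (16 * q%:R) ^+ k)^-1 * (g%:R * Y%:R ^+ q * (Y%:R ^+ 3 * h ^+ 2)) =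
  Y%:R ^+ 3 * h ^+ 2 * (g%:R * Y%:R ^+ q / (96 * (16 * q%:R) ^+ k)) / 2 ^+ 20.
  move: ((16 * q%:R) ^+ k) A0 (Y%:R ^+ q) => A A0 P; have t20 : 0 < 2 ^+ 20 :> R by rewrite exprn_gt0.
  by move: (2 ^+ 20 : R) t20 => T T0; field; rewrite !gt_eqF.
rewrite ler_pM2r; last by rewrite invr_gt0 exprn_gt0.
by apply: ler_wpM2l => //; pos.
Qed.

Lemma fbound_unit q D g Y B : (B ^ 2 <= 4 * Y)%N ->
  fbound R B (2 * q) (D * g) <= 3 * D%:R * 100 ^+ q * (g%:R * Y%:R ^+ q).
Proof.
move=> hB; rewrite /fbound exprM natrM.
have -> : 3 * D%:R * 100 ^+ q * (g%:R * Y%:R ^+ q) = 3 * (D%:R * g%:R) * (100 * Y%:R) ^+ q :> R by rewrite exprMn; ring.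
apply: ler_wpM2l; first by pos.
apply: lerXn2r; rewrite ?nnegrE; [by pos|by pos|].
have : B%:R ^+ 2 <= 4 * Y%:R :> R by rewrite -natrX -natrM ler_nat.
by rewrite exprMn; rlra.
Qed.

Lemma Gdisc_absl z x y : Gdisc z (- x) y = Gdisc z x y :> R.
Proof. by rewrite /Gdisc sqrrN. Qed.

(** Every quantity is compared with [U = g Y^q Y^3 h^2]. The parameters are fixed in the order [D],
    [Rr], [E], and then the thresholds for [H] and [Y], each depending only on earlier ones. *)
Lemma circle_lower q (Ce : R) : (3 <= q)%N -> 0 < Ce ->
  exists (c1 : R) (Rr T H0 : nat), [/\ 0 < c1, (0 < Rr)%N & forall H Y B e, (0 < H)%N -> (H0 <= H)%N -> (T * H ^ 2 <= Y)%N ->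
   (Y < B ^ 2)%N -> (B ^ 2 <= 4 * Y)%N -> 0 <= e <= Ce * (48 * H%:R)^-1 ^+ 2 / Y%:R ^+ 2 ->
   (forall p l : int, (absz p ^ 2 + absz l ^ 2 <= 4 * (Rr * H) ^ 2)%N -> 99 / 100 <= cos (2 * pi * (Y%:R * nrm p%:~R l%:~R)) :> R) ->
   c1 * (Y%:R ^+ (q - 1) * (Y%:R ^+ 3 * (48 * H%:R)^-1 ^+ 2)) <=
   \sum_(v : boxv B (2 * q)) wgt R v * \sum_(w < (2 * Y).*2.+1) Lop e (fun z => Gdisc z (sqn v)%:R (w%:R - (2 * Y)%:R)) Y%:R (48 * H%:R)^-1].
Proof.
move=> q3 Ce0.
have [Cm [Cm0 hm]] := @minor_arcs R q q3.
have [CA [CA0 hA]] := @Adual_le R Ce Ce0.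
have kp := kappa_gt0 R.
pose c5 : R := (2 ^+ 20 * 96 * (16 * q%:R) ^+ (2 * q - 1))^-1.
have qp : 0 < q%:R :> R by rewrite ltr0n (leq_trans _ q3).
have c50 : 0 < c5 by rewrite invr_gt0 mulr_gt0 ?exprn_gt0 ?mulr_gt0 // exprn_gt0.
have b20 : 0 < kappa R * c5 / 20 by rewrite divr_gt0 ?mulr_gt0.
(* The minor arcs decay with [D], and neither [c5] nor the constants here involve [D]; [Cf] below
   does, so the remaining thresholds come later. *)
have [D [D0 hD]] := nat_large (Cm * CA * 4 ^+ (q - 1) * 2) b20.
have Dp : 0 < D%:R :> R by rewrite ltr0n.
pose Cf : R := 3 * D%:R * 100 ^+ q.
have Cf0 : 0 < Cf by rewrite /Cf !mulr_gt0 ?exprn_gt0.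
have [k kE] : exists k, (2 * q = k.+1)%N by exists (2 * q).-1; rewrite prednK // muln_gt0 /= (leq_trans _ q3).
have [Cp [Cp0 hp]] := @peak_error R k Ce D D Ce0 D0 D0.
have b20' : 0 < c5 / 20 by rewrite divr_gt0.
have [R1 [R10 hR1]] := nat_large (Cf * (2 * (96 * (32 * 48)))) b20'.
pose Rr := (R1 + 48)%N; have hR := hR1 Rr (leq_addr _ _).
have Rr0 : (0 < Rr)%N by rewrite /Rr addnS.
pose Kc : R := 96 * (16 * 16 * 8) * (1 + D%:R).
have Kc0 : 0 < Kc by rewrite /Kc; pos.
have b60 : 0 < c5 / 60 by rewrite divr_gt0.
have [E1 [E10 hE1]] := nat_large (Cf * Kc * 64) b60.
pose E := (E1 + 2)%N; have hE := hE1 E (leq_addr _ _).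
have b30 : 0 < c5 / 30 by rewrite divr_gt0.
have [H1 [H10 hH1]] := nat_large (Cf * (Kc * (64 + (2 * E%:R + 1) ^+ 2))) b30.
pose Cr : R := D.+1%:R ^+ 2 * Cp * Cf.
have Cr0 : 0 < Cr by rewrite /Cr !mulr_gt0 ?exprn_gt0 ?ltr0n.
have k60 : 0 < kappa R * c5 / 60 by rewrite divr_gt0 ?mulr_gt0.
have [H2 [H20 hH2]] := nat_large Cr k60.
have [T1 [T10 hT1]] := nat_large (Cr * (48 * 48)) k60.
pose T := (H2 ^ 2 + T1 + (8 * q) ^ 2 + (12 * D) ^ 2 + (2 * D ^ 3).+1 + 2 * D * D + 4)%N.
exists (kappa R * c5 * (9 / 100)), Rr, T, (H1 + H2)%N; split=> //; first by rewrite !mulr_gt0.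
move=> H Y B e H0 HH HT YB BY he al.
set h := (48 * H%:R)^-1 in he *; set c := Y%:R in he al *.
have Hp : 0 < H%:R :> R by rewrite ltr0n.
have h0 : 0 < h by rewrite /h; pos.
have H1r : 1 <= H%:R :> R by rewrite ler1n.
have hH : h <= H%:R^-1 by rewrite /h lef_pV2 ?posrE //; [clear -H1r; rlra|pos].
have h48 : h <= 1 / 48 by rewrite /h div1r lef_pV2 ?posrE //; [clear -H1r; rlra|pos].
have hh : 0 < h <= 1 by rewrite h0 /=; clear -h48; rlra.
have YT : (T <= Y)%N by apply: leq_trans HT; rewrite leq_pmulr // expn_gt0 H0.
have YH : (H2 ^ 2 <= Y)%N by apply: leq_trans YT; rewrite /T -!addnA leq_addr.
have Yq : ((8 * q) ^ 2 <= Y)%N by apply: leq_trans YT; rewrite /T; clear; lia.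
have YD : ((12 * D) ^ 2 <= Y)%N by apply: leq_trans YT; rewrite /T; clear; lia.
have YD3 : (2 * D ^ 3 < Y)%N by apply: leq_trans YT; rewrite /T; clear; lia.
have YDD : (2 * D * D <= Y)%N by apply: leq_trans YT; rewrite /T; clear; lia.
have Y4 : (4 <= Y)%N by apply: leq_trans YT; rewrite /T; clear; lia.
have T1Y : (T1 * H ^ 2 <= Y)%N by apply: leq_trans HT; rewrite leq_mul2r /T; apply/orP; right; clear; lia.
have Y0 : (0 < Y)%N by apply: leq_trans Y4.
have c4 : 4 <= c by rewrite /c ler_nat.
have c0 : 0 < c by clear -c4; rlra.
have B0 : (0 < B)%N by case: (B) YB => //; rewrite exp0n.
have Bp : 0 < B%:R :> R by rewrite ltr0n.
have HB : (H2 <= B)%N by rewrite -leq_sqr (leq_trans YH) // ltnW.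
(* The factorial makes every [d <= D] divide [Q]; the other factor makes [Q] larger than any
   [sqn v + W]. *)
pose g := (D`! * (32 * q + 3))%N.
have fD : (0 < D`!)%N by exact: fact_gt0.
have gq : (32 * q + 3 <= g)%N by rewrite /g leq_pmull.
have g4 : (4 <= g)%N by apply: leq_trans gq; clear -q3; lia.
have g0 : (0 < g)%N by apply: leq_trans g4.
have gp : 0 < g%:R :> R by rewrite ltr0n.
(* The arcs have half-width [J / Q = D / Y], hence the value [D] for the parameter [C0] of the
   partition. *)
pose Q := (Y * g)%N; pose J := (D * g)%N; pose W := (2 * Y)%N.
have Q0 : (0 < Q)%N by rewrite muln_gt0 Y0.
have J0 : (0 < J)%N by rewrite muln_gt0 D0.
have Qp : 0 < Q%:R :> R by rewrite ltr0n.
have [Wt [w01 wmin part]] : exists W : nat -> R, [/\ forall j, 0 <= W j <= 1,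
    forall j d (b : int), (j < Q)%N -> (0 < d <= D)%N -> coprime `|b| d -> D%:R * W j <= B%:R ^+ 2 * `|j%:R / Q%:R - b%:~R / d%:R|
    & forall F : int -> R, (forall z, F (z + Q%:Z) = F z) ->
      \sum_(j < Q) F j%:Z = \sum_(p : 'I_D.+1 * 'I_D.+1 | peak p) \sum_(x <- zr J) tent R J x * F (ppos Q p + x) + \sum_(j < Q) W j * F j%:Z].
  apply: (@peak_partition R B Q D J D) => //.
  - by move=> d dD; exact: dvd_fact_mul.
  - exact: width_lt.
  - by rewrite /Q /J [(B ^ 2 * _)%N]mulnCA leq_mul2l leq_mul2r (ltnW YB) !orbT.
have BQ : (B ^ 2 <= Q)%N by apply: leq_trans BY _; rewrite /Q mulnC leq_mul2l g4 orbT.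
have {hm} hm := hm B Q D D%:R Wt B0 BQ D0 Dp w01 wmin.
pose A (y : R) : R := Lop e (fun z => disc_sum W z y) c h.
have cvA y : Adual e c h L y @[L --> \oo] --> A y.
  apply: Adual_cvg; [exact: ltW|clear -h48 c4; rlra|].
  by rewrite /W natrM -/c; clear -h48 c4; rlra.
(* The bound for [Adual] is uniform in [L] and therefore passes to the Poisson limit. *)
have Able y : `|A y| <= CA * c ^+ 3 * h ^+ 2.
  have nr : \forall L \near \oo, `|Adual e c h L y| <= CA * c ^+ 3 * h ^+ 2.
    by near=> L; apply: hA => //; near: L; exact: nbhs_infty_gt.
  rewrite ler_norml; apply/andP; split.
    by apply: (cvgr_to_ge (cvA y)); apply: filterS nr => L; rewrite ler_norml => /andP[].
  by apply: (cvgr_to_le (cvA y)); apply: filterS nr => L; rewrite ler_norml => /andP[].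
pose a (x : R) : R := \sum_(w < W.*2.+1) Lop e (fun z => Gdisc z x (w%:R - W%:R)) c h.
have aE y : \sum_(m < W.*2.+1) a (m%:R - W%:R) * cos (2 * pi * (y * (m%:R - W%:R))) = A y.
  rewrite /A /disc_sum Lop_sum; apply: eq_bigr => m _; rewrite Lop_sum /a mulr_suml; apply: eq_bigr => w _.
  by rewrite LopMr.
have /andP[e0 _] := he.
rewrite -/W (@circle_mean R B (2 * q) W Q a); last first.
- move=> n Wn; rewrite /a big1 // => w _; apply/eqP; rewrite -normr_le0.
  have := @Lop_bound R e (fun z => Gdisc z n%:R (w%:R - W%:R)) c h 0 (ltW h0) e0; rewrite mulr0; apply.
  move=> z /andP[z1 z2]; rewrite Gdisc0l ?normr0 //; first by clear -z1 h48 c4; rlra.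
  rewrite ger0_norm //; apply: (@le_trans _ _ W%:R); last by rewrite ler_nat ltnW.
  by rewrite /W natrM -/c; clear -z2 h48 c4; rlra.
- by move=> x; apply: eq_bigr => w _; congr (Lop e _ c h); apply/funext => z; exact: Gdisc_absl.
- by move=> v; apply: (@box_sum_lt q B) => //; exact: sqn_le.
- exact: Q0.
pose F (z : int) : R := complex.Re (wsum B (z%:~R / Q%:R) ^+ (2 * q)) * A (z%:~R / Q%:R).
have -> : \sum_(j < Q) complex.Re (wsum B (j%:R / Q%:R) ^+ (2 * q)) * (\sum_(m < W.*2.+1) a (m%:R - W%:R) * cos (2 * pi * (j%:R / Q%:R * (m%:R - W%:R)))) = \sum_(j < Q) F j%:Z.
  by apply: eq_bigr => j _; rewrite aE /F -pmulrn.
rewrite part; last first.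
  move=> z; rewrite /F; have -> : (z + Q%:Z)%:~R / Q%:R = z%:~R / Q%:R + 1 :> R.
    by rewrite intrD -pmulrn mulrDl divff // gt_eqF.
  congr (complex.Re (_ ^+ _) * _).
    exact: (wsum_periodic B (z%:~R / Q%:R : R) 1).
  by rewrite /A; congr (Lop e _ c h); apply/funext => x; exact: disc_sum_periodic.
have pE (p : 'I_D.+1 * 'I_D.+1) (x : int) : peak p -> (ppos Q p + x)%:~R / Q%:R = p.2%:R / p.1%:R + x%:~R / Q%:R :> R.
  move=> /andP[a1 _]; have p0 : (0 < p.1)%N by apply: leq_ltn_trans a1.
  have pd : (p.1 %| Q)%N by rewrite /Q /g; apply: dvd_fact_mul; rewrite p0 /= -ltnS; exact: ltn_ord.
  have p0r : p.1%:R != 0 :> R by rewrite pnatr_eq0 -lt0n.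
  have := congr1 (fun z : int => z%:~R : R) (ppos_mul pd); rewrite !intrM -!pmulrn => E2.
  rewrite intrD /ppos -[(Q %/ p.1 * p.2)%N%:Z%:~R]pmulrn (canRL (mulfK p0r) E2).
  by field; rewrite p0r gt_eqF.
have -> : \sum_(p : 'I_D.+1 * 'I_D.+1 | peak p) \sum_(x <- zr J) tent R J x * F (ppos Q p + x) = peak_sum B (2 * q) J Q D A.
  by apply: eq_bigr => p pp; apply: eq_bigr => x _; rewrite /F pE.
pose U : R := g%:R * c ^+ q * (c ^+ 3 * h ^+ 2).
have U0 : 0 < U by rewrite /U !mulr_gt0 ?exprn_gt0.
have rem : `|\sum_(j < Q) Wt j * F j%:Z| <= kappa R * c5 / 20 * U.
  apply: (@le_trans _ _ (\sum_(j < Q) Wt j * cabs (wsum B (j%:R / Q%:R)) ^+ (2 * q) * (CA * c ^+ 3 * h ^+ 2))).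
    apply: le_trans (ler_norm_sum _ _ _) _; apply: ler_sum => j _; have /andP[w0 _] := w01 j.
    rewrite normrM (ger0_norm w0) -mulrA; apply: ler_wpM2l => //; rewrite /F -pmulrn normrM.
    by apply: ler_pM => //; apply: le_trans (Re_le_cabs _) _; rewrite cabsX.
  rewrite -mulr_suml; apply: le_trans (ler_wpM2r _ hm) _; first by pos.
  have Bq : B%:R ^+ (2 * q - 2) <= (4 * c) ^+ (q - 1) :> R.
    have -> : (2 * q - 2 = 2 * (q - 1))%N by rewrite mulnBr.
    by rewrite exprM; apply: lerXn2r; rewrite ?nnegrE; [pos|pos|rewrite -natrX /c -natrM ler_nat].
  apply: (@le_trans _ _ (Cm * (D%:R^-1 + D%:R^-1) * (4 * c) ^+ (q - 1) * Q%:R * (CA * c ^+ 3 * h ^+ 2))).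
    apply: ler_wpM2r; first by pos.
    by apply: ler_wpM2r => //; apply: ler_wpM2l => //; pos.
  have cq : c ^+ q = c * c ^+ (q - 1) by rewrite -exprS subn1 prednK // (leq_trans _ q3).
  have -> : Cm * (D%:R^-1 + D%:R^-1) * (4 * c) ^+ (q - 1) * Q%:R * (CA * c ^+ 3 * h ^+ 2) = Cm * CA * 4 ^+ (q - 1) * 2 / D%:R * U.
    rewrite /U cq exprMn /Q natrM -/c; move: (c ^+ (q - 1)) (4 ^+ (q - 1) : R) => P1 P2; field.
    by rewrite gt_eqF.
  by apply: ler_wpM2r; [exact: ltW|exact: hD].
pose X : R := fbound R B (2 * q) J * (c ^+ 3 * h ^+ 2).
have X0 : 0 <= X by rewrite /X mulr_ge0 ?fbound_ge0 //; pos.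
have XU : X <= Cf * U.
  have -> : Cf * U = Cf * (g%:R * c ^+ q) * (c ^+ 3 * h ^+ 2) by rewrite /U; ring.
  apply: ler_wpM2r; first by pos.
  exact: fbound_unit.
(* Errors are relative to the trivial size [X], which exceeds [U] by at most the constant [Cf]. *)
have small (s b : R) : 0 <= s -> Cf * s <= b -> X * s <= b * U.
  move=> s0 sb; apply: (@le_trans _ _ (Cf * U * s)); first exact: ler_wpM2r.
  by rewrite mulrAC; apply: ler_wpM2r => //; exact: ltW.
have Rp : 0 < Rr%:R :> R by rewrite ltr0n.
have HE : H%:R = (48 * h)^-1 :> R by rewrite /h invfM invrK mulrA mulVf ?mul1r.
have E0 : 0 < E%:R :> R by rewrite ltr0n /E addn2.
pose Tl : R := fbound R B (2 * q) J * (96 * c ^+ 3) * (32 * h / (Rr * H)%:R).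
have Tl_le : 2 * Tl <= c5 / 20 * U.
  have -> : 2 * Tl = X * (2 * (96 * (32 * 48)) / Rr%:R).
    by rewrite /Tl /X natrM HE; field; rewrite !gt_eqF.
  apply: small; first by rewrite divr_ge0 // ltW.
  by apply: le_trans hR; rewrite -[leRHS]mulrA.
pose cmp : R := fbound R B (2 * q) J * c ^+ 3 * (Kc * ((E%:R^-1 + h) * (64 * h ^+ 2) + (2 * E%:R + 1) ^+ 2 * h ^+ 4)).
have cmp_le : cmp <= c5 / 20 * U.
  have -> : cmp = X * (Kc * ((E%:R^-1 + h) * 64 + (2 * E%:R + 1) ^+ 2 * h ^+ 2)).
    by rewrite /cmp /X; ring.
  apply: small; first by pos.
  have h2h : h ^+ 2 <= h by rewrite expr2 -[leRHS]mul1r; apply: ler_wpM2r; [exact: ltW|clear -h48; rlra].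
  have a1 : Cf * Kc * 64 / E%:R <= c5 / 60 by exact: hE.
  have a2 : Cf * (Kc * (64 + (2 * E%:R + 1) ^+ 2)) * h <= c5 / 30.
    apply: le_trans (hH1 H (leq_trans (leq_addr _ _) HH)); apply: ler_wpM2l => //; by pos.
  have a3 : Cf * (Kc * ((2 * E%:R + 1) ^+ 2 * h ^+ 2)) <= Cf * (Kc * ((2 * E%:R + 1) ^+ 2 * h)).
    apply: ler_wpM2l; first exact: ltW.
    by apply: ler_wpM2l; [exact: ltW|apply: ler_wpM2l => //; pos].
  have -> : Cf * (Kc * ((E%:R^-1 + h) * 64 + (2 * E%:R + 1) ^+ 2 * h ^+ 2)) =
    Cf * Kc * 64 / E%:R + Cf * (Kc * (64 * h)) + Cf * (Kc * ((2 * E%:R + 1) ^+ 2 * h ^+ 2)) by ring.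
  have a4 : Cf * (Kc * (64 + (2 * E%:R + 1) ^+ 2)) * h = Cf * (Kc * (64 * h)) + Cf * (Kc * ((2 * E%:R + 1) ^+ 2 * h)) by ring.
  by clear -a1 a2 a3 a4; rlra.
pose Err : R := Cp * (fbound R B (2 * q) J * c ^+ 3) * (h ^+ 2 / B%:R + c^-1 + h ^+ 4).
have Err_le : D.+1%:R ^+ 2 * Err <= kappa R * c5 / 20 * U.
  have -> : D.+1%:R ^+ 2 * Err = X * (D.+1%:R ^+ 2 * Cp * (B%:R^-1 + (c * h ^+ 2)^-1 + h ^+ 2)).
    by rewrite /Err /X; field; rewrite !gt_eqF.
  apply: small; first by pos.
  have -> : Cf * (D.+1%:R ^+ 2 * Cp * (B%:R^-1 + (c * h ^+ 2)^-1 + h ^+ 2)) = Cr / B%:R + Cr * (c * h ^+ 2)^-1 + Cr * h ^+ 2 by rewrite /Cr; ring.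
  have a1 : Cr / B%:R <= kappa R * c5 / 60 by exact: hH2.
  have a2 : Cr * h ^+ 2 <= kappa R * c5 / 60.
    apply: le_trans (hH2 H (leq_trans (leq_addl _ _) HH)); apply: ler_wpM2l; first exact: ltW.
    by apply: le_trans hH; rewrite expr2 -[leRHS]mul1r; apply: ler_wpM2r; [exact: ltW|clear -h48; rlra].
  have a3 : Cr * (c * h ^+ 2)^-1 <= kappa R * c5 / 60.
    apply: le_trans (hT1 T1 (leqnn _)); rewrite -mulrA; apply: ler_wpM2l; first exact: ltW.
    have T1p : 0 < T1%:R :> R by rewrite ltr0n.
    have ch : 0 < c * h ^+ 2 by pos.
    rewrite ler_pdivlMr // mulrC ler_pdivrMr //.
    have TY : T1%:R * H%:R ^+ 2 <= c by rewrite /c -natrX -natrM ler_nat.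
    have -> : T1%:R = 48 * 48 * (T1%:R * H%:R ^+ 2 * h ^+ 2) :> R by rewrite HE; field; rewrite gt_eqF.
    apply: ler_wpM2l => //; apply: ler_wpM2r => //; by pos.
  by clear -a1 a2 a3; rlra.
have K1 : (1 <= Rr * H)%N by rewrite muln_gt0 Rr0.
(* The estimate holds for all large [L] with constants free of [L], hence in the limit. *)
have lower : kappa R * (29 / 100 * (c5 * U) - 2 * Tl - cmp) - D.+1%:R ^+ 2 * Err <= peak_sum B (2 * q) J Q D A.
  have cv := @peak_sum_cvg R B (2 * q) J Q D (fun L => Adual e c h L) A cvA.
  apply: (cvgr_to_ge cv).
  near=> L.
  have HL : (36 * H <= L)%N by near: L; exact: nbhs_infty_ge.
  have L0 : (0 < L)%N by apply: leq_trans HL; rewrite muln_gt0.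
  have LU : c5 * U <= Lam B (2 * q) J Q c h L 0.
    by apply: Lam_lower_unit => //; exact: ltnW.
  apply: le_trans (@peak_sum_lower R q D B J Q c h L (Rr * H) cmp Tl Err (Adual e c h L) q3 J0 (ltW c0) D0 _ _ al _).
  - by rewrite lerD2r; apply: ler_wpM2l; [exact: ltW|clear -LU; rlra].
  - move=> u uu; have l2 : c * (J%:R / Q%:R) <= D%:R.
      by rewrite /J /Q !natrM -/c le_eqVlt; apply/orP; left; apply/eqP; field; rewrite !gt_eqF.
    have l3 : (2 <= E)%N by rewrite /E addn2.
    exact: (@Lam_compare R B (2 * q) J Q c h L u D%:R E B0 J0 Q0 L0 (ltW c0) hh (ltW Dp) l2 uu l3).
  - move=> d b dD bd co; rewrite kE.
    have -> : Err = Cp * (fbound R B k.+1 J * c ^+ 3) * (h ^+ 2 / B%:R + c^-1 + h ^+ 4) by rewrite -kE.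
    apply: hp => //.
    + by rewrite /c -!natrM ler_nat.
    + by rewrite -natrX /c -natrM ler_nat.
    + by rewrite /J /Q !natrM -/c; field; rewrite !gt_eqF.
  - have hK : 1 <= h * (Rr * H)%:R.
      have -> : h * (Rr * H)%:R = Rr%:R / 48 by rewrite natrM HE; field; rewrite gt_eqF.
      by rewrite ler_pdivlMr // mul1r ler_nat /Rr leq_addl.
    exact: (@Lam_tail R B (2 * q) J Q c h L (Rr * H) B0 J0 L0 (ltW c0) hh hK K1).
rewrite mulrDr.
have cq : U = Q%:R * (c ^+ (q - 1) * (c ^+ 3 * h ^+ 2)).
  rewrite /U /Q natrM -/c; have -> : c ^+ q = c * c ^+ (q - 1) by rewrite -exprS subn1 prednK // (leq_trans _ q3).
  by ring.
rewrite -mulrDr ler_pdivlMl // mulrCA -cq.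
(* Tail, comparison, arc error and minor arcs take 1/20 each from 29/100, and 9/100 remains. *)
move: rem; rewrite ler_norml => /andP[rem _].
have k2 : kappa R * (2 * Tl) <= kappa R * (c5 / 20 * U) by apply: ler_wpM2l => //; exact: ltW.
have k3 : kappa R * cmp <= kappa R * (c5 / 20 * U) by apply: ler_wpM2l => //; exact: ltW.
have z1 : kappa R * (29 / 100 * (c5 * U) - 2 * Tl - cmp) = 29 / 100 * (kappa R * c5 * U) - kappa R * (2 * Tl) - kappa R * cmp by ring.
have z2 : kappa R * (c5 / 20 * U) = kappa R * c5 / 20 * U by ring.
have z3 : kappa R * c5 / 20 * U = (kappa R * c5 * U) / 20 by ring.
have z4 : kappa R * c5 * (9 / 100) * U = 9 / 100 * (kappa R * c5 * U) by ring.
by clear -z1 z2 z3 z4 k2 k3 rem lower Err_le; rlra.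
Unshelve. all: by end_near.
Qed.

End circle_lower.

(** * Lattice points of the ball *)

Lemma absz_shift_lt (z : int) (m n : nat) : (absz z <= m)%N -> (m <= n)%N -> (absz (z + n%:Z)%R < n.*2.+1)%N.
Proof. lia. Qed.

Lemma absz_shiftK (z : int) (m n : nat) : (absz z <= m)%N -> (m <= n)%N -> (absz (z + n%:Z))%:Z - n%:Z = z.
Proof. lia. Qed.

Section lattice_points.
Context (R : realType) (q : nat).
Implicit Types (x X : R) (B W : nat).
Local Notation pts x := (@integer_points R q `&` dilation x @` @kball R q)%classic.

Lemma enorm4 (t : (2 * q).-tuple R) : enorm t ^+ 4 = (\sum_(i < 2 * q) tnth t i ^+ 2) ^+ 2.
Proof.
rewrite /enorm (_ : 4 = 2 * 2)%N // exprM sqr_sqrtr //.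
by apply: sumr_ge0 => i _; exact: sqr_ge0.
Qed.

Lemma dilation_ballP x (r : (2 * q).-tuple R * R) : 0 <= x ->
  (dilation x @` @kball R q)%classic r <-> (\sum_(i < 2 * q) tnth r.1 i ^+ 2) ^+ 2 + r.2 ^+ 2 <= x ^+ 4.
Proof.
move=> x0; split.
  move=> [p /kballE + <-]; rewrite enorm4 /= => hp.
  have -> : \sum_(i < 2 * q) tnth [tuple x * tnth p.1 i | i < 2 * q] i ^+ 2 = x ^+ 2 * \sum_(i < 2 * q) tnth p.1 i ^+ 2.
    by rewrite mulr_sumr; apply: eq_bigr => i _; rewrite tnth_mktuple exprMn.
  have -> : (x ^+ 2 * \sum_(i < 2 * q) tnth p.1 i ^+ 2) ^+ 2 + (x ^+ 2 * p.2) ^+ 2 =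
    x ^+ 4 * ((\sum_(i < 2 * q) tnth p.1 i ^+ 2) ^+ 2 + p.2 ^+ 2) by ring.
  by rewrite -[leRHS]mulr1; apply: ler_wpM2l => //; exact: exprn_ge0.
case: r => t w /= hr; exists (dilation x^-1 (t, w)).
  apply/kballE; rewrite enorm4 /=.
  have -> : \sum_(i < 2 * q) tnth [tuple x^-1 * tnth t i | i < 2 * q] i ^+ 2 = x^-1 ^+ 2 * \sum_(i < 2 * q) tnth t i ^+ 2.
    by rewrite mulr_sumr; apply: eq_bigr => i _; rewrite tnth_mktuple exprMn.
  have -> : (x^-1 ^+ 2 * \sum_(i < 2 * q) tnth t i ^+ 2) ^+ 2 + (x^-1 ^+ 2 * w) ^+ 2 =
    x^-1 ^+ 4 * ((\sum_(i < 2 * q) tnth t i ^+ 2) ^+ 2 + w ^+ 2) by ring.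
  apply: le_trans (ler_wpM2l _ hr) _; first by rewrite exprn_ge0 ?invr_ge0.
  rewrite -exprMn exprn_ile1 ?mulr_ge0 ?invr_ge0 //.
  by have [->|xn] := eqVneq x 0; [rewrite mulr0|rewrite mulVf].
(* At [x = 0] the dilated ball is the origin, which is all that the inequality allows. *)
have [xE|xn] := eqVneq x 0.
  rewrite xE expr0n /= in hr.
  have s0 : 0 <= (\sum_(i < 2 * q) tnth t i ^+ 2) ^+ 2 by exact: sqr_ge0.
  have w0 : w = 0 by apply/eqP; rewrite -sqrf_eq0; apply/eqP; have := sqr_ge0 w; rlra.
  have t0 i : tnth t i = 0.
    have sz : \sum_(i < 2 * q) tnth t i ^+ 2 = 0 by apply/eqP; rewrite -sqrf_eq0; apply/eqP; have := sqr_ge0 w; rlra.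
    apply/eqP; rewrite -sqrf_eq0; apply/eqP.
    by apply: (psumr_eq0P _ sz) => // j _; exact: sqr_ge0.
  rewrite /dilation w0 xE; congr pair; last by rewrite !mulr0.
  by apply: eq_from_tnth => i; rewrite tnth_mktuple mul0r t0.
rewrite /dilation /=; congr pair; last by rewrite mulrA -exprMn mulfV // expr1n mul1r.
by apply: eq_from_tnth => i; rewrite !tnth_mktuple mulrA mulfV // mul1r.
Qed.

Definition rad B W (p : boxv B (2 * q) * 'I_W.*2.+1) : R :=
  Num.sqrt ((sqn p.1)%:R ^+ 2 + (p.2%:R - W%:R) ^+ 2).

Lemma rad_le B W (p : boxv B (2 * q) * 'I_W.*2.+1) X : 0 <= X ->
  (rad p <= X) = ((sqn p.1)%:R ^+ 2 + (p.2%:R - W%:R) ^+ 2 <= X ^+ 2).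
Proof.
move=> X0; rewrite -ler_sqr ?nnegrE ?sqrtr_ge0 // sqr_sqrtr // addr_ge0 ?sqr_ge0 //.
Qed.

Definition emb B W (p : boxv B (2 * q) * 'I_W.*2.+1) : (2 * q).-tuple R * R :=
  ([tuple (coord (p.1 i))%:~R | i < 2 * q], p.2%:R - W%:R).

Lemma emb_inj B W : injective (@emb B W).
Proof.
move=> [v w] [v' w'] E; congr pair; last first.
  have Ew : w%:R - W%:R = w'%:R - W%:R :> R := congr1 snd E.
  by apply: val_inj; apply/eqP; rewrite -(eqr_nat R); apply/eqP; apply: (addIr (- W%:R)).
apply/ffunP => i; have := congr1 (fun t : (2 * q).-tuple R * R => tnth t.1 i) E.
rewrite /= !tnth_mktuple => /eqP; rewrite eqr_int /coord => /eqP h.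
by apply: val_inj; move: h => /addIr [].
Qed.

Lemma sum_coord B (v : boxv B (2 * q)) :
  \sum_(i < 2 * q) ((coord (v i))%:~R : R) ^+ 2 = (sqn v)%:R.
Proof.
rewrite /sqn natr_sum; apply: eq_bigr => i _.
by rewrite natrX -absz_int real_normK // num_real.
Qed.

Lemma int_sqr_le (z : int) (m : nat) : (z%:~R : R) ^+ 2 <= m%:R ^+ 2 -> (absz z <= m)%N.
Proof.
by rewrite -[X in X <= _]real_normK ?num_real // absz_int ler_sqr ?nnegrE // ler_nat.
Qed.

(** Points of the dilated ball have coordinates at most [x <= B] and last entry at most [x^2 <= W],
    so the finite box contains all of them and [emb] is a bijection onto them. *)
Lemma lattice_count B W x : 0 <= x -> x ^+ 2 <= (B ^ 2)%:R -> x ^+ 2 <= W%:R ->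
  #|` fset_set (pts x)| = #|[pred p : boxv B (2 * q) * 'I_W.*2.+1 | rad p <= x ^+ 2]|.
Proof.
move=> x0 xB xW; set P := [pred p | _].
have fin := @finite_lattice_points R q x.
have -> : fset_set (pts x) = [fset r in [seq emb p | p <- enum P]]%fset.
  apply/fsetP => r; rewrite in_fset_set // !inE /=; apply/idP/idP.
    rewrite inE => -[[ri rw] /(dilation_ballP r x0) hr].
    have hr' : (\sum_(i < 2 * q) tnth r.1 i ^+ 2) ^+ 2 + r.2 ^+ 2 <= (x ^+ 2) ^+ 2 by rewrite -exprM.
    have s0 : 0 <= \sum_(i < 2 * q) tnth r.1 i ^+ 2 by apply: sumr_ge0 => i _; exact: sqr_ge0.
    have sx : \sum_(i < 2 * q) tnth r.1 i ^+ 2 <= x ^+ 2.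
      rewrite -ler_sqr ?nnegrE ?sqr_ge0 //; have := sqr_ge0 r.2; rlra.
    have wx : r.2 ^+ 2 <= W%:R ^+ 2.
      apply: (@le_trans _ _ ((x ^+ 2) ^+ 2)); first by have := sqr_ge0 (\sum_(i < 2 * q) tnth r.1 i ^+ 2); rlra.
      by rewrite ler_sqr ?nnegrE ?sqr_ge0.
    have [zw zwE] := intrP rw.
    have zwW : (absz zw <= W)%N by apply: int_sqr_le; rewrite -zwE.
    pose z i := Num.floor (tnth r.1 i).
    have zE i : tnth r.1 i = (z i)%:~R by rewrite /z; have := ri i; rewrite intrEfloor => /eqP.
    have zB i : (absz (z i) <= B)%N.
      apply: int_sqr_le; rewrite -zE -natrX; apply: le_trans xB; apply: le_trans sx.
      by rewrite (bigD1 i) //= lerDl sumr_ge0 // => j _; exact: sqr_ge0.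
    have bz i : (absz (z i + (2 * B)%:Z)%R < (2 * B).*2.+1)%N by apply: absz_shift_lt (zB i) _; rewrite leq_pmull.
    have bw : (absz (zw + W%:Z)%R < W.*2.+1)%N by exact: absz_shift_lt zwW _.
    pose p : boxv B (2 * q) * 'I_W.*2.+1 := ([ffun i => Ordinal (bz i)], Ordinal bw).
    have cE i : coord (p.1 i) = z i by rewrite /coord ffunE /=; apply: absz_shiftK (zB i) _; rewrite leq_pmull.
    have pr : emb p = r.
      case: (r) zE zwE => r1 r2 /= zE zwE; rewrite /emb; congr pair.
        by apply: eq_from_tnth => i; rewrite tnth_mktuple cE zE.
      rewrite zwE /= !pmulrn -intrB; congr (_%:~R); exact: absz_shiftK zwW _.
    apply/mapP; exists p => //; rewrite mem_enum inE rad_le ?sqr_ge0 //.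
    rewrite -sum_coord; move: hr'; rewrite -pr /=.
    by under eq_bigr do rewrite tnth_mktuple.
  move=> /mapP [p]; rewrite mem_enum => hp ->; have {}hp : rad p <= x ^+ 2 := hp.
  rewrite rad_le ?sqr_ge0 // in hp; rewrite inE; split.
    split=> [i|] /=; first by rewrite tnth_mktuple intr_int.
    by rewrite !pmulrn -intrB intr_int.
  apply/dilation_ballP => //=; under eq_bigr do rewrite tnth_mktuple.
  by rewrite sum_coord (_ : x ^+ 4 = (x ^+ 2) ^+ 2) // -exprM.
rewrite card_fseq undup_id; first by rewrite size_map cardE.
by rewrite map_inj_uniq ?enum_uniq //; exact: emb_inj.
Qed.

Lemma lattice_error_bounded (X0 : R) : exists M : R, 0 <= M /\ forall x, 0 <= x <= X0 -> `|lattice_error q x| <= M.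
Proof.
exists (#|` fset_set (pts X0)|%:R + `|fine (kvol (@kball R q)) * X0 ^+ (2 * q + 2)|); split.
  by rewrite addr_ge0.
move=> x /andP[x0 xX]; rewrite /lattice_error; apply: le_trans (ler_normB _ _) _; apply: lerD.
  rewrite ger0_norm // ler_nat; apply: fsubset_leq_card; apply/fsubsetP => r.
  rewrite !in_fset_set; [|exact: finite_lattice_points..].
  rewrite !inE => -[ri /(dilation_ballP r x0) hr]; split=> //; apply/dilation_ballP; first exact: le_trans xX.
  by apply: le_trans hr _; apply: lerXn2r; rewrite ?nnegrE // (le_trans x0).
rewrite !normrM; apply: ler_wpM2l => //; rewrite !ger0_norm ?exprn_ge0 // ?(le_trans x0 xX) //.
by apply: lerXn2r; rewrite ?nnegrE // (le_trans x0).
Qed.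

Lemma count_error B W X : 0 <= X -> X <= (B ^ 2)%:R -> X <= W%:R ->
  #|[pred p : boxv B (2 * q) * 'I_W.*2.+1 | rad p <= X]|%:R - fine (kvol (@kball R q)) * X ^+ q.+1
  = lattice_error q (Num.sqrt X).
Proof.
move=> X0 XB XW; have sE : Num.sqrt X ^+ 2 = X by rewrite sqr_sqrtr.
rewrite /lattice_error (@lattice_count B W) ?sqrtr_ge0 ?sE //.
by rewrite (_ : (2 * q + 2 = 2 * q.+1)%N) ?exprM ?sE // mulnS addnC.
Qed.

(** The trapezoidal weight disappears: it is 1 while [sqn v <= B^2], and beyond that the radius
    exceeds [c + 2 h], where the kernel vanishes. *)
Lemma box_sum_Kker B W e c h : 0 <= h -> 2 * h <= c -> (0 < B)%N -> c + 2 * h <= (B ^ 2)%:R ->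
  \sum_(v : boxv B (2 * q)) wgt R v * \sum_(w < W.*2.+1) Lop e (fun z => Gdisc z (sqn v)%:R (w%:R - W%:R)) c h
  = \sum_(p : boxv B (2 * q) * 'I_W.*2.+1) Kker e c h (rad p).
Proof.
move=> h0 hc B0 cB.
rewrite -(pair_bigA _ (fun v w => Kker e c h (rad (v, w)))) /=; apply: eq_bigr => v _.
rewrite mulr_sumr; apply: eq_bigr => w _.
have -> : Lop e (fun z => Gdisc z (sqn v)%:R (w%:R - W%:R)) c h = Kker e c h (rad (v, w)).
  congr (Lop e _ c h); apply/funext => z; rewrite /Gdisc /Grad /rad sqr_sqrtr; first by rewrite opprD addrA.
  by rewrite addr_ge0 ?sqr_ge0.
case: (leqP (sqn v) (B ^ 2)) => hv; first by rewrite wgt1 // mul1r.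
rewrite Kker_eq0 ?mulr0 //; apply: le_trans cB _; apply: (@le_trans _ _ (sqn v)%:R); first by rewrite ler_nat ltnW.
rewrite /rad /= -[leLHS]ger0_norm // -sqrtr_sqr; apply: ler_wsqrtr.
by rewrite lerDl sqr_ge0.
Qed.

End lattice_points.

(** The least [B] with [Y < B^2] works, since [B <= 2 (B - 1)]. *)
Lemma square_between (Y : nat) : (0 < Y)%N -> exists B : nat, [/\ (0 < B)%N, (Y < B ^ 2)%N & (B ^ 2 <= 4 * Y)%N].
Proof.
move=> Y0; have ex : exists n, (Y < n ^ 2)%N by exists Y.+1; rewrite -mulnn; nia.
case: (ex_minnP ex) => B YB min; have B2 : (1 < B)%N by case: B YB min => [|[|B]] //; lia.
exists B; split=> //; first by lia.
have hB : (B.-1 ^ 2 <= Y)%N by rewrite leqNgt; apply/negP => /min; lia.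
apply: (@leq_trans ((2 * B.-1) ^ 2)%N); first by rewrite leq_sqr; lia.
by rewrite expnMn leq_mul2l.
Qed.

(** * Alignment of phases, size of [Y], conclusion *)

Section final.
Context (R : realType).
Implicit Types (x X : R) (H N Y q : nat).

Lemma cos_near_int x : near_int (100%:R^-1) x -> 99 / 100 <= cos (2 * pi * x).
Proof.
move=> [k hk]; have := congr1 (@complex.Re R) (ceDint (x - k%:~R) k); rewrite subrK /= => ->.
have := cos_ge_quad (2 * pi * (x - k%:~R)); apply: le_trans.
have p0 := pi_gt0 R; have p4 := pi_lt4 R.
have b : `|2 * pi * (x - k%:~R)| <= 8 / 100.
  rewrite normrM (@ger0_norm _ (2 * pi)); last by pos.
  by apply: ler_pM => //; [pos|rlra].
have : (2 * pi * (x - k%:~R)) ^+ 2 <= (8 / 100) ^+ 2.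
  by rewrite -[leLHS]real_normK ?num_real //; apply: lerXn2r; rewrite ?nnegrE //; pos.
by rlra.
Qed.

(** Only the distinct values of [p^2 + l^2] count in the exponent. Approximating the multiples of
    [T0 sqrt n] instead of [sqrt n] makes the aligned number at least [T0]; precision 1/100 turns
    into cosine at least 99/100. *)
Lemma aligned_multiple N (T0 : nat) : exists t : nat, [/\ (1 <= t)%N, (t <= 100 ^ size (two_squares N))%N &
  forall p l : int, (absz p ^ 2 + absz l ^ 2 <= N)%N -> 99 / 100 <= cos (2 * pi * ((t * T0)%:R * nrm p%:~R l%:~R)) :> R].
Proof.
pose s := two_squares N.
have [t [t1 t2 ht]] := @dirichlet_simultaneous R (size s) 100 (fun i => T0%:R * Num.sqrt (nth 0%N s i)%:R) isT.
exists t; split=> // p l plN.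
have nE : nrm p%:~R l%:~R = Num.sqrt (absz p ^ 2 + absz l ^ 2)%:R :> R.
  by rewrite /nrm natrD !natrX -!absz_int !real_normK ?num_real.
rewrite nE; set m := (absz p ^ 2 + absz l ^ 2)%N in plN *.
have [m0|m0] := posnP m; first by rewrite m0 sqrtr0 !mulr0 cos0; rlra.
have ms : m \in s.
  rewrite mem_filter mem_iota add1n ltnS plN m0 !andbT.
  have sq (n : nat) : (n <= n ^ 2)%N by case: n => // n; rewrite expnS expn1 leq_pmulr.
  have pm : (absz p < m.+1)%N by rewrite ltnS (leq_trans (sq _)) // leq_addr.
  have lm : (absz l < m.+1)%N by rewrite ltnS (leq_trans (sq _)) // leq_addl.
  by apply/existsP; exists (Ordinal pm); apply/existsP; exists (Ordinal lm).
have im : (index m s < size s)%N by rewrite index_mem.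
apply: cos_near_int; have := ht (Ordinal im); rewrite /= nth_index //.
by rewrite natrM mulrA.
Qed.

(** The eighth power of the claim; [C + 1] replaces the eighth root of [C]. *)
Lemma ell_le (a b C z : R) : 0 <= a -> 0 <= b -> 0 <= C -> 0 <= z -> a ^+ 2 * b <= C * z ^+ 4 ->
  a `^ 4^-1 * b `^ 8^-1 <= (C + 1) * Num.sqrt z.
Proof.
move=> a0 b0 C0 z0 hab.
have s0 := sqrtr_ge0 z; have sE : Num.sqrt z ^+ 2 = z by rewrite sqr_sqrtr.
rewrite -(@ler_pXn2r _ 8) // ?nnegrE ?mulr_ge0 ?powR_ge0 ?addr_ge0 //.
rewrite !exprMn -!powR_mulrn ?powR_ge0 ?addr_ge0 // -!powRrM.
have -> : 4^-1 * 8%:R = 2%:R :> R by field.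
rewrite mulVf ?pnatr_eq0 // powRr1 // !powR_mulrn ?addr_ge0 //.
apply: le_trans hab _.
have -> : Num.sqrt z ^+ 8 = z ^+ 4 by rewrite (_ : 8 = 2 * 4)%N // exprM sE.
apply: ler_wpM2r; first by rewrite exprn_ge0.
have C1 : 1 <= C + 1 by rlra.
apply: (@le_trans _ _ (C + 1)); first by rlra.
by rewrite -[leLHS]expr1; apply: ler_weXn2l.
Qed.

(** With [N] of order [H^2], Landau's bound gives [a = O(N / sqrt (ln N))] and [ln a = O(ln N)]; the
    logarithms cancel in [a^2 ln a = O(N^2)]. This cancellation produces the exponents 1/4 and
    1/8. *)
Lemma log_bound (CL : R) (T Rr : nat) : 0 < CL -> (0 < T)%N -> (0 < Rr)%N ->
  (forall N, (2 <= N)%N -> (size (two_squares N))%:R * Num.sqrt (ln N%:R) <= CL * N%:R) ->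
  exists C : R, 0 < C /\ forall H t : nat, (4 <= H)%N -> (1 <= t)%N ->
    (t <= 100 ^ size (two_squares (4 * (Rr * H) ^ 2)))%N ->
    let a := ln (Num.sqrt (2 * (t * (T * H ^ 2))%:R)) in 1 <= a -> a ^+ 2 * ln a <= C * H%:R ^+ 4.
Proof.
move=> CL0 T0 Rr0 hL.
pose CY : R := 100 * CL + T%:R + 3.
have Tp : 0 < T%:R :> R by rewrite ltr0n.
have Rp : 0 < Rr%:R :> R by rewrite ltr0n.
have CY0 : 0 < CY by rewrite /CY; rlra.
exists (CY ^+ 2 * (CY + 1) * (16 * Rr%:R ^+ 4)); split; first by pos.
move=> H t H4 t1 tN a a1; set N := (4 * (Rr * H) ^ 2)%N in tN.
have Hp : 4 <= H%:R :> R by rewrite ler_nat.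
have R1 : 1 <= Rr%:R :> R by rewrite ler1n.
pose n1 : R := 2 * (Rr%:R * H%:R).
have n1H : H%:R <= n1 by rewrite /n1; rnra.
have NE : N%:R = n1 ^+ 2 by rewrite /N natrM natrX natrM /n1; ring.
have N64 : (64 <= N)%N.
  have n8 : 8 <= n1 by rewrite /n1; rnra.
  rewrite -(ler_nat R) NE (_ : 64%:R = 8 ^+ 2 :> R); last by ring.
  by apply: lerXn2r; rewrite ?nnegrE //; rlra.
have N2 : (2 <= N)%N by apply: leq_trans N64.
have Np : 0 < N%:R :> R by rewrite ltr0n (leq_trans _ N2).
pose L : R := ln N%:R.
have L1 : 1 <= L.
  apply: (@le_trans _ _ (ln (2 ^+ 6))).
    by rewrite lnXn // -[_ *+ 6]mulr_natl; have := ln2_ge R; rlra.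
  by rewrite ler_ln ?posrE ?exprn_gt0 // -natrX ler_nat.
pose s := Num.sqrt L; have sE : s ^+ 2 = L by rewrite sqr_sqrtr //; rlra.
have s0 : 0 <= s by exact: sqrtr_ge0.
have s1 : 1 <= s by rnra.
have LN : L <= N%:R by apply: ltW; exact: ln_sublinear.
have n10 : 0 < n1 by rlra.
have sn : s <= n1 by rewrite -ler_sqr ?nnegrE // ?sE -?NE // ltW.
have n1s : n1 <= N%:R / s by rewrite ler_pdivlMr ?NE; [rewrite expr2; apply: ler_wpM2l => //; exact: ltW|rlra].
have tp : 0 < t%:R :> R by rewrite ltr0n.
have lnt : ln t%:R <= 100 * (CL * (N%:R / s)).
  apply: (@le_trans _ _ (ln (100 ^+ size (two_squares N)))).
    by rewrite ler_ln ?posrE ?exprn_gt0 // -natrX ler_nat.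
  rewrite lnXn // -[_ *+ _]mulr_natl.
  have l100 : ln 100 <= 100 :> R by apply: ltW; exact: ln_sublinear.
  apply: (@le_trans _ _ ((size (two_squares N))%:R * 100)); first exact: ler_wpM2l.
  rewrite mulrC; apply: ler_wpM2l => //; rewrite mulrA ler_pdivlMr; last by rlra.
  exact: hL.
have lnTH : ln (T * H ^ 2)%:R <= (T%:R + 2) * (N%:R / s) :> R.
  rewrite natrM natrX lnM ?posrE ?exprn_gt0 //; last by rlra.
  rewrite lnXn; last by rlra.
  have a2 : ln T%:R <= T%:R :> R by apply: ltW; exact: ln_sublinear.
  have a3 : ln H%:R <= H%:R :> R by apply: ltW; apply: ln_sublinear; rlra.
  rewrite -[_ *+ 2]mulr_natl; rnra.
have aE : a = 2^-1 * (ln 2 + (ln t%:R + ln (T * H ^ 2)%:R)).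
  have TH : 0 < (T * H ^ 2)%:R :> R by rewrite ltr0n muln_gt0 T0 expn_gt0 (leq_trans _ H4).
  have yp : 0 < 2 * (t * (T * H ^ 2))%:R :> R by rewrite natrM !mulr_gt0.
  have sp : 0 < Num.sqrt (2 * (t * (T * H ^ 2))%:R) :> R by rewrite sqrtr_gt0.
  have := congr1 (@ln R) (sqr_sqrtr (ltW yp)); rewrite lnXn // -[_ *+ 2]mulr_natl -/a => e2.
  have -> : a = 2^-1 * (2 * a) by field.
  by rewrite e2 [(t * _)%:R]natrM lnM ?posrE ?mulr_gt0 // [ln (t%:R * _)]lnM ?posrE.
have aY : a <= CY * (N%:R / s).
  have l2 : ln 2 < 2 :> R by exact: ln_sublinear.
  move: lnt lnTH n1s; rewrite aE /CY; set z := N%:R / s => b1 b2 b3.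
  have z1 : 1 <= z by clear -b3 n1H Hp; rlra.
  have CLz : 0 <= CL * z by rewrite mulr_ge0 //; clear -CL0 z1; rlra.
  have Tz : 0 <= T%:R * z by rewrite mulr_ge0 //; clear -z1; rlra.
  have -> : (100 * CL + T%:R + 3) * z = 100 * (CL * z) + T%:R * z + 3 * z by ring.
  have e2 : (T%:R + 2) * z = T%:R * z + 2 * z by ring.
  by clear -l2 b1 b2 z1 CLz Tz e2; rlra.
have bL : ln a <= (CY + 1) * L.
  apply: (@le_trans _ _ (ln (CY * N%:R))).
    rewrite ler_ln ?posrE; [|by rlra|by pos].
    apply: le_trans aY _; apply: ler_wpM2l; first exact: ltW.
    by rewrite ler_pdivrMr ?ler_peMr //; rlra.
  rewrite lnM ?posrE //.
  have : ln CY <= CY by apply: ltW; exact: ln_sublinear.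
  by rewrite -/L; rnra.
have b0 : 0 <= ln a by apply: ln_ge0.
apply: (@le_trans _ _ ((CY * (N%:R / s)) ^+ 2 * ((CY + 1) * L))).
  apply: ler_pM => //; first exact: sqr_ge0.
  by apply: lerXn2r; rewrite ?nnegrE //; [rlra|pos].
rewrite -sE NE /n1 le_eqVlt; apply/orP; left; apply/eqP; field.
by rewrite gt_eqF //; rlra.
Qed.

End final.

(** Lower and upper bound of the same functional: [Y^(q+2) h^2] against [M (Y h)^(5/2)], with
    [h = 1 / (48 H)]. *)
Lemma functional_inequality (R : realType) q : (3 <= q)%N ->
  exists (c1 C : R) (Rr T H0 : nat), [/\ 0 < c1, 0 < C, (0 < Rr)%N, (0 < T)%N & forall H Y (M : R),
    (0 < H)%N -> (H0 <= H)%N -> (T * H ^ 2 <= Y)%N -> 0 <= M ->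
    (forall p l : int, (absz p ^ 2 + absz l ^ 2 <= 4 * (Rr * H) ^ 2)%N -> 99 / 100 <= cos (2 * pi * (Y%:R * nrm p%:~R l%:~R)) :> R) ->
    (forall x : R, 0 <= x <= Num.sqrt (2 * Y%:R) -> `|lattice_error q x| <= M) ->
    c1 * Num.sqrt Y%:R ^+ (2 * q - 1) * Num.sqrt H%:R <= C * M].
Proof.
move=> q3.
(* The power to annihilate is [q + 6]: five from the profile, [q + 1] from the volume. *)
have [Ce [Ce0 hE]] := @epsP R q.+2.
have qE : (q.+2.+4 = q + 6)%N by rewrite !addnS addn0.
have [C' [C'0 hK]] := @Kker_variation R Ce Ce0.
have [c1 [Rr [T [H0 [c10 Rr0 hc]]]]] := @circle_lower R q Ce q3 Ce0.
exists (6 * c1), C', Rr, (T + 48)%N, H0; split=> //; [by rewrite mulr_gt0|by rewrite addnS|].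
move=> H Y M Hp HH HT M0 al hM.
have Hr : 1 <= H%:R :> R by rewrite ler1n.
have HY : (48 * H ^ 2 <= Y)%N by apply: leq_trans HT; rewrite leq_mul2r leq_addl orbT.
have TY : (T * H ^ 2 <= Y)%N by apply: leq_trans HT; rewrite leq_mul2r leq_addr orbT.
have cY : 48 * H%:R ^+ 2 <= Y%:R :> R by rewrite -natrX -natrM ler_nat.
pose h : R := (48 * H%:R)^-1; pose c : R := Y%:R.
have h0 : 0 < h by rewrite /h invr_gt0 mulr_gt0 //; rlra.
have hH : h * H%:R = 48^-1 by rewrite /h invfM -mulrA mulVf ?mulr1 // gt_eqF //; rlra.
have h48 : h <= 48^-1 by rewrite -hH ler_peMr // ltW.
have H2 : 1 <= H%:R ^+ 2 :> R by rewrite exprn_ege1.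
have c4 : 4 <= c by rewrite /c; rlra.
have ch : 1 <= c * h.
  apply: (@le_trans _ _ (48 * H%:R ^+ 2 * h)); last by rewrite ler_pM2r.
  have -> : 48 * H%:R ^+ 2 * h = 48 * H%:R * (h * H%:R) by ring.
  by rewrite hH; rlra.
have hh : 0 < h <= 1 by rewrite h0 /=; rlra.
have hh4 : 0 < h <= 1 / 4 by rewrite h0 /=; rlra.
have [e0 e1 eK] := hE c h c4 hh; set e := eps _ c h in e0 e1 eK; rewrite qE in eK.
have he : 0 <= e <= Ce * h ^+ 2 / c ^+ 2 by rewrite e0 e1.
have [P [P1 P2 P3]] := hK e c h c4 hh4 ch he.
have Y0 : (0 < Y)%N by rewrite -(ltr_nat R); rewrite -/c; rlra.
have [B [B0 YB BY]] := square_between Y0.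
have cB : c + 2 * h <= (B ^ 2)%:R.
  apply: (@le_trans _ _ Y.+1%:R); last by rewrite ler_nat.
  by rewrite -natr1 -/c; rlra.
have h2c : 2 * h <= c by rlra.
have low := hc H Y B e Hp HH TY YB BY he al.
have cW : c + 2 * h <= (2 * Y)%:R by rewrite natrM -/c; rlra.
rewrite (box_sum_Kker q (2 * Y) e (ltW h0) h2c B0 cB) in low.
have up : `|\sum_(p : boxv B (2 * q) * 'I_(2 * Y).*2.+1) Kker e c h (rad R p)| <= M * P 0.
  apply: (@radial_functional_bound R q e c h (fine (kvol (@kball R q))) M P _ _ e0 h0 h2c M0 eK _ _ P1 P2).
    by move=> p; exact: sqrtr_ge0.
  move=> X /andP[X0 X1]; rewrite count_error //; [|exact: le_trans X1 cB|exact: le_trans X1 cW].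
  apply: hM; rewrite sqrtr_ge0 /=; apply: ler_wsqrtr; rewrite -/c; rlra.
have key : c1 * (c ^+ (q - 1) * (c ^+ 3 * h ^+ 2)) <= M * (C' * Num.sqrt (c * h) ^+ 5).
  apply: le_trans low _; apply: le_trans (ler_norm _) _; apply: le_trans up _.
  by apply: ler_wpM2l.
pose y := Num.sqrt c; pose r := Num.sqrt h; pose sH := Num.sqrt (H%:R : R).
have c0 : 0 <= c by exact: ler0n.
have y0 : 0 < y by rewrite sqrtr_gt0; clear -c4; rlra.
have r0 : 0 < r by rewrite sqrtr_gt0.
have yE : y ^+ 2 = c by rewrite sqr_sqrtr.
have rE : r ^+ 2 = h by rewrite sqr_sqrtr // ltW.
have sHE : sH ^+ 2 = H%:R by rewrite sqr_sqrtr.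
have sH0 : 0 <= sH by exact: sqrtr_ge0.
have rs : 6 * (r * sH) <= 1.
  rewrite -(@expr_le1 _ 2) //; last by rewrite !mulr_ge0 // ltW.
  by rewrite !exprMn rE sHE hH; clear; rlra.
have key2 : c1 * y ^+ (2 * q - 1) <= M * C' * r.
  rewrite -(@ler_pM2r _ (y ^+ 5 * r ^+ 4)); last by rewrite mulr_gt0 ?exprn_gt0.
  have -> : M * C' * r * (y ^+ 5 * r ^+ 4) = M * (C' * Num.sqrt (c * h) ^+ 5).
    by rewrite sqrtrM // -/y -/r; ring.
  apply: le_trans key; rewrite -yE -rE -!exprM.
  have -> : c1 * y ^+ (2 * q - 1) * (y ^+ 5 * r ^+ 4) = c1 * (y ^+ (2 * q - 1) * y ^+ 5 * r ^+ 4) by ring.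
  have -> : y ^+ (2 * q - 1) * y ^+ 5 = y ^+ (2 * (q - 1)) * y ^+ (2 * 3).
    by rewrite -!exprD; congr (_ ^+ _); clear -q3; lia.
  by rewrite -[y ^+ _ * y ^+ _ * _]mulrA.
rewrite -/c -/y -/sH.
have -> : 6 * c1 * y ^+ (2 * q - 1) * sH = (c1 * y ^+ (2 * q - 1)) * (6 * sH) by ring.
apply: (@le_trans _ _ (M * C' * r * (6 * sH))); first by apply: ler_wpM2r => //; rewrite mulr_ge0.
have -> : M * C' * r * (6 * sH) = C' * M * (6 * (r * sH)) by ring.
by rewrite -[leRHS]mulr1; apply: ler_wpM2l => //; rewrite mulr_ge0 // ltW.
Qed.

(** By contradiction, since the functional sees only the supremum of the error on [[0, sqrt (2 Y)]]
    and not where it is attained: failure for all [x > X] bounds this supremum, and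
    [functional_inequality] contradicts it for large [H]. *)
Theorem theorem3 (R : realType) (q : nat) (hq : (3 <= q)%N) :
  exists beta : R, 0 < beta /\
    forall X : R, exists x : R, X < x /\
      beta * x ^+ (2 * q - 1) * (ln x) `^ 4^-1 * (ln (ln x)) `^ 8^-1
        <= `| lattice_error q x |.
Proof.
have [c1 [C [Rr [T [H0 [c10 C0 Rr0 T0 hF]]]]]] := @functional_inequality R q hq.
have [CL [CL0 hL]] := landau R.
have [C8 [C80 h8]] := @log_bound R CL T Rr CL0 T0 Rr0 hL.
pose K : R := 2 ^+ (2 * q) * (C8 + 1) * C.
have K0 : 0 < K by rewrite /K !mulr_gt0 ?exprn_gt0 //; rlra.
exists (c1 / (4 * K)); split; first by rewrite divr_gt0 // mulr_gt0.
set beta := c1 / (4 * K).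
have b0 : 0 < beta by rewrite divr_gt0 // mulr_gt0.
move=> X; apply: contrapT => no.
pose ell (x : R) : R := (ln x) `^ 4^-1 * (ln (ln x)) `^ 8^-1.
have ub x : X < x -> `|lattice_error q x| <= beta * x ^+ (2 * q - 1) * ell x.
  move=> Xx; rewrite /ell mulrA leNgt; apply/negP => h; apply: no; exists x; split=> //; exact: ltW.
pose X0 := Num.max X (expR 1).
have [M0 [M00 hM0]] := @lattice_error_bounded R q X0.
(* The third summand makes [ln xY >= 1], so the iterated logarithm is nonnegative; the last makes
   the contribution [M0] of the bounded range at most a quarter of the lower bound. *)
pose H := (H0 + 4 + Num.bound (expR 1 : R) + Num.bound ((4 * C * M0 / c1) ^+ 2))%N.
have H4 : (4 <= H)%N by rewrite /H -!addnA addnCA leq_addr.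
have HH : (H0 <= H)%N by rewrite /H -!addnA leq_addr.
have Hr : 1 <= H%:R :> R by rewrite ler1n (leq_trans _ H4).
have He : expR 1 <= H%:R :> R.
  apply: le_trans (ltW (archi_boundP (ltW (expR_gt0 1)))) _; rewrite ler_nat /H.
  by rewrite -addnA addnCA leq_addr.
have HM : 4 * C * M0 <= c1 * Num.sqrt H%:R.
  rewrite [leRHS]mulrC -ler_pdivrMr //; have q0 : 0 <= 4 * C * M0 / c1 by rewrite divr_ge0 ?mulr_ge0 // ltW.
  rewrite -[leLHS]ger0_norm // -sqrtr_sqr; apply: ler_wsqrtr.
  apply: le_trans (ltW (archi_boundP (sqr_ge0 _))) _; rewrite ler_nat /H leq_addl //.
have [t [t1 t2 al]] := @aligned_multiple R (4 * (Rr * H) ^ 2) (T * H ^ 2).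
pose Y := (t * (T * H ^ 2))%N.
have YT : (T * H ^ 2 <= Y)%N by rewrite /Y leq_pmull.
have YH : (H ^ 2 <= Y)%N by apply: leq_trans YT; rewrite leq_pmull.
have YHr : H%:R ^+ 2 <= Y%:R :> R by rewrite -natrX ler_nat.
pose y : R := Num.sqrt Y%:R; pose xY : R := Num.sqrt (2 * Y%:R).
have H21 : 1 <= H%:R ^+ 2 :> R by rewrite exprn_ege1.
have Yp : 1 <= Y%:R :> R by apply: le_trans YHr.
have yE : y ^+ 2 = Y%:R by rewrite sqr_sqrtr.
have y0 : 0 <= y by exact: sqrtr_ge0.
have y1 : 1 <= y by rnra.
have xE : xY ^+ 2 = 2 * Y%:R by rewrite sqr_sqrtr.
have x0 : 0 <= xY by exact: sqrtr_ge0.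
have xy : xY <= 2 * y.
  by rewrite -ler_sqr ?nnegrE ?mulr_ge0 // xE exprMn yE; rlra.
have xH : H%:R <= xY by rewrite -ler_sqr ?nnegrE // xE; rlra.
have xe : expR 1 <= xY by apply: le_trans xH.
have ln1 (x : R) : expR 1 <= x -> 1 <= ln x.
  move=> hx; rewrite -[leLHS]expRK ler_ln ?posrE ?expR_gt0 //.
  by apply: lt_le_trans hx; exact: expR_gt0.
have a1 : 1 <= ln xY by exact: ln1.
have ellY : ell xY <= (C8 + 1) * Num.sqrt H%:R.
  apply: ell_le; [exact: le_trans a1|exact: ln_ge0|exact: ltW|exact: ler0n|].
  exact: h8.
have ell0 x : 0 <= ell x by rewrite /ell mulr_ge0 ?powR_ge0.
(* Monotonicity starts at [e], which is why [X0] is at least [expR 1] and smaller [x] are covered by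
   [M0]. *)
have ell_mono (x : R) : expR 1 <= x -> x <= xY -> ell x <= ell xY.
  move=> hx xx; have l1 := ln1 x hx.
  have xp : 0 < x by apply: lt_le_trans hx; exact: expR_gt0.
  have lm : ln x <= ln xY by rewrite ler_ln ?posrE // (lt_le_trans xp).
  apply: ler_pM; rewrite ?powR_ge0 //.
    by apply: ge0_ler_powR; rewrite ?invr_ge0 ?nnegrE //; [clear -l1|clear -a1]; rlra.
  apply: ge0_ler_powR; rewrite ?invr_ge0 ?nnegrE ?ln_ge0 //.
  by rewrite ler_ln ?posrE //; [clear -l1|clear -a1]; rlra.
have bx (x : R) : 0 <= x -> 0 <= beta * x ^+ (2 * q - 1).
  by move=> xp; apply: mulr_ge0; [exact: ltW|exact: exprn_ge0].
pose M : R := M0 + beta * xY ^+ (2 * q - 1) * ell xY.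
have bM : 0 <= beta * xY ^+ (2 * q - 1) * ell xY by apply: mulr_ge0 => //; exact: bx.
have Mp : 0 <= M by rewrite addr_ge0.
have hM (x : R) : 0 <= x <= xY -> `|lattice_error q x| <= M.
  move=> /andP[xp xx]; have [xX|Xx] := leP x X0.
    by apply: (@le_trans _ _ M0); [apply: hM0; rewrite xp|rewrite lerDl].
  have /andP[X1 X2] : (X < x) && (expR 1 < x) by rewrite -gt_max.
  apply: le_trans (ub x X1) _; apply: ler_wpDl => //.
  apply: ler_pM => //; [exact: bx| |by apply: ell_mono => //; exact: ltW].
  by apply: ler_wpM2l; [exact: ltW|apply: lerXn2r].
have Hpos : (0 < H)%N by exact: leq_trans H4.
have := hF H Y M Hpos HH YT Mp al hM.
rewrite -/y; set sH := Num.sqrt H%:R in ellY HM *.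
have sH1 : 1 <= sH by rewrite -[leLHS]sqrtr1; apply: ler_wsqrtr.
(* Both contributions to [C * M] are at most a quarter of [c1 * Z * sH]: the range up to [X0] by the
   choice of [H], the rest by the factor 4 in [beta]. *)
pose Z : R := y ^+ (2 * q - 1).
have Z1 : 1 <= Z by rewrite exprn_ege1.
have xZ : xY ^+ (2 * q - 1) <= 2 ^+ (2 * q) * Z.
  apply: (@le_trans _ _ ((2 * y) ^+ (2 * q - 1))); first by apply: lerXn2r; rewrite ?nnegrE ?mulr_ge0.
  rewrite exprMn -/Z; apply: ler_wpM2r; first by clear -Z1; rlra.
  by apply: ler_weXn2l; [rewrite ler1n|exact: leq_subr].
have main : C * (beta * xY ^+ (2 * q - 1) * ell xY) <= c1 * (Z * sH) / 4.
  apply: (@le_trans _ _ (C * (beta * (2 ^+ (2 * q) * Z) * ((C8 + 1) * sH)))).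
    apply: ler_wpM2l; first exact: ltW.
    apply: ler_pM => //; first exact: bx.
    by apply: ler_wpM2l => //; exact: ltW.
  rewrite /beta /K le_eqVlt; apply/orP; left; apply/eqP.
  have p2 : 0 < 2 ^+ (2 * q) :> R by rewrite exprn_gt0.
  move: (2 ^+ (2 * q) : R) p2 => p p2; field.
  by rewrite !gt_eqF //; clear -C80; rlra.
rewrite -/Z /M mulrDr => fin.
have z1 : c1 * sH <= c1 * (Z * sH).
  by apply: ler_wpM2l; [exact: ltW|rewrite ler_peMl //; clear -sH1; rlra].
have z2 : 0 < c1 * (Z * sH) by rewrite mulr_gt0 // mulr_gt0 //; [clear -Z1|clear -sH1]; rlra.
have z3 : c1 * Z * sH = c1 * (Z * sH) by ring.
by clear -fin z1 z2 z3 main HM; rlra.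
Qed.
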